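(* Let $a\in(-1,1)$, $a\ne 0$, $\mu,M\geq 0$, and let $u\in W^{1,2}(B_1^+,x_n^a)$ satisfy: (1) $L_au=\operatorname{div}(x_n^a\nabla u)=0$ in $B_1^+$ (weakly); (2) for every $\psi\in C_0^\infty(B_1)$, $$\Big|\int_{B_1^+}(\nabla u\cdot\nabla\psi)\,x_n^a\,dx\Big|\le\mu\int_{B_1'}|\psi|\,dx';$$ (3) $|u|\le M$ in $B_1^+$. Then the following holds. (i) If $a>0$, then $u\in C^{0,1-a}(B_{1/4}^+)$ with $\|u\|_{C^{0,1-a}(B_{1/4}^+)}\le C(a,M,\mu,n)$. (ii) If $a<0$, then $u\in C^{1,-a}(B_{1/4}^+\cup B_{1/4}')$ with $\|u\|_{C^{1,-a}(B_{1/4}^+\cup B_{1/4}')}\le C(a,M,\mu,n)$.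
   Context: $B_r$ is the open ball of radius $r$ centered at $0$ in $\mathbb{R}^n$, points are $x=(x',x_n)$ with $x'\in\mathbb{R}^{n-1}$, $B_r^+=B_r\cap\{x_n>0\}$, $B_r'=B_r\cap\{x_n=0\}$. $W^{1,2}(B_1^+,x_n^a)$ is the weighted Sobolev space of functions that, together with their first distributional derivatives, are square integrable on $B_1^+$ with respect to $x_n^a\,dx$. Condition (2) is the weak form of $|\lim_{x_n\to0+}x_n^au_{x_n}(x',x_n)|\le\mu$ on $B_1'$. On $B_{1/4}'$ the gradient is understood as the limit from $B_{1/4}^+$. $C(\cdot)$ denotes a constant depending only on the listed quantities. *)

(* Defs.v *)
From HB Require Import structures.
From mathcomp Require Import all_boot all_order all_algebra.
From mathcomp Require Import all_classical all_reals all_analysis.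
Set Implicit Arguments.
Unset Strict Implicit.
Unset Printing Implicit Defensive.
Import Order.TTheory GRing.Theory Num.Theory.
Import numFieldNormedType.Exports.
Local Open Scope classical_set_scope.
Local Open Scope ring_scope.

(* R^n is 'rV[R]_n; its sigma-algebra is the one generated by the coordinates,
   i.e. the Borel sigma-algebra. *)
Section measurable_row.
Variables (R : realType) (n : nat).

Definition coords (i : 'I_n) (x : 'rV[R]_n) : measurableTypeR R := x 0 i.

Let row_set0 : g_sigma_preimage coords set0.
Proof. exact: sigma_algebra0. Qed.

Let row_setC A : g_sigma_preimage coords A -> g_sigma_preimage coords (~` A).
Proof. exact: sigma_algebraC. Qed.

Let row_bigcup (F : (set 'rV[R]_n)^nat) :
  (forall i, g_sigma_preimage coords (F i)) ->
  g_sigma_preimage coords (\bigcup_i (F i)).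
Proof. exact: sigma_algebra_bigcup. Qed.

HB.instance Definition _ := @isMeasurable.Build default_measure_display
  'rV[R]_n (g_sigma_preimage coords) row_set0 row_setC row_bigcup.

End measurable_row.

(* (x', t) |-> the point of R^(n+1) with first n coordinates x' and last
   coordinate t. *)
Definition snoc (R : realType) (n : nat) (p : 'rV[R]_n * measurableTypeR R) :
    'rV[R]_n.+1 :=
  \row_i (if unlift ord_max i is Some j then p.1 0 j else p.2).

Lemma measurable_coords (R : realType) n (i : 'I_n) :
  measurable_fun setT (@coords R n i).
Proof.
move=> _ Y mY; rewrite setTI; apply: sub_sigma_algebra => /=.
rewrite -bigcup_seq/=; exists i => /=; first by rewrite mem_index_enum.
by exists Y => //; rewrite setTI.
Qed.

Lemma measurable_fun_coordsP d (T : measurableType d) (R : realType) n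
    (f : T -> 'rV[R]_n) :
  (forall i, measurable_fun setT (@coords R n i \o f)) -> measurable_fun setT f.
Proof.
move=> mf _ A mA; rewrite setTI.
have : preimage_set_system setT f (g_sigma_preimage (@coords R n)) (f @^-1` A).
  by exists A => //; rewrite setTI.
rewrite -g_sigma_preimage_comp; move: (f @^-1` A).
apply: smallest_sub; first exact: sigma_algebra_measurable.
move=> B; rewrite -bigcup_seq /= => -[i _] [C mC <-].
exact: mf.
Qed.

Lemma measurable_snoc (R : realType) n : measurable_fun setT (@snoc R n).
Proof.
apply: measurable_fun_coordsP => i.
rewrite /comp /coords /snoc; under eq_fun do rewrite mxE.
case: unliftP => [j _|_].
- apply: (measurableT_comp (@measurable_coords R n j)); exact: measurable_fst.
- exact: measurable_snd.
Qed.

Fixpoint leb (R : realType) (n : nat) : set 'rV[R]_n -> \bar R :=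
  if n is m.+1 return set 'rV[R]_n -> \bar R then
    pushforward (@leb R m \x @lebesgue_measure R)%E (@snoc R m)
  else \d_(0 : 'rV[R]_0).
Arguments leb {R} n.

Section leb_measure.
Variable R : realType.

Let leb_is_measure n :
  exists m : {measure set 'rV[R]_n -> \bar R}, leb n = m :> (set _ -> _).
Proof.
elim: n => [|n [m IH]]; first by exists (\d_(0 : 'rV[R]_0)).
exists (measure_function_pushforward__canonical__measure_function_Measure
          (m \x @lebesgue_measure R)%E (@measurable_snoc R n)).
by rewrite /= IH.
Qed.

Let leb0 n : leb n (@set0 'rV[R]_n) = 0%E.
Proof. by have [m ->] := leb_is_measure n; exact: measure0. Qed.

Let leb_ge0 n (A : set 'rV[R]_n) : (0 <= leb n A)%E.
Proof. by have [m ->] := leb_is_measure n; exact: measure_ge0. Qed.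

Let leb_sigma_additive n : semi_sigma_additive (@leb R n).
Proof.
have [m ->] := leb_is_measure n; exact: measure_semi_sigma_additive.
Qed.

HB.instance Definition _ n := isMeasure.Build _ _ _ (@leb R n)
  (@leb0 n) (@leb_ge0 n) (@leb_sigma_additive n).

End leb_measure.

Lemma leb_box (R : realType) n (A : 'I_n -> set (measurableTypeR R)) :
  (forall i, measurable (A i)) ->
  leb n [set x | forall i, A i (x 0 i)] =
  (\prod_(i < n) lebesgue_measure (A i))%E.
Proof.
elim: n A => [|n IH] A mA.
  rewrite big_ord0 /= diracE mem_set//= => -[].
  done.
rewrite big_ord_recr /= /pushforward.
rewrite (_ : _ @^-1` _ =
  [set x : 'rV[R]_n | forall i, A (widen_ord (leqnSn n) i) (x 0 i)] `*` A ord_max).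
  rewrite product_measure1E//; last first.
    rewrite (_ : mkset _ = \bigcap_(i in [set: 'I_n])
       ((@coords R n i) @^-1` A (widen_ord (leqnSn n) i))); last first.
      by apply/seteqP; split => x /= h i; [move=> _|]; apply: h.
    apply: fin_bigcap_measurable => // i _.
    by rewrite -[X in measurable X]setTI; exact: measurable_coords.
  by congr (_ * _)%E; exact: IH.
apply/seteqP; split => -[x t] /=.
  move=> h; split.
  - move=> i; have := h (widen_ord (leqnSn n) i); rewrite mxE.
    case: unliftP => [j e|e] /=.
      suff -> : i = j by [].
      by apply/val_inj; have := congr1 val e; rewrite /= /bump leqNgt ltn_ord.
    by have := congr1 val e => /= e'; have := ltn_ord i; rewrite e' ltnn.
  - by have := h ord_max; rewrite mxE unlift_none.
case=> h1 h2 i; rewrite mxE.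
case: unliftP => [j ->|->] //=.
have := h1 j; suff -> : widen_ord (leqnSn n) j = lift ord_max j by [].
by apply/val_inj; rewrite /= /bump leqNgt ltn_ord.
Qed.

Section euclidean.
Variables (R : realType) (n : nat).
Implicit Types (x y : 'rV[R]_n) (U : set 'rV[R]_n) (f : 'rV[R]_n -> R).

Definition dotp x y : R := \sum_i x 0 i * y 0 i.

(* The library's norm on 'rV[R]_n is the sup norm, so balls and Hölder
   quotients below use this one. *)
Definition enorm x : R := Num.sqrt (dotp x x).

Definition eball (r : R) : set 'rV[R]_n := [set x | enorm x < r].

Definition partial (i : 'I_n) f : 'rV[R]_n -> R :=
  fun x => 'D_(delta_mx 0 i) f x.

Definition grad f x : 'rV[R]_n := \row_i partial i f x.

Definition smooth f := forall s : seq 'I_n,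
  continuous (foldr partial f s) /\
  forall x i, derivable (foldr partial f s) x (delta_mx 0 i).

Definition supp f : set 'rV[R]_n := closure [set x | f x != 0].

(* phi in C_0^oo(U), extended by 0 outside U *)
Definition test_fun U (phi : 'rV[R]_n -> R) :=
  [/\ smooth phi, compact (supp phi) & supp phi `<=` U].

Definition weak_gradient U (u : 'rV[R]_n -> R) (g : 'rV[R]_n -> 'rV[R]_n) :=
  forall phi, test_fun U phi -> forall i,
    \int[leb n]_(x in U) (u x * partial i phi x) =
    - \int[leb n]_(x in U) (g x 0 i * phi x).

End euclidean.

Section half_space.
Variables (R : realType) (n : nat).
Local Notation E := 'rV[R]_n.+1.
Implicit Types (U : set E) (u : E -> R) (g : E -> E).

Definition half_ball (r : R) : set E := eball r `&` [set x | 0 < x 0 ord_max].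

Definition flat_ball (r : R) : set E := eball r `&` [set x | x 0 ord_max = 0].

Definition weight (a : R) (x : E) : R := x 0 ord_max `^ a.

Definition wL2 (a : R) U (f : E -> R) :=
  measurable_fun U f /\
  (\int[leb n.+1]_(x in U) (f x ^+ 2 * weight a x)%:E < +oo)%E.

(* u in W^{1,2}(U, x_n^a), with distributional gradient g (which is unique up
   to a null set); meant for open U contained in {x_n > 0}, where x_n^a is
   locally bounded away from 0, so that all functions in wL2 are locally
   integrable. *)
Definition wW12 (a : R) U u g :=
  [/\ wL2 a U u, forall i, wL2 a U (fun x => g x 0 i) & weak_gradient U u g].

(* the integral over U of (g . grad phi) x_n^a *)
Definition energy (a : R) U g (phi : E -> R) : R :=
  \int[leb n.+1]_(x in U) (dotp (g x) (grad phi x) * weight a x).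

(* the integral of f over B_r' with respect to dx' *)
Definition flat_integral (r : R) (f : E -> R) : R :=
  \int[leb n]_(x' in [set x' | flat_ball r (snoc (x', 0))]) f (snoc (x', 0)).

End half_space.

Section hoelder_spaces.
Variables (R : realType) (n : nat).
Local Notation E := 'rV[R]_n.
Implicit Types (D U S : set E) (v : E -> R) (alpha : R).

Definition sup_norm (V : zmodType) (N : V -> R) D (f : E -> V) : \bar R :=
  ereal_sup [set (N (f x))%:E | x in D].

Definition hoelder_seminorm (V : zmodType) (N : V -> R) D alpha (f : E -> V) :
    \bar R :=
  ereal_sup [set (N (f p.1 - f p.2) / enorm (p.1 - p.2) `^ alpha)%:E |
    p in [set p : E * E | [/\ D p.1, D p.2 & p.1 != p.2]]].

Definition C0_norm D alpha v : \bar R :=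
  (sup_norm Num.norm D v + hoelder_seminorm Num.norm D alpha v)%E.

Definition C0_hoelder D alpha v :=
  {within D, continuous v} /\ (C0_norm D alpha v < +oo)%E.

(* For U open and S contained in its boundary: the gradient on U, extended to
   S by its limit from U. *)
Definition grad_upto U v (x : E) : E :=
  if x \in U then grad v x else lim (grad v @ within U (nbhs x)).

Definition C1_norm U S alpha v : \bar R :=
  (sup_norm Num.norm (U `|` S) v + sup_norm (@enorm R n) (U `|` S) (grad_upto U v)
   + hoelder_seminorm (@enorm R n) (U `|` S) alpha (grad_upto U v))%E.

(* v in C^{1,alpha}(U u S), U and S as above *)
Definition C1_hoelder U S alpha v :=
  [/\ forall x, U x -> differentiable v x,
      forall x, S x -> cvg (grad v @ within U (nbhs x)),
      {within U `|` S, continuous v},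
      {within U `|` S, continuous (grad_upto U v)} &
      (C1_norm U S alpha v < +oo)%E].

End hoelder_spaces.

(* Main.v *)
Require Import Defs.
From HB Require Import structures.
From mathcomp Require Import all_boot all_order all_algebra.
From mathcomp Require Import all_classical all_reals all_analysis.
From mathcomp Require Import measurable_realfun ring lra.
Set Implicit Arguments.
Unset Strict Implicit.
Unset Printing Implicit Defensive.
Import Order.TTheory GRing.Theory Num.Theory.
Import numFieldNormedType.Exports.
Local Open Scope classical_set_scope.
Local Open Scope ring_scope.

(* Let B psi = x_N^-a div(x_N^a grad psi). Averaging a radial bump over the generalized
   translation attached to B, i.e. over |x' - y'|^2 + s^2 + t^2 - 2 s t cos theta for x =
   (x', t) and y = (y', s), against sin(theta)^(a - 1) (integrated by parts, so that a may
   be negative), gives for every centre y and scale lam^(-1/2) a test function that is even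
   in x_N and whose normalized lam-derivative is B of a function of the same kind. Hence
   the mean S_lam(y) of u x_N^a against it has a lam-derivative which (2) bounds by mu
   times an integral over {x_N = 0} of the second function; it vanishes as soon as
   lam^(-1/2) <= y_N. So S_lam(y) is eventually constant in lam, and by the symmetry of the
   kernel its final value is a constant multiple of u(y) for almost every y. The same flux
   bound controls the first and second differences in y of the lam-derivative by powers of
   lam. Integrating from lam = 4 on, and splitting the integral at lam = |d|^-2 for an
   increment d, gives the bound |d|^(1 - a) for the increments of u if a > 0, and |d|^(-a)
   for those of its gradient if a < 0. *)

(** * Smooth building blocks *)

(** B is not invariant under translations in x_N, so ordinary mollification does not commute with
    it; the generalized translation does, and its kernels behave like radial functions in the
    fictitious dimension n + 1 + a, the origin of [hdim]. Evenness in x_N matters because x_N^a B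
    psi contains a x_N^(a - 1) times the normal derivative of psi, which for a < 0 is integrable
    only if that derivative vanishes on {x_N = 0}. At scale r = lam^(-1/2) the flux lives on an
    n-dimensional cube of side comparable to r, so the lam-derivative of the mean is O(lam^(hdim -
    2) r^n) = O(lam^((a - 3) / 2)), and each difference in y gains a factor |d| lam^(1/2). First
    differences are then integrable at infinity exactly when a < 0, second differences never; at lam
    = |d|^-2 the bounds with and without the last gain coincide, and the divergent power of lam
    becomes the power of |d|. The normalization of the kernels is found by applying the same bound
    to u = 1, which has no flux. All constants are fixed before u. *)

Section flat_exponential.
Variable R : realType.
Implicit Types (p : {poly R}) (x : R).

(** All derivatives are carried along as one sequence, because the kernels involve f and f' at once
    and are differentiated further. *)
Definition jet (g : nat -> R -> R) :=
  forall j x, is_derive x 1 (g j) (g j.+1 x).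

Lemma jet_continuous g j : jet g -> continuous (g j).
Proof.
move=> jg x; apply/differentiable_continuous/derivable1_diffP.
by have [] := jg j x.
Qed.

Definition flat p x : R := if 0 < x then p.[x^-1] * expR (- x^-1) else 0.

(** Differentiating p(1/x) exp(-1/x) gives q(1/x) exp(-1/x) with q = X^2 (p - p'), so the functions
    [flat p] are closed under differentiation. *)
Definition dflat p : {poly R} := 'X^2 * (p - p^`()).

(** Each monomial satisfies y^i <= i! exp(y). *)
Lemma horner_le_expR p : exists C, 0 <= C /\ forall y, 0 <= y -> `|p.[y]| <= C * expR y.
Proof.
exists (\sum_(i < size p) `|p`_i| * i`!%:R); split.
  by apply: sumr_ge0 => i _; rewrite mulr_ge0.
move=> y y0; rewrite horner_coef mulr_suml (le_trans (ler_norm_sum _ _ _))//.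
apply: ler_sum => i _; rewrite normrM normrX (ger0_norm y0) -mulrA ler_wpM2l//.
rewrite -ler_pdivrMl ?ltr0n ?fact_gt0// mulrC.
case: (nat_of_ord i) => [|j]; first by rewrite expr0 fact0 divr1 -expR0 ler_expR.
by apply: le_trans (expR_ge1Dxn j y0); rewrite lerDr.
Qed.

(** The two powers of x, obtained by applying the previous bound to p X^2, make the difference
    quotient of [flat p] at 0 tend to 0. *)
Lemma flat_le p : exists C, 0 <= C /\ forall x, `|flat p x| <= C * x ^+ 2.
Proof.
have [C [C0 HC]] := horner_le_expR (p * 'X^2).
exists C; split=> // x; rewrite /flat; case: ifPn => [x0|_]; last first.
  by rewrite normr0 mulr_ge0// sqr_ge0.
have := HC x^-1; rewrite invr_ge0 (ltW x0) => /(_ isT).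
rewrite hornerM hornerXn normrM normrX [`|x^-1|]gtr0_norm ?invr_gt0// => H.
rewrite normrM expRN [`|(expR _)^-1|]gtr0_norm ?invr_gt0 ?expR_gt0//.
rewrite ler_pdivrMr ?expR_gt0// mulrAC -ler_pdivrMr ?exprn_gt0//.
by rewrite -exprVn.
Qed.

Lemma is_derive_flat p x : is_derive x 1 (flat p) (flat (dflat p) x).
Proof.
have [x0|x0|->] := ltrgtP x 0.
- have -> : flat (dflat p) x = 0 by rewrite /flat ltNge (ltW x0).
  apply: (@near_eq_is_derive _ _ _ (cst 0)).
  near=> y; rewrite /flat/= ltNge (ltW _)//.
  by near: y; exact: lt_nbhsl.
- have -> : flat (dflat p) x = (dflat p).[x^-1] * expR (- x^-1) by rewrite /flat x0.
  apply: (@near_eq_is_derive _ _ _ (fun y : R => p.[y^-1] * expR (- y^-1))).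
    by near=> y; rewrite /flat ifT//; near: y; exact: lt_nbhsr.
  have xn0 : x != 0 by rewrite gt_eqF.
  have dV : is_derive x 1 (fun y : R => y^-1) (- x ^- 2 *: 1) by exact: is_deriveV.
  have dN : is_derive x 1 (fun y : R => - y^-1) (- (- x ^- 2 *: 1)) by exact: is_deriveN.
  have dE := @is_derive1_comp _ expR (fun y => - y^-1) x _ _ (is_derive_expR (- x^-1)) dN.
  have dP := @is_derive1_comp _ (horner p) (fun y => y^-1) x _ _ (is_derive_poly p x^-1) dV.
  have := is_deriveM dP dE => dM; apply: (is_derive_eq dM).
  by rewrite /dflat !hornerE /= /GRing.scale/=; field.
- have -> : flat (dflat p) 0 = 0 by rewrite /flat ltxx.
  have [C [C0 HC]] := flat_le p.
  have C1 : 0 < C + 1 by rewrite ltr_pwDr.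
  have cv : h^-1 *: (flat p (h *: 1 + 0) - flat p 0) @[h --> 0^'] --> (0 : R).
    apply/cvgrPdist_le => e e0; near=> h.
    have hn0 : h != 0 by near: h; exact: nbhs_dnbhs_neq.
    have he : `|h| <= e / (C + 1).
      near: h; apply: cvg_within.
      have /cvgrPdist_le/= := (@cvg_id _ (nbhs (0 : R))).
      move=> /(_ (e / (C + 1))); rewrite divr_gt0// => /(_ isT).
      by apply: filterS => h; rewrite sub0r normrN.
    rewrite sub0r normrN addr0 [flat p 0]/flat ltxx subr0.
    rewrite [h *: 1](_ : _ = h); last by rewrite /GRing.scale/= mulr1.
    rewrite /GRing.scale/= normrM normfV ler_pdivrMl ?normr_gt0//.
    rewrite (le_trans (HC h))// -(real_normK (num_real h)) expr2 mulrCA ler_wpM2l//.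
    have : `|h| * (C + 1) <= e by rewrite -ler_pdivlMr.
    by apply: le_trans; rewrite mulrC ler_wpM2l// lerDl.
  split; last exact: cvg_lim cv.
  by apply/cvg_ex; exists 0.
Unshelve. all: by end_near. Qed.

Definition flat_jet (j : nat) : R -> R := flat (iter j dflat 1).

Lemma jet_flat : jet flat_jet.
Proof. by move=> j x; exact: is_derive_flat. Qed.

(** The j-th derivative of exp(-1 / (1 - x)), continued by 0 to x >= 1; [bump 0] at |z|^2 is the
    usual mollifier. *)
Definition bump (j : nat) (x : R) : R := (-1) ^+ j * flat_jet j (1 - x).

Lemma jet_bump : jet bump.
Proof.
move=> j x; rewrite /bump.
have d1 : is_derive x 1 (fun y : R => 1 - y) (-1).
  by apply: (is_derive_eq (is_deriveB _ _)); rewrite sub0r.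
have d := @is_derive1_comp _ (flat_jet j) (fun y => 1 - y) x _ _ (jet_flat j (1 - x)) d1.
apply: (is_derive_eq (is_deriveZ ((-1) ^+ j) d)).
by rewrite exprS /GRing.scale/=; ring.
Qed.

Lemma bump_out j x : 1 <= x -> bump j x = 0.
Proof. by move=> x1; rewrite /bump /flat_jet /flat ltNge subr_le0 x1/= mulr0. Qed.

Lemma bump1E x : x < 1 -> - bump 1 x = (1 - x) ^- 2 * expR (- (1 - x)^-1).
Proof.
move=> x1; rewrite /bump /flat_jet /flat /= subr_gt0 x1 expr1 mulN1r opprK.
by rewrite /dflat derivC subr0 mulr1 hornerXn exprVn.
Qed.

Lemma bump1_le0 x : 0 <= - bump 1 x.
Proof.
have [x1|x1] := leP 1 x; first by rewrite bump_out// oppr0.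
by rewrite bump1E// mulr_ge0 ?expR_ge0// invr_ge0 sqr_ge0.
Qed.

Lemma bump1_lt0 x : x < 1 -> 0 < - bump 1 x.
Proof.
by move=> x1; rewrite bump1E// mulr_gt0 ?expR_gt0// invr_gt0 exprn_gt0// subr_gt0.
Qed.

End flat_exponential.

(** * The Euclidean norm and its comparison with the sup norm *)

Section norms.
Variables (R : realType) (m : nat).
Implicit Types x y : 'rV[R]_m.

Lemma coord_le_norm x i : `|x 0 i| <= `|x|.
Proof.
rewrite [leRHS]mx_normrE; apply: (@le_bigmax _ _ _ _ _ (0, i)).
Qed.

Lemma norm_le_coord x C : 0 <= C -> (forall i, `|x 0 i| <= C) -> `|x| <= C.
Proof.
move=> C0 xC; rewrite [leLHS]mx_normrE; apply/bigmax_leP; split => //= -[i j] _ /=.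
by rewrite ord1.
Qed.

Lemma dotp_ge0 x : 0 <= dotp x x.
Proof. by apply: sumr_ge0 => i _; rewrite -expr2 sqr_ge0. Qed.

Lemma enorm_ge0 x : 0 <= enorm x.
Proof. exact: sqrtr_ge0. Qed.

Lemma enorm_sqr x : enorm x ^+ 2 = dotp x x.
Proof. by rewrite sqr_sqrtr// dotp_ge0. Qed.

Lemma coord_le_enorm x i : `|x 0 i| <= enorm x.
Proof.
rewrite -(@ler_pXn2r _ 2)// ?nnegrE ?enorm_ge0// enorm_sqr real_normK ?num_real//.
rewrite /dotp (bigD1 i)//= -expr2 lerDl; apply: sumr_ge0 => j _.
by rewrite -expr2 sqr_ge0.
Qed.

Lemma norm_le_enorm x : `|x| <= enorm x.
Proof. by apply: norm_le_coord; [exact: enorm_ge0|exact: coord_le_enorm]. Qed.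

Lemma dotp_le_norm x : dotp x x <= m%:R * `|x| ^+ 2.
Proof.
rewrite /dotp (@le_trans _ _ (\sum_(i < m) `|x| ^+ 2))//.
  apply: ler_sum => i _; rewrite -expr2 -(real_normK (num_real (x 0 i))).
  by rewrite ler_pXn2r ?nnegrE// coord_le_norm.
by rewrite sumr_const card_ord mulr_natl.
Qed.

Lemma dotpC x y : dotp x y = dotp y x.
Proof. by apply: eq_bigr => i _; rewrite mulrC. Qed.

Lemma dotpDl x y z : dotp (x + y) z = dotp x z + dotp y z.
Proof.
by rewrite /dotp -big_split/=; apply: eq_bigr => i _; rewrite mxE mulrDl.
Qed.

Lemma dotpZl c x y : dotp (c *: x) y = c * dotp x y.
Proof.
by rewrite /dotp big_distrr/=; apply: eq_bigr => i _; rewrite mxE mulrA.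
Qed.

Lemma dotpDr x y z : dotp z (x + y) = dotp z x + dotp z y.
Proof. by rewrite dotpC dotpDl !(dotpC z). Qed.

Lemma dotpZr c x y : dotp x (c *: y) = c * dotp x y.
Proof. by rewrite dotpC dotpZl dotpC. Qed.

Lemma enorm_eq0 x : enorm x = 0 -> x = 0.
Proof.
move=> x0; apply/rowP => i; rewrite mxE; apply/eqP; rewrite -normr_eq0.
by rewrite eq_le normr_ge0 andbT -x0 coord_le_enorm.
Qed.

Lemma enorm0 : enorm (0 : 'rV[R]_m) = 0.
Proof.
by rewrite /enorm /dotp big1 ?sqrtr0// => i _; rewrite mxE mul0r.
Qed.

Lemma enormN x : enorm (- x) = enorm x.
Proof.
by rewrite /enorm /dotp; congr Num.sqrt; apply: eq_bigr => i _; rewrite !mxE mulrNN.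
Qed.

(** Expansion of the squared length of |y| x - |x| y. *)
Lemma dotp_cauchy x y : dotp x y <= enorm x * enorm y.
Proof.
have d0 z : dotp 0 z = 0 by rewrite /dotp big1// => i _; rewrite mxE mul0r.
have [x0|x0] := eqVneq (enorm x) 0; first by rewrite x0 (enorm_eq0 x0) d0 mul0r.
have [y0|y0] := eqVneq (enorm y) 0.
  by rewrite y0 (enorm_eq0 y0) dotpC d0 mulr0.
have {}x0 : 0 < enorm x by rewrite lt_neqAle eq_sym x0 enorm_ge0.
have {}y0 : 0 < enorm y by rewrite lt_neqAle eq_sym y0 enorm_ge0.
have := dotp_ge0 (enorm y *: x + (- enorm x) *: y).
rewrite !(dotpDl, dotpDr, dotpZl, dotpZr) (dotpC y x) -!enorm_sqr => H.
have xy := mulr_gt0 x0 y0.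
by rewrite -(ler_pM2l xy); lra.
Qed.

Lemma enormD x y : enorm (x + y) <= enorm x + enorm y.
Proof.
have H := dotp_cauchy x y.
rewrite -(@ler_pXn2r _ 2)// ?nnegrE ?addr_ge0 ?enorm_ge0// sqrrD !enorm_sqr.
by rewrite !(dotpDl, dotpDr) (dotpC y x); lra.
Qed.

End norms.

(** Along a line, directional derivatives become derivatives in one real variable, to which the
    chain rule and the fundamental theorem apply. *)
Lemma is_derive_line (R : realType) (V W : normedModType R) (f : V -> W) x v d :
  is_derive x v f d <-> is_derive (0 : R) 1 (fun t : R => f (t *: v + x)) d.
Proof.
have E : 'D_v f x = 'D_1 (fun t : R => f (t *: v + x)) (0 : R).
  suff E2 : (fun h : R => h^-1 *: ((f \o shift x) (h *: v) - f x)) =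
      (fun h : R => h^-1 *: (((fun t : R => f (t *: v + x)) \o shift 0) (h *: 1)
        - f (0 *: v + x))) by rewrite /derive E2.
  apply/funext => h /=.
  by rewrite addr0 scale0r add0r [h *: (1 : R)](_ : _ = h)//; exact: mulr1.
split => -[d1 d2]; split; rewrite -?E ?d2//; [|exact: (derivable1P f x v).2|by rewrite E].
exact: (derivable1P f x v).1.
Qed.

Lemma is_derive_comp_line (R : realType) (V : normedModType R) (f : V -> R)
    (g : R -> R) x v df dg :
  is_derive x v f df -> is_derive (f x) 1 g dg ->
  is_derive x v (fun y => g (f y)) (dg * df).
Proof.
move=> /is_derive_line df1 dg1; apply/is_derive_line.
have dg2 : is_derive (f (0 *: v + x)) 1 g dg by rewrite scale0r add0r.
exact: (@is_derive1_comp _ g (fun t : R => f (t *: v + x)) 0 _ _ dg2 df1).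
Qed.

Lemma is_derive_coord (R : realType) m (x v : 'rV[R]_m) i :
  is_derive x v (fun y : 'rV[R]_m => y 0 i) (v 0 i).
Proof.
have := @differentiable_coord R 1 m x 0 i => d.
split; first exact: diff_derivable.
rewrite /derive; apply: cvg_lim => //; apply: cvg_near_cst.
near=> t; rewrite /= !mxE addrK scalerA mulVf ?scale1r//.
by near: t; exact: nbhs_dnbhs_neq.
Unshelve. all: by end_near. Qed.

(** * Parametrized smooth functions *)

Section families.
Variables (R : realType) (T : Type) (m : nat) (base : set (T -> R)).
Local Notation E := 'rV[R]_m.

(** Functions of a parameter p and a point x, generated from base functions of p. Differentiation in
    x stays in the class, so inductions on it give smoothness, bounds uniform in p and measurability
    in p for all kernels below. *)
Inductive fam : (T -> E -> R) -> Prop :=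
| fam_base b : base b -> fam (fun p _ => b p)
| fam_coord i : fam (fun _ x => x 0 i)
| fam_comp g j h : jet g -> fam h -> fam (fun p x => g j (h p x))
| fam_add h1 h2 : fam h1 -> fam h2 -> fam (fun p x => h1 p x + h2 p x)
| fam_mul h1 h2 : fam h1 -> fam h2 -> fam (fun p x => h1 p x * h2 p x).

Hypothesis base_cst : forall c : R, base (cst c).

Lemma fam_cst c : fam (fun _ _ => c).
Proof. exact: (fam_base (base_cst c)). Qed.

Lemma fam_opp h : fam h -> fam (fun p x => - h p x).
Proof.
move=> fh; rewrite (_ : (fun _ => _) = fun p x => (-1) * h p x); last first.
  by apply/funext => p; apply/funext => x; rewrite mulN1r.
by apply: fam_mul => //; exact: fam_cst.
Qed.

Lemma fam_sub h1 h2 : fam h1 -> fam h2 -> fam (fun p x => h1 p x - h2 p x).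
Proof. by move=> f1 f2; apply: fam_add => //; exact: fam_opp. Qed.

Lemma fam_sum I (r : seq I) (P : pred I) (h : I -> T -> E -> R) :
  (forall i, fam (h i)) -> fam (fun p x => \sum_(i <- r | P i) h i p x).
Proof.
move=> fh; elim: r => [|i r IH].
  rewrite (_ : (fun _ => _) = fun _ _ => 0); first exact: fam_cst.
  by apply/funext => p; apply/funext => x; rewrite big_nil.
rewrite (_ : (fun _ => _) = fun p x =>
    (if P i then h i p x else 0) + \sum_(j <- r | P j) h j p x); last first.
  apply/funext => p; apply/funext => x; rewrite big_cons.
  by case: ifP => //; rewrite add0r.
by apply: fam_add => //; case: (P i) => //; exact: fam_cst.
Qed.

Lemma fam_exp h k : fam h -> fam (fun p x => h p x ^+ k).
Proof.
move=> fh; elim: k => [|k IH].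
  rewrite (_ : (fun _ => _) = fun _ _ => 1); first exact: fam_cst.
  by apply/funext => p; apply/funext => x; rewrite expr0.
rewrite (_ : (fun _ => _) = fun p x => h p x * h p x ^+ k); first exact: fam_mul.
by apply/funext => p; apply/funext => x; rewrite exprS.
Qed.

Lemma fam_dotp (y : E) : fam (fun _ x => dotp (x - y) (x - y)).
Proof.
rewrite (_ : (fun _ => _) = fun _ (x : E) =>
    \sum_i (x 0 i - y 0 i) * (x 0 i - y 0 i)); last first.
  apply/funext => p; apply/funext => x; apply: eq_bigr => i _.
  by rewrite !mxE.
apply: fam_sum => i.
have f : fam (fun _ x => x 0 i - y 0 i).
  by apply: fam_sub; [exact: fam_coord|exact: fam_cst].
exact: fam_mul.
Qed.

Lemma fam_derive h v : fam h ->
  exists h', fam h' /\ forall p x, is_derive x v (h p) (h' p x).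
Proof.
elim=> [b bb|i|g j k jg fk [k' [fk' dk]]|h1 h2 f1 [k1 [fk1 d1]] f2 [k2 [fk2 d2]]
  |h1 h2 f1 [k1 [fk1 d1]] f2 [k2 [fk2 d2]]].
- exists (fun _ _ => 0); split; first exact: fam_cst.
  by move=> p x; exact: is_derive_cst.
- exists (fun _ _ => v 0 i); split; first exact: fam_cst.
  by move=> p x; exact: is_derive_coord.
- exists (fun p x => g j.+1 (k p x) * k' p x); split.
    by apply: fam_mul => //; exact: fam_comp.
  by move=> p x; exact: is_derive_comp_line.
- exists (fun p x => k1 p x + k2 p x); split; first exact: fam_add.
  by move=> p x; exact: is_deriveD.
- exists (fun p x => h1 p x * k2 p x + h2 p x * k1 p x); split.
    by apply: fam_add; apply: fam_mul.
  by move=> p x; exact: is_deriveM.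
Qed.

Lemma fam_differentiable h p x : fam h -> differentiable (h p) x.
Proof.
elim=> [b bb|i|g j k jg fk dk|h1 h2 f1 d1 f2 d2|h1 h2 f1 d1 f2 d2].
- exact: differentiable_cst.
- exact: differentiable_coord.
- apply: (@differentiable_comp _ _ _ _ (k p) (g j)) => //.
  by apply/derivable1_diffP; have [] := jg j (k p x).
- exact: differentiableD.
- exact: differentiableM.
Qed.

Lemma fam_continuous h p : fam h -> continuous (h p).
Proof. by move=> fh x; exact/differentiable_continuous/fam_differentiable. Qed.

Lemma fam_partial h s : fam h -> exists h', fam h' /\
  forall p, foldr (@partial R m) (h p) s = h' p.
Proof.
move=> fh; elim: s => [|i s [k [fk ks]]]; first by exists h.
have [k' [fk' dk]] := fam_derive (delta_mx 0 i) fk.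
exists k'; split => // p /=; rewrite ks; apply/funext => x.
by rewrite /partial; have [_ ->] := dk p x.
Qed.

Lemma fam_smooth h p : fam h -> smooth (h p).
Proof.
move=> fh s; have [k [fk ks]] := fam_partial s fh; rewrite ks; split.
  exact: fam_continuous.
move=> x i; have [k' [fk' dk]] := fam_derive (delta_mx 0 i) fk.
by have [] := dk p x.
Qed.

Variable D : set T.

Lemma fam_bounded h rho :
  (forall b, base b -> exists C, forall p, D p -> `|b p| <= C) ->
  fam h -> exists2 C, 0 <= C & forall p x, D p -> `|x| <= rho -> `|h p x| <= C.
Proof.
move=> bD; elim=> [b bb|i|g j k jg fk [C C0 HC]|h1 h2 f1 [C1 C10 H1] f2 [C2 C20 H2]
  |h1 h2 f1 [C1 C10 H1] f2 [C2 C20 H2]].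
- have [C HC] := bD _ bb; exists `|C| => // p x Dp _.
  exact: le_trans (HC _ Dp) (ler_norm _).
- exists `|rho| => // p x _ xr; rewrite (le_trans _ (ler_norm rho))//.
  rewrite (le_trans _ xr)//; exact: coord_le_norm.
(* The inner function takes its values in [-C, C], where the jet attains its extrema. *)
- have cg : {within `[-C, C], continuous (g j)}.
    by apply: continuous_subspaceT; exact: jet_continuous.
  have CC : - C <= C by rewrite (le_trans _ C0)// oppr_le0.
  have [u _ Hu] := EVT_max CC cg; have [v _ Hv] := EVT_min CC cg.
  exists (`|g j u| + `|g j v|); first by rewrite addr_ge0.
  move=> p x Dp xr; have kC : k p x \in `[-C, C].
    by rewrite in_itv/= -ler_norml; exact: HC.
  rewrite ler_norml (le_trans _ (Hv _ kC)) ?(le_trans (Hu _ kC))//.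
    by rewrite (le_trans (ler_norm _))// lerDl.
  rewrite opprD -[leRHS]add0r lerD ?oppr_le0// lerNl.
  by rewrite (le_trans (ler_norm _))// normrN.
- exists (C1 + C2); first by rewrite addr_ge0.
  move=> p x Dp xr; rewrite (le_trans (ler_normD _ _))// lerD//; [exact: H1|exact: H2].
- exists (C1 * C2); first by rewrite mulr_ge0.
  by move=> p x Dp xr; rewrite normrM ler_pM//; [exact: H1|exact: H2].
Qed.

End families.

Lemma fam_measurable d (T : measurableType d) (R : realType) m
    (base : set (T -> R)) (D : set T) h (x : 'rV[R]_m) :
  (forall b, base b -> measurable_fun D b) ->
  fam base h -> measurable_fun D (fun p => h p x).
Proof.
move=> mb; elim=> [b bb|i|g j k jg fk mk|h1 h2 f1 d1 f2 d2|h1 h2 f1 d1 f2 d2].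
- exact: mb.
- exact: measurable_cst.
- apply: (@measurableT_comp _ _ _ _ _ _ (g j)) => //.
  by apply: continuous_measurable_fun; exact: jet_continuous.
- exact: measurable_funD.
- exact: measurable_funM.
Qed.

Section elementary_functions.
Variables (R : realType) (m : nat).
Local Notation E := 'rV[R]_m.
Implicit Types f g : E -> R.

(** With a one-point parameter the base functions are just the constants. *)
Definition elem f := exists2 h, fam [set: unit -> R] h & h tt = f.

Lemma elem_cst (c : R) : elem (fun=> c).
Proof. by exists (fun _ _ => c) => //; exact: fam_cst. Qed.

Lemma elem_coord i : elem (fun x => x 0 i).
Proof. by exists (fun _ x => x 0 i) => //; exact: fam_coord. Qed.

Lemma elem_comp (g : nat -> R -> R) j f : jet g -> elem f -> elem (fun x => g j (f x)).
Proof.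
by move=> jg [h fh <-]; exists (fun p x => g j (h p x)) => //; exact: fam_comp.
Qed.

Lemma elem_add f1 f2 : elem f1 -> elem f2 -> elem (fun x => f1 x + f2 x).
Proof.
move=> [h1 fh1 <-] [h2 fh2 <-]; exists (fun p x => h1 p x + h2 p x) => //.
exact: fam_add.
Qed.

Lemma elem_mul f1 f2 : elem f1 -> elem f2 -> elem (fun x => f1 x * f2 x).
Proof.
move=> [h1 fh1 <-] [h2 fh2 <-]; exists (fun p x => h1 p x * h2 p x) => //.
exact: fam_mul.
Qed.

Lemma elem_sub f1 f2 : elem f1 -> elem f2 -> elem (fun x => f1 x - f2 x).
Proof.
move=> [h1 fh1 <-] [h2 fh2 <-]; exists (fun p x => h1 p x - h2 p x) => //.
exact: fam_sub.
Qed.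

Lemma elem_sum I (r : seq I) (f : I -> E -> R) :
  (forall i, elem (f i)) -> elem (fun x => \sum_(i <- r) f i x).
Proof.
move=> ef; elim: r => [|i r IH].
  rewrite (_ : (fun _ => _) = fun=> 0); first exact: elem_cst.
  by apply/funext => x; rewrite big_nil.
rewrite (_ : (fun _ => _) = fun x => f i x + \sum_(j <- r) f j x).
  exact: elem_add.
by apply/funext => x; rewrite big_cons.
Qed.

Lemma elem_dotp (y : E) : elem (fun x => dotp (x - y) (x - y)).
Proof.
by exists (fun _ x => dotp (x - y) (x - y)) => //; exact: fam_dotp.
Qed.

Lemma elem_partial i f : elem f -> elem (partial i f).
Proof.
move=> [h fh <-]; have [h' [fh' E']] := fam_partial (fun=> I) [:: i] fh.
by exists h' => //; rewrite -E'.
Qed.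

Lemma elem_smooth f : elem f -> smooth f.
Proof. by move=> [h fh <-]; exact: (fam_smooth _ _ fh). Qed.

Lemma elem_continuous f : elem f -> continuous f.
Proof. by move=> ef; have [] := elem_smooth ef [::]. Qed.

Lemma elem_differentiable f x : elem f -> differentiable f x.
Proof. by move=> [h fh <-]; exact: fam_differentiable fh. Qed.

Lemma elem_is_derive f i x : elem f -> is_derive x (delta_mx 0 i) f (partial i f x).
Proof.
by move=> ef; apply: derivableP; apply: diff_derivable; exact: elem_differentiable.
Qed.

Lemma partial_out i f x : ~ supp f x -> partial i f x = 0.
Proof.
move=> nfx; rewrite /partial (@near_eq_derive _ _ _ _ (cst 0)) ?derive_cst//.
have : open (~` supp f) by apply: closed_openC; exact: closed_closure.
move=> oC; have := open_nbhs_nbhs (conj oC nfx).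
apply: filterS => y /= ny; apply: contrapT => /eqP fy; apply: ny.
exact: subset_closure.
Qed.

Lemma supp_out f x : ~ supp f x -> f x = 0.
Proof.
by move=> ny; apply: contrapT => /eqP fy; apply: ny; exact: subset_closure.
Qed.

Lemma supp_sub f (K : set E) : closed K -> (forall x, f x != 0 -> K x) ->
  supp f `<=` K.
Proof.
by move=> cK fK; rewrite /supp closureE => x; apply.
Qed.

End elementary_functions.

(** * Lebesgue measure and calculus on row vectors *)

Section row_measurability.
Variables (R : realType) (m : nat).
Local Notation E := 'rV[R]_m.

Lemma measurable_coord i (A : set R) : measurable A ->
  measurable [set x : E | A (x 0 i)].
Proof.
move=> mA; have := @measurable_coords R m i measurableT _ mA.
by rewrite setTI.
Qed.

Lemma measurable_box (A : 'I_m -> set R) : (forall i, measurable (A i)) ->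
  measurable [set x : E | forall i, A i (x 0 i)].
Proof.
move=> mA; rewrite (_ : mkset _ = \bigcap_(i in [set: 'I_m]) [set x : E | A i (x 0 i)]).
  by apply: fin_bigcap_measurable => // i _; exact: measurable_coord.
by apply/seteqP; split => x /= h i; [move=> _|]; exact: h.
Qed.

(** An open set is the union of the countably many boxes with rational centre and half side 1 / (k +
    1) that it contains, enumerated through [pickle]. *)
Lemma open_measurable_rV (O : set E) : open O -> measurable O.
Proof.
move=> oO.
pose B (p : 'rV[rat]_m * nat) : set E :=
  [set x | forall i, `](ratr (p.1 0 i) - p.2.+1%:R^-1), (ratr (p.1 0 i) + p.2.+1%:R^-1)[%classic (x 0 i)].
pose F (j : nat) := if unpickle j is Some p then
  (if `[< B p `<=` O >] then B p else set0) else set0.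
rewrite (_ : O = \bigcup_j F j).
  apply: bigcup_measurable => j _; rewrite /F; case: unpickle => [p|//].
  case: ifP => // _.
  by apply: (@measurable_box (fun i => `](ratr (p.1 0 i) - p.2.+1%:R^-1), (ratr (p.1 0 i) + p.2.+1%:R^-1)[%classic)) => i; exact: measurable_itv.
apply/seteqP; split => [x Ox|x [j _]]; last first.
  by rewrite /F; case: unpickle => // p; case: asboolP => // + Bx; apply.
have /nbhs_ballP[e /= e0 He] := open_nbhs_nbhs (conj oO Ox).
(* Half of e, because x and y may lie on opposite sides of the rational centre. *)
have [k ke] : exists k : nat, k.+1%:R^-1 < e / 2 :> R.
  have e2 : 0 < e / 2 by rewrite divr_gt0.
  have [k] := ltr_add_invr e2; rewrite add0r => Hk; by exists k.
have /choice[q Hq] : forall i : 'I_m, exists q : rat,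
    ratr q \in `](x 0 i - k.+1%:R^-1), (x 0 i + k.+1%:R^-1)[.
  have d0 : 0 < k.+1%:R^-1 :> R by rewrite invr_gt0 ltr0n.
  by move=> i; apply: rat_in_itvoo; rewrite ltrD2l (@lt_trans _ _ 0)// oppr_lt0.
exists (pickle (\row_i q i, k)) => //; rewrite /F pickleK.
have HB : B (\row_i q i, k) `<=` O.
  move=> y /= By; apply: He; rewrite -ball_normE/=.
  apply: (@le_lt_trans _ _ (k.+1%:R^-1 *+ 2)); last first.
    by move: (k.+1%:R^-1) ke => d; lra.
  apply: norm_le_coord => [|i]; first by rewrite mulrn_wge0// invr_ge0.
  have := By i; have := Hq i; rewrite /= !mxE !in_itv/=.
  by move: (k.+1%:R^-1) => d /andP[h1 h2] /andP[h3 h4]; rewrite ler_norml; lra.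
case: asboolP => //= _ i; have := Hq i; rewrite /= mxE !in_itv/=.
by move: (k.+1%:R^-1) => d /andP[h1 h2]; lra.
Qed.

Lemma continuous_measurable_rV (f : E -> R) :
  continuous f -> measurable_fun setT f.
Proof.
move=> cf; apply: (measurability _ (RGenOpens.measurableE R)).
move=> _ [_ [a [b ->] <-]]; rewrite setTI; apply: open_measurable_rV.
by move/continuousP : cf; apply; exact: interval_open.
Qed.

Lemma measurable_eball (r : R) : measurable (eball r : set E).
Proof.
have c : continuous (fun x : E => dotp x x).
  have [k [fk ek]] : exists k, fam [set: unit -> R] k /\ k tt = fun x : E => dotp x x.
    exists (fun _ x => dotp (x - 0) (x - 0)); split; first exact: fam_dotp.
    by apply/funext => x; rewrite subr0.
  by rewrite -ek; apply: fam_continuous fk.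
have mf := continuous_measurable_rV c.
rewrite (_ : eball r = [set x : E | 0 < r /\ dotp x x < r ^+ 2]).
  have [r0|r0] := ltP 0 r; last first.
    by rewrite (_ : mkset _ = set0)//; apply/seteqP; split => // x [].
  rewrite (_ : mkset _ = (fun x : E => dotp x x) @^-1` `]-oo, r ^+ 2[%classic).
    by rewrite -[X in measurable X]setTI; exact: mf.
  by apply/seteqP; split => x /=; rewrite in_itv/= => // -[].
apply/seteqP; split => x; rewrite /eball/=.
  move=> xr; have r0 := le_lt_trans (enorm_ge0 x) xr; split => //.
  by rewrite -enorm_sqr ltr_pXn2r// nnegrE ?enorm_ge0// ltW.
by case=> r0; rewrite -enorm_sqr ltr_pXn2r// ?nnegrE ?enorm_ge0// ltW.
Qed.

End row_measurability.

Section leb_sigma_finite.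
Variable R : realType.

Lemma leb_cube n (y : 'rV[R]_n) (r : R) : 0 <= r ->
  leb n [set x : 'rV[R]_n | forall i, `|x 0 i - y 0 i| <= r] = ((r *+ 2) ^+ n)%:E.
Proof.
move=> r0.
rewrite (_ : mkset _ = [set x : 'rV[R]_n | forall i,
    `[(y 0 i - r), (y 0 i + r)]%classic (x 0 i)]); last first.
  by apply/seteqP; split => x /= h i; have := h i; rewrite in_itv/= ler_distl.
rewrite (@leb_box R n (fun i => `[(y 0 i - r), (y 0 i + r)]%classic))//.
rewrite (eq_bigr (fun=> (r *+ 2)%:E)) ?prodEFin.
  by rewrite prodr_const card_ord.
move=> i _; rewrite lebesgue_measure_itv/= lte_fin.
have [->|rn0] := eqVneq r 0; first by rewrite subr0 addr0 ltxx mul0rn.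
have r1 : 0 < r by rewrite lt_neqAle eq_sym rn0.
move: (y 0 i) => z; rewrite ifT; last lra.
by rewrite -EFinD; congr (_%:E); lra.
Qed.

Lemma leb_sigma_finite n : sigma_finite setT (leb n : set 'rV[R]_n -> \bar R).
Proof.
exists (fun k => [set x : 'rV[R]_n | forall i, `|x 0 i - (0 : 'rV[R]_n) 0 i| <= k%:R]).
  apply/seteqP; split => // x _.
  have := Num.Theory.archi_boundP (normr_ge0 x) => Hk.
  exists (Num.bound `|x|) => //= i; rewrite mxE subr0.
  by rewrite (le_trans (coord_le_norm _ _))// ltW.
move=> k; split; last by rewrite leb_cube// ltry.
rewrite (_ : mkset _ = [set x : 'rV[R]_n | forall i,
    `[((0 : 'rV[R]_n) 0 i - k%:R), ((0 : 'rV[R]_n) 0 i + k%:R)]%classic (x 0 i)]); last first.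
  by apply/seteqP; split => x /= h i; have := h i; rewrite in_itv/= ler_distl.
exact: (@measurable_box R n (fun i => `[((0 : 'rV[R]_n) 0 i - k%:R), ((0 : 'rV[R]_n) 0 i + k%:R)]%classic)).
Qed.

HB.instance Definition _ n := @Measure_isSigmaFinite.Build _ _ R (@leb R n)
  (@leb_sigma_finite n).

End leb_sigma_finite.

Section leb_fubini.
Variables (R : realType) (n : nat).
Notation mu := (@lebesgue_measure R).
Local Open Scope ereal_scope.

Lemma ge0_integral_leb (f : 'rV[R]_n.+1 -> \bar R) :
  measurable_fun setT f -> (forall x, 0 <= f x) ->
  \int[leb n.+1]_x f x = \int[leb n]_y \int[mu]_t f (snoc (y, t)).
Proof.
move=> mf f0.
have mg : measurable_fun setT (f \o @snoc R n).
  by apply: measurableT_comp => //; exact: measurable_snoc.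
rewrite -(@fubini_tonelli1 _ _ _ _ R (leb n) mu (f \o @snoc R n))//; last first.
  by move=> x; exact: f0.
have := @ge0_integral_pushforward _ _ _ _ R (@snoc R n) (@measurable_snoc R n)
  (leb n \x mu) setT f measurableT mf (fun y _ => f0 y).
by rewrite preimage_setT.
Qed.

Section integrable.
Variable f : 'rV[R]_n.+1 -> \bar R.
Hypothesis intf : (leb n.+1).-integrable setT f.

Lemma integrable_snoc : (leb n \x mu).-integrable setT (f \o @snoc R n).
Proof.
have mf := measurable_int _ intf.
have mg : measurable_fun setT (f \o @snoc R n).
  by apply: measurableT_comp => //; exact: measurable_snoc.
apply/integrableP; split => //.
have [_] := integrableP _ _ _ intf; congr (_ < _).
have := @ge0_integral_pushforward _ _ _ _ R (@snoc R n) (@measurable_snoc R n)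
  (leb n \x mu) setT (fun x => `|f x|) measurableT.
by rewrite preimage_setT; apply => //; exact: measurableT_comp.
Qed.

Let integral_leb_prod :
  \int[leb n.+1]_x f x = \int[leb n \x mu]_z (f \o @snoc R n) z.
Proof.
have := @integral_pushforward _ _ _ _ R (@snoc R n) (@measurable_snoc R n)
  (leb n \x mu) setT f (measurable_int _ intf).
by rewrite preimage_setT; apply => //; exact: integrable_snoc.
Qed.

Lemma integral_leb :
  \int[leb n.+1]_x f x = \int[leb n]_y \int[mu]_t f (snoc (y, t)).
Proof.
rewrite integral_leb_prod.
by rewrite -(@integral12_prod_meas1 _ _ _ _ R (leb n) mu _ integrable_snoc).
Qed.

Lemma integral_lebC :
  \int[leb n.+1]_x f x = \int[mu]_t \int[leb n]_y f (snoc (y, t)).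
Proof.
rewrite integral_leb_prod.
by rewrite -(@integral21_prod_meas1 _ _ _ _ R (leb n) mu _ integrable_snoc).
Qed.

End integrable.

End leb_fubini.

Section calculus_on_intervals.
Variable R : realType.
Notation mu := (@lebesgue_measure R).
Implicit Types (F f : R -> R) (a b : R).

Lemma integral_FTC2 F f a b : a < b ->
  (forall x, a < x < b -> is_derive x 1 F (f x)) ->
  {within `[a, b], continuous F} -> {within `[a, b], continuous f} ->
  (\int[mu]_(x in `[a, b]) (f x)%:E)%E = (F b - F a)%:E.
Proof.
move=> ab dF cF cf; rewrite EFinB; apply: continuous_FTC2 => //.
- have [_ Fa Fb] := (continuous_within_itvP F ab).1 cF.
  by split => // x; rewrite in_itv/= => xab; have [] := dF _ xab.
- move=> x; rewrite in_itv/= => xab; rewrite derive1E.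
  by have [_ ->] := dF _ xab.
Qed.

(** Monotone convergence along the intervals [rho / (k + 2), rho], which avoid the singularity at 0;
    the denominator exceeds 1, so none of them is degenerate. *)
Lemma integral_powR_le (p rho : R) : -1 < p -> 0 < rho ->
  (\int[mu]_(t in `]0%R, rho]) (t `^ p)%:E <= (rho `^ (p + 1) / (p + 1))%:E)%E.
Proof.
move=> p1 rho0; have p10 : 0 < p + 1 by lra.
pose F k : set R := `[rho / k.+2%:R, rho]%classic.
have k0 k : 0 < rho / k.+2%:R by rewrite divr_gt0.
have krho k : rho / k.+2%:R < rho by rewrite ltr_pdivrMr// ltr_pMr// ltr1n.
have -> : `]0, rho]%classic = \bigcup_k F k.
  apply/seteqP; split => [x /=|x [k _]]; rewrite /F/= !in_itv/= => /andP[x0 xr].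
    have [k /ltW Hk] : exists k : nat, rho / x < k%:R.
      by exists (Num.bound (rho / x)); rewrite archi_boundP// divr_ge0// ltW.
    exists k => //=; rewrite in_itv/= xr andbT ler_pdivrMr// mulrC.
    by rewrite -ler_pdivrMr// (le_trans Hk)// ler_nat leqW.
  by rewrite (lt_le_trans (k0 k)).
have cv := @ge0_nondecreasing_set_cvg_integral _ (measurableTypeR R) R F
  (fun t => (t `^ p)%:E) lebesgue_measure.
have -> : (\int[mu]_(t in \bigcup_k F k) (t `^ p)%:E)%E =
    limn (fun k => \int[mu]_(t in F k) (t `^ p)%:E)%E.
  apply/esym/cvg_lim => //; apply: cv.
  - apply/nondecreasing_seqP => k; apply/subsetPset => x; rewrite /F/= !in_itv/=.
    move=> /andP[h ->]; rewrite andbT (le_trans _ h)// ler_pM2l// lef_pV2 ?posrE//.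
    by rewrite ler_nat.
  - by move=> k; exact: measurable_itv.
  - move=> k; apply/measurable_EFinP; apply: measurable_funTS.
    exact: measurable_powR.
  - by move=> k x _; rewrite lee_fin powR_ge0.
apply: lime_le.
  apply: ereal_nondecreasing_is_cvgn; apply/nondecreasing_seqP => k.
  apply: ge0_subset_integral => //=.
  - exact: measurable_itv.
  - exact: measurable_itv.
  - apply/measurable_EFinP; apply: measurable_funTS; exact: measurable_powR.
  - by move=> x _; rewrite lee_fin powR_ge0.
  - move=> x; rewrite /F/= !in_itv/=.
    move=> /andP[h ->]; rewrite andbT (le_trans _ h)// ler_pM2l// lef_pV2 ?posrE//.
    by rewrite ler_nat.
near=> k.
have dF (x : R) : 0 < x -> is_derive x 1 (fun t : R => t `^ (p + 1) / (p + 1)) (x `^ p).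
  move=> x0; have d := is_derive1_powR (p + 1) x0.
  have d2 := is_deriveM d (is_derive_cst (p + 1)^-1 x 1).
  apply: (is_derive_eq d2); rewrite /GRing.scale/= mulr0 add0r addrK.
  by rewrite mulrA mulVf ?mul1r// gt_eqF.
have -> : (\int[mu]_(t in F k) (t `^ p)%:E)%E =
    (rho `^ (p + 1) / (p + 1) - (rho / k.+2%:R) `^ (p + 1) / (p + 1))%:E.
  apply: (@integral_FTC2 (fun t : R => t `^ (p + 1) / (p + 1))) => //.
  - by move=> x /andP[x0 _]; apply: dF; rewrite (lt_trans _ x0).
  - apply: derivable_within_continuous => x; rewrite in_itv/= => /andP[x0 _].
    by have [] := dF x (lt_le_trans (k0 k) x0).
  - apply: derivable_within_continuous => x; rewrite in_itv/= => /andP[x0 _].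
    by have [] := is_derive1_powR p (lt_le_trans (k0 k) x0).
by rewrite lee_fin lerBlDr lerDl divr_ge0 ?powR_ge0// ltW.
Unshelve. all: by end_near. Qed.

End calculus_on_intervals.

Section continuous_bounded.
Variables (R : realType) (m : nat).
Local Notation E := 'rV[R]_m.

Lemma compact_cube (rho : R) : compact [set x : E | `|x| <= rho].
Proof.
apply: bounded_closed_compact.
  exists rho; split; first exact: num_real.
  by move=> M rM x /= xr; rewrite (le_trans xr)// ltW.
rewrite (_ : mkset _ = (fun x : E => `|x|) @^-1` [set t | t <= rho])//.
apply: closed_comp; last exact: closed_le.
by move=> x _; exact: norm_continuous.
Qed.

Lemma continuous_bounded_cube (f : E -> R) (rho : R) : continuous f ->
  exists2 C, 0 <= C & forall x, `|x| <= rho -> `|f x| <= C.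
Proof.
move=> cf; have cK := @compact_cube rho.
have cfK : {within [set x : E | `|x| <= rho], continuous f}.
  exact: continuous_subspaceT.
have [M [_ HM]] := compact_bounded (continuous_compact cfK cK).
exists (`|M| + 1); first by rewrite addr_ge0.
move=> x xr; apply: (HM (`|M| + 1)).
  by rewrite (le_lt_trans (ler_norm _))// ltrDl.
by exists x.
Qed.

Lemma measurable_cube (rho : R) : measurable [set x : E | `|x| <= rho].
Proof.
rewrite (_ : mkset _ = (fun x : E => `|x|) @^-1` `]-oo, rho]%classic); last first.
  by apply/seteqP; split => x /=; rewrite in_itv.
rewrite -[X in measurable X]setTI.
have := @continuous_measurable_rV R m (fun x : E => `|x|).
by apply => //; exact: norm_continuous.
Qed.

Lemma leb_cube0 (rho : R) : 0 <= rho ->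
  leb m [set x : E | `|x| <= rho] = ((rho *+ 2) ^+ m)%:E.
Proof.
move=> r0; rewrite -(leb_cube (0 : E) r0); congr (leb m _).
apply/seteqP; split => x /= h.
  by move=> i; rewrite mxE subr0 (le_trans (coord_le_norm _ _)).
by apply: norm_le_coord => // i; have := h i; rewrite mxE subr0.
Qed.

Lemma integrable_continuous_cube (f : E -> R) (rho : R) : continuous f ->
  (forall x, rho < `|x| -> f x = 0) -> (leb m).-integrable setT (EFin \o f).
Proof.
move=> cf f0; have mQ := @measurable_cube `|rho|.
have -> : EFin \o f = (EFin \o f) \_ [set x : E | `|x| <= `|rho|].
  apply/funext => x; rewrite patchE; case: ifPn => //; rewrite notin_setE/=.
  move=> /negP; rewrite -ltNge => xr; rewrite f0//.
  by rewrite (le_lt_trans (ler_norm _)).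
rewrite -integrable_mkcond//.
apply: measurable_bounded_integrable => //.
- by rewrite [ltLHS](leb_cube0 (normr_ge0 rho)) ltry.
- by apply: measurable_funTS; exact: continuous_measurable_rV.
- have [C C0 HC] := continuous_bounded_cube `|rho| cf.
  exists C; split; first exact: num_real.
  by move=> M CM x /= xr; rewrite (le_trans (HC _ xr))// ltW.
Qed.

End continuous_bounded.

Lemma near_snoc_last (R : realType) (n : nat) (y : 'rV[R]_n) (t h : R) :
  h *: delta_mx 0 ord_max + snoc (y, t) = snoc (y, h + t).
Proof.
apply/rowP => j; rewrite !mxE eqxx/=.
case: unliftP => [k ->|->] /=; last by rewrite eqxx mulr1.
by rewrite eq_sym (negbTE (neq_lift _ _)) mulr0 add0r.
Qed.

Lemma near_snoc_lift (R : realType) (n : nat) (y : 'rV[R]_n) (t h : R) (i : 'I_n) :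
  h *: delta_mx 0 (lift ord_max i) + snoc (y, t) = snoc (h *: delta_mx 0 i + y, t).
Proof.
apply/rowP => j; rewrite !mxE eqxx/=.
case: unliftP => [k ->|->] /=; first by rewrite !mxE eqxx (inj_eq (@lift_inj _ _)).
by rewrite (negbTE (neq_lift _ _)) mulr0 add0r.
Qed.

Lemma snocK (R : realType) (n : nat) (x : 'rV[R]_n.+1) :
  snoc (\row_i x 0 (lift ord_max i), x 0 ord_max) = x.
Proof.
by apply/rowP => j; rewrite mxE; case: unliftP => [k ->|->] //=; rewrite mxE.
Qed.

Lemma snoc_last (R : realType) (n : nat) (y : 'rV[R]_n) (t : R) :
  snoc (y, t) 0 ord_max = t.
Proof. by rewrite mxE unlift_none. Qed.

Lemma snoc_lift (R : realType) (n : nat) (y : 'rV[R]_n) (t : R) i :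
  snoc (y, t) 0 (lift ord_max i) = y 0 i.
Proof. by rewrite mxE liftK. Qed.

Lemma snoc_norm_ge (R : realType) (n : nat) (y : 'rV[R]_n) (t : R) :
  `|y| <= `|snoc (y, t)|.
Proof.
apply: norm_le_coord => // i; rewrite -(snoc_lift y t).
exact: coord_le_norm.
Qed.

Lemma snoc_norm_last (R : realType) (n : nat) (y : 'rV[R]_n) (t : R) :
  `|t| <= `|snoc (y, t)|.
Proof. by rewrite -{1}(snoc_last y t); exact: coord_le_norm. Qed.

Lemma snoc_continuousl (R : realType) (n : nat) (t : R) :
  continuous (fun y : 'rV[R]_n => snoc (y, t)).
Proof.
move=> y A /nbhs_ballP[e /= e0 He]; apply/nbhs_ballP; exists e => //= z yz.
apply: He; move: yz; rewrite -!ball_normE/=; apply: le_lt_trans.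
apply: norm_le_coord => // i; rewrite !mxE; case: unliftP => [j _|_] /=.
  by have := coord_le_norm (y - z) j; rewrite !mxE.
by rewrite subrr normr0.
Qed.

Lemma snoc_continuousr (R : realType) (n : nat) (y : 'rV[R]_n) :
  continuous (fun t : R => snoc (y, t)).
Proof.
move=> t A /nbhs_ballP[e /= e0 He]; apply/nbhs_ballP; exists e => //= z yz.
apply: He; move: yz; rewrite -!ball_normE/=; apply: le_lt_trans.
apply: norm_le_coord => // i; rewrite !mxE; case: unliftP => [j _|_] //=.
by rewrite subrr normr0.
Qed.

(** * Partial derivatives of compactly supported functions have zero integral *)

Section divergence.
Variable R : realType.
Notation mu := (@lebesgue_measure R).

Lemma integral_derive_last (f f' : R -> R) (rho : R) :
  (forall t : R, is_derive t 1 f (f' t)) -> continuous f' ->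
  (forall t, rho <= `|t| -> f t = 0) -> (forall t, rho < `|t| -> f' t = 0) ->
  (\int[mu]_t (f' t)%:E = 0)%E.
Proof.
move=> df cf f0 f'0; pose r := `|rho| + 1.
have r0 : 0 < r by rewrite ltr_wpDl.
have rr : rho < r by rewrite (le_lt_trans (ler_norm _))// ltrDl.
have -> : (\int[mu]_t (f' t)%:E = \int[mu]_(t in `[(- r)%R, r]) (f' t)%:E)%E.
  rewrite [RHS]integral_mkcond; apply: eq_integral => t _; rewrite patchE.
  case: ifPn => //; rewrite notin_setE/= in_itv/= -ler_norml => /negP.
  by rewrite -ltNge => tr; rewrite f'0// (lt_trans rr).
rewrite (@integral_FTC2 _ f)//.
- rewrite !f0 ?subr0// ?normrN gtr0_norm// ltW//.
- by rewrite gtrN.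
- apply: continuous_subspaceT => t.
  by apply/differentiable_continuous/derivable1_diffP; have [] := df t.
- exact: continuous_subspaceT.
Qed.

(** In the last direction, integrate the last variable first and use the fundamental theorem; in any
    other direction integrate it last, so that the induction hypothesis applies on each slice. *)
Lemma integral_partial n (i : 'I_n) (f : 'rV[R]_n -> R) (rho : R) :
  (forall x, derivable f x (delta_mx 0 i)) -> continuous (partial i f) ->
  (forall x, rho <= `|x| -> f x = 0) ->
  (forall x, rho < `|x| -> partial i f x = 0) ->
  (\int[leb n]_x (partial i f x)%:E = 0)%E.
Proof.
elim: n i f => [[]//|n IH] i f df cf f0 pf0.
have ip := integrable_continuous_cube cf pf0.
case: (unliftP ord_max i) => [j ji|imax]; subst i.
- rewrite (integral_lebC ip) integral0_eq// => t _.
  have dE y : ((f \o shift (snoc (y, t))) \o *:%R^~ (delta_mx 0 (lift ord_max j)))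
      = (((fun z => f (snoc (z, t))) \o shift y) \o *:%R^~ (delta_mx 0 j)).
    by apply/funext => h /=; rewrite near_snoc_lift.
  have pE y : partial (lift ord_max j) f (snoc (y, t)) =
      partial j (fun z => f (snoc (z, t))) y.
    rewrite /partial /derive.
    by under eq_fun do rewrite -[(f \o _) _]/((_ \o *:%R^~ _) _) dE.
  under eq_integral do rewrite /= pE.
  apply: IH.
  + move=> y; have := df (snoc (y, t)); rewrite /derivable.
    by under eq_fun do rewrite -[(f \o _) _]/((_ \o *:%R^~ _) _) dE.
  + rewrite (_ : partial _ _ = partial (lift ord_max j) f \o (fun y => snoc (y, t))).
      by move=> y; apply: continuous_comp; [exact: snoc_continuousl|exact: cf].
    by apply/funext => y /=; rewrite pE.
  + by move=> y yr; apply: f0; exact: le_trans yr (snoc_norm_ge _ _).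
  + by move=> y yr; rewrite -pE; apply: pf0; exact: lt_le_trans yr (snoc_norm_ge _ _).
- rewrite (integral_leb ip) integral0_eq// => y _.
  apply: (@integral_derive_last (fun t => f (snoc (y, t)))
    (fun t => partial ord_max f (snoc (y, t))) rho).
  + move=> t; have dfl := derivableP (df (snoc (y, t))).
    apply/is_derive_line; move/is_derive_line : dfl => dfl.
    rewrite (_ : (fun h : R => f (snoc (y, h *: 1 + t))) =
      (fun h : R => f (h *: delta_mx 0 ord_max + snoc (y, t))))//.
    by apply/funext => h; rewrite near_snoc_last [h *: 1](_ : _ = h)//; exact: mulr1.
  + move=> t; apply: (@continuous_comp _ _ _ (fun t => snoc (y, t))).
      exact: snoc_continuousr.
    exact: cf.
  + by move=> t tr; apply: f0; exact: le_trans tr (snoc_norm_last _ _).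
  + by move=> t tr; apply: pf0; exact: lt_le_trans tr (snoc_norm_last _ _).
Qed.

End divergence.

Section half_balls.
Variables (R : realType) (n : nat).
Local Notation E := 'rV[R]_n.+1.
Notation mu := (@lebesgue_measure R).

Lemma measurable_half_ball (rho : R) : measurable (half_ball rho : set E).
Proof.
apply: measurableI; first exact: measurable_eball.
rewrite -[X in measurable X]/([set x : E | 0 < x 0 ord_max]).
have -> : [set x : E | 0 < x 0 ord_max] = [set x : E | `]0, +oo[%classic (x 0 ord_max)].
  by apply/seteqP; split => x /=; rewrite in_itv/= andbT.
exact: (@measurable_coord R n.+1 ord_max `]0, +oo[%classic).
Qed.

Lemma measurable_weight (a : R) : measurable_fun setT (@weight R n a).
Proof.
have mc : measurable_fun setT (fun x : E => x 0 ord_max).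
  apply: (@continuous_measurable_rV R n.+1) => x.
  by have := @coord_continuous R 1 n.+1 0 ord_max x.
apply: (measurableT_comp (f := fun t : R => t `^ a) _ mc).
exact: measurable_powR.
Qed.

(** The half ball sits in the box [-rho, rho]^n x (0, rho], on which the integral factors. *)
Lemma weight_integral_le (a rho : R) : -1 < a -> 0 < rho ->
  (\int[leb n.+1]_(x in half_ball rho) (weight a x)%:E <=
   ((rho *+ 2) ^+ n * (rho `^ (a + 1) / (a + 1)))%:E)%E.
Proof.
move=> a1 r0.
pose A (i : 'I_n.+1) : set R := if i == ord_max then `]0, rho]%classic
  else `[- rho, rho]%classic.
pose Q : set E := [set x | forall i, A i (x 0 i)].
have mQ : measurable Q.
  by apply: measurable_box => i; rewrite /A; case: ifP.
have Qs y t : Q (snoc (y, t)) = (`|y| <= rho /\ `]0, rho]%classic t).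
  rewrite propeqE; split => [h|[yr tr] i]; last first.
    rewrite /A; case: (unliftP ord_max i) => [j ->|->].
      rewrite eq_sym (negbTE (neq_lift _ _)) snoc_lift /= in_itv/= -ler_norml.
      exact: le_trans (coord_le_norm _ _) yr.
    by rewrite eqxx snoc_last.
  split; last by have := h ord_max; rewrite /A eqxx snoc_last.
  apply: norm_le_coord => [|j]; first exact: ltW.
  have := h (lift ord_max j).
  by rewrite /A eq_sym (negbTE (neq_lift _ _)) snoc_lift /= in_itv/= -ler_norml.
have sQ : half_ball rho `<=` Q.
  move=> x [/= xr x0] i; have xi : `|x 0 i| < rho.
    exact: le_lt_trans (coord_le_enorm _ _) xr.
  rewrite /A; case: eqP => [->|_] /=; rewrite in_itv/= ?x0/=.
    by rewrite (le_trans (ler_norm _))// ltW// (le_lt_trans (coord_le_enorm _ _) xr).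
  by rewrite -ler_norml ltW.
apply: (@le_trans _ _ (\int[leb n.+1]_(x in Q) (weight a x)%:E)%E).
  apply: ge0_subset_integral => //; first exact: measurable_half_ball.
    by apply/measurable_EFinP; apply: measurable_funTS; exact: measurable_weight.
  by move=> x _; rewrite lee_fin powR_ge0.
pose f := (fun x : E => (weight a x)%:E) \_ Q.
have f0 x : (0 <= f x)%E by rewrite /f patchE; case: ifP => // _; rewrite lee_fin powR_ge0.
have mf : measurable_fun setT f.
  apply/(measurable_restrictT _ _).1 => //.
  by apply/measurable_EFinP; apply: measurable_funTS; exact: measurable_weight.
rewrite integral_mkcond -/f ge0_integral_leb//.
pose c := rho `^ (a + 1) / (a + 1).
have c0 : 0 <= c by rewrite divr_ge0 ?powR_ge0//; lra.
pose Q1 : set 'rV[R]_n := [set y | `|y| <= rho].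
have mQ1 : measurable Q1 by exact: measurable_cube.
apply: (@le_trans _ _ (\int[leb n]_(y in Q1) c%:E)%E); last first.
  rewrite integral_cst//.
  by rewrite [X in (_ * X <= _)%E](leb_cube0 n (ltW r0)) -EFinM lee_fin mulrC.
rewrite [leRHS]integral_mkcond; apply: ge0_le_integral => //.
- by move=> y _; apply: integral_ge0.
- have mg : measurable_fun setT (f \o @snoc R n).
    by apply: measurableT_comp => //; exact: measurable_snoc.
  apply: (measurable_fun_fubini_tonelli_F (f \o @snoc R n)) => //= x.
- apply/(measurable_restrictT _ _).1 => //; exact: measurable_cst.
move=> y _; rewrite patchE; case: ifPn => [|]; rewrite ?inE ?notin_setE => yQ.
  rewrite (_ : (\int[mu]_t f (snoc (y, t)))%E = (\int[mu]_(t in `]0%R, rho]) (t `^ a)%:E)%E).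
    exact: integral_powR_le.
  rewrite [RHS]integral_mkcond; apply: eq_integral => t _.
  rewrite /f !patchE; have [tr|tr] := pselect (`]0, rho]%classic t).
    by rewrite !mem_set ?Qs// /weight snoc_last.
  by rewrite !memNset ?Qs// => -[].
rewrite integral0_eq// => t _; rewrite /f patchE.
by case: ifPn => //; rewrite inE Qs => -[].
Qed.

End half_balls.

Section Rintegral_tools.
Context d (T : measurableType d) (R : realType) (m : {measure set T -> \bar R}).
Variable D : set T.
Hypothesis mD : measurable D.
Implicit Types f g h : T -> R.

Lemma integrable_bound f g : measurable_fun D f ->
  (forall x, D x -> `|f x| <= g x) -> m.-integrable D (EFin \o g) ->
  m.-integrable D (EFin \o f).
Proof.
move=> mf fg; apply: le_integrable => //; first exact/measurable_EFinP.
by move=> x Dx /=; rewrite lee_fin (le_trans (fg _ Dx))// ler_norm.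
Qed.

Lemma Rintegral_dominated (f_ : nat -> T -> R) f g :
  (forall k, measurable_fun D (f_ k)) -> measurable_fun D f ->
  (forall x, D x -> f_ k x @[k --> \oo] --> f x) ->
  m.-integrable D (EFin \o g) ->
  (forall k x, D x -> `|f_ k x| <= g x) ->
  \int[m]_(x in D) f_ k x @[k --> \oo] --> \int[m]_(x in D) f x.
Proof.
move=> mf_ mf cf ig fg.
have [] := @dominated_convergence _ _ _ m D mD (fun k => EFin \o f_ k) (EFin \o f)
  (EFin \o g).
- by move=> k; exact/measurable_EFinP.
- exact/measurable_EFinP.
- by apply: aeW => x Dx; apply/fine_cvgP; split; [exact: nearW|exact: cf].
- exact: ig.
- by apply: aeW => k x Dx /=; rewrite lee_fin fg.
move=> _ _ cv; apply: fine_cvg; rewrite fineK//.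
apply: integrable_fin_num => //; apply: (integrable_bound mf _ ig) => x Dx.
have /cvg_norm cn := cf x Dx.
rewrite -(cvg_lim _ cn)//; apply: limr_le; first by apply/cvg_ex; exists `|f x|.
by apply: nearW => k; exact: fg.
Qed.

Lemma Rintegral_sum (I : Type) (r : seq I) (f : I -> T -> R) :
  (forall i, m.-integrable D (EFin \o f i)) ->
  \int[m]_(x in D) (\sum_(i <- r) f i x) = \sum_(i <- r) \int[m]_(x in D) f i x.
Proof.
move=> intf; elim: r => [|i r IH].
  rewrite big_nil; under eq_Rintegral do rewrite big_nil.
  by rewrite Rintegral_cst// mul0r.
rewrite big_cons -IH -RintegralD//; last first.
  apply: (@eq_integrable _ _ _ _ _ mD (fun x => \sum_(i <- r) (f i x)%:E)%E).
    by move=> x _ /=; rewrite sumEFin.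
  by apply: (@integrable_sum _ _ _ m D mD _ r xpredT (fun i x => (f i x)%:E)) => i0 _; exact: intf.
by apply: eq_Rintegral => x _; rewrite big_cons.
Qed.

Lemma Rintegral_ae_eq f g : measurable_fun D f -> measurable_fun D g ->
  ae_eq m D f g -> \int[m]_(x in D) f x = \int[m]_(x in D) g x.
Proof.
move=> mf mg fg; congr fine; apply: ae_eq_integral => //.
- exact/measurable_EFinP.
- exact/measurable_EFinP.
- by apply: filterS fg => x fgx Dx; rewrite fgx.
Qed.

Lemma le_norm_Rintegral_bound f g : measurable_fun D f ->
  (forall x, D x -> `|f x| <= g x) -> m.-integrable D (EFin \o g) ->
  `|\int[m]_(x in D) f x| <= \int[m]_(x in D) g x.
Proof.
move=> mf fg ig; have intf := integrable_bound mf fg ig.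
apply: le_trans (le_normr_Rintegral mD intf) _.
apply: le_Rintegral => //; apply: integrable_bound ig => //.
  exact: measurableT_comp.
by move=> x Dx; rewrite normr_id fg.
Qed.

End Rintegral_tools.

Lemma powR_pred (R : realType) (p t : R) : 0 < t -> t `^ p = t * t `^ (p - 1).
Proof.
move=> t0; have e : p = 1 + (p - 1) by rewrite addrCA subrr addr0.
rewrite {1}e [LHS]powRD; first by rewrite powRr1// ltW.
by rewrite (gt_eqF t0) implybT.
Qed.

(** * Smooth approximations of the weight t^a that vanish near 0 *)

Section cutoff.
Variables (R : realType) (a : R).

(** Iterating a chosen derivative inside S produces the jet. *)
Lemma jet_of_closed (S : set (R -> R)) :
  (forall f, S f -> exists2 f', S f' & forall x : R, is_derive x 1 f (f' x)) ->
  forall f, S f -> exists2 g, jet g & g 0%N = f.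
Proof.
move=> HS f Sf.
have /choice[D HD] : forall f : R -> R, exists f' : R -> R, S f ->
    S f' /\ forall x : R, is_derive x 1 f (f' x).
  move=> h; have [Sh|nSh] := pselect (S h); last by exists h.
  by have [h' Sh' dh] := HS h Sh; exists h'.
have Sj j : S (iter j D f) by elim: j => //= j /HD[].
by exists (fun j => iter j D f) => // j x; have [_] := HD _ (Sj j); exact.
Qed.

(* Smooth on R, zero for t <= 1 / (k + 1), and increasing to t^a as k grows. *)
Definition cut (k : nat) (t : R) : R := t `^ a * flat 1 (t * k.+1%:R - 1).

(** Differentiation lowers b or replaces p by [dflat p]; with both left free the class is closed
    under it. *)
Inductive cuts (k : nat) : set (R -> R) :=
| cuts_base c b p : cuts k (fun t => c * (t `^ b * flat p (t * k.+1%:R - 1)))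
| cuts_add f g : cuts k f -> cuts k g -> cuts k (fun t => f t + g t).

Lemma is_derive_cut k b (p : {poly R}) (t : R) :
  is_derive t 1 (fun t => t `^ b * flat p (t * k.+1%:R - 1))
    (b * (t `^ (b - 1) * flat p (t * k.+1%:R - 1)) +
     k.+1%:R * (t `^ b * flat (dflat p) (t * k.+1%:R - 1))).
Proof.
have [t0|t0] := ltP 0 t.
  have d1 := is_derive1_powR b t0.
  have d2 : is_derive t 1 (fun t : R => t * k.+1%:R - 1) k.+1%:R.
    have e := is_deriveB (is_deriveM (is_derive_id t (1 : R))
      (is_derive_cst (k.+1%:R : R) t 1)) (is_derive_cst (1 : R) t 1).
    by apply: (is_derive_eq e); rewrite /GRing.scale/= mulr0 add0r mulr1 subr0.
  have d3 := @is_derive1_comp _ (flat p) (fun t => t * k.+1%:R - 1) t _ _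
    (is_derive_flat p _) d2.
  by apply: (is_derive_eq (is_deriveM d1 d3)); rewrite /GRing.scale/=; ring.
(* At t <= 0, where nothing is known about the power, the flat factor vanishes on a whole
   neighbourhood. *)
have neg q (s : R) : s < k.+1%:R^-1 -> flat q (s * k.+1%:R - 1) = 0.
  by move=> sk; rewrite /flat ltNge subr_le0 -ler_pdivlMr ?ltr0n// div1r ltW.
have tk : t < k.+1%:R^-1 by rewrite (le_lt_trans t0)// invr_gt0 ltr0n.
rewrite !neg// !mulr0 add0r; apply: (@near_eq_is_derive _ _ _ (cst 0)).
near=> s; rewrite neg ?mulr0//; near: s; exact: lt_nbhsl.
Unshelve. all: by end_near. Qed.

Lemma cut_jet k : exists2 g, jet g & g 0%N = cut k.
Proof.
apply: (@jet_of_closed (cuts k)); last first.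
  rewrite (_ : cut k = fun t => 1 * (t `^ a * flat 1 (t * k.+1%:R - 1))).
    exact: cuts_base.
  by apply/funext => t; rewrite mul1r.
move=> f; elim=> [c b p|g h _ [g' Sg' dg] _ [h' Sh' dh]]; last first.
  by exists (fun t => g' t + h' t); [exact: cuts_add|move=> x; exact: is_deriveD].
exists (fun t => c * b * (t `^ (b - 1) * flat p (t * k.+1%:R - 1)) +
     c * k.+1%:R * (t `^ b * flat (dflat p) (t * k.+1%:R - 1))).
  by apply: cuts_add; exact: cuts_base.
move=> x; apply: (is_derive_eq (is_deriveZ c (is_derive_cut k b p x))).
by rewrite /GRing.scale/= mulrDr !mulrA.
Qed.

Definition dcut (k : nat) (t : R) : R :=
  a * (t `^ (a - 1) * flat 1 (t * k.+1%:R - 1)) +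
  k.+1%:R * (t `^ a * flat (dflat 1) (t * k.+1%:R - 1)).

Lemma cut_out k t : t <= k.+1%:R^-1 -> cut k t = 0.
Proof.
move=> tk; rewrite /cut /flat ltNge subr_le0 -ler_pdivlMr ?ltr0n// div1r tk/=.
by rewrite mulr0.
Qed.

Lemma flat1_le1 (t : R) : 0 <= flat 1 t <= 1.
Proof.
rewrite /flat; case: ifPn => [t0|_]; last by rewrite lexx ler01.
by rewrite hornerC mul1r expR_ge0/= -expR0 ler_expR oppr_le0 invr_ge0 ltW.
Qed.

Lemma cut_le k t : `|cut k t| <= t `^ a.
Proof.
have /andP[h0 h1] := flat1_le1 (t * k.+1%:R - 1).
by rewrite /cut normrM (ger0_norm h0) (ger0_norm (powR_ge0 _ _)) ler_piMr ?powR_ge0.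
Qed.

Lemma near_large (c B : R) : 0 < c -> \forall k \near \oo, B <= c * k.+1%:R - 1.
Proof.
move=> c0; near=> k; rewrite lerBrDr -ler_pdivrMl// mulrC.
rewrite (@le_trans _ _ k%:R)// ?ler_nat//.
by near: k; exact: nbhs_infty_ger.
Unshelve. all: by end_near. Qed.

Lemma dflat1E (s : R) : 0 < s -> flat (dflat 1) s = s^-1 ^+ 2 * expR (- s^-1).
Proof. by move=> s0; rewrite /flat s0 /dflat derivC subr0 mulr1 hornerXn. Qed.

(** The factor k + 1 produced by differentiation is absorbed: with s = t (k + 1) - 1 one has (k + 1)
    t = s + 1, and (s + 1) s^-2 exp(-1/s) is bounded, being X + X^2 at 1/s times exp(-1/s). *)
Lemma dcut_le : exists2 C, 0 <= C & forall k t, 0 < t ->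
  `|dcut k t| <= C * t `^ (a - 1).
Proof.
have [C [C0 HC]] := @horner_le_expR R ('X + 'X^2).
exists (`|a| + C); first by rewrite addr_ge0.
move=> k t t0; rewrite /dcut mulrDl (le_trans (ler_normD _ _))// lerD//.
  rewrite normrM ler_wpM2l// normrM (ger0_norm (powR_ge0 _ _)) ler_piMr ?powR_ge0//.
  by have /andP[h0 h1] := flat1_le1 (t * k.+1%:R - 1); rewrite ger0_norm.
set s := t * k.+1%:R - 1; have [s0|s0] := ltP 0 s; last first.
  by rewrite /flat ltNge s0/= !mulr0 normr0 mulr_ge0// powR_ge0.
rewrite dflat1E//.
have := HC s^-1; rewrite invr_ge0 (ltW s0) => /(_ isT).
rewrite hornerD hornerX hornerXn => H.
have E : k.+1%:R * t `^ a = (s + 1) * t `^ (a - 1).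
  by rewrite /s subrK (powR_pred a t0); ring.
rewrite mulrA E mulrAC normrM (ger0_norm (powR_ge0 t _)) ler_wpM2r ?powR_ge0//.
rewrite mulrA expRN normrM normfV (ger0_norm (expR_ge0 _)) ler_pdivrMr ?expR_gt0//.
apply: le_trans H; rewrite le_eqVlt; apply/orP; left; apply/eqP; congr `|_|.
by field; rewrite gt_eqF.
Qed.

Lemma cut_cvg t : 0 < t -> cut k t @[k --> \oo] --> t `^ a.
Proof.
move=> t0; rewrite -[X in _ --> X]mulr1; apply: cvgMr.
apply/cvgrPdist_le => e e0; near=> k.
have s0 : e^-1 <= t * k.+1%:R - 1 by near: k; exact: near_large.
move: (t * k.+1%:R - 1) s0 => s s0.
have sp : 0 < s by rewrite (lt_le_trans _ s0)// invr_gt0.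
rewrite /flat sp hornerC mul1r ger0_norm; last first.
  by rewrite subr_ge0 -expR0 ler_expR oppr_le0 invr_ge0 ltW.
have : s^-1 <= e by rewrite -[leRHS]invrK lef_pV2 ?posrE// invr_gt0.
by have := expR_ge1Dx (- s^-1); lra.
Unshelve. all: by end_near. Qed.

Lemma dcut_cvg t : 0 < t -> dcut k t @[k --> \oo] --> a * t `^ (a - 1).
Proof.
move=> t0; rewrite -[X in _ --> X]addr0; apply: cvgD.
  apply: cvgMr; rewrite -[X in _ --> X]mulr1; apply: cvgMr.
  apply/cvgrPdist_le => e e0; near=> k.
  have s0 : e^-1 <= t * k.+1%:R - 1 by near: k; exact: near_large.
  move: (t * k.+1%:R - 1) s0 => s s0.
  have sp : 0 < s by rewrite (lt_le_trans _ s0)// invr_gt0.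
  rewrite /flat sp hornerC mul1r ger0_norm; last first.
    by rewrite subr_ge0 -expR0 ler_expR oppr_le0 invr_ge0 ltW.
  have : s^-1 <= e by rewrite -[leRHS]invrK lef_pV2 ?posrE// invr_gt0.
  by have := expR_ge1Dx (- s^-1); lra.
(* The remaining term is at most (s + 1) s^-2 p, hence at most 2 p / s once s >= 1. *)
apply/cvgrPdist_le => e e0; near=> k.
pose p := t `^ (a - 1); have p0 : 0 < p by exact: powR_gt0.
have s1 : 1 <= t * k.+1%:R - 1 by near: k; exact: near_large.
have s2 : 2 * p / e <= t * k.+1%:R - 1 by near: k; exact: near_large.
have E : k.+1%:R * t `^ a = (t * k.+1%:R - 1 + 1) * p.
  by rewrite subrK /p (powR_pred a t0); ring.
rewrite sub0r normrN mulrA E; move: (t * k.+1%:R - 1) s1 s2 => s s1 s2.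
have sp : 0 < s by lra.
rewrite dflat1E// ger0_norm; last first.
  apply: mulr_ge0; first by apply: mulr_ge0; lra.
  by rewrite mulr_ge0 ?expR_ge0 ?sqr_ge0.
have e1 : expR (- s^-1) <= 1 by rewrite -expR0 ler_expR oppr_le0 invr_ge0 ltW.
apply: (@le_trans _ _ ((s + 1) * p * (s^-1 ^+ 2))).
  by rewrite ler_wpM2l ?ler_piMr ?sqr_ge0// mulr_ge0//; lra.
rewrite exprVn ler_pdivrMr ?exprn_gt0//.
have : 2 * p <= s * e by rewrite -ler_pdivrMr.
nra.
Unshelve. all: by end_near. Qed.

End cutoff.

(** * The weak equation against even test functions *)

Lemma cvg_sum_seq (R : realType) I (r : seq I) (f : nat -> I -> R) (l : I -> R) :
  (forall i, f k i @[k --> \oo] --> l i) ->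
  \sum_(i <- r) f k i @[k --> \oo] --> \sum_(i <- r) l i.
Proof.
move=> fl; elim: r => [|i r IH].
  by under eq_fun do rewrite big_nil; rewrite big_nil; exact: cvg_cst.
by under eq_fun do rewrite big_cons; rewrite big_cons; exact: cvgD.
Qed.

Section vanishing_normal_derivative.
Variables (R : realType) (n : nat).
Local Notation E := 'rV[R]_n.+1.

(** Mean value theorem on the vertical segment down to {x_N = 0}. This is what keeps the term with a
    / x_N in [bessel] bounded. *)
Lemma last_le (rho C : R) (psi : E -> R) : elem psi ->
  (forall x : E, `|x| <= rho -> `|partial ord_max (partial ord_max psi) x| <= C) ->
  (forall x : E, x 0 ord_max = 0 -> partial ord_max psi x = 0) ->
  forall x : E, half_ball rho x -> `|partial ord_max psi x| <= C * x 0 ord_max.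
Proof.
move=> epsi HC psi0 x Ox.
have x0 : 0 < x 0 ord_max by case: Ox.
have xr : `|x| <= rho.
  by case: Ox => /= xr _; rewrite (le_trans (norm_le_enorm _))// ltW.
pose y := \row_i x 0 (lift ord_max i).
pose g (t : R) := partial ord_max psi (snoc (y, t)).
have dg (t : R) : is_derive t 1 g (partial ord_max (partial ord_max psi) (snoc (y, t))).
  have := elem_is_derive ord_max (snoc (y, t)) (elem_partial ord_max epsi).
  move/is_derive_line => d; apply/is_derive_line.
  rewrite (_ : (fun h : R => g (h *: 1 + t)) = (fun h : R =>
    partial ord_max psi (h *: delta_mx 0 ord_max + snoc (y, t))))//.
  apply/funext => h; rewrite near_snoc_last [h *: (1 : R)](_ : _ = h)//.
  by rewrite /GRing.scale/= mulr1.
have cg : {within `[0, x 0 ord_max], continuous g}.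
  apply: derivable_within_continuous => t _; by have [] := dg t.
have [c cx] := MVT x0 (fun t _ => dg t) cg.
have g0 : g 0 = 0 by rewrite /g psi0// snoc_last.
have gx : g (x 0 ord_max) = partial ord_max psi x by rewrite /g snocK.
rewrite g0 gx !subr0 => ->.
rewrite normrM (gtr0_norm x0) ler_wpM2r ?(ltW x0)//; apply: HC.
move: cx; rewrite in_itv/= => /andP[c0 cx].
apply: norm_le_coord => [|i]; first exact: le_trans (normr_ge0 x) xr.
case: (unliftP ord_max i) => [j ->|->].
  by rewrite snoc_lift mxE (le_trans (coord_le_norm _ _)).
rewrite snoc_last ger0_norm ?(ltW c0)// (le_trans (ltW cx))//.
by rewrite (le_trans (ler_norm _))// (le_trans (coord_le_norm _ _)).
Qed.

End vanishing_normal_derivative.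

Section bessel_operator.
Variables (R : realType) (n : nat).
Local Notation E := 'rV[R]_n.+1.

(* x_N^-a div(x_N^a grad psi). *)
Definition bessel (a : R) (psi : E -> R) (x : E) : R :=
  \sum_i partial i (partial i psi) x + a / x 0 ord_max * partial ord_max psi x.

Lemma is_derive_cut_jet (a : R) k (g : nat -> R -> R) : jet g -> g 0%N = cut a k ->
  forall t, g 1%N t = dcut a k t.
Proof.
move=> jg g0 t; have [_ <-] := jg 0%N t; rewrite g0.
by have [_ ->] := is_derive_cut k a 1 t.
Qed.

Lemma measurable_elem (f : E -> R) D : measurable D -> elem f -> measurable_fun D f.
Proof.
move=> mD ef; apply: measurable_funTS; apply: continuous_measurable_rV.
exact: elem_continuous.
Qed.

Lemma measurable_bessel a psi D : measurable D -> (forall x : E, D x -> 0 < x 0 ord_max) ->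
  elem psi -> measurable_fun D (bessel a psi).
Proof.
move=> mD D0 epsi; apply: measurable_funD.
  apply: measurable_elem => //; apply: elem_sum => i.
  by do 2 apply: elem_partial.
apply: measurable_funM; last by apply: measurable_elem => //; exact: elem_partial.
apply: measurable_funM => //.
apply: (eq_measurable_fun (weight (-1))).
  by move=> x /set_mem /D0 x0; rewrite /weight powR_inv1// ltW.
by apply: measurable_funTS; exact: measurable_weight.
Qed.

Lemma half_ball_last rho (x : E) : half_ball rho x -> 0 < x 0 ord_max.
Proof. by case. Qed.

Lemma integrable_weight (a rho : R) : -1 < a -> 0 < rho ->
  (leb n.+1).-integrable (half_ball rho : set E) (EFin \o weight a).
Proof.
move=> a1 rho0; apply/integrableP; split.
  by apply/measurable_EFinP; apply: measurable_funTS; exact: measurable_weight.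
apply: le_lt_trans (ltry _); apply: le_trans (weight_integral_le n a1 rho0).
rewrite le_eqVlt; apply/orP; left; apply/eqP; apply: eq_integral => x _ /=.
by rewrite ger0_norm// powR_ge0.
Qed.

Variables (a rho M : R) (u : E -> R) (Du : E -> E).
Hypotheses (a1 : -1 < a) (rho0 : 0 < rho).
Local Notation Omega := (half_ball rho).
Hypothesis mu : measurable_fun Omega u.
Hypothesis uM : forall x, Omega x -> `|u x| <= M.
Hypothesis Du2 : forall i, wL2 a Omega (fun x => Du x 0 i).
Hypothesis wg : weak_gradient Omega u Du.
Variable psi : E -> R.
Hypothesis epsi : elem psi.
Hypothesis cpsi : compact (supp psi).
Hypothesis spsi : supp psi `<=` eball rho.
Hypothesis psi0 : forall x : E, x 0 ord_max = 0 -> partial ord_max psi x = 0.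

Let mO : measurable (Omega : set E) := @measurable_half_ball R n rho.

(** The components of the field cut_k(x_N) grad psi, an approximation of x_N^a grad psi that is
    smooth and supported inside the half ball, so that the weak gradient can be tested with it. *)
Let phi k i (x : E) : R := cut a k (x 0 ord_max) * partial i psi x.

Let elem_cut k : elem (fun x : E => cut a k (x 0 ord_max)).
Proof. by have [g jg <-] := cut_jet a k; apply: elem_comp => //; exact: elem_coord. Qed.

Let elem_phi k i : elem (phi k i).
Proof. by apply: elem_mul; [exact: elem_cut|exact: elem_partial]. Qed.

Let test_phi k i : test_fun Omega (phi k i).
Proof.
pose K : set E := supp psi `&` [set x | k.+1%:R^-1 <= x 0 ord_max].
have cK : closed K.
  apply: closedI; first exact: closed_closure.
  rewrite -[X in closed X]/((fun x : E => x 0 ord_max) @^-1` [set t | k.+1%:R^-1 <= t]).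
  apply: closed_comp; last exact: closed_ge.
  by move=> x _; have := @coord_continuous R 1 n.+1 0 ord_max x.
have sK : supp (phi k i) `<=` K.
  apply: supp_sub => // x; rewrite mulf_eq0 negb_or => /andP[c0 p0]; split.
    by apply: contrapT => /partial_out p; move: p0; rewrite p eqxx.
  by rewrite /= leNgt; apply: contra c0 => /ltW xk; rewrite cut_out.
split; first exact/elem_smooth/elem_phi.
  apply: subclosed_compact cpsi _; first exact: closed_closure.
  by move=> x /sK[].
move=> x /sK[/spsi xr /= xk]; split => //=; apply: lt_le_trans xk.
by rewrite invr_gt0 ltr0n.
Qed.

Let partial_phi k i x : partial i (phi k i) x =
  (i == ord_max)%:R * (dcut a k (x 0 ord_max) * partial ord_max psi x) +
  cut a k (x 0 ord_max) * partial i (partial i psi) x.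
Proof.
have [g jg g0] := cut_jet a k.
have dc := is_derive_comp_line (is_derive_coord x (delta_mx 0 i) ord_max) (jg 0%N _).
rewrite (is_derive_cut_jet jg g0) g0 in dc.
have dp := elem_is_derive i x (elem_partial i epsi).
have := is_deriveM dc dp => d; have [_] := d.
rewrite -[LHS]/(partial i (phi k i) x) => ->; rewrite /GRing.scale/= mxE/= eq_sym.
by have [->|_] := eqVneq i ord_max; rewrite ?mulr1n ?mulr0n; ring.
Qed.

Let rho_norm (x : E) : Omega x -> `|x| <= rho.
Proof. by move=> [/= xr _]; rewrite (le_trans (norm_le_enorm _))// ltW. Qed.

Let elem_bound (f : E -> R) : elem f ->
  exists2 C, 0 <= C & forall x, Omega x -> `|f x| <= C.
Proof.
move=> /elem_continuous /(@continuous_bounded_cube R n.+1 f rho)[C C0 HC].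
by exists C => // x /rho_norm; exact: HC.
Qed.

Let integrable_flux i (f : E -> R) : elem f ->
  (leb n.+1).-integrable Omega (EFin \o (fun x => Du x 0 i * f x * weight a x)).
Proof.
move=> ef; have [C C0 HC] := elem_bound ef; have [mD iD] := Du2 i.
have mf : measurable_fun Omega (fun x => Du x 0 i * f x * weight a x).
  apply: measurable_funM; last by apply: measurable_funTS; exact: measurable_weight.
  by apply: measurable_funM => //; exact: measurable_elem.
have iD2 : (leb n.+1).-integrable Omega (EFin \o (fun x => Du x 0 i ^+ 2 * weight a x)).
  apply/integrableP; split.
    apply/measurable_EFinP; apply: measurable_funM.
      exact: measurable_funX.
    by apply: measurable_funTS; exact: measurable_weight.
  apply: le_lt_trans iD; rewrite le_eqVlt; apply/orP; left; apply/eqP.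
  apply: eq_integral => x _ /=.
  by rewrite ger0_norm// mulr_ge0 ?powR_ge0 ?sqr_ge0.
have ig : (leb n.+1).-integrable Omega (EFin \o (fun x : E =>
    C * (weight a x + Du x 0 i ^+ 2 * weight a x))).
  have := integrableZl mO C (integrableD mO (integrable_weight a1 rho0) iD2).
  by apply: eq_integrable.
apply: (integrable_bound mO mf _ ig) => x Ox.
have wa := powR_ge0 (x 0 ord_max) a; rewrite -/(weight a x) in wa.
rewrite !normrM (ger0_norm wa).
have : `|Du x 0 i| <= 1 + Du x 0 i ^+ 2.
  by rewrite -(real_normK (num_real (Du x 0 i))); have := normr_ge0 (Du x 0 i); nra.
have := HC x Ox; have := normr_ge0 (f x); have := normr_ge0 (Du x 0 i).
move: (Du x 0 i ^+ 2) (`|Du x 0 i|) (`|f x|) (weight a x) wa => d2 d g w *.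
have : d * g <= (1 + d2) * C by apply: ler_pM.
nra.
Qed.

Let integrable_bounded (f : E -> R) C : measurable_fun Omega f ->
  (forall x, Omega x -> `|f x| <= C) -> (leb n.+1).-integrable Omega (EFin \o f).
Proof.
move=> mf fC.
have i0 : (leb n.+1).-integrable Omega (EFin \o (fun=> C)).
  have := integrableZl mO C (@integrable_weight 0 rho _ rho0).
  rewrite ltrN10 => /(_ isT); apply: eq_integrable => // x _ /=.
  by rewrite /weight powRr0 mule1.
exact: (integrable_bound mO mf fC i0).
Qed.

Let lap (x : E) := \sum_i partial i (partial i psi) x.

Let elem_lap : elem lap.
Proof. by apply: elem_sum => i; do 2 apply: elem_partial. Qed.

Let psi_last_le : exists2 C, 0 <= C &
  forall x : E, Omega x -> `|partial ord_max psi x| <= C * x 0 ord_max.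
Proof.
have e2 := elem_partial ord_max (elem_partial ord_max epsi).
have [C C0 HC] := @continuous_bounded_cube R n.+1 _ rho (elem_continuous e2).
by exists C => // x; exact: last_le.
Qed.

Let weak_k k : \int[leb n.+1]_(x in Omega)
    (u x * (dcut a k (x 0 ord_max) * partial ord_max psi x + cut a k (x 0 ord_max) * lap x)) =
  - \sum_i \int[leb n.+1]_(x in Omega) (Du x 0 i * phi k i x).
Proof.
rewrite -sumrN; under [RHS]eq_bigr do rewrite -(wg (test_phi k _)).
have int_i i : (leb n.+1).-integrable Omega (EFin \o (fun x => u x * partial i (phi k i) x)).
  have ep := elem_partial i (elem_phi k i); have [C C0 HC] := elem_bound ep.
  apply: (@integrable_bounded _ (M * C)).
    by apply: measurable_funM => //; exact: measurable_elem.
  by move=> x Ox; rewrite normrM ler_pM// ?uM ?HC.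
rewrite -(Rintegral_sum mO _ int_i); apply: eq_Rintegral => x _.
rewrite -big_distrr/=; congr (_ * _).
under [RHS]eq_bigr do rewrite partial_phi.
rewrite big_split/= -big_distrr/=; congr (_ + _).
rewrite (bigD1 ord_max)//= eqxx mul1r big1 ?addr0// => i /negbTE ->.
by rewrite mul0r.
Qed.

(** Limit k -> oo in [weak_k]. The derivative that falls on the cutoff tends to a x_N^(a - 1) times
    the normal derivative of psi, the drift term of x_N^a [bessel a psi]; by [dcut_le] and [last_le]
    it is dominated by a multiple of x_N^a, which is integrable since a > -1. *)
Lemma weak_form : \int[leb n.+1]_(x in Omega) (u x * weight a x * bessel a psi x) =
  - energy a Omega Du psi.
Proof.
pose A k x := u x * (dcut a k (x 0 ord_max) * partial ord_max psi x + cut a k (x 0 ord_max) * lap x).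
have mG : measurable_fun Omega (fun x => u x * weight a x * bessel a psi x).
  apply: measurable_funM.
    by apply: measurable_funM => //; apply: measurable_funTS; exact: measurable_weight.
  by apply: measurable_bessel => // x /half_ball_last.
have cA : \int[leb n.+1]_(x in Omega) A k x @[k --> \oo] -->
    \int[leb n.+1]_(x in Omega) (u x * weight a x * bessel a psi x).
  have [C1 C10 H1] := dcut_le a; have [C2 C20 H2] := psi_last_le.
  have [C3 C30 H3] := elem_bound elem_lap.
  apply: (@Rintegral_dominated _ _ _ _ _ mO A _ (fun x => M * (C1 * C2 + C3) * weight a x)) => //.
  - move=> k; apply: measurable_funM => //; apply: measurable_funD.
      apply: measurable_funM; last by apply: measurable_elem => //; exact: elem_partial.
      have [g jg g0] := cut_jet a k.
      apply: (eq_measurable_fun (fun x : E => g 1%N (x 0 ord_max))).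
        by move=> x _; rewrite (is_derive_cut_jet jg g0).
      by apply: measurable_elem => //; apply: elem_comp => //; exact: elem_coord.
    by apply: measurable_funM; apply: measurable_elem.
  - move=> x Ox; have x0 := half_ball_last Ox.
    rewrite -mulrA; apply: cvgMr.
    rewrite (_ : weight a x * _ = a * x 0 ord_max `^ (a - 1) * partial ord_max psi x +
      x 0 ord_max `^ a * lap x); last first.
      rewrite /bessel -/(lap x) /weight [in LHS](powR_pred a x0) [in RHS](powR_pred a x0).
      by field; rewrite gt_eqF.
    apply: cvgD; apply: cvgMl; [exact: dcut_cvg|exact: cut_cvg].
  - have := integrableZl mO (M * (C1 * C2 + C3)) (integrable_weight a1 rho0).
    by apply: eq_integrable.
  move=> k x Ox; have x0 := half_ball_last Ox.
  rewrite /A normrM -(mulrA M); apply: ler_pM => //; first exact: uM.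
  rewrite [leRHS]mulrDl; apply: (le_trans (ler_normD _ _)); apply: lerD.
    have -> : C1 * C2 * weight a x = C1 * x 0 ord_max `^ (a - 1) * (C2 * x 0 ord_max).
      by rewrite /weight [in LHS](powR_pred a x0); ring.
    by rewrite normrM; apply: ler_pM => //; [exact: H1|exact: H2].
  by rewrite normrM mulrC; apply: ler_pM => //; [exact: H3|exact: cut_le].
have cB : - \sum_i \int[leb n.+1]_(x in Omega) (Du x 0 i * phi k i x) @[k --> \oo] -->
    - energy a Omega Du psi.
  have -> : energy a Omega Du psi = \sum_i \int[leb n.+1]_(x in Omega)
      (Du x 0 i * partial i psi x * weight a x).
    rewrite /energy -(Rintegral_sum mO); last first.
      by move=> i; apply: integrable_flux; exact: elem_partial.
    apply: eq_Rintegral => x _; rewrite /dotp big_distrl/=.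
    by apply: eq_bigr => i _; rewrite mxE.
  apply: cvgN; apply: cvg_sum_seq => i.
  have ig := integrable_flux i (elem_partial i epsi).
  have ign := integrable_norm ig.
  apply: (@Rintegral_dominated _ _ _ _ _ mO _ _
     (fun x => `|Du x 0 i * partial i psi x * weight a x|)) => //.
  - move=> k; apply: measurable_funM; first by have [] := Du2 i.
    exact: measurable_elem.
  - by apply/measurable_EFinP; exact: measurable_int ig.
  - move=> x Ox; have x0 := half_ball_last Ox; rewrite -mulrA; apply: cvgMr.
    by rewrite mulrC; apply: cvgMl; exact: cut_cvg.
  - move=> k x Ox; rewrite -mulrA normrM [leRHS]normrM ler_wpM2l// normrM [leRHS]normrM.
    by rewrite mulrC ler_wpM2l// (le_trans (cut_le _ _ _))// ler_norm.
have cA' : \int[leb n.+1]_(x in Omega) A k x @[k --> \oo] --> - energy a Omega Du psi.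
  by under eq_fun do rewrite weak_k.
exact: (cvg_unique _ cA cA').
Qed.

End bessel_operator.

(** * Translated kernels *)

Section kernel.
Variables (R : realType) (n : nat) (a : R).
Local Notation E := 'rV[R]_n.+1.
Implicit Types (f : nat -> R -> R) (c : R) (x y : E).

(* With c = cos theta, x = (x', t) and y = (y', s), this is
   |x' - y'|^2 + s^2 + t^2 - 2 s t cos theta. *)
Definition qf c x y : R :=
  dotp (x - y) (x - y) + 2 * (1 - c) * x 0 ord_max * y 0 ord_max.

(* Integration by parts turns a * sin(theta)^(a - 1) * f(qf) into
   sin(theta)^(a + 1) * Ff, whose weight is integrable for every a > -1. *)
Definition Ff f c x y : R :=
  (a + 1) * f 0%N (qf c x y) - 2 * c * x 0 ord_max * y 0 ord_max * f 1%N (qf c x y).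

(* [theta |-> pi - theta] exchanges the two terms; their sum is even in x_N. *)
Definition kf f c x y : R := Ff f c x y + Ff f (- c) x y.

(* The j-th derivative of 4 s f'' + 2 (n + 1 + a) f', formally the Laplacian of
   f(|z|^2) in dimension n + 1 + a. *)
Definition radlap f (j : nat) (s : R) : R :=
  4 * s * f j.+2 s + (4 * j%:R + 2 * (n%:R + 1 + a)) * f j.+1 s.

Lemma dotpC_sub x y : dotp (x - y) (x - y) = dotp (y - x) (y - x).
Proof. by apply: eq_bigr => i _; rewrite !mxE; ring. Qed.

Lemma qfC c x y : qf c x y = qf c y x.
Proof. by rewrite /qf dotpC_sub; ring. Qed.

Lemma FfC f c x y : Ff f c x y = Ff f c y x.
Proof. by rewrite /Ff qfC; ring. Qed.

Lemma kfC f c x y : kf f c x y = kf f c y x.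
Proof. by rewrite /kf !(FfC _ _ x). Qed.

Lemma is_derive_qf c x y i :
  is_derive x (delta_mx 0 i) (fun x => qf c x y)
    (2 * (x 0 i - y 0 i) + (i == ord_max)%:R * (2 * (1 - c) * y 0 ord_max)).
Proof.
have d1 : is_derive x (delta_mx 0 i) (fun x => dotp (x - y) (x - y)) (2 * (x 0 i - y 0 i)).
  rewrite (_ : (fun x => _) = \sum_j (fun x : E => (x 0 j - y 0 j) * (x 0 j - y 0 j))); last first.
    apply/funext => z; rewrite fct_sumE; apply: eq_bigr => j _.
    by rewrite !mxE.
  have dj j : is_derive x (delta_mx 0 i) (fun x : E => (x 0 j - y 0 j) * (x 0 j - y 0 j))
      (2 * (x 0 j - y 0 j) * (j == i)%:R).
    have dc := is_deriveB (is_derive_coord x (delta_mx 0 i) j) (is_derive_cst (y 0 j) x (delta_mx 0 i)).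
    apply: (is_derive_eq (is_deriveM dc dc)).
    by rewrite !fctE /GRing.scale/= mxE /= subr0; ring.
  have ds := is_derive_sum dj; apply: (is_derive_eq ds).
  rewrite (bigD1 i)//= eqxx mulr1 big1 ?addr0// => j /negbTE ->.
  by rewrite mulr0.
have d2 := is_deriveM (is_derive_coord x (delta_mx 0 i) ord_max)
  (is_derive_cst (2 * (1 - c) * y 0 ord_max) x (delta_mx 0 i)).
rewrite (_ : (fun x => _) = (fun x => dotp (x - y) (x - y)) +
  (fun x : E => x 0 ord_max) * cst (2 * (1 - c) * y 0 ord_max)); last first.
  by apply/funext => z; rewrite /qf !fctE/=; ring.
apply: (is_derive_eq (is_deriveD d1 d2)).
by rewrite /GRing.scale/= mxE/= eq_sym; ring.
Qed.

Variable f : nat -> R -> R.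
Hypothesis jf : jet f.

Let q' c x y (i : 'I_n.+1) : R :=
  2 * (x 0 i - y 0 i) + (i == ord_max)%:R * (2 * (1 - c) * y 0 ord_max).

Lemma is_derive_jet_qf j c x y i :
  is_derive x (delta_mx 0 i) (fun x => f j (qf c x y)) (f j.+1 (qf c x y) * q' c x y i).
Proof. exact: is_derive_comp_line (is_derive_qf c x y i) (jf j _). Qed.

Let is_derive_m c x y i :
  is_derive x (delta_mx 0 i) (fun x => 2 * c * x 0 ord_max * y 0 ord_max)
    ((i == ord_max)%:R * (2 * c * y 0 ord_max)).
Proof.
have d := is_deriveZ (2 * c * y 0 ord_max) (is_derive_coord x (delta_mx 0 i) ord_max).
rewrite (_ : (fun x => _) = (2 * c * y 0 ord_max) *: (fun x : E => x 0 ord_max)); last first.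
  by apply/funext => z; rewrite fctE /GRing.scale/=; ring.
by apply: (is_derive_eq d); rewrite mxE/= eq_sym /GRing.scale/= mulrC.
Qed.

Let is_derive_P j c x y i : is_derive x (delta_mx 0 i)
  (fun x => (a + 1) * f j (qf c x y) - 2 * c * x 0 ord_max * y 0 ord_max * f j.+1 (qf c x y))
  (q' c x y i * ((a + 1) * f j.+1 (qf c x y) -
     2 * c * x 0 ord_max * y 0 ord_max * f j.+2 (qf c x y))
   - (i == ord_max)%:R * (2 * c * y 0 ord_max) * f j.+1 (qf c x y)).
Proof.
have d1 := is_deriveZ (a + 1) (is_derive_jet_qf j c x y i).
have d2 := is_deriveM (is_derive_m c x y i) (is_derive_jet_qf j.+1 c x y i).
by apply: (is_derive_eq (is_deriveB d1 d2)); rewrite /GRing.scale/=; ring.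
Qed.

Lemma partial_Ff c x y i : partial i (fun x => Ff f c x y) x =
  q' c x y i * ((a + 1) * f 1%N (qf c x y) -
     2 * c * x 0 ord_max * y 0 ord_max * f 2%N (qf c x y))
   - (i == ord_max)%:R * (2 * c * y 0 ord_max) * f 1%N (qf c x y).
Proof. by have [_] := is_derive_P 0 c x y i. Qed.

Lemma partial2_Ff c x y i : partial i (partial i (fun x => Ff f c x y)) x =
  2 * ((a + 1) * f 1%N (qf c x y) - 2 * c * x 0 ord_max * y 0 ord_max * f 2%N (qf c x y))
  + q' c x y i ^+ 2 * ((a + 1) * f 2%N (qf c x y) -
     2 * c * x 0 ord_max * y 0 ord_max * f 3%N (qf c x y))
   - (i == ord_max)%:R * (2 * (2 * c * y 0 ord_max) * q' c x y i * f 2%N (qf c x y)).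
Proof.
have pE : partial i (fun x : E => Ff f c x y) = (fun x : E =>
  q' c x y i * ((a + 1) * f 1%N (qf c x y) -
     2 * c * x 0 ord_max * y 0 ord_max * f 2%N (qf c x y))
   - (i == ord_max)%:R * (2 * c * y 0 ord_max) * f 1%N (qf c x y)).
  by apply/funext => z; exact: partial_Ff.
rewrite pE.
have dq : is_derive x (delta_mx 0 i) (fun x => q' c x y i) 2.
  have d0 := is_deriveD (is_deriveZ (2 : R) (is_deriveB (is_derive_coord x (delta_mx 0 i) i)
     (is_derive_cst (y 0 i) x (delta_mx 0 i))))
     (is_derive_cst ((i == ord_max)%:R * (2 * (1 - c) * y 0 ord_max)) x (delta_mx 0 i)).
  apply: (is_derive_eq d0); rewrite mxE !eqxx/= /GRing.scale/=; ring.
have d2 := is_deriveM dq (is_derive_P 1 c x y i).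
have d3 := is_deriveZ ((i == ord_max)%:R * (2 * c * y 0 ord_max)) (is_derive_jet_qf 1 c x y i).
have := is_deriveB d2 d3 => d4; have [_] := d4.
rewrite /partial => ->; rewrite /GRing.scale/=.
by case: (i == ord_max); rewrite ?mulr1n ?mulr0n; ring.
Qed.

(** [dgg] is the derivative of [gg] in c = cos theta. *)
Definition gg c x y : R := 2 * a * (y 0 ord_max / x 0 ord_max) * f 1%N (qf c x y)
  - 4 * y 0 ord_max ^+ 2 * c * f 2%N (qf c x y).

Definition dgg c x y : R := - 4 * (a + 1) * y 0 ord_max ^+ 2 * f 2%N (qf c x y)
  + 8 * x 0 ord_max * y 0 ord_max ^+ 3 * c * f 3%N (qf c x y).

(* The two sides differ by the exact derivative
   d/dtheta (sin theta ^ (a + 2) * gg (cos theta)) / sin theta ^ (a + 1), so that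
   averaging over theta intertwines the Bessel operator with [radlap]. *)
Lemma bessel_Ff c x y : x 0 ord_max != 0 ->
  bessel a (fun x => Ff f c x y) x = Ff (radlap f) c x y -
    ((a + 2) * c * gg c x y - (1 - c ^+ 2) * dgg c x y).
Proof.
move=> x0; rewrite /bessel (eq_bigr _ (fun i _ => partial2_Ff c x y i)).
rewrite partial_Ff eqxx mul1r (bigD1 ord_max)//= eqxx.
set P := (a + 1) * f 1%N _ - _; set Q := (a + 1) * f 2%N _ - _.
(* The tangential squares enter only through X, which is eliminated in favour of [qf]; what remains
   is a rational identity in the last coordinates and the derivatives of f. *)
pose X := \sum_(i < n.+1 | i != ord_max) (x 0 i - y 0 i) ^+ 2.
rewrite (eq_bigr (fun i => 2 * P + (x 0 i - y 0 i) ^+ 2 * (4 * Q))); last first.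
  move=> i /negbTE ni; rewrite /q' ni mulr0n !mul0r subr0 addr0; ring.
have -> : \sum_(i < n.+1 | i != ord_max) (2 * P + (x 0 i - y 0 i) ^+ 2 * (4 * Q)) =
    n%:R * (2 * P) + X * (4 * Q).
  rewrite big_split/= /X big_distrl/= sumr_const; congr (_ + _).
  rewrite -[LHS]mulr_natl; congr (_%:R * _).
  have := cardC1 (ord_max : 'I_n.+1); rewrite card_ord/= => cE; rewrite -[RHS]cE.
  by apply: eq_card => i; rewrite !inE.
have qE : qf c x y = X + (x 0 ord_max - y 0 ord_max) ^+ 2 +
    2 * (1 - c) * x 0 ord_max * y 0 ord_max.
  rewrite /qf /dotp (bigD1 ord_max)//= !mxE; congr (_ + _).
  rewrite addrC expr2; congr (_ + _); apply: eq_bigr => i _.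
  by rewrite !mxE expr2.
rewrite /gg /dgg /Ff /radlap /q' /P /Q eqxx !mulr1n.
have XE : X = qf c x y - (x 0 ord_max - y 0 ord_max) ^+ 2 -
    2 * (1 - c) * x 0 ord_max * y 0 ord_max by rewrite qE; ring.
rewrite XE.
by field.
Qed.

End kernel.

(** * Fubini on A x B for functions dominated by an integrable function on A, with B of finite
    measure *)

Section Fubini_rectangle.
Context d1 d2 (T1 : measurableType d1) (T2 : measurableType d2) (R : realType).
Variables (m1 : {sigma_finite_measure set T1 -> \bar R})
  (m2 : {sigma_finite_measure set T2 -> \bar R}).
Variables (A : set T1) (B : set T2) (h : T1 * T2 -> R) (g : T1 -> R).
Hypotheses (mA : measurable A) (mB : measurable B) (B_fin : (m2 B < +oo)%E).
Hypothesis mh : measurable_fun (A `*` B) h.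
Hypothesis ig : m1.-integrable A (EFin \o g).
Hypothesis hg : forall x y, A x -> B y -> `|h (x, y)| <= g x.

Let mAB : measurable (A `*` B). Proof. exact: measurableX. Qed.
Let H := (EFin \o h) \_ (A `*` B).
Let mH : measurable_fun setT H.
Proof. by apply/(measurable_restrictT _ _).1 => //; exact/measurable_EFinP. Qed.

Let HE x y : H (x, y) = ((fun x => ((fun y => (h (x, y))%:E) \_ B) y) \_ A) x.
Proof.
rewrite /H !patchE/=; have [Ax|Ax] := boolP (x \in A); last first.
  rewrite ifN//; apply/negP => /set_mem/= [/mem_set + _].
  by rewrite (negbTE Ax).
have [By|By] := boolP (y \in B).
  by rewrite ifT// inE/=; split; exact: set_mem.
rewrite ifN//; apply/negP => /set_mem/= [_ /mem_set].
by rewrite (negbTE By).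
Qed.

Let g0 x : A x -> B !=set0 -> 0 <= g x.
Proof. by move=> Ax [y By]; exact: le_trans (hg Ax By). Qed.

Let iH : (m1 \x m2)%E.-integrable setT H.
Proof.
apply/integrable12ltyP => //.
have [B0|/set0P B0] := eqVneq B set0.
  rewrite integral0_eq// => x _; rewrite integral0_eq// => y _.
  rewrite /H patchE ifN ?abse0// notin_setE/= B0 => -[]//.
have c0 : (0 <= m2 B)%E by exact: measure_ge0.
have igc : m1.-integrable setT (fun x => (m2 B * ((EFin \o g) \_ A) x)%E).
  rewrite -(fineK (x := m2 B)) ?ge0_fin_numE//.
  by apply: integrableZl => //; rewrite -integrable_mkcond.
have [_] := integrableP _ _ _ igc; apply: le_lt_trans.
apply: ge0_le_integral => //.
- by move=> x _; exact: integral_ge0.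
- apply: (measurable_fun_fubini_tonelli_F (abse \o H)) => //=.
  exact: measurableT_comp.
- by apply: measurableT_comp => //; exact: measurable_int igc.
move=> x _; rewrite patchE; have [Ax|Ax] := boolP (x \in A); last first.
  rewrite integral0_eq ?mule0 ?abse0// => y _.
  by rewrite HE patchE (negbTE Ax) abse0.
have gx : 0 <= g x by apply: g0 => //; exact: set_mem.
apply: (@le_trans _ _ (\int[m2]_(y in B) (g x)%:E)%E); last first.
  by rewrite integral_cst// gee0_abs ?mule_ge0// muleC.
rewrite [leRHS]integral_mkcond; apply: ge0_le_integral => //.
- apply: measurableT_comp => //.
  apply: (measurableT_comp mH); exact: measurable_pair1.
- apply/(measurable_restrictT _ _).1 => //.
move=> y _; rewrite HE !patchE Ax; case: ifPn => [By|_] /=.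
  by rewrite lee_fin hg//; exact: set_mem.
by rewrite normr0.
Qed.

Lemma integrable_rectangle : (m1 \x m2)%E.-integrable (A `*` B) (EFin \o h).
Proof. by apply/integrable_mkcond. Qed.

Let FE x : fubini_F m2 H x = ((fun x => \int[m2]_(y in B) (h (x, y))%:E) \_ A)%E x.
Proof.
rewrite /fubini_F patchE; case: ifPn => Ax.
  rewrite [RHS]integral_mkcond; apply: eq_integral => y _.
  by rewrite HE patchE Ax.
by rewrite integral0_eq// => y _; rewrite HE patchE (negbTE Ax).
Qed.

Let GE y : fubini_G m1 H y = ((fun y => \int[m1]_(x in A) (h (x, y))%:E) \_ B)%E y.
Proof.
rewrite /fubini_G patchE; case: ifPn => By.
  rewrite [RHS]integral_mkcond; apply: eq_integral => x _.
  by rewrite HE !patchE By.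
by rewrite integral0_eq// => x _; rewrite HE !patchE (negbTE By); case: ifP.
Qed.

Let mh1 x : A x -> measurable_fun B (fun y => h (x, y)).
Proof.
move=> Ax; apply/measurable_EFinP; apply/(measurable_restrictT _ _).2 => //.
rewrite (_ : _ \_ _ = H \o (fun y => (x, y))); last first.
  by apply/funext => y /=; rewrite HE patchE mem_set.
apply: (measurableT_comp mH); exact: measurable_pair1.
Qed.

Let mh2 y : B y -> measurable_fun A (fun x => h (x, y)).
Proof.
move=> By; apply/measurable_EFinP; apply/(measurable_restrictT _ _).2 => //.
rewrite (_ : _ \_ _ = H \o (fun x => (x, y))); last first.
  by apply/funext => x /=; rewrite HE !patchE (mem_set By).
apply: (measurableT_comp mH); exact: measurable_pair2.
Qed.

Lemma integrable_section1 x : A x -> m2.-integrable B (fun y => (h (x, y))%:E).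
Proof.
move=> Ax; apply: measurable_bounded_integrable => //; first exact: mh1.
exists (g x); split; first exact: num_real.
by move=> M gM y /= By; rewrite (le_trans (hg _ _))// ltW.
Qed.

Lemma integrable_section2 y : B y -> m1.-integrable A (fun x => (h (x, y))%:E).
Proof.
move=> By; apply: (integrable_bound mA (mh2 By) _ ig) => x Ax.
exact: hg.
Qed.

Lemma Rintegral_rectangle1 :
  \int[(m1 \x m2)%E]_(z in A `*` B) h z = \int[m1]_(x in A) \int[m2]_(y in B) h (x, y).
Proof.
rewrite /Rintegral; congr fine; rewrite integral_mkcond.
rewrite -(integral12_prod_meas1 iH) [RHS]integral_mkcond.
apply: eq_integral => x _; rewrite FE !patchE; case: ifPn => // Ax.
rewrite fineK//; apply: integrable_fin_num => //; apply: integrable_section1.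
exact: set_mem.
Qed.

Lemma Rintegral_rectangle2 :
  \int[(m1 \x m2)%E]_(z in A `*` B) h z = \int[m2]_(y in B) \int[m1]_(x in A) h (x, y).
Proof.
rewrite /Rintegral; congr fine; rewrite integral_mkcond.
rewrite -(integral21_prod_meas1 iH) [RHS]integral_mkcond.
apply: eq_integral => y _; rewrite GE !patchE; case: ifPn => // By.
rewrite fineK//; apply: integrable_fin_num => //; apply: integrable_section2.
exact: set_mem.
Qed.

Lemma measurable_Rintegral_section2 :
  measurable_fun B (fun y => \int[m1]_(x in A) h (x, y)).
Proof.
apply: (measurableT_comp (f := fine)) => //.
apply/(measurable_restrictT _ _).2 => //.
rewrite (_ : _ \_ _ = fubini_G m1 H); last by apply/funext => y; rewrite GE.
exact: measurable_fubini_G iH.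
Qed.

Lemma measurable_Rintegral_section1 :
  measurable_fun A (fun x => \int[m2]_(y in B) h (x, y)).
Proof.
apply: (measurableT_comp (f := fine)) => //.
apply/(measurable_restrictT _ _).2 => //.
rewrite (_ : _ \_ _ = fubini_F m2 H); last by apply/funext => y; rewrite FE.
exact: measurable_fubini_F iH.
Qed.

End Fubini_rectangle.

(** * Averaging over the angle *)

Section angular_average.
Variables (R : realType) (n : nat) (a : R).
Hypothesis a1 : -1 < a.
Local Notation E := 'rV[R]_n.+1.
Notation mu := (@lebesgue_measure R).
Notation I := (`[0%R, pi]%classic : set R).
Implicit Types (c t : R) (x y : E).

Lemma continuous_powR_norm (p : R) : 0 < p -> continuous (fun s : R => `|s| `^ p).
Proof.
move=> p0 s; have [->|s0] := eqVneq s 0.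
  apply/cvgrPdist_le => e e0; rewrite normr0 powR0 ?gt_eqF//.
  near=> z; rewrite sub0r normrN ger0_norm ?powR_ge0//.
  have ez : `|z| <= e `^ p^-1.
    near: z; have ep : 0 < e `^ p^-1 by exact: powR_gt0.
    have /cvgrPdist_le/= := (@cvg_id _ (nbhs (0 : R))).
    by move=> /(_ _ ep); apply: filterS => z; rewrite sub0r normrN.
  rewrite (le_trans (ge0_ler_powR (ltW p0) _ _ ez)) ?nnegrE ?powR_ge0//.
  by rewrite -powRrM mulVf ?gt_eqF// powRr1// ltW.
have n0 : 0 < `|s| by rewrite normr_gt0.
apply: (@continuous_comp _ _ _ (fun s : R => `|s|) (fun t : R => t `^ p)).
  exact: norm_continuous.
apply/differentiable_continuous/derivable1_diffP.
by have [] := is_derive1_powR p n0.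
Unshelve. all: by end_near. Qed.

Let a10 : 0 < a + 1. Proof. by rewrite -ltrBlDr sub0r. Qed.

(** The absolute value changes nothing on [0, pi] and makes the weight continuous on the whole
    line. *)
Definition sw t : R := `|sin t| `^ (a + 1).

Lemma sw_ge0 t : 0 <= sw t. Proof. exact: powR_ge0. Qed.

Lemma sw_le1 t : sw t <= 1.
Proof.
have e1 : (1 : R) `^ (a + 1) = 1 by rewrite powR1.
rewrite /sw -[leRHS]e1.
by apply: ge0_ler_powR; rewrite ?nnegrE ?sin_max// ltW.
Qed.

Lemma continuous_sw : continuous sw.
Proof.
move=> t; apply: (@continuous_comp _ _ _ sin (fun s : R => `|s| `^ (a + 1))).
  exact: continuous_sin.
exact: (@continuous_powR_norm (a + 1)).
Qed.

Lemma is_derive_gg f c x y : jet f -> x 0 ord_max != 0 ->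
  is_derive c 1 (fun c => gg a f c x y) (dgg a f c x y).
Proof.
move=> jf x0.
have dq : is_derive c 1 (fun c => qf c x y) (- 2 * x 0 ord_max * y 0 ord_max).
  rewrite /qf; apply: is_derive_eq.
  by rewrite /GRing.scale/=; ring.
have d1 := @is_derive1_comp _ (f 1%N) (fun c => qf c x y) c _ _ (jf 1%N _) dq.
have d2 := @is_derive1_comp _ (f 2%N) (fun c => qf c x y) c _ _ (jf 2%N _) dq.
have d3 := is_deriveZ (2 * a * (y 0 ord_max / x 0 ord_max)) d1.
have d4 := is_deriveZ (4 * y 0 ord_max ^+ 2) (is_deriveM (is_derive_id c (1 : R)) d2).
rewrite (_ : (fun c => _) = (2 * a * (y 0 ord_max / x 0 ord_max)) *: (f 1%N \o (fun c => qf c x y))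
   - (4 * y 0 ord_max ^+ 2) *: (id * (f 2%N \o (fun c => qf c x y)))); last first.
  by apply/funext => z; rewrite /gg !fctE /GRing.scale/=; ring.
apply: (is_derive_eq (is_deriveB d3 d4)).
by rewrite /dgg /GRing.scale/=; field.
Qed.

Let a20 : 0 < a + 2. Proof. by apply: lt_trans a10 _; rewrite ltrD2l ltr1n. Qed.

(** The integrand is the derivative of e |sin t|^(a + 2) g(e cos t), which vanishes at 0 and pi
    because a + 2 > 0. The sign e = 1 or -1 serves the two halves of [kf]. *)
Let ibp (g dg : R -> R) (e : R) : (forall c, is_derive c 1 g (dg c)) -> continuous dg ->
  e * e = 1 ->
  (\int[mu]_(t in `[0%R, pi]) (sw t * ((a + 2) * (e * cos t) * g (e * cos t) -
    (1 - (e * cos t) ^+ 2) * dg (e * cos t)))%:E = 0)%E.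
Proof.
move=> Dg cdg ee.
have cg : continuous g.
  by move=> c; apply/differentiable_continuous/derivable1_diffP; have [] := Dg c.
have cec : continuous (fun t : R => e * cos t).
  by move=> t; apply: cvgMr; exact: continuous_cos.
pose F t := e * (`|sin t| `^ (a + 2) * g (e * cos t)).
have -> : 0%E = (F pi - F 0)%:E :> \bar R.
  by rewrite /F sinpi sin0 normr0 powR0 ?gt_eqF// !mul0r subrr.
apply: (@integral_FTC2 _ F) => //; first exact: pi_gt0.
- move=> t /andP[t0 tp]; have st : 0 < sin t by rewrite sin_gt0_pi// t0.
  pose G (s : R) := e * (sin s `^ (a + 2) * g (e * cos s)).
  apply: (@near_eq_is_derive _ _ _ G).
    near=> s; rewrite /F /G ger0_norm//; near: s.
    have : \forall s \near t, 0 < s < pi by near=> s; apply/andP; split; near: s; [exact: lt_nbhsr|exact: lt_nbhsl].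
    by apply: filterS => s sp; rewrite sin_ge0_pi//; case/andP: sp => /ltW -> /ltW ->.
  have dp := @is_derive1_comp _ (fun s => s `^ (a + 2)) sin t _ _ (is_derive1_powR (a + 2) st) (is_derive_sin t).
  have dc := is_deriveZ e (is_derive_cos t).
  have dgc := @is_derive1_comp _ g (fun s => e * cos s) t _ _ (Dg _) dc.
  have dF := is_deriveZ e (is_deriveM dp dgc).
  apply: (is_derive_eq dF); rewrite /sw ger0_norm ?(ltW st)// /GRing.scale/=.
  have -> : sin t `^ (a + 2) = sin t * sin t `^ (a + 1).
    by rewrite (powR_pred _ st); congr (_ * _ `^ _); ring.
  have -> : a + 2 - 1 = a + 1 by ring.
  have e2 : 1 - (e * cos t) ^+ 2 = sin t ^+ 2.
    by rewrite exprMn expr2 ee mul1r -sin2cos2.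
  rewrite e2; move: (sin t `^ (a + 1)) (g _) (dg _) => p gc dgc'.
  rewrite (_ : e * (sin t * p * (dgc' * (e * - sin t)) + gc * ((a + 2) * p * cos t)) =
     (e * e) * (- (sin t * p * dgc' * sin t)) + e * gc * ((a + 2) * p * cos t)); last ring.
  by rewrite ee; ring.
- apply: continuous_subspaceT => t; apply: cvgMr; apply: cvgM.
    apply: (@continuous_comp _ _ _ sin (fun s : R => `|s| `^ (a + 2))).
      exact: continuous_sin.
    exact: continuous_powR_norm.
  by apply: (@continuous_comp _ _ _ (fun t : R => e * cos t) g); [exact: cec|exact: cg].
- apply: continuous_subspaceT => t; apply: cvgM; first exact: continuous_sw.
  apply: cvgB; apply: cvgM.
  + by apply: cvgMr; exact: cec.
  + by apply: (@continuous_comp _ _ _ (fun t : R => e * cos t) g); [exact: cec|exact: cg].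
  + apply: cvgB; first exact: cvg_cst.
    by apply: (@continuous_comp _ _ _ (fun t : R => e * cos t) (fun s => s ^+ 2)); [exact: cec|exact: exprn_continuous].
  + by apply: (@continuous_comp _ _ _ (fun t : R => e * cos t) dg); [exact: cec|exact: cdg].
Unshelve. all: by end_near. Qed.

Lemma continuous_qf x y : continuous (fun c => qf c x y).
Proof.
move=> c; apply/differentiable_continuous/derivable1_diffP.
by rewrite /qf; have [] : is_derive c 1 (fun c => dotp (x - y) (x - y) + 2 * (1 - c) * x 0 ord_max * y 0 ord_max) (- 2 * x 0 ord_max * y 0 ord_max) by apply: is_derive_eq; rewrite /GRing.scale/=; ring.
Qed.

Lemma continuous_jet_qf f j x y : jet f -> continuous (fun c => f j (qf c x y)).
Proof.
move=> jf c; apply: (@continuous_comp _ _ _ (fun c => qf c x y) (f j)).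
  exact: continuous_qf.
exact: jet_continuous.
Qed.

Lemma continuous_dgg f x y : jet f -> continuous (fun c => dgg a f c x y).
Proof.
move=> jf c; rewrite /dgg; apply: cvgD.
  by apply: cvgMr; exact: continuous_jet_qf.
apply: cvgM; last exact: continuous_jet_qf.
by apply: cvgMr; exact: cvg_id.
Qed.

Lemma jet_radlap f : jet f -> jet (radlap n a f).
Proof.
move=> jf j s; rewrite /radlap.
have d1 := is_deriveM (is_deriveZ (4 : R) (is_derive_id s (1 : R))) (jf j.+2 s).
have d2 := is_deriveZ (4 * j%:R + 2 * (n%:R + 1 + a)) (jf j.+1 s).
rewrite (_ : (fun s => _) = (4 \*: id) * f j.+2 + (4 * j%:R + 2 * (n%:R + 1 + a)) \*: f j.+1)//.
apply: (is_derive_eq (is_deriveD d1 d2)).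
by rewrite -[(4 \*: id) s]/(4 * s) /GRing.scale/= -[j.+1%:R]natr1; ring.
Qed.

Lemma continuous_Ff f x y : jet f -> continuous (fun c => Ff a f c x y).
Proof.
move=> jf c; apply: cvgB.
  by apply: cvgMr; exact: continuous_jet_qf.
apply: cvgM; last exact: continuous_jet_qf.
by do 2 apply: cvgMl; apply: cvgMr; exact: cvg_id.
Qed.

Section at_point.
Variables (f : nat -> R -> R) (x y : E) (e : R).
Hypotheses (jf : jet f) (x0 : x 0 ord_max != 0).

Let h t := sw t * ((a + 2) * (e * cos t) * gg a f (e * cos t) x y -
    (1 - (e * cos t) ^+ 2) * dgg a f (e * cos t) x y).

Let cec : continuous (fun t : R => e * cos t).
Proof. by move=> t; apply: cvgMr; exact: continuous_cos. Qed.

Lemma continuous_angular_Ff g : jet g ->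
  continuous (fun t => sw t * Ff a g (e * cos t) x y).
Proof.
move=> jg t; apply: cvgM; first exact: continuous_sw.
apply: (@continuous_comp _ _ _ (fun t : R => e * cos t) (fun c => Ff a g c x y)).
  exact: cec.
exact: continuous_Ff.
Qed.

Let ch : continuous h.
Proof.
have cgg : continuous (fun c => gg a f c x y).
  move=> c; apply/differentiable_continuous/derivable1_diffP.
  by have [] := is_derive_gg c y jf x0.
move=> t; apply: cvgM; first exact: continuous_sw.
apply: cvgB; apply: cvgM.
+ by apply: cvgMr; exact: cec.
+ by apply: (@continuous_comp _ _ _ (fun t : R => e * cos t) (fun c => gg a f c x y)); [exact: cec|exact: cgg].
+ apply: cvgB; first exact: cvg_cst.
  by apply: (@continuous_comp _ _ _ (fun t : R => e * cos t) (fun s => s ^+ 2)); [exact: cec|exact: exprn_continuous].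
+ by apply: (@continuous_comp _ _ _ (fun t : R => e * cos t) (fun c => dgg a f c x y)); [exact: cec|exact: continuous_dgg].
Qed.

Let besselE t : sw t * bessel a (fun x => Ff a f (e * cos t) x y) x =
  sw t * Ff a (radlap n a f) (e * cos t) x y - h t.
Proof. by rewrite bessel_Ff// /h; ring. Qed.

Lemma continuous_angular_bessel :
  continuous (fun t => sw t * bessel a (fun x => Ff a f (e * cos t) x y) x).
Proof.
rewrite (funext besselE) => t; apply: cvgB; last exact: ch.
by apply: continuous_angular_Ff; exact: jet_radlap.
Qed.

(** The discrepancy in [bessel_Ff] is a total derivative in theta, which [ibp] integrates to 0. *)
Lemma angular_bessel : e * e = 1 ->
  \int[mu]_(t in I) (sw t * bessel a (fun x => Ff a f (e * cos t) x y) x) =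
  \int[mu]_(t in I) (sw t * Ff a (radlap n a f) (e * cos t) x y).
Proof.
move=> ee.
have ih := ibp (fun c => is_derive_gg c y jf x0) (@continuous_dgg f x y jf) ee.
have int g : continuous g -> mu.-integrable I (EFin \o g).
  move=> cg; apply: continuous_compact_integrable; first exact: segment_compact.
  exact: continuous_subspaceT.
under eq_Rintegral => t _ do rewrite besselE.
rewrite RintegralB//; [|exact/int/continuous_angular_Ff/jet_radlap|exact: int].
by rewrite [X in _ - X](_ : _ = 0) ?subr0// /Rintegral ih.
Qed.

End at_point.

End angular_average.

Section bessel_linear.
Variables (R : realType) (n : nat) (a : R).
Local Notation E := 'rV[R]_n.+1.

Lemma partial_sum I (L : seq I) (k : I -> R) (g : I -> E -> R) i :
  (forall p, elem (g p)) ->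
  partial i (fun x => \sum_(p <- L) k p * g p x) =
  (fun x => \sum_(p <- L) k p * partial i (g p) x).
Proof.
move=> eg; apply/funext => x.
suff d : is_derive x (delta_mx 0 i) (fun x => \sum_(p <- L) k p * g p x)
  (\sum_(p <- L) k p * partial i (g p) x) by have [_] := d.
elim: L => [|p L IH].
  rewrite big_nil (_ : (fun _ => _) = cst 0); first exact: is_derive_cst.
  by apply/funext => z; rewrite big_nil.
rewrite big_cons (_ : (fun _ => _) = k p *: g p + (fun x => \sum_(p <- L) k p * g p x)).
  by apply: is_deriveD; apply: is_deriveZ; exact: elem_is_derive.
by apply/funext => z; rewrite big_cons.
Qed.

Lemma bessel_sum I (L : seq I) (k : I -> R) (g : I -> E -> R) x :
  (forall p, elem (g p)) ->
  bessel a (fun x => \sum_(p <- L) k p * g p x) x = \sum_(p <- L) k p * bessel a (g p) x.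
Proof.
move=> eg; rewrite /bessel.
have p2 i : partial i (partial i (fun x => \sum_(p <- L) k p * g p x)) x =
    \sum_(p <- L) k p * partial i (partial i (g p)) x.
  by rewrite partial_sum// partial_sum// => p; exact: elem_partial.
transitivity (\sum_i \sum_(p <- L) k p * partial i (partial i (g p)) x +
    a / x 0 ord_max * (\sum_(p <- L) k p * partial ord_max (g p) x)).
  by congr (_ + _); [apply: eq_bigr => i _; exact: p2|rewrite partial_sum].
rewrite exchange_big/= mulr_sumr -big_split/=.
by apply: eq_bigr => p _; rewrite -mulr_sumr mulrDr mulrCA.
Qed.

Lemma elem_qf c (y : E) : elem (fun x => qf c x y).
Proof.
apply: elem_add; first exact: elem_dotp.
apply: elem_mul; last exact: elem_cst.
by apply: elem_mul; [exact: elem_cst|exact: elem_coord].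
Qed.

Lemma elem_Ff f c (y : E) : jet f -> elem (fun x => Ff a f c x y).
Proof.
move=> jf; apply: elem_sub.
  by apply: elem_mul; [exact: elem_cst|apply: elem_comp => //; exact: elem_qf].
apply: elem_mul; last by apply: elem_comp => //; exact: elem_qf.
apply: elem_mul; last exact: elem_cst.
by apply: elem_mul; [exact: elem_cst|exact: elem_coord].
Qed.

Lemma elem_kf f c (y : E) : jet f -> elem (fun x => kf a f c x y).
Proof. by move=> jf; apply: elem_add; exact: elem_Ff. Qed.

Lemma bessel_kf f c x (y : E) : jet f ->
  bessel a (fun x => kf a f c x y) x =
  bessel a (fun x => Ff a f c x y) x + bessel a (fun x => Ff a f (- c) x y) x.
Proof.
move=> jf.
have := @bessel_sum _ [:: c; - c] (fun=> 1) (fun c x => Ff a f c x y) x.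
have e : (fun x : E => \sum_(p <- [:: c; - c]) 1 * Ff a f p x y) = (fun x => kf a f c x y).
  by apply/funext => z; rewrite !big_cons !big_nil !mul1r addr0.
rewrite e !big_cons !big_nil !mul1r addr0; apply.
by move=> p; exact: elem_Ff.
Qed.

(** For x_N >= 0 the extra term of [qf] is nonnegative and |x - y| >= ||x| - |y||. For x_N < 0,
    reflecting x in {x_N = 0} while replacing c by -c leaves [qf] unchanged and reduces to the first
    case. Test functions live on the whole ball, so both signs occur. *)
Lemma qf_ge c (x y : E) : -1 <= c <= 1 -> 0 <= y 0 ord_max ->
  (enorm x - enorm y) ^+ 2 <= qf c x y.
Proof.
move=> /andP[c1 c2] y0.
have H : dotp x x + dotp y y - 2 * enorm x * enorm y = (enorm x - enorm y) ^+ 2.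
  by rewrite -!enorm_sqr; ring.
rewrite -H /qf.
have xyE : dotp (x - y) (x - y) = dotp x x + dotp y y - 2 * dotp x y.
  rewrite /dotp mulr_sumr -big_split/= -sumrB; apply: eq_bigr => i _.
  by rewrite !mxE; ring.
have [x0|x0] := leP 0 (x 0 ord_max).
  have : 0 <= 2 * (1 - c) * x 0 ord_max * y 0 ord_max.
    by rewrite !mulr_ge0// subr_ge0.
  have := dotp_cauchy x y; rewrite xyE; lra.
(* The reflected point: [qf c x y] equals |x' - y|^2 + 2 (1 + c) (- x_N) y_N. *)
pose x' : E := \row_i (if i == ord_max then - x 0 i else x 0 i).
have x'E : enorm x' = enorm x.
  rewrite /enorm /dotp; congr Num.sqrt; apply: eq_bigr => i _; rewrite mxE.
  by case: ifP => // _; rewrite mulrNN.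
have x'y : dotp x' y = dotp x y - 2 * x 0 ord_max * y 0 ord_max.
  rewrite /dotp (bigD1 ord_max)//= [in RHS](bigD1 ord_max)//= mxE eqxx.
  rewrite (eq_bigr (fun i => x 0 i * y 0 i)); first ring.
  by move=> i /negbTE ni; rewrite mxE ni.
have := dotp_cauchy x' y; rewrite x'E x'y xyE.
have : 0 <= 2 * (1 + c) * (- x 0 ord_max) * y 0 ord_max.
  by rewrite !mulr_ge0// ?oppr_ge0 ?(ltW x0)//; lra.
nra.
Qed.

(** By [qf_ge], the argument of f is at least r^2 for both signs of c. *)
Lemma kf_out f r c (x y : E) : (forall j s, r ^+ 2 <= s -> f j s = 0) -> 0 <= r ->
  -1 <= c <= 1 -> 0 <= y 0 ord_max -> enorm y + r <= enorm x -> kf a f c x y = 0.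
Proof.
move=> f0 r0 c1 y0 xyr.
have c1' : -1 <= - c <= 1 by case/andP: c1 => ? ?; apply/andP; lra.
have rr : r ^+ 2 <= (enorm x - enorm y) ^+ 2.
  by rewrite ler_pXn2r ?nnegrE//; lra.
rewrite /kf /Ff !f0; first ring.
- exact: le_trans rr (qf_ge x c1' y0).
- exact: le_trans rr (qf_ge x c1' y0).
- exact: le_trans rr (qf_ge x c1 y0).
- exact: le_trans rr (qf_ge x c1 y0).
Qed.

(** On {x_N = 0} the angle disappears, so the flux of a kernel is read off its radial profile. *)
Lemma kf_flat f c (x y : E) : x 0 ord_max = 0 ->
  kf a f c x y = 2 * (a + 1) * f 0%N (dotp (x - y) (x - y)).
Proof.
by move=> x0; rewrite /kf /Ff /qf x0 !mulr0 !mul0r !addr0 !subr0; ring.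
Qed.

(** At x_N = 0 the normal derivative of [Ff] is odd in c, so the two halves of [kf] cancel; this
    makes the kernel admissible in [weak_form]. *)
Lemma partial_kf_flat f c (x y : E) : jet f -> x 0 ord_max = 0 ->
  partial ord_max (fun x => kf a f c x y) x = 0.
Proof.
move=> jf x0.
have := @partial_sum _ [:: c; - c] (fun=> 1) (fun c x => Ff a f c x y) ord_max.
have e : (fun x : E => \sum_(p <- [:: c; - c]) 1 * Ff a f p x y) = (fun x => kf a f c x y).
  by apply/funext => z; rewrite !big_cons !big_nil !mul1r addr0.
rewrite e => ->; last by move=> p; exact: elem_Ff.
rewrite !big_cons !big_nil !mul1r addr0 !partial_Ff// eqxx.
have qE : qf (- c) x y = qf c x y by rewrite /qf x0; ring.
by rewrite qE x0 mulr1n; ring.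
Qed.

End bessel_linear.

(** * The flux bound for averaged kernels *)

Section kernel_bound.
Variables (R : realType) (n : nat) (a rho m : R).
Hypotheses (a1 : -1 < a) (rho0 : 0 < rho) (m0 : 0 <= m).
Local Notation E := 'rV[R]_n.+1.
Notation mu := (@lebesgue_measure R).
Notation I := (`[0%R, pi]%classic : set R).
Notation Omega := (half_ball rho : set E).

(** The only property of u retained by the estimates: w stands for u x_N^a, and the energy has been
    rewritten by [weak_form]. In this form the bound also applies to w = x_N^a, with m = 0. *)
Definition subflux (w : E -> R) := forall psi : E -> R, elem psi ->
  compact (supp psi) -> supp psi `<=` eball rho ->
  (forall x : E, x 0 ord_max = 0 -> partial ord_max psi x = 0) ->
  `|\int[leb n.+1]_(x in Omega) (w x * bessel a psi x)| <=
  m * flat_integral rho (fun x => `|psi x|).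

(* L lists coefficients and centres, so that first and second differences with respect to
   the centre are combinations. *)
Definition comb (f : nat -> R -> R) (L : seq (R * E)) (c : R) (x : E) : R :=
  \sum_(p <- L) p.1 * kf a f c x p.2.

Definition mean (w : E -> R) (k : R -> E -> R) : R :=
  \int[(leb n.+1 \x mu)%E]_(z in Omega `*` I) (w z.1 * (sw a z.2 * k (cos z.2) z.1)).

Let mO : measurable Omega := @measurable_half_ball R n rho.
Let mI : measurable I. Proof. exact: measurable_itv. Qed.
Let mOI : measurable (Omega `*` I). Proof. exact: measurableX. Qed.

Let I_fin : (mu I < +oo)%E.
Proof. by rewrite lebesgue_measure_itv/= lte_fin pi_gt0 -EFinD ltry. Qed.

Lemma enorm_snoc0 (x' : 'rV[R]_n) : enorm (snoc (x', 0)) = enorm x'.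
Proof.
rewrite /enorm /dotp big_ord_recr/= snoc_last mulr0 addr0; congr Num.sqrt.
apply: eq_bigr => i _.
have -> : widen_ord (leqnSn n) i = lift ord_max i.
  by apply: ord_inj; rewrite lift_max.
by rewrite snoc_lift.
Qed.

Lemma measurable_flat_set : measurable [set x' : 'rV[R]_n | flat_ball rho (snoc (x', 0))].
Proof.
rewrite (_ : mkset _ = eball rho); first exact: measurable_eball.
apply/seteqP; split => x /=; rewrite /flat_ball /eball/= enorm_snoc0; first by case.
by split => //=; rewrite snoc_last.
Qed.

Lemma comb_elem f L c : jet f -> elem (comb f L c).
Proof.
move=> jf; apply: elem_sum => p.
by apply: elem_mul; [exact: elem_cst|exact: elem_kf].
Qed.

Let J : set R := [set c | -1 <= c <= 1].
Let bc : set (R -> R) := [set b | exists C, forall c, J c -> `|b c| <= C].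

Let bc_cst (c : R) : bc (cst c). Proof. by exists `|c|. Qed.

Lemma comb_fam f L : jet f -> fam bc (comb f L).
Proof.
move=> jf.
have fc c0 : fam bc (fun c (_ : E) => c0 * c : R).
  apply: (@fam_base R R n.+1 bc (fun c => c0 * c)); exists `|c0| => c /= cJ.
  by rewrite normrM ler_piMr// ler_norml.
have fq (e : R) (y : E) : fam bc (fun c x => qf (e * c) x y).
  apply: fam_add; first exact: fam_dotp.
  apply: fam_mul; last exact: fam_cst.
  apply: fam_mul; last exact: fam_coord.
  apply: fam_mul; first exact: fam_cst.
  by apply: fam_sub => //; exact: fam_cst.
have fF (e : R) (y : E) : fam bc (fun c x => Ff a f (e * c) x y).
  apply: fam_sub => //.
    by apply: fam_mul; [exact: fam_cst|exact: fam_comp].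
  apply: fam_mul; last exact: fam_comp.
  apply: fam_mul; last exact: fam_cst.
  apply: fam_mul; last exact: fam_coord.
  by apply: fam_mul; [exact: fam_cst|exact: fc].
apply: (@fam_sum R R n.+1 bc bc_cst _ L xpredT (fun p c x => p.1 * kf a f c x p.2)) => p.
apply: fam_mul; first exact: fam_cst.
rewrite (_ : (fun _ => _) = fun c x => Ff a f (1 * c) x p.2 + Ff a f ((-1) * c) x p.2).
  exact: fam_add.
by apply/funext => c; apply/funext => x; rewrite mul1r mulN1r.
Qed.

Lemma comb_bounded f L : jet f -> exists2 C, 0 <= C &
  forall c x, -1 <= c <= 1 -> `|x| <= rho -> `|comb f L c x| <= C.
Proof.
move=> jf.
by have [C C0 HC] := @fam_bounded _ _ _ _ J _ rho (fun b bb => bb) (comb_fam L jf); exists C.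
Qed.

Let rho_norm (x : E) : Omega x -> `|x| <= rho.
Proof. by move=> [/= xr _]; rewrite (le_trans (norm_le_enorm _))// ltW. Qed.

Lemma bessel_comb_bounded f L : jet f -> exists2 C, 0 <= C &
  forall c x, -1 <= c <= 1 -> Omega x -> `|bessel a (comb f L c) x| <= C.
Proof.
move=> jf; have fc := comb_fam L jf.
have H i : exists2 C, 0 <= C & forall c x, J c -> `|x| <= rho ->
    `|partial i (partial i (comb f L c)) x| <= C.
  have [h [fh hE]] := fam_partial bc_cst [:: i; i] fc.
  have [C C0 HC] := @fam_bounded _ _ _ _ J _ rho (fun b bb => bb) fh.
  by exists C => // c x Jc xr; have /= -> := hE c; exact: HC.
have /choice[C HC'] : forall i, exists C : R, 0 <= C /\ forall c (x : E), J c ->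
    `|x| <= rho -> `|partial i (partial i (comb f L c)) x| <= C.
  by move=> i; have [C C0 HC] := H i; exists C.
have C0 i : 0 <= C i by have [] := HC' i.
have HC i := (HC' i).2.
exists (\sum_i C i + `|a| * C ord_max).
  by rewrite addr_ge0 ?mulr_ge0// sumr_ge0.
move=> c x Jc Ox; have x0 := half_ball_last Ox.
rewrite /bessel (le_trans (ler_normD _ _))// lerD//.
  rewrite (le_trans (ler_norm_sum _ _ _))//; apply: ler_sum => i _.
  by apply: HC => //; exact: rho_norm.
(* By [last_le], division by x_N costs one more derivative of the kernel and nothing else. *)
rewrite normrM normrM normfV (gtr0_norm x0) -mulrA ler_wpM2l// ler_pdivrMl// mulrC.
apply: (@last_le _ _ rho) => //; first exact: comb_elem.
  by move=> z zr; exact: HC.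
move=> z z0; rewrite /comb partial_sum; last by move=> p; exact: elem_kf.
by rewrite big1// => p _; rewrite partial_kf_flat// mulr0.
Qed.

Let mZ1 i : measurable_fun setT (fun z : E * R => z.1 0 i).
Proof. exact: (measurableT_comp (@measurable_coords R n.+1 i) measurable_fst). Qed.

Let mcos (e : R) : measurable_fun setT (fun z : E * R => e * cos z.2).
Proof.
apply: measurable_funM => //.
apply: (measurableT_comp (f := cos)) => //; apply: continuous_measurable_fun.
exact: continuous_cos.
Qed.

(** Here the roles are exchanged: z = (x, theta) is the parameter and the centre y is the variable,
    so that means can be differentiated in y. *)
Lemma fam_qf (base : set (E * R -> R)) (e : R) : (forall c, base (cst c)) ->
  (forall i, base (fun z => z.1 0 i)) -> base (fun z => e * cos z.2) ->
  fam base (fun z (y : E) => qf (e * cos z.2) z.1 y).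
Proof.
move=> base_cst bx bcos.
apply: fam_add.
  apply: (@fam_sum R _ n.+1 base base_cst _ (index_enum _) xpredT
    (fun i (z : E * R) (y : E) => (z.1 - y) 0 i * (z.1 - y) 0 i)) => i.
  have H : fam base (fun (z : E * R) (y : E) => (z.1 - y) 0 i).
    rewrite (_ : (fun _ => _) = fun (z : E * R) (y : E) => z.1 0 i - y 0 i).
      apply: fam_sub => //; last exact: fam_coord.
      exact: (@fam_base R _ n.+1 base (fun z : E * R => z.1 0 i)).
    by apply/funext => z; apply/funext => y; rewrite !mxE.
  exact: fam_mul.
apply: fam_mul; last exact: fam_coord.
apply: fam_mul; last exact: (@fam_base R _ n.+1 base (fun z : E * R => z.1 0 ord_max)).
apply: fam_mul; first exact: fam_cst.
apply: fam_sub => //; first exact: fam_cst.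
exact: (@fam_base R _ n.+1 base (fun z : E * R => e * cos z.2)).
Qed.

Lemma fam_Ff (base : set (E * R -> R)) f (e : R) : (forall c, base (cst c)) ->
  (forall i, base (fun z => z.1 0 i)) -> base (fun z => e * cos z.2) -> jet f ->
  fam base (fun z (y : E) => Ff a f (e * cos z.2) z.1 y).
Proof.
move=> base_cst bx bcos jf; have fq := fam_qf base_cst bx bcos.
apply: fam_sub => //.
  by apply: fam_mul; [exact: fam_cst|exact: fam_comp].
apply: fam_mul; last exact: fam_comp.
apply: fam_mul; last exact: fam_coord.
apply: fam_mul; last exact: (@fam_base R _ n.+1 base (fun z : E * R => z.1 0 ord_max)).
apply: fam_mul; first exact: fam_cst.
exact: (@fam_base R _ n.+1 base (fun z : E * R => e * cos z.2)).
Qed.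

Lemma fam_kf (base : set (E * R -> R)) f : (forall c, base (cst c)) ->
  (forall i, base (fun z => z.1 0 i)) -> (forall e, base (fun z => e * cos z.2)) -> jet f ->
  fam base (fun z (y : E) => kf a f (cos z.2) z.1 y).
Proof.
move=> base_cst bx bcos jf.
rewrite (_ : (fun _ => _) = (fun z y => Ff a f (1 * cos z.2) z.1 y + Ff a f (-1 * cos z.2) z.1 y)).
  by apply: fam_add; exact: fam_Ff.
by apply/funext => z; apply/funext => y; rewrite mul1r mulN1r.
Qed.

Let mb : set (E * R -> R) := [set b | measurable_fun setT b].

Let mb_cst (c : R) : mb (cst c). Proof. exact: measurable_cst. Qed.
Let mb_x i : mb (fun z => z.1 0 i). Proof. exact: mZ1. Qed.
Let mb_cos e : mb (fun z => e * cos z.2). Proof. exact: mcos. Qed.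

Lemma measurable_jet_qf f j e (y : E) : jet f ->
  measurable_fun setT (fun z : E * R => f j (qf (e * cos z.2) z.1 y)).
Proof.
move=> jf; apply: (@fam_measurable _ _ R n.+1 mb setT
    (fun z (y : E) => f j (qf (e * cos z.2) z.1 y)) y) => //.
by apply: fam_comp => //; exact: fam_qf.
Qed.

Lemma measurable_Ff f e (y : E) : jet f ->
  measurable_fun setT (fun z : E * R => Ff a f (e * cos z.2) z.1 y).
Proof.
move=> jf; apply: (@fam_measurable _ _ R n.+1 mb setT
    (fun z (y : E) => Ff a f (e * cos z.2) z.1 y) y) => //.
exact: fam_Ff.
Qed.

Lemma measurable_comb f L : jet f ->
  measurable_fun setT (fun z : E * R => comb f L (cos z.2) z.1).
Proof.
move=> jf; apply: measurable_sum => p; apply: measurable_funM => //.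
apply: (@fam_measurable _ _ R n.+1 mb setT
    (fun z (y : E) => kf a f (cos z.2) z.1 y) p.2) => //.
exact: fam_kf.
Qed.

Lemma measurable_bessel_Ff f e (y : E) : jet f ->
  measurable_fun (Omega `*` I)
    (fun z : E * R => bessel a (fun x => Ff a f (e * cos z.2) x y) z.1).
Proof.
move=> jf.
(* The quotient 1 / x_N in [gg] is written as x_N^(-1), whose measurability is known on the whole
   space. *)
pose g (z : E * R) := 2 * a * (y 0 ord_max * weight (-1) z.1) * f 1%N (qf (e * cos z.2) z.1 y) -
  4 * y 0 ord_max ^+ 2 * (e * cos z.2) * f 2%N (qf (e * cos z.2) z.1 y).
apply: (eq_measurable_fun (fun z : E * R => Ff a (radlap n a f) (e * cos z.2) z.1 y -
    ((a + 2) * (e * cos z.2) * g z -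
     (1 - (e * cos z.2) ^+ 2) * dgg a f (e * cos z.2) z.1 y))).
  move=> z; rewrite inE => -[Ox _]; have x0 := half_ball_last Ox.
  by rewrite bessel_Ff ?gt_eqF// /g /gg /weight powR_inv1// ltW.
apply: measurable_funTS; apply: measurable_funB.
  by apply: measurable_Ff; exact: jet_radlap.
have mc := mcos e; have mf j := measurable_jet_qf j e y jf.
have mx : measurable_fun setT (fun z : E * R => z.1 0 ord_max) by exact: mZ1.
have mwt : measurable_fun setT (fun z : E * R => weight (-1) z.1).
  exact: (measurableT_comp (@measurable_weight R n (-1)) measurable_fst).
apply: measurable_funB; apply: measurable_funM.
- exact: measurable_funM.
- apply: measurable_funB; apply: measurable_funM => //; last exact: measurable_funM.
  by apply: measurable_funM => //; exact: measurable_funM.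
- by apply: measurable_funB => //; exact: measurable_funX.
- rewrite /dgg; apply: measurable_funD; apply: measurable_funM => //.
  by do 2 (apply: measurable_funM => //); apply: measurable_funM.
Qed.

Lemma bessel_comb f L c x : jet f -> bessel a (comb f L c) x =
  \sum_(p <- L) p.1 * (bessel a (fun x => Ff a f (1 * c) x p.2) x +
    bessel a (fun x => Ff a f (-1 * c) x p.2) x).
Proof.
move=> jf; rewrite bessel_sum; last by move=> p; exact: elem_kf.
by apply: eq_bigr => p _; rewrite bessel_kf// mul1r mulN1r.
Qed.

Lemma measurable_bessel_comb f L : jet f ->
  measurable_fun (Omega `*` I) (fun z : E * R => bessel a (comb f L (cos z.2)) z.1).
Proof.
move=> jf; rewrite (_ : (fun z : E * R => _) = fun z : E * R => \sum_(p <- L) p.1 *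
    (bessel a (fun x => Ff a f (1 * cos z.2) x p.2) z.1 +
     bessel a (fun x => Ff a f (-1 * cos z.2) x p.2) z.1)); last first.
  by apply/funext => z; exact: bessel_comb.
apply: measurable_sum => p; apply: measurable_funM => //.
by apply: measurable_funD; exact: measurable_bessel_Ff.
Qed.

Lemma flat_integral_le (psi : E -> R) (Y : 'rV[R]_n) (s Q : R) : 0 <= s -> 0 <= Q ->
  continuous psi -> (forall x' : 'rV[R]_n, `|psi (snoc (x', 0))| <= Q) ->
  (forall (x' : 'rV[R]_n) i, s < `|x' 0 i - Y 0 i| -> psi (snoc (x', 0)) = 0) ->
  flat_integral rho (fun x => `|psi x|) <= Q * (s *+ 2) ^+ n.
Proof.
move=> s0 Q0 cpsi psiQ psiS; rewrite /flat_integral.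
set C := [set x' : 'rV[R]_n | forall i, `|x' 0 i - Y 0 i| <= s].
have mC : measurable C.
  rewrite (_ : C = [set x' : 'rV[R]_n | forall i, (fun i : 'I_n =>
      [set t : R | `|t - Y 0 i| <= s]) i (x' 0 i)])//.
  apply: (@measurable_box R n (fun i => [set t : R | `|t - Y 0 i| <= s])) => i.
  rewrite (_ : mkset _ = `[Y 0 i - s, Y 0 i + s]%classic); first exact: measurable_itv.
  by apply/seteqP; split => t /=; rewrite in_itv/= ler_distl.
have CE : (\int[leb n]_x' (\1_C x')%:E = ((s *+ 2) ^+ n)%:E)%E.
  by rewrite integral_indic// setIT; exact: leb_cube.
have mF := measurable_flat_set.
set F := [set x' | flat_ball rho (snoc (x', 0))] in mF *.
have mpsi : measurable_fun F (fun x' => `|psi (snoc (x', 0))|).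
  apply: measurable_funTS; apply: measurableT_comp => //.
  apply: continuous_measurable_rV => x'.
  apply: (@continuous_comp _ _ _ (fun x' : 'rV[R]_n => snoc (x', 0)) psi) => //.
    exact: snoc_continuousl.
  exact: cpsi.
have iC : (leb n).-integrable setT (EFin \o (fun x' => Q * \1_C x')).
  rewrite (_ : EFin \o _ = fun x' => (Q%:E * (\1_C x')%:E)%E)//.
  apply: integrableZl => //; apply/integrableP; split.
    by apply/measurable_EFinP; exact: measurable_indic.
  under eq_integral do rewrite gee0_abs ?lee_fin//.
  by rewrite CE ltry.
have iC' : (leb n).-integrable F (EFin \o (fun x' => Q * \1_C x')).
  exact: integrableS iC.
rewrite (le_trans (ler_norm _))//.
apply: (le_trans (le_norm_Rintegral_bound mF mpsi _ iC')) => [x' Fx'|].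
  rewrite normr_id indicE; case: (boolP (x' \in C)) => xC; first by rewrite mulr1.
  have [i si] : exists i, s < `|x' 0 i - Y 0 i|.
    apply: contrapT => H; move/negP: xC; apply; apply/mem_set => i.
    by rewrite leNgt; apply/negP => ?; apply: H; exists i.
  by rewrite (psiS x' i si) normr0 mulr0.
rewrite /Rintegral -lee_fin fineK; last exact: integrable_fin_num.
apply: (@le_trans _ _ (\int[leb n]_x' (Q * \1_C x')%:E)%E).
  apply: ge0_subset_integral => //.
    by apply/measurable_EFinP; apply: measurable_funM => //; exact: measurable_indic.
  by move=> x' _; rewrite lee_fin mulr_ge0.
under eq_integral do rewrite EFinM.
rewrite ge0_integralZl//; first by rewrite CE EFinM.
by apply/measurable_EFinP; exact: measurable_indic.
Qed.

Variables (w : E -> R) (M : R).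
Hypotheses (mw : measurable_fun Omega w) (M0 : 0 <= M).
Hypothesis wM : forall x, Omega x -> `|w x| <= M * weight a x.

Lemma measurable_mean_integrand (k : E * R -> R) : measurable_fun (Omega `*` I) k ->
  measurable_fun (Omega `*` I) (fun z => w z.1 * (sw a z.2 * k z)).
Proof.
move=> mk; apply: measurable_funM.
  apply: (measurable_comp mO _ mw) => [x [z [Oz _] <-]//|].
  exact: measurable_funTS.
apply: measurable_funM => //; apply: measurable_funTS.
apply: (measurableT_comp (f := sw a)) => //; apply: continuous_measurable_fun.
exact: continuous_sw.
Qed.

Lemma mean_integrand_le (k : E * R -> R) C z : 0 <= C -> (Omega `*` I) z ->
  `|k z| <= C -> `|w z.1 * (sw a z.2 * k z)| <= M * C * weight a z.1.
Proof.
move=> C0 [Oz Iz] kC; rewrite normrM mulrAC ler_pM//; first exact: wM.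
rewrite normrM (ger0_norm (sw_ge0 _ _)) -[leRHS]mul1r ler_pM ?sw_ge0//.
exact: sw_le1.
Qed.

Lemma integrable_dominating C : (leb n.+1).-integrable Omega (EFin \o (fun x => C * weight a x)).
Proof.
rewrite (_ : EFin \o _ = fun x => (C%:E * (weight a x)%:E)%E)//.
by apply: integrableZl => //; exact: integrable_weight.
Qed.

Lemma cos_range (t : R) : -1 <= cos t <= 1.
Proof. by rewrite cos_geN1 cos_le1. Qed.

Hypothesis fw : subflux w.

Let Rintegral_angular (x : E) (L : seq (R * E)) (G : R -> R * E -> R -> R) :
  (forall e p, continuous (G e p)) ->
  \int[mu]_(t in I) (w x * \sum_(p <- L) p.1 * (G 1 p t + G (-1) p t)) =
  w x * \sum_(p <- L) p.1 * (\int[mu]_(t in I) G 1 p t + \int[mu]_(t in I) G (-1) p t).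
Proof.
move=> cG.
have int g : continuous g -> mu.-integrable I (EFin \o g).
  move=> cg; apply: continuous_compact_integrable; first exact: segment_compact.
  exact: continuous_subspaceT.
have cS p : continuous (fun t => p.1 * (G 1 p t + G (-1) p t)).
  by move=> t; apply: cvgMr; apply: cvgD; exact: cG.
rewrite RintegralZl//; last first.
  by apply: int => t; apply: cvg_big => [|p _]; [exact: add_continuous|exact: cS].
congr (_ * _); transitivity (\sum_(p <- L) \int[mu]_(t in I) (p.1 * (G 1 p t + G (-1) p t))).
  apply: (@Rintegral_sum _ _ _ mu I mI _ L (fun p t => p.1 * (G 1 p t + G (-1) p t))) => p.
  exact: int.
apply: eq_bigr => p _; rewrite RintegralZl//; last first.
  by apply: int => t; apply: cvgD; exact: cG.
by rewrite RintegralD//; exact/int/cG.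
Qed.

Lemma angular_comb f (L : seq (R * E)) x : jet f -> Omega x ->
  \int[mu]_(t in I) (w x * (sw a t * bessel a (comb f L (cos t)) x)) =
  \int[mu]_(t in I) (w x * (sw a t * comb (radlap n a f) L (cos t) x)).
Proof.
move=> jf Ox; have jL : jet (radlap n a f) by exact: jet_radlap.
have x0 : x 0 ord_max != 0 by rewrite gt_eqF// (half_ball_last Ox).
pose G1 (e : R) (p : R * E) (t : R) :=
  sw a t * bessel a (fun x => Ff a f (e * cos t) x p.2) x.
pose G2 (e : R) (p : R * E) (t : R) := sw a t * Ff a (radlap n a f) (e * cos t) x p.2.
transitivity (\int[mu]_(t in I) (w x * \sum_(p <- L) p.1 * (G1 1 p t + G1 (-1) p t))).
  apply: eq_Rintegral => t _; congr (_ * _); rewrite bessel_comb// big_distrr/=.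
  by apply: eq_bigr => p _; rewrite /G1 mulrCA mulrDr.
transitivity (\int[mu]_(t in I) (w x * \sum_(p <- L) p.1 * (G2 1 p t + G2 (-1) p t))); last first.
  apply: eq_Rintegral => t _; congr (_ * _); rewrite /comb big_distrr/=.
  by apply: eq_bigr => p _; rewrite /G2 /kf !mul1r !mulN1r -mulrDr mulrCA.
rewrite !Rintegral_angular//.
- by congr (_ * _); apply: eq_bigr => p _; rewrite !angular_bessel ?mulr1 ?mulN1r ?opprK.
- by move=> e p; exact: continuous_angular_Ff.
- by move=> e p; exact: continuous_angular_bessel.
Qed.

(** For each angle, the combination of kernels built on f is an even test function to which
    [subflux] applies. In the bound, 2 (a + 1) Q is its size on {x_N = 0} by [kf_flat], (2 s)^n the
    volume of a cube containing its trace, and pi the length of the angular interval, the weight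
    [sw] being at most 1. The gap between rho' and rho keeps the support inside the open ball. *)
Lemma kernel_bound f (L : seq (R * E)) (r s Q rho' : R) (Y : 'rV[R]_n) : jet f -> 0 <= r -> 0 <= s ->
  0 <= Q -> 0 <= rho' -> rho' < rho ->
  (forall j t, r ^+ 2 <= t -> f j t = 0) ->
  (forall p, p \in L -> 0 <= p.2 0 ord_max /\ enorm p.2 + r <= rho') ->
  (forall x : E, x 0 ord_max = 0 ->
    `|\sum_(p <- L) p.1 * f 0%N (dotp (x - p.2) (x - p.2))| <= Q) ->
  (forall (x : E) i, x 0 ord_max = 0 -> s < `|x 0 (lift ord_max i) - Y 0 i| ->
    \sum_(p <- L) p.1 * f 0%N (dotp (x - p.2) (x - p.2)) = 0) ->
  `|mean w (comb (radlap n a f) L)| <= m * (2 * (a + 1) * Q * (s *+ 2) ^+ n) * pi.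
Proof.
move=> jf r0 s0 Q0 rho'0 rho'rho f0 HL HQ Hs.
have jL : jet (radlap n a f) by exact: jet_radlap.
have a10 : 0 <= a + 1 by rewrite -lerBlDr sub0r ltW.
set B := m * (2 * (a + 1) * Q * (s *+ 2) ^+ n).
have [C C0 HC] := comb_bounded L jL.
have [C' C'0 HC'] := bessel_comb_bounded L jf.
have m1 : measurable_fun (Omega `*` I)
    (fun z => w z.1 * (sw a z.2 * comb (radlap n a f) L (cos z.2) z.1)).
  apply: measurable_mean_integrand; apply: measurable_funTS.
  exact: measurable_comb.
have m2 : measurable_fun (Omega `*` I)
    (fun z => w z.1 * (sw a z.2 * bessel a (comb f L (cos z.2)) z.1)).
  by apply: measurable_mean_integrand; exact: measurable_bessel_comb.
rewrite /mean (@Rintegral_rectangle1 _ _ _ _ R (leb n.+1) mu Omega I _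
  (fun x => M * C * weight a x) mO mI I_fin m1)//; last 2 first.
- exact: integrable_dominating.
- move=> x t Ox It; apply: (@mean_integrand_le (fun z => comb (radlap n a f) L (cos z.2) z.1) C (x, t)) => //=.
  by apply: HC; [exact: cos_range|exact: rho_norm].
(* For fixed x the angular integral turns the radial Laplacian into [bessel]; afterwards the order
   of integration is reversed, so that each angle supplies one test function. *)
have -> : \int[leb n.+1]_(x in Omega) \int[mu]_(t in I)
    (w x * (sw a t * comb (radlap n a f) L (cos t) x)) =
    \int[leb n.+1]_(x in Omega) \int[mu]_(t in I)
    (w x * (sw a t * bessel a (comb f L (cos t)) x)).
  by apply: eq_Rintegral => x; rewrite inE => Ox; rewrite angular_comb.
rewrite -(@Rintegral_rectangle1 _ _ _ _ R (leb n.+1) mu Omega I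
  (fun z => w z.1 * (sw a z.2 * bessel a (comb f L (cos z.2)) z.1))
  (fun x => M * C' * weight a x) mO mI I_fin m2)//; last 2 first.
- exact: integrable_dominating.
- move=> x t Ox It; apply: (@mean_integrand_le (fun z => bessel a (comb f L (cos z.2)) z.1) C' (x, t)) => //=.
  by apply: HC' => //; exact: cos_range.
rewrite (@Rintegral_rectangle2 _ _ _ _ R (leb n.+1) mu Omega I _
  (fun x => M * C' * weight a x) mO mI I_fin m2)//; last 2 first.
- exact: integrable_dominating.
- move=> x t Ox It; apply: (@mean_integrand_le (fun z => bessel a (comb f L (cos z.2)) z.1) C' (x, t)) => //=.
  by apply: HC' => //; exact: cos_range.
have m3 := @measurable_Rintegral_section2 _ _ _ _ R (leb n.+1) mu Omega I _
  (fun x => M * C' * weight a x) mO mI I_fin m2 (integrable_dominating _).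
have Z t : I t -> `|\int[leb n.+1]_(x in Omega)
    (w x * (sw a t * bessel a (comb f L (cos t)) x))| <= B.
  move=> It; set psi := comb f L (cos t).
  have epsi : elem psi by exact: comb_elem.
  have psi_out x : rho' <= enorm x -> psi x = 0.
    move=> xr; rewrite /psi /comb big_seq big1// => p pL.
    have [p0 pr] := HL p pL.
    by rewrite (kf_out a f0 r0 (cos_range t) p0) ?mulr0// (le_trans pr).
  have spsi : supp psi `<=` eball rho.
    apply: (@subset_trans _ [set x : E | enorm x <= rho']).
      apply: supp_sub; last first.
        by move=> x; apply: contra_neqP => /negP; rewrite -ltNge => /ltW/psi_out.
      rewrite (_ : mkset _ = (fun x => dotp (x - 0) (x - 0)) @^-1` [set t : R | t <= rho' ^+ 2]).
        apply: closed_comp; last exact: closed_le.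
        by move=> x _; apply: elem_continuous; exact: elem_dotp.
      apply/seteqP; split => x /=; rewrite subr0 -enorm_sqr ler_sqr ?nnegrE//;
        exact: enorm_ge0.
    by move=> x /= xr; exact: le_lt_trans rho'rho.
  have cpsi : compact (supp psi).
    apply: (subclosed_compact _ (@compact_cube R n.+1 rho)); first exact: closed_closure.
    by move=> x /spsi xr; rewrite /= (le_trans (norm_le_enorm _))// ltW.
  have psi_flat (x : E) : x 0 ord_max = 0 ->
      psi x = 2 * (a + 1) * \sum_(p <- L) p.1 * f 0%N (dotp (x - p.2) (x - p.2)).
    move=> x0; rewrite /psi /comb big_distrr/=; apply: eq_bigr => p _.
    by rewrite kf_flat// mulrCA.
  have := fw epsi cpsi spsi.
  have -> : \int[leb n.+1]_(x in Omega) (w x * (sw a t * bessel a psi x)) =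
      sw a t * \int[leb n.+1]_(x in Omega) (w x * bessel a psi x).
    rewrite -RintegralZl//; last first.
      apply: (integrable_bound mO _ _ (integrable_dominating (M * C'))).
        by apply: measurable_funM => //; apply: measurable_bessel => // x /half_ball_last.
      move=> x Ox; rewrite normrM mulrAC ler_pM//; first exact: wM.
      by apply: HC' => //; exact: cos_range.
    by apply: eq_Rintegral => x _; rewrite mulrCA.
  move=> H; rewrite normrM (ger0_norm (sw_ge0 _ _)) -[leRHS]mul1r ler_pM ?sw_ge0 ?sw_le1//.
  apply: (le_trans (H _)) => [x x0|]; last first.
    rewrite ler_wpM2l//; apply: (@flat_integral_le psi Y s (2 * (a + 1) * Q)) => //.
    - by rewrite !mulr_ge0.
    - exact: elem_continuous.
    - move=> x'; rewrite psi_flat ?snoc_last// normrM ger0_norm ?mulr_ge0//.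
      by rewrite ler_wpM2l ?mulr_ge0// HQ// snoc_last.
    - move=> x' i si; rewrite psi_flat ?snoc_last// (Hs _ i) ?mulr0// ?snoc_last//.
      by rewrite snoc_lift.
  rewrite /psi /comb partial_sum; last by move=> p; exact: elem_kf.
  by rewrite big1// => p _; rewrite partial_kf_flat// mulr0.
have B0 : 0 <= B by rewrite !mulr_ge0// ?exprn_ge0 ?mulrn_wge0.
have iB : mu.-integrable I (EFin \o cst B).
  apply: continuous_compact_integrable; first exact: segment_compact.
  by apply: continuous_subspaceT => t; exact: cvg_cst.
apply: (@le_trans _ _ (\int[mu]_(t in I) cst B t)).
  have m4 : measurable_fun I (fun t => \int[leb n.+1]_(x in Omega)
      (w x * (sw a t * bessel a (comb f L (cos t)) x))).
    apply: m3 => x t Ox It.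
    apply: (@mean_integrand_le (fun z => bessel a (comb f L (cos z.2)) z.1) C' (x, t)) => //=.
    by apply: HC' => //; exact: cos_range.
  exact: (@le_norm_Rintegral_bound _ _ _ mu I mI _ (cst B) m4 Z iB).
by rewrite Rintegral_cst//= lebesgue_measure_itv/= lte_fin pi_gt0 -EFinD/= subr0.
Qed.

End kernel_bound.

(** * Dependence of the means on the centre and the scale *)

(** Both g + f and g - f are nondecreasing. *)
Lemma derive_le (R : realType) (f df g dg : R -> R) (al be : R) : al <= be ->
  (forall t : R, al <= t <= be -> is_derive t 1 f (df t)) ->
  (forall t : R, al <= t <= be -> is_derive t 1 g (dg t)) ->
  (forall t, al <= t <= be -> `|df t| <= dg t) ->
  `|f be - f al| <= g be - g al.
Proof.
move=> ab Df Dg H.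
have mono (h dh : R -> R) : (forall t : R, al <= t <= be -> is_derive t 1 h (dh t)) ->
    (forall t, al <= t <= be -> 0 <= dh t) -> h al <= h be.
  move=> Dh dh0.
  have ch : {within `[al, be], continuous h}.
    apply: derivable_within_continuous => t; rewrite in_itv/= => tab.
    by have [] := Dh t tab.
  have Dh' t : t \in `]al, be[ -> is_derive t 1 h (dh t).
    by rewrite in_itv/= => /andP[at_ tb]; apply: Dh; rewrite !ltW.
  have [c] := MVT_segment ab Dh' ch.
  rewrite in_itv/= => cab e; rewrite -subr_ge0 e mulr_ge0 ?subr_ge0//.
  exact: dh0.
have H1 : (g + f) al <= (g + f) be.
  apply: (mono _ (fun t => dg t + df t)) => t tab.
    by apply: is_deriveD; [exact: Dg|exact: Df].
  by have := H t tab; rewrite ler_norml => /andP[? _]; lra.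
have H2 : (g - f) al <= (g - f) be.
  apply: (mono _ (fun t => dg t - df t)) => t tab.
    by apply: is_deriveB; [exact: Dg|exact: Df].
  by have := H t tab; rewrite ler_norml => /andP[_ ?]; lra.
move: H1 H2; rewrite /= -[(g + f) _]/(g _ + f _) -[(g + f) _]/(g _ + f _).
rewrite -[(g - f) _]/(g _ - f _) -[(g - f) _]/(g _ - f _) ler_norml => H1 H2.
by apply/andP; split; lra.
Qed.

(** * Quantitative first and second order estimates for increments *)

Section taylor.
Variables (R : realType) (m : nat).
Local Notation E := 'rV[R]_m.
Implicit Types (f : E -> R) (Y d : E).

Lemma linear_row_coord (L : {linear E -> R}) d :
  L d = \sum_i d 0 i * L (delta_mx 0 i).
Proof.
by rewrite {1}(row_sum_delta d) linear_sum/=; apply: eq_bigr => i _; rewrite linearZ.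
Qed.

Lemma is_derive_segment f Y d (t : R) : differentiable f (Y + t *: d) ->
  is_derive t 1 (fun s : R => f (Y + s *: d))
    (\sum_i d 0 i * partial i f (Y + t *: d)).
Proof.
move=> df; have : is_derive (Y + t *: d) d f (\sum_i d 0 i * partial i f (Y + t *: d)).
  apply: DeriveDef; first exact: diff_derivable.
  rewrite deriveE// linear_row_coord; apply: eq_bigr => i _.
  by rewrite /partial deriveE.
move/is_derive_line => D; apply/is_derive_line.
rewrite (_ : (fun _ => _) = (fun h : R => f (h *: d + (Y + t *: d)))); last first.
  apply/funext => h; congr (f _); rewrite [h *: (1 : R)](_ : _ = h); last first.
    by rewrite /GRing.scale/= mulr1.
  by rewrite scalerDl addrCA.
exact: D.
Qed.

Lemma segment_norm (rho t : R) Y d : 0 <= t <= 1 -> `|Y| <= rho -> `|Y + d| <= rho ->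
  `|Y + t *: d| <= rho.
Proof.
move=> /andP[t0 t1] Yr Ydr.
have -> : Y + t *: d = (1 - t) *: Y + t *: (Y + d).
  by rewrite scalerBl scale1r scalerDr addrA subrK.
rewrite (le_trans (ler_normD _ _))// !normrZ ger0_norm ?subr_ge0// (ger0_norm t0).
have -> : rho = (1 - t) * rho + t * rho by ring.
by rewrite lerD// ler_wpM2l// subr_ge0.
Qed.

Lemma norm_sum_coord d (b : 'I_m -> R) B : (forall i, `|b i| <= B) ->
  `|\sum_i d 0 i * b i| <= m%:R * B * `|d|.
Proof.
move=> bB; rewrite (le_trans (ler_norm_sum _ _ _))//.
apply: (@le_trans _ _ (\sum_(i < m) `|d| * B)).
  by apply: ler_sum => i _; rewrite normrM ler_pM// coord_le_norm.
rewrite sumr_const card_ord; have -> : m%:R * B * `|d| = (`|d| * B) *+ m => //.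
by rewrite -mulr_natl; ring.
Qed.

Let id_derive (t K : R) : is_derive t 1 (fun s : R => K * s) K.
Proof.
have := is_deriveZ K (is_derive_id t (1 : R)).
by rewrite /GRing.scale/= mulr1.
Qed.

Lemma lipschitz_bound f (rho C : R) Y d : (forall x, differentiable f x) ->
  (forall i x, `|x| <= rho -> `|partial i f x| <= C) ->
  `|Y| <= rho -> `|Y + d| <= rho -> `|f (Y + d) - f Y| <= m%:R * C * `|d|.
Proof.
move=> df HC Yr Ydr.
have := @derive_le R (fun s => f (Y + s *: d)) _ (fun s => m%:R * C * `|d| * s) _ 0 1
  ler01 (fun t _ => is_derive_segment (df (Y + t *: d))) (fun t _ => id_derive t _).
rewrite scale1r scale0r addr0 mulr1 mulr0 subr0; apply => t t01.
by apply: norm_sum_coord => i; apply: HC; exact: segment_norm.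
Qed.

Variables (rho C : R) (f : E -> R).
Hypothesis df : forall x, differentiable f x.
Hypothesis ddf : forall i x, differentiable (partial i f) x.
Hypothesis HC : forall i j x, `|x| <= rho -> `|partial j (partial i f) x| <= C.

Lemma taylor_bound Y d : `|Y| <= rho -> `|Y + d| <= rho ->
  `|f (Y + d) - f Y - \sum_i d 0 i * partial i f Y| <= m%:R * (m%:R * C) * `|d| ^+ 2.
Proof.
move=> Yr Ydr; set S := \sum_i _.
have H (t : R) : is_derive t 1 (fun s : R => f (Y + s *: d) - S * s)
    (\sum_i d 0 i * partial i f (Y + t *: d) - S).
  exact: is_deriveB (is_derive_segment (df _)) (id_derive t S).
have := @derive_le R _ _ (fun s => m%:R * (m%:R * C) * `|d| ^+ 2 * s) _ 0 1
  ler01 (fun t _ => H t) (fun t _ => id_derive t _).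
rewrite scale1r scale0r addr0 !mulr1 !mulr0 !subr0 addrAC; apply => t t01.
rewrite /S -sumrB; under eq_bigr do rewrite -mulrBr.
have -> : m%:R * (m%:R * C) * `|d| ^+ 2 = m%:R * (m%:R * C * `|d|) * `|d| by ring.
apply: norm_sum_coord => i.
have C0 : 0 <= C by rewrite (le_trans _ (HC i i Yr)).
apply: le_trans (lipschitz_bound (ddf i) (HC i) Yr _) _; first exact: segment_norm.
rewrite ler_wpM2l ?mulr_ge0// normrZ; case/andP: t01 => t0 t1.
by rewrite ger0_norm// ler_piMl.
Qed.

(** Mean value inequality for s |-> f (Y + d + s h) - f (Y + s h), whose derivative is an increment
    of the gradient. *)
Lemma second_difference_bound Y d h : `|Y| <= rho -> `|Y + d| <= rho -> `|Y + h| <= rho ->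
  `|Y + h + d| <= rho ->
  `|f (Y + h + d) - f (Y + h) - f (Y + d) + f Y| <= m%:R * (m%:R * C * `|d|) * `|h|.
Proof.
move=> Yr Ydr Yhr Yhdr.
have H (t : R) : is_derive t 1 (fun s : R => f (Y + d + s *: h) - f (Y + s *: h))
    (\sum_i h 0 i * (partial i f (Y + d + t *: h) - partial i f (Y + t *: h))).
  apply: is_derive_eq.
    exact: is_deriveB (is_derive_segment (df _)) (is_derive_segment (df _)).
  by rewrite -sumrB; apply: eq_bigr => i _; rewrite mulrBr.
have := @derive_le R _ _ (fun s => m%:R * (m%:R * C * `|d|) * `|h| * s) _ 0 1
  ler01 (fun t _ => H t) (fun t _ => id_derive t _).
rewrite !scale1r !scale0r !addr0 mulr1 mulr0 subr0 (addrAC Y d h).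
have -> : f (Y + h + d) - f (Y + h) - f (Y + d) + f Y =
  f (Y + h + d) - f (Y + h) - (f (Y + d) - f Y) by ring.
apply => t t01.
apply: norm_sum_coord => i; rewrite (addrAC Y d).
apply: lipschitz_bound (ddf i) (HC i) _ _; first exact: segment_norm.
rewrite addrAC; apply: segment_norm => //.
by rewrite addrAC.
Qed.

End taylor.

Section quadratic_differentiability.
Variables (R : realType) (m : nat).
Local Notation E := 'rV[R]_m.

(** The arguments are swapped so that [dotpr c] is a linear form. *)
Definition dotpr (c d : E) : R := dotp d c.

Let dotpr_linear c : linear (dotpr c).
Proof. by move=> k x y; rewrite /dotpr dotpDl dotpZl. Qed.

HB.instance Definition _ c := GRing.isLinear.Build R E R _ (dotpr c) (dotpr_linear c).

Let dotpr_continuous c : continuous (dotpr c).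
Proof.
apply: (@elem_continuous R m (dotpr c)); apply: elem_sum => i.
by apply: elem_mul; [exact: elem_coord|exact: elem_cst].
Qed.

(** Used to differentiate under the integral sign: averaging a Taylor remainder that is uniform in
    the parameter leaves a quadratic remainder. *)
Lemma differentiable_quadratic (f : E -> R) x c K :
  (forall d, `|d| <= 1 -> `|f (x + d) - f x - dotp d c| <= K * `|d| ^+ 2) ->
  differentiable f x /\ forall i, partial i f x = c 0 i.
Proof.
move=> H.
have fo : (f \o shift x : E -> R) = (cst (f x) + dotpr c : E -> R) +o_ (0 : E) id.
  apply/eqaddoP => _/posnumP[e].
  have eK : 0 < e%:num / (`|K| + 1) by rewrite divr_gt0// ltr_wpDl.
  near=> d.
  have d1 : `|d| <= 1.
    near: d; have /cvgrPdist_le/= := (@cvg_id _ (nbhs (0 : E))).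
    by move=> /(_ _ ltr01); apply: filterS => d; rewrite sub0r normrN.
  have de : `|d| <= e%:num / (`|K| + 1).
    near: d; have /cvgrPdist_le/= := (@cvg_id _ (nbhs (0 : E))).
    by move=> /(_ _ eK); apply: filterS => d; rewrite sub0r normrN.
  rewrite -[(_ - _) d]/(f (d + x) - (f x + dotp d c)) opprD addrA (addrC d).
  rewrite (le_trans (H d d1))// expr2 mulrA ler_wpM2r//.
  rewrite (@le_trans _ _ ((`|K| + 1) * `|d|))//.
    by rewrite ler_wpM2r// (le_trans (ler_norm K))// lerDl.
  by rewrite mulrC -ler_pdivlMr// ltr_wpDl.
have dE := diff_unique (dotpr_continuous (c := c)) fo.
have df : differentiable f x.
  by apply/diff_locallyP; rewrite dE; split => //; exact: dotpr_continuous.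
split => // i; rewrite /partial deriveE// dE /= /dotpr /dotp (bigD1 i)//= big1 ?addr0.
  by rewrite mxE !eqxx mul1r.
by move=> j ji; rewrite mxE (negbTE ji) andbF mul0r.
Unshelve. all: by end_near. Qed.

End quadratic_differentiability.

(** * Averages over x and theta, and their derivatives in a parameter *)

Section averages.
Variables (R : realType) (n : nat) (a rho : R).
Hypotheses (a1 : -1 < a) (rho0 : 0 < rho).
Local Notation E := 'rV[R]_n.+1.
Notation mu := (@lebesgue_measure R).
Notation I := (`[0%R, pi]%classic : set R).
Notation Omega := (half_ball rho : set E).
Notation D := (Omega `*` I).
Notation P := (leb n.+1 \x mu)%E.

Definition avg (w : E -> R) (k : E * R -> R) : R :=
  \int[P]_(z in D) (w z.1 * (sw a z.2 * k z)).

Definition wtot : R := \int[P]_(z in D) weight a z.1.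

Let mO : measurable Omega := @measurable_half_ball R n rho.
Let mI : measurable I. Proof. exact: measurable_itv. Qed.
Let mD : measurable D. Proof. exact: measurableX. Qed.

Lemma measurable_weight_rectangle : measurable_fun D (fun z : E * R => weight a z.1).
Proof.
apply: measurable_funTS.
exact: (measurableT_comp (@measurable_weight R n a) measurable_fst).
Qed.

Lemma integrable_weight_rectangle : P.-integrable D (EFin \o (fun z : E * R => weight a z.1)).
Proof.
have I_fin : (mu I < +oo)%E.
  by rewrite lebesgue_measure_itv/= lte_fin pi_gt0 -EFinD ltry.
apply: (@integrable_rectangle _ _ _ _ R (leb n.+1) mu Omega I _ (weight a) mO mI I_fin
  measurable_weight_rectangle (integrable_weight n a1 rho0)).
by move=> x y _ _; rewrite ger0_norm// powR_ge0.
Qed.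

Lemma wtot_ge0 : 0 <= wtot.
Proof. by apply: Rintegral_ge0 => z _; exact: powR_ge0. Qed.

Variables (w : E -> R) (M : R).
Hypotheses (mw : measurable_fun Omega w) (M0 : 0 <= M).
Hypothesis wM : forall x, Omega x -> `|w x| <= M * weight a x.

Definition admissible (k : E * R -> R) :=
  measurable_fun D k /\ exists C : R, forall z, D z -> `|k z| <= C.

Let integrable_cweight C : P.-integrable D (EFin \o (fun z : E * R => C * weight a z.1)).
Proof.
rewrite (_ : EFin \o _ = fun z : E * R => (C%:E * (weight a z.1)%:E)%E)//.
by apply: integrableZl => //; exact: integrable_weight_rectangle.
Qed.

Let bound (k : E * R -> R) (C : R) z : D z -> `|k z| <= C ->
  `|w z.1 * (sw a z.2 * k z)| <= M * C * weight a z.1.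
Proof.
move=> Dz kC; have C0 : 0 <= C := le_trans (normr_ge0 _) kC.
exact: (mean_integrand_le a1 wM C0 Dz kC).
Qed.

Lemma avg_integrable k : admissible k ->
  P.-integrable D (EFin \o (fun z => w z.1 * (sw a z.2 * k z))).
Proof.
move=> [mk [C kC]]; apply: (@integrable_bound _ _ R P D mD _ (fun z => M * C * weight a z.1) _ _
  (integrable_cweight (M * C))).
  exact: measurable_mean_integrand.
by move=> z Dz; apply: bound => //; exact: kC.
Qed.

Lemma avg_le k C : admissible k -> (forall z, D z -> `|k z| <= C) ->
  `|avg w k| <= M * C * wtot.
Proof.
move=> [mk _] kC; rewrite /wtot -RintegralZl//; last exact: integrable_weight_rectangle.
apply: le_norm_Rintegral_bound => //; first exact: measurable_mean_integrand.
by move=> z Dz; apply: bound => //; exact: kC.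
Qed.

Lemma admissibleD k1 k2 : admissible k1 -> admissible k2 ->
  admissible (fun z => k1 z + k2 z).
Proof.
move=> [m1 [C1 H1]] [m2 [C2 H2]]; split; first exact: measurable_funD.
exists (C1 + C2) => z Dz.
by rewrite (le_trans (ler_normD _ _))// lerD//; [exact: H1|exact: H2].
Qed.

Lemma admissibleZ c k : admissible k -> admissible (fun z => c * k z).
Proof.
move=> [m1 [C1 H1]]; split; first exact: measurable_funM.
by exists (`|c| * C1) => z Dz; rewrite normrM ler_wpM2l// H1.
Qed.

Lemma avgD k1 k2 : admissible k1 -> admissible k2 ->
  avg w (fun z => k1 z + k2 z) = avg w k1 + avg w k2.
Proof.
move=> h1 h2; rewrite /avg -RintegralD//; [|exact: avg_integrable..].
by apply: eq_Rintegral => z _; rewrite !mulrDr.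
Qed.

Lemma avgZ c k : admissible k -> avg w (fun z => c * k z) = c * avg w k.
Proof.
move=> h; rewrite /avg -RintegralZl//; last exact: avg_integrable.
by apply: eq_Rintegral => z _; ring.
Qed.

Lemma admissible_sum (T : Type) (r : seq T) (k : T -> E * R -> R) :
  (forall p, admissible (k p)) -> admissible (fun z => \sum_(p <- r) k p z).
Proof.
move=> h; elim: r => [|p r IH].
  under eq_fun do rewrite big_nil; split; first exact: measurable_cst.
  by exists 0 => z _; rewrite normr0.
by under eq_fun do rewrite big_cons; apply: admissibleD.
Qed.

Lemma avg_sum (T : Type) (r : seq T) (k : T -> E * R -> R) : (forall p, admissible (k p)) ->
  avg w (fun z => \sum_(p <- r) k p z) = \sum_(p <- r) avg w (k p).
Proof.
move=> h; elim: r => [|p r IH].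
  rewrite big_nil /avg; under eq_Rintegral do rewrite big_nil !mulr0.
  by rewrite Rintegral_cst// mul0r.
rewrite big_cons -IH -avgD//; last exact: admissible_sum.
by congr (avg w _); apply/funext => z; rewrite big_cons.
Qed.

(** The coefficients allowed in kernels: being bounded on the rectangle, they are integrable there
    against the weight. *)
Definition kbase : set (E * R -> R) :=
  [set b : E * R -> R | measurable_fun setT b /\ exists C : R, forall z, D z -> `|b z| <= C].

Lemma kbase_cst (c : R) : kbase (cst c).
Proof. by split; [exact: measurable_cst|exists `|c|]. Qed.

Lemma kbase_coord i : kbase (fun z => z.1 0 i).
Proof.
split; first exact: (measurableT_comp (@measurable_coords R n.+1 i) measurable_fst).
exists rho => z [[/= zr _] _].
by rewrite (le_trans (coord_le_enorm _ _))// ltW.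
Qed.

Lemma kbase_cos e : kbase (fun z => e * cos z.2).
Proof.
split.
  apply: measurable_funM => //.
  apply: (measurableT_comp (f := cos)) => //; apply: continuous_measurable_fun.
  exact: continuous_cos.
exists `|e| => z _; rewrite normrM ler_piMr// ler_norml cos_geN1.
exact: cos_le1.
Qed.

Variable m : nat.
Local Notation F := 'rV[R]_m.

Lemma kbase_fam_bounded (h : E * R -> F -> R) r : fam kbase h ->
  exists2 C, 0 <= C & forall z x, D z -> `|x| <= r -> `|h z x| <= C.
Proof. by apply: fam_bounded => b []. Qed.

Lemma fam_admissible (h : E * R -> F -> R) x : fam kbase h -> admissible (h^~ x).
Proof.
move=> fh; split.
  apply: measurable_funTS; apply: (fam_measurable _ _ fh) => b [mb _].
  exact: mb.
by have [C _ HC] := kbase_fam_bounded `|x| fh; exists C => z Dz; exact: HC.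
Qed.

Lemma fam_kbase_partial (h : E * R -> F -> R) i : fam kbase h ->
  fam kbase (fun z => partial i (h z)).
Proof.
move=> /(fam_partial kbase_cst [:: i])[h' [fh' hE]].
by rewrite (_ : (fun _ => _) = h')//; apply/funext => z; rewrite -hE.
Qed.

Lemma kbase_fam_C2 (h : E * R -> F -> R) r : fam kbase h -> exists2 C, 0 <= C &
  [/\ forall z x, D z -> `|x| <= r -> `|h z x| <= C,
      forall z i x, D z -> `|x| <= r -> `|partial i (h z) x| <= C &
      forall z i j x, D z -> `|x| <= r -> `|partial j (partial i (h z)) x| <= C].
Proof.
move=> fh; have [C0 C00 H0] := kbase_fam_bounded r fh.
have /choice[C1 H1] i : exists C1 : R, 0 <= C1 /\ forall z x, D z -> `|x| <= r ->
    `|partial i (h z) x| <= C1.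
  by have [C1 ? ?] := kbase_fam_bounded r (fam_kbase_partial i fh); exists C1.
have /choice[C2 H2] (p : 'I_m * 'I_m) : exists C2 : R, 0 <= C2 /\ forall z x, D z ->
    `|x| <= r -> `|partial p.2 (partial p.1 (h z)) x| <= C2.
  have [C2 ? ?] := kbase_fam_bounded r (fam_kbase_partial p.2 (fam_kbase_partial p.1 fh)).
  by exists C2.
have S1 : 0 <= \sum_i C1 i by apply: sumr_ge0 => i _; have [] := H1 i.
have S2 : 0 <= \sum_p C2 p by apply: sumr_ge0 => p _; have [] := H2 p.
exists (C0 + \sum_i C1 i + \sum_p C2 p); first by rewrite !addr_ge0.
split=> [z x Dz xr|z i x Dz xr|z i j x Dz xr].
- by rewrite (le_trans (H0 z x Dz xr))// -addrA lerDl addr_ge0.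
- rewrite (le_trans ((H1 i).2 z x Dz xr))// (bigD1 i)//= -!addrA addrCA lerDl.
  rewrite !addr_ge0// sumr_ge0// => j _; by have [] := H1 j.
- rewrite (le_trans ((H2 (i, j)).2 z x Dz xr))// (bigD1 (i, j) (F := C2))//= addrCA lerDl.
  rewrite !addr_ge0// sumr_ge0// => p _; by have [] := H2 p.
Qed.

(** The second derivatives of h in x are bounded uniformly in z near x, so [taylor_bound] can be
    averaged and [differentiable_quadratic] applies. *)
Lemma fam_avg_differentiable (h : E * R -> F -> R) x : fam kbase h ->
  differentiable (fun x => avg w (h^~ x)) x /\
  forall i, partial i (fun x => avg w (h^~ x)) x = avg w (fun z => partial i (h z) x).
Proof.
move=> fh; have [C C0 [_ _ H2]] := kbase_fam_C2 (`|x| + 1) fh.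
have adm i : admissible (fun z => partial i (h z) x).
  exact: (fam_admissible x (fam_kbase_partial i fh)).
pose c : F := \row_i avg w (fun z => partial i (h z) x).
have [] := @differentiable_quadratic R m (fun x => avg w (h^~ x)) x c
  (M * (m%:R * (m%:R * C)) * wtot).
  move=> d d1.
  have -> : avg w (h^~ (x + d)) - avg w (h^~ x) - dotp d c =
      avg w (fun z => (h z (x + d) + (-1) * h z x) + (-1) * \sum_i d 0 i * partial i (h z) x).
    have A0 y : admissible (h^~ y) by exact: fam_admissible.
    have A1 : admissible (fun z => \sum_i d 0 i * partial i (h z) x).
      by apply: admissible_sum => i; exact: admissibleZ.
    rewrite avgD ?avgZ ?avgD ?avgZ//; [|exact: admissibleZ|exact: admissibleD (A0 _) (admissibleZ _ _)|exact: admissibleZ].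
    rewrite !mulN1r; congr (_ - _); rewrite avg_sum; last by move=> i; exact: admissibleZ.
    by apply: eq_bigr => i _; rewrite avgZ// mxE.
  set G := fun z : E * R => _.
  have AG : admissible G.
    have A0 y : admissible (h^~ y) by exact: fam_admissible.
    apply: admissibleD; first exact: admissibleD (A0 _) (admissibleZ _ (A0 _)).
    by apply: admissibleZ; apply: admissible_sum => i; exact: admissibleZ.
  have GB z : D z -> `|G z| <= m%:R * (m%:R * C) * `|d| ^+ 2.
    move=> Dz; rewrite /G !mulN1r; apply: (@taylor_bound _ _ (`|x| + 1)).
    - by move=> y; exact: fam_differentiable fh.
    - by move=> i y; apply: (fam_differentiable _ _ (fam_kbase_partial i fh)).
    - by move=> i j y yr; exact: H2.
    - by rewrite lerDl.
    - by rewrite (le_trans (ler_normD _ _))// lerD2l.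
  have := avg_le AG GB.
  by have -> : M * (m%:R * (m%:R * C)) * wtot * `|d| ^+ 2 =
    M * (m%:R * (m%:R * C) * `|d| ^+ 2) * wtot by ring.
by move=> dh pE; split => // i; rewrite pE mxE.
Qed.

End averages.

(** * The derivative of the means in the scale *)

Section scales.
Variables (R : realType) (n : nat) (a rho : R).
Hypotheses (a1 : -1 < a) (rho0 : 0 < rho).
Local Notation E := 'rV[R]_n.+1.
Notation I := (`[0%R, pi]%classic : set R).
Notation Omega := (half_ball rho : set E).
Implicit Types (lam : R) (L : seq (R * E)).

(* The jets of phi(lam s) and of -2 phi'(lam s), where phi = bump 0; the lam-derivative of
   lam^hdim * kl is -1/2 * lam^(hdim - 2) * radlap fl. *)
Definition fl lam (j : nat) (s : R) : R := lam ^+ j * bump j (lam * s).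

Definition kl lam (j : nat) (s : R) : R := - 2 * (lam ^+ j * bump j.+1 (lam * s)).

Let is_derive_bump (c x : R) j :
  is_derive x 1 (fun t : R => bump j (c * t)) (c * bump j.+1 (c * x)).
Proof.
have := is_deriveZ c (is_derive_id x (1 : R)).
rewrite [c *: (1 : R)](_ : _ = c); last by rewrite /GRing.scale/= mulr1.
move=> d; rewrite mulrC.
by apply: (is_derive_comp_line (f := fun t : R => c * t) d); exact: jet_bump.
Qed.

Lemma jet_fl lam : jet (fl lam).
Proof.
move=> j s; apply: (is_derive_eq (is_deriveZ (lam ^+ j) (is_derive_bump lam s j))).
by rewrite /fl /GRing.scale/= exprSr; ring.
Qed.

Lemma jet_kl lam : jet (kl lam).
Proof.
move=> j s.
apply: (is_derive_eq (is_deriveZ (- 2 : R) (is_deriveZ (lam ^+ j) (is_derive_bump lam s j.+1)))).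
by rewrite /kl /GRing.scale/= exprSr; ring.
Qed.

(** Half the homogeneous dimension n + 1 + a of the measure x_N^a dx: since lam is an inverse square
    length, lam^hdim compensates the volume of a ball of radius lam^(-1/2) centred on {x_N = 0}. *)
Definition hdim : R := (n%:R + 1 + a) / 2.

(** The last term is the one that the derivative of the factor lam^hdim in [Sw] cancels. Only the
    orders j = 0 and j = 1 occur in [Ff]. *)
Let dkl lam j s : R :=
  - (2^-1 * lam ^- 2) * radlap n a (fl lam) j s - hdim / lam * kl lam j s.

Let is_derive_kl0 lam s : lam != 0 -> is_derive lam 1 (fun l => kl l 0 s) (dkl lam 0 s).
Proof.
move=> l0.
rewrite (_ : (fun l => _) = - 2 \*: (fun t => bump 1 (s * t))); last first.
  by apply/funext => l; rewrite /kl expr0 mul1r (mulrC l).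
apply: (is_derive_eq (is_deriveZ (- 2 : R) (is_derive_bump s lam 1))).
rewrite /dkl /kl /radlap /fl /hdim /GRing.scale/= (mulrC s lam) !expr0 !expr1.
by field.
Qed.

Let is_derive_kl1 lam s : lam != 0 -> is_derive lam 1 (fun l => kl l 1 s) (dkl lam 1 s).
Proof.
move=> l0.
rewrite (_ : (fun l => _) = - 2 \*: (id * (fun t => bump 2 (s * t)))); last first.
  by apply/funext => l; rewrite /kl expr1 (mulrC l s).
apply: (is_derive_eq (is_deriveZ (- 2 : R)
  (is_deriveM (is_derive_id lam (1 : R)) (is_derive_bump s lam 2)))).
rewrite /dkl /kl /radlap /fl /hdim /GRing.scale/= (mulrC s lam) !expr1.
by field.
Qed.

Lemma is_derive_comb_kl lam L c x : lam != 0 ->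
  is_derive lam 1 (fun l => comb a (kl l) L c x)
  (- (2^-1 * lam ^- 2) * comb a (radlap n a (fl lam)) L c x -
   hdim / lam * comb a (kl lam) L c x).
Proof.
move=> l0.
have dF e (y : E) : is_derive lam 1 (fun l => Ff a (kl l) e x y)
    (- (2^-1 * lam ^- 2) * Ff a (radlap n a (fl lam)) e x y - hdim / lam * Ff a (kl lam) e x y).
  apply: (is_derive_eq (is_deriveB
    (is_deriveZ (a + 1) (is_derive_kl0 (qf e x y) l0))
    (is_deriveZ (2 * e * x 0 ord_max * y 0 ord_max) (is_derive_kl1 (qf e x y) l0)))).
  by rewrite /Ff /dkl /GRing.scale/=; ring.
elim: L => [|p L IH].
  rewrite /comb !big_nil; under eq_fun do rewrite big_nil.
  by rewrite !mulr0 subrr; exact: is_derive_cst.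
rewrite (_ : (fun l => _) = (fun l => p.1 * (Ff a (kl l) c x p.2 + Ff a (kl l) (- c) x p.2)) +
    (fun l => comb a (kl l) L c x)); last first.
  by apply/funext => l; rewrite /comb big_cons.
apply: (is_derive_eq (is_deriveD (is_deriveZ p.1 (is_deriveD (dF c p.2) (dF (- c) p.2))) IH)).
by rewrite /comb !big_cons /kf /GRing.scale/=; ring.
Qed.

Variables (w : E -> R) (M : R).
Hypotheses (mw : measurable_fun Omega w) (M0 : 0 <= M).
Hypothesis wM : forall x, Omega x -> `|w x| <= M * weight a x.

Definition Sw L lam : R := lam `^ hdim * mean a rho w (comb a (kl lam) L).

Let kbaseM (b1 b2 : E * R -> R) : kbase rho b1 -> kbase rho b2 ->
  kbase rho (fun z => b1 z * b2 z).
Proof.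
move=> [m1 [C1 H1]] [m2 [C2 H2]]; split; first exact: measurable_funM.
by exists (C1 * C2) => z Dz; rewrite normrM ler_pM// ?H1// H2.
Qed.

Lemma comb_admissible f L : jet f ->
  admissible rho (fun z : E * R => comb a f L (cos z.2) z.1).
Proof.
move=> jf; apply: admissible_sum => p; apply: admissibleZ.
apply: (@fam_admissible R n rho _ (fun z (y : E) => kf a f (cos z.2) z.1 y) p.2).
by apply: fam_kf => //; [exact: kbase_cst|exact: kbase_coord|exact: kbase_cos].
Qed.

Lemma is_derive_mean_kl L lam : lam != 0 ->
  is_derive lam 1 (fun l => mean a rho w (comb a (kl l) L))
  (- (2^-1 * lam ^- 2) * mean a rho w (comb a (radlap n a (fl lam)) L) -
   hdim / lam * mean a rho w (comb a (kl lam) L)).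
Proof.
(* The scale is encoded as the single coordinate of a row vector, so that [fam_avg_differentiable]
   differentiates under the integral in lam as well. *)
move=> l0; pose h (z : E * R) (Y : 'rV[R]_1) := comb a (kl (Y 0 0)) L (cos z.2) z.1.
have fh : fam (kbase rho) h.
  have kb (e : R) (y : E) : kbase rho (fun z : E * R => qf (e * cos z.2) z.1 y).
    have fq : fam (kbase rho) (fun (z : E * R) (y : E) => qf (e * cos z.2) z.1 y).
      by apply: fam_qf; [exact: kbase_cst|exact: kbase_coord|exact: kbase_cos].
    split; first by apply: (fam_measurable _ _ fq) => b [].
    by have [C _ HC] := kbase_fam_bounded `|y| fq; exists C => z Dz; exact: HC.
  have fkl (e : R) (y : E) j : fam (kbase rho)
      (fun (z : E * R) (Y : 'rV[R]_1) => kl (Y 0 0) j (qf (e * cos z.2) z.1 y)).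
    apply: fam_mul; first exact: (fam_cst _ (@kbase_cst R n rho)).
    apply: fam_mul; first by apply: (fam_exp (@kbase_cst R n rho)); exact: fam_coord.
    apply: (fam_comp (g := @bump R)); first exact: jet_bump.
    apply: fam_mul; first exact: fam_coord.
    exact: (@fam_base R _ 1 _ (fun z : E * R => qf (e * cos z.2) z.1 y)).
  have fF (e : R) (y : E) : fam (kbase rho)
      (fun (z : E * R) (Y : 'rV[R]_1) => Ff a (kl (Y 0 0)) (e * cos z.2) z.1 y).
    apply: (fam_sub (@kbase_cst R n rho)).
      by apply: fam_mul; [exact: (fam_cst _ (@kbase_cst R n rho))|exact: fkl].
    apply: fam_mul; last exact: fkl.
    apply: (@fam_base R _ 1 _ (fun z : E * R => 2 * (e * cos z.2) * z.1 0 ord_max * y 0 ord_max)).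
    apply: kbaseM; last exact: kbase_cst.
    apply: kbaseM; last exact: kbase_coord.
    by apply: kbaseM; [exact: kbase_cst|exact: kbase_cos].
  apply: (@fam_sum R _ 1 _ (@kbase_cst R n rho) _ L xpredT (fun p (z : E * R) (Y : 'rV[R]_1) =>
    p.1 * kf a (kl (Y 0 0)) (cos z.2) z.1 p.2)) => p.
  apply: fam_mul; first exact: (fam_cst _ (@kbase_cst R n rho)).
  rewrite (_ : (fun _ => _) = fun (z : E * R) (Y : 'rV[R]_1) =>
    Ff a (kl (Y 0 0)) (1 * cos z.2) z.1 p.2 + Ff a (kl (Y 0 0)) ((-1) * cos z.2) z.1 p.2).
    exact: fam_add.
  by apply/funext => z; apply/funext => Y; rewrite mul1r mulN1r.
pose e : 'rV[R]_1 := delta_mx 0 0.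
have eE (l : R) : ((0 + l *: e : 'rV[R]_1) 0 0) = l.
  by rewrite !mxE eqxx mulr1 add0r.
have [dh pE] := fam_avg_differentiable a1 rho0 mw wM (0 + lam *: e) fh.
have hE l : h^~ (0 + l *: e) = fun z => comb a (kl l) L (cos z.2) z.1.
  by apply/funext => z; rewrite /h eE.
have ME : (fun l => mean a rho w (comb a (kl l) L)) =
    (fun s : R => avg a rho w (h^~ (0 + s *: e))).
  by apply/funext => l; rewrite hE.
rewrite ME; apply: (is_derive_eq (is_derive_segment dh)).
rewrite big_ord1 [e 0 ord0]mxE eqxx mul1r pE.
have -> : (fun z => partial ord0 (h z) (0 + lam *: e)) = (fun z =>
   (- (2^-1 * lam ^- 2)) * comb a (radlap n a (fl lam)) L (cos z.2) z.1 +
   (- (hdim / lam)) * comb a (kl lam) L (cos z.2) z.1).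
  apply/funext => z.
  have := is_derive_segment (fam_differentiable z (0 + lam *: e) fh).
  rewrite big_ord1 [e 0 ord0]mxE eqxx mul1r.
  have -> : (fun s : R => h z (0 + s *: e)) = (fun l => comb a (kl l) L (cos z.2) z.1).
    by apply/funext => l; rewrite -[LHS]/((h^~ (0 + l *: e)) z) hE.
  have [_ e2] := is_derive_comb_kl L (cos z.2) z.1 l0.
  rewrite (mulNr (hdim / lam)) => -[_ e1]; exact: (etrans (esym e1) e2).
have A f : jet f -> admissible rho (fun z : E * R => comb a f L (cos z.2) z.1).
  exact: comb_admissible.
have Ak := A _ (jet_kl lam); have Ar := A _ (jet_radlap n a (jet_fl lam)).
rewrite (avgD a1 rho0 mw wM (admissibleZ _ Ar) (admissibleZ _ Ak)).
rewrite -(mulNr (hdim / lam)).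
exact: (f_equal2 +%R (avgZ a1 rho0 mw wM _ Ar) (avgZ a1 rho0 mw wM _ Ak)).
Qed.

(** After the cancellation of the terms with [hdim], only the mean of [radlap] survives, which is
    what [kernel_bound] estimates. *)
Lemma is_derive_Sw L lam : 0 < lam ->
  is_derive lam 1 (Sw L)
  (- (2^-1 * lam `^ (hdim - 2)) * mean a rho w (comb a (radlap n a (fl lam)) L)).
Proof.
move=> l0.
have d1 := is_derive_mean_kl L (lt0r_neq0 l0).
apply: (is_derive_eq (is_deriveM (is_derive1_powR hdim l0) d1)).
rewrite /GRing.scale/= (powR_pred hdim l0) (powR_pred (hdim - 1) l0).
have -> : hdim - 1 - 1 = hdim - 2 by ring.
by field; exact: lt0r_neq0.
Qed.

End scales.

(** * Powers of lam in the derivative of the means and in its differences *)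

Section scale_estimates.
Variables (R : realType) (n : nat).
Local Notation E := 'rV[R]_n.+1.

Definition phi (x : E) : R := bump 0 (dotp x x).

Let phi_elem : elem phi.
Proof.
apply: (elem_comp (g := @bump R)); first exact: jet_bump.
by have := @elem_dotp R n.+1 0; under eq_fun do rewrite !subr0.
Qed.

Lemma bump_le1 (x : R) : `|bump 0 x| <= 1.
Proof.
rewrite /bump expr0 mul1r; have /andP[h0 h1] := flat1_le1 (1 - x).
by rewrite /flat_jet/= ger0_norm.
Qed.

Let phi_out x : 1 <= `|x| -> phi x = 0.
Proof.
move=> x1; apply: bump_out; rewrite -enorm_sqr expr_ge1 ?enorm_ge0//.
exact: le_trans (norm_le_enorm x).
Qed.

Let phi_C2 : exists2 C, 0 <= C & [/\
  forall i (x : E), `|x| <= 5 -> `|partial i phi x| <= C &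
  forall i j (x : E), `|x| <= 5 -> `|partial j (partial i phi) x| <= C].
Proof.
have bd (f : E -> R) : elem f -> exists C, 0 <= C /\ forall x : E, `|x| <= 5 -> `|f x| <= C.
  move=> /elem_continuous/continuous_bounded_cube => /(_ 5)[C C0 HC].
  by exists C; split.
have /choice[C1 H1] i := bd _ (elem_partial i phi_elem).
have /choice[C2 H2] (p : 'I_n.+1 * 'I_n.+1) := bd _ (elem_partial p.2 (elem_partial p.1 phi_elem)).
exists (\sum_i C1 i + \sum_p C2 p).
  by rewrite addr_ge0// sumr_ge0// => i _; [have [] := H1 i|have [] := H2 i].
split=> [i x x5|i j x x5].
  rewrite (le_trans ((H1 i).2 x x5))// (bigD1 i)//= -addrA lerDl.
  by rewrite addr_ge0 ?sumr_ge0// => j _; [have [] := H1 j|have [] := H2 j].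
rewrite (le_trans ((H2 (i, j)).2 x x5))// (bigD1 (i, j) (F := C2))//= addrCA lerDl.
by rewrite addr_ge0 ?sumr_ge0// => p _; [have [] := H1 p|have [] := H2 p].
Qed.

(** If |X| <= 3, all points involved lie in the cube |x| <= 5, where the derivatives of [phi] are
    bounded; if |X| > 3, all values of [phi] vanish. K >= 1 lets the same constant serve increments
    longer than the scale. *)
Lemma phi_diff : exists2 K, 1 <= K & [/\
  forall X D : E, `|D| <= 1 -> `|phi (X + D) - phi X| <= K * `|D| &
  forall X D H : E, `|D| <= 1 -> `|H| <= 1 ->
    `|phi (X + H + D) - phi (X + H) - phi (X + D) + phi X| <= K * (`|H| * `|D|)].
Proof.
have [C C0 [H1 H2]] := phi_C2.
have df x : differentiable phi x by exact: elem_differentiable.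
have ddf i x : differentiable (partial i phi) x.
  by apply: elem_differentiable; exact: elem_partial.
have far (X D : E) (d : R) : d + 1 <= `|X| -> `|D| <= d -> phi (X + D) = 0.
  move=> X3 D1; apply: phi_out.
  have := ler_normD (X + D) (- D); rewrite addrK normrN => H.
  by rewrite -(lerD2r `|D|); apply: le_trans H; rewrite (le_trans _ X3)// addrC lerD2r.
set N : R := n.+1%:R.
have N0 : 0 <= N by exact: ler0n.
exists (1 + N * C + N * (N * C)).
  by rewrite -addrA lerDl addr_ge0 ?mulr_ge0.
have K0 : 0 <= 1 + N * C + N * (N * C) by rewrite !addr_ge0 ?mulr_ge0.
split=> [X D D1|X D H D1 HH1].
  have DX := ler_normD X D.
  have [X3|X3] := leP `|X| 3.
    apply: le_trans (lipschitz_bound df H1 _ _) _; [lra|lra|].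
    by rewrite ler_wpM2r// addrAC lerDr addr_ge0// !mulr_ge0.
  rewrite (far X D 1) ?phi_out//; [|lra|lra].
  by rewrite subrr normr0 mulr_ge0.
have DX := ler_normD X D; have HX := ler_normD X H.
have HDX := ler_normD (X + H) D; have HD := ler_normD H D.
have [X3|X3] := leP `|X| 3.
  apply: le_trans (second_difference_bound df ddf H2 _ _ _ _) _; [lra|lra|lra|lra|].
  have -> : n.+1%:R * (n.+1%:R * C * `|D|) * `|H| = N * (N * C) * (`|H| * `|D|) by rewrite /N; ring.
  by rewrite ler_wpM2r ?mulr_ge0// lerDr addr_ge0 ?mulr_ge0.
rewrite -(addrA X H D) (far X (H + D) 2); [|lra|lra].
rewrite (far X H 1) ?(far X D 1) ?phi_out//; [|lra|lra|lra].
by rewrite !subr0 addr0 normr0 !mulr_ge0.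
Qed.

Lemma phi_scale (lam : R) (x : E) : 0 <= lam ->
  bump 0 (lam * dotp x x) = phi (Num.sqrt lam *: x).
Proof. by move=> l0; rewrite /phi dotpZl dotpZr mulrA -expr2 sqr_sqrtr. Qed.

Variables (a rho rho' m : R).
Hypotheses (a1 : -1 < a) (rho0 : 0 < rho) (m0 : 0 <= m).
Hypotheses (rho'0 : 0 <= rho') (rho'rho : rho' < rho).
Notation Omega := (half_ball rho : set E).
Variables (w : E -> R) (M : R).
Hypotheses (mw : measurable_fun Omega w) (M0 : 0 <= M).
Hypothesis wM : forall x, Omega x -> `|w x| <= M * weight a x.
Hypothesis fw : subflux a rho m w.
Implicit Types (lam : R) (y d h : E).

Definition Sy lam y : R := Sw a rho w [:: (1, y)] lam.

Definition Ty lam y : R := - (2^-1 * lam `^ (hdim n a - 2)) *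
  mean a rho w (comb a (radlap n a (fl lam)) [:: (1, y)]).

Lemma is_derive_Sy lam y : 0 < lam -> is_derive lam 1 (Sy^~ y) (Ty lam y).
Proof. by move=> l0; exact: (is_derive_Sw a1 rho0 mw wM). Qed.

Lemma mean_comb f (L : seq (R * E)) : jet f ->
  mean a rho w (comb a f L) = \sum_(p <- L) p.1 * mean a rho w (comb a f [:: (1, p.2)]).
Proof.
move=> jf; have adm L' : admissible rho (fun z : E * R => comb a f L' (cos z.2) z.1).
  exact: comb_admissible.
transitivity (avg a rho w (fun z => \sum_(p <- L) p.1 * comb a f [:: (1, p.2)] (cos z.2) z.1)).
  congr (avg _ _ _ _); apply/funext => z; apply: eq_bigr => p _.
  by rewrite /comb big_seq1 mul1r.
rewrite (avg_sum a1 rho0 mw wM); last by move=> p; exact: admissibleZ.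
by apply: eq_bigr => p _; exact: (avgZ a1 rho0 mw wM).
Qed.

(** The centre lies in the closed half space and its kernel at scale lam is supported in the ball of
    radius rho'. *)
Definition ok lam y := 0 <= y 0 ord_max /\ enorm y + (Num.sqrt lam)^-1 <= rho'.

(** The constant of [kernel_bound] for s = 3 r, where 2 s = 6 r; its factor 2 cancels the 1/2 in
    [Ty]. *)
Variable C3 : R.
Hypothesis C3E : C3 = m * (a + 1) * 6 ^+ n * pi.

Let C30 : 0 <= C3.
Proof.
by rewrite C3E !mulr_ge0// ?exprn_ge0// ?pi_ge0// -lerBlDr sub0r ltW.
Qed.

(** With r = lam^(-1/2), the volume r^n of the trace times the prefactor lam^(hdim - 2) is lam^((a -
    3) / 2). What remains is the size Q of the combination of profiles on {x_N = 0}, where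
    cancellation between nearby centres is felt. *)
Lemma Ty_list lam (L : seq (R * E)) (Y : E) Q : 0 < lam -> 0 <= Q ->
  (forall p, p \in L -> ok lam p.2 /\ `|p.2 - Y| <= (Num.sqrt lam)^-1 *+ 2) ->
  (forall x : E, x 0 ord_max = 0 ->
    `|\sum_(p <- L) p.1 * phi (Num.sqrt lam *: (x - p.2))| <= Q) ->
  `|\sum_(p <- L) p.1 * Ty lam p.2| <= C3 * Q * lam `^ ((a - 3) / 2).
Proof.
move=> l0 Q0 HL HQ; set r := (Num.sqrt lam)^-1.
have sl0 : 0 < Num.sqrt lam by rewrite sqrtr_gt0.
have r0 : 0 < r by rewrite invr_gt0.
have r2 : r ^+ 2 = lam^-1 by rewrite /r exprVn sqr_sqrtr// ltW.
have fE x : \sum_(p <- L) p.1 * fl lam 0 (dotp (x - p.2) (x - p.2)) =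
    \sum_(p <- L) p.1 * phi (Num.sqrt lam *: (x - p.2)).
  by apply: eq_bigr => p _; rewrite /fl expr0 mul1r phi_scale// ltW.
have H := @kernel_bound R n a rho m a1 rho0 m0 w M mw wM fw (fl lam) L r (r *+ 3) Q
  rho' (\row_i Y 0 (lift ord_max i)) (jet_fl lam) (ltW r0) _ Q0 rho'0 rho'rho.
have {H}H : `|mean a rho w (comb a (radlap n a (fl lam)) L)| <=
    m * (2 * (a + 1) * Q * (r *+ 3 *+ 2) ^+ n) * pi.
  apply: H.
  - by rewrite mulrn_wge0// ltW.
  - move=> j t; rewrite r2 => lt1; rewrite /fl bump_out ?mulr0//.
    by rewrite -ler_pdivrMl// mulr1.
  - by move=> p /HL[[]].
  - by move=> x x0; rewrite fE; exact: HQ.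
  (* A point more than 3 r away from Y in one coordinate is more than r away from every centre. *)
  - move=> x i x0 xi; rewrite fE big_seq big1// => p pL.
    have [_ pY] := HL p pL.
    rewrite -phi_scale ?ltW// bump_out ?mulr0//.
    rewrite -ler_pdivrMl// mulr1 -r2 -enorm_sqr ler_sqr ?nnegrE ?enorm_ge0 ?(ltW r0)//.
    apply: le_trans (norm_le_enorm _); apply: le_trans (coord_le_norm _ (lift ord_max i)).
    have := le_trans (coord_le_norm _ (lift ord_max i)) pY.
    move: xi; rewrite !mxE => xi pi.
    have := ler_normD (x 0 (lift ord_max i) - p.2 0 (lift ord_max i))
      (p.2 0 (lift ord_max i) - Y 0 (lift ord_max i)).
    rewrite addrA subrK => T; move: (lt_le_trans xi T) pi; rewrite -/r.
    by rewrite -!(mulr_natr r); lra.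
have -> : \sum_(p <- L) p.1 * Ty lam p.2 = - (2^-1 * lam `^ (hdim n a - 2)) *
    mean a rho w (comb a (radlap n a (fl lam)) L).
  rewrite (mean_comb _ (jet_radlap n a (jet_fl lam))) big_distrr/=.
  by apply: eq_bigr => p _; rewrite /Ty mulrCA.
have cg : 0 <= 2^-1 * lam `^ (hdim n a - 2) by rewrite mulr_ge0 ?powR_ge0.
rewrite normrM normrN (ger0_norm cg); apply: (le_trans (ler_wpM2l cg H)).
have rn : r ^+ n * lam `^ (hdim n a - 2) = lam `^ ((a - 3) / 2).
  have -> : r = lam `^ (- 2^-1).
    by rewrite powRN powR12_sqrt// ltW.
  rewrite -powR_mulrn ?powR_ge0// -powRrM -powRD; last by rewrite (gt_eqF l0) ?implybT.
  by congr (_ `^ _); rewrite /hdim; field.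
rewrite -mulrnA -[r *+ _]mulr_natl exprMn -rn C3E.
have -> : 2^-1 * lam `^ (hdim n a - 2) *
  (m * (2 * (a + 1) * Q * ((3 * 2)%:R ^+ n * r ^+ n)) * pi) =
  m * (a + 1) * (3 * 2)%:R ^+ n * pi * Q * (r ^+ n * lam `^ (hdim n a - 2)) by field.
by [].
Qed.

Lemma Ty_le lam y : 0 < lam -> ok lam y -> `|Ty lam y| <= C3 * lam `^ ((a - 3) / 2).
Proof.
move=> l0 oky; have sl0 : 0 < (Num.sqrt lam)^-1 by rewrite invr_gt0 sqrtr_gt0.
have := @Ty_list lam [:: (1, y)] y 1 l0 ler01.
rewrite big_seq1 mul1r mulr1; apply.
  by move=> p; rewrite inE => /eqP ->; rewrite subrr normr0 mulrn_wge0// ltW.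
by move=> x _; rewrite big_seq1 mul1r; exact: bump_le1.
Qed.

(** A centre at height at least lam^(-1/2) has a profile that vanishes on {x_N = 0}, so Q = 0. *)
Lemma Ty_eq0 lam y : 0 < lam -> ok lam y -> 1 <= lam * y 0 ord_max ^+ 2 -> Ty lam y = 0.
Proof.
move=> l0 oky ly; have sl0 : 0 < (Num.sqrt lam)^-1 by rewrite invr_gt0 sqrtr_gt0.
have := @Ty_list lam [:: (1, y)] y 0 l0 (lexx _).
rewrite big_seq1 mul1r mulr0 mul0r normr_le0 => H; apply/eqP; apply: H.
  by move=> p; rewrite inE => /eqP ->; rewrite subrr normr0 mulrn_wge0// ltW.
move=> x x0; rewrite big_seq1 mul1r -phi_scale ?(ltW l0)// bump_out ?normr0//.
apply: (le_trans ly); rewrite ler_wpM2l ?(ltW l0)// -enorm_sqr.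
rewrite -(real_normK (num_real (y 0 ord_max))) ler_sqr ?nnegrE ?enorm_ge0//.
by have := coord_le_enorm (x - y) ord_max; rewrite !mxE x0 sub0r normrN.
Qed.

Variable K : R.
Hypothesis K1 : 1 <= K.
Hypothesis phi1 : forall X D : E, `|D| <= 1 -> `|phi (X + D) - phi X| <= K * `|D|.
Hypothesis phi2 : forall X D H : E, `|D| <= 1 -> `|H| <= 1 ->
    `|phi (X + H + D) - phi (X + H) - phi (X + D) + phi X| <= K * (`|H| * `|D|).

Let half_pow lam : 0 < lam -> forall p, Num.sqrt lam * lam `^ p = lam `^ (p + 2^-1).
Proof.
move=> l0 p; rewrite -powR12_sqrt ?ltW// -powRD; last by rewrite (gt_eqF l0) ?implybT.
by rewrite addrC.
Qed.

Let scaled lam d : 0 < lam -> `|d| <= (Num.sqrt lam)^-1 -> `|Num.sqrt lam *: - d| <= 1.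
Proof.
move=> l0 dl; rewrite normrZ normrN ger0_norm ?sqrtr_ge0//.
by rewrite -ler_pdivlMl ?sqrtr_gt0// mulr1.
Qed.

Let normsc lam d : `|Num.sqrt lam *: - d| = Num.sqrt lam * `|d|.
Proof. by rewrite normrZ normrN ger0_norm ?sqrtr_ge0. Qed.

(** For |d| <= lam^(-1/2) the profiles differ by at most K lam^(1/2) |d|. For larger d this factor
    is at least 1 and the two terms are bounded separately. *)
Lemma Ty_diff lam y d : 0 < lam -> ok lam y -> ok lam (y + d) ->
  `|Ty lam (y + d) - Ty lam y| <= 2 * C3 * K * `|d| * lam `^ ((a - 2) / 2).
Proof.
move=> l0 oky okyd; have sl0 : 0 < Num.sqrt lam by rewrite sqrtr_gt0.
have K0 : 0 <= K by exact: le_trans ler01 K1.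
have E1 : Num.sqrt lam * lam `^ ((a - 3) / 2) = lam `^ ((a - 2) / 2).
  by rewrite half_pow//; congr (_ `^ _); field.
have p0 : 0 <= lam `^ ((a - 3) / 2) by exact: powR_ge0.
rewrite -E1; have [dl|/ltW dl] := leP `|d| (Num.sqrt lam)^-1.
  have := @Ty_list lam [:: (1, y + d); (-1, y)] y (K * (Num.sqrt lam * `|d|)) l0.
  rewrite big_cons big_seq1 mul1r mulN1r => H.
  apply: le_trans (H _ _ _) _.
  - by rewrite !mulr_ge0// ltW.
  - move=> p; rewrite !inE => /orP[/eqP ->|/eqP ->] /=; split => //.
      by rewrite addrAC subrr add0r (le_trans dl)// mulr2n lerDl invr_ge0 ltW.
    by rewrite subrr normr0 mulrn_wge0// invr_ge0 ltW.
  - move=> x _; rewrite big_cons big_seq1 mul1r mulN1r.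
    have := phi1 (Num.sqrt lam *: (x - y)) (scaled l0 dl).
    by rewrite normsc -scalerDr opprD addrA.
  have -> : C3 * (K * (Num.sqrt lam * `|d|)) * lam `^ ((a - 3) / 2) =
    C3 * K * `|d| * (Num.sqrt lam * lam `^ ((a - 3) / 2)) by ring.
  rewrite -!(mulrA 2) ler_peMl ?ler1n//.
  by rewrite !mulr_ge0// ltW.
apply: (le_trans (ler_normB _ _)).
apply: (le_trans (lerD (Ty_le l0 okyd) (Ty_le l0 oky))).
have d1 : 1 <= Num.sqrt lam * `|d| by rewrite -ler_pdivrMl// mulr1.
have -> : 2 * C3 * K * `|d| * (Num.sqrt lam * lam `^ ((a - 3) / 2)) =
  2 * C3 * lam `^ ((a - 3) / 2) * (K * (Num.sqrt lam * `|d|)) by ring.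
have -> : C3 * lam `^ ((a - 3) / 2) + C3 * lam `^ ((a - 3) / 2) =
  2 * C3 * lam `^ ((a - 3) / 2) by ring.
by rewrite ler_peMr ?mulr_ge0// -[leLHS]mulr1 ler_pM.
Qed.

(** A difference of two increments in the direction h, each bounded on its own. It gains nothing
    from d and serves at the scales lam >= |d|^-2. *)
Lemma Ty_diff2 lam y d h : 0 < lam -> ok lam y -> ok lam (y + d) -> ok lam (y + h) ->
  ok lam (y + h + d) ->
  `|Ty lam (y + h + d) - Ty lam (y + h) - Ty lam (y + d) + Ty lam y| <=
    4 * C3 * K * `|h| * lam `^ ((a - 2) / 2).
Proof.
move=> l0 oky okyd okyh okyhd.
rewrite (_ : _ + _ = (Ty lam (y + d + h) - Ty lam (y + d)) - (Ty lam (y + h) - Ty lam y)); last first.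
  by rewrite (addrAC y d h); ring.
apply: (le_trans (ler_normB _ _)).
have H1 := Ty_diff l0 oky okyh; have := @Ty_diff lam (y + d) h l0 okyd.
rewrite (addrAC y d h) => /(_ okyhd) H2; apply: (le_trans (lerD H2 H1)).
by rewrite le_eqVlt; apply/orP; left; apply/eqP; ring.
Qed.

(** If both increments are shorter than lam^(-1/2), the four profiles cancel to second order; if one
    of them is longer, the gain from the other one suffices. *)
Lemma Ty_diff3 lam y d h : 0 < lam -> ok lam y -> ok lam (y + d) -> ok lam (y + h) ->
  ok lam (y + h + d) ->
  `|Ty lam (y + h + d) - Ty lam (y + h) - Ty lam (y + d) + Ty lam y| <=
    4 * C3 * K * (`|h| * `|d|) * lam `^ ((a - 1) / 2).
Proof.
move=> l0 oky okyd okyh okyhd.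
have sl0 : 0 < Num.sqrt lam by rewrite sqrtr_gt0.
have K0 : 0 <= K by exact: le_trans ler01 K1.
have E1 : Num.sqrt lam * lam `^ ((a - 2) / 2) = lam `^ ((a - 1) / 2).
  by rewrite half_pow//; congr (_ `^ _); field.
have E2 : Num.sqrt lam * lam `^ ((a - 3) / 2) = lam `^ ((a - 2) / 2).
  by rewrite half_pow//; congr (_ `^ _); field.
have p0 : 0 <= lam `^ ((a - 2) / 2) by exact: powR_ge0.
have [dl|/ltW dl] := leP `|d| (Num.sqrt lam)^-1; last first.
  apply: (le_trans (Ty_diff2 l0 oky okyd okyh okyhd)); rewrite -E1.
  have d1 : 1 <= Num.sqrt lam * `|d| by rewrite -ler_pdivrMl// mulr1.
  have -> : 4 * C3 * K * (`|h| * `|d|) * (Num.sqrt lam * lam `^ ((a - 2) / 2)) =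
    4 * C3 * K * `|h| * lam `^ ((a - 2) / 2) * (Num.sqrt lam * `|d|) by ring.
  by rewrite ler_peMr// !mulr_ge0 ?ler0n.
have [hl|/ltW hl] := leP `|h| (Num.sqrt lam)^-1; last first.
  have := @Ty_diff2 lam y h d l0 oky okyh okyd; rewrite (addrAC y d h) => /(_ okyhd) H.
  rewrite (_ : _ + _ = Ty lam (y + h + d) - Ty lam (y + d) - Ty lam (y + h) + Ty lam y); last by ring.
  apply: (le_trans H); rewrite -E1.
  have d1 : 1 <= Num.sqrt lam * `|h| by rewrite -ler_pdivrMl// mulr1.
  have -> : 4 * C3 * K * (`|h| * `|d|) * (Num.sqrt lam * lam `^ ((a - 2) / 2)) =
    4 * C3 * K * `|d| * lam `^ ((a - 2) / 2) * (Num.sqrt lam * `|h|) by ring.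
  by rewrite ler_peMr// !mulr_ge0 ?ler0n.
have := @Ty_list lam [:: (1, y + h + d); (-1, y + h); (-1, y + d); (1, y)] y
  (K * ((Num.sqrt lam * `|h|) * (Num.sqrt lam * `|d|))) l0.
rewrite !big_cons big_nil !mul1r !mulN1r addr0 !addrA => H.
apply: le_trans (H _ _ _) _.
- by rewrite !mulr_ge0// ltW.
- move=> p; rewrite !inE => /or4P[] /eqP -> /=; split => //.
  + rewrite -(addrA y) addrAC subrr add0r mulr2n (le_trans (ler_normD _ _))//.
    exact: lerD.
  + by rewrite addrAC subrr add0r (le_trans hl)// mulr2n lerDl invr_ge0 ltW.
  + by rewrite addrAC subrr add0r (le_trans dl)// mulr2n lerDl invr_ge0 ltW.
  + by rewrite subrr normr0 mulrn_wge0// invr_ge0 ltW.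
- move=> x _; rewrite !big_cons big_nil !mul1r !mulN1r addr0 !addrA.
  have := phi2 (Num.sqrt lam *: (x - y)) (scaled l0 dl) (scaled l0 hl).
  by rewrite !normsc -!scalerDr !opprD !addrA.
rewrite -E1 -E2.
have -> : C3 * (K * (Num.sqrt lam * `|h| * (Num.sqrt lam * `|d|))) * lam `^ ((a - 3) / 2) =
  C3 * K * (`|h| * `|d|) * (Num.sqrt lam * (Num.sqrt lam * lam `^ ((a - 3) / 2))) by ring.
rewrite -!(mulrA 4) ler_peMl ?ler1n//.
by rewrite !mulr_ge0 ?powR_ge0// ltW.
Qed.

End scale_estimates.

(** * Integration over the scales *)

Section integrated_estimates.
Variable R : realType.
Implicit Types (f df : R -> R) (K q al be : R).

Lemma powR_growth f df K q al be : 0 < al -> al <= be -> q != 0 ->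
  (forall t : R, al <= t <= be -> is_derive t 1 f (df t)) ->
  (forall t, al <= t <= be -> `|df t| <= K * t `^ (q - 1)) ->
  `|f be - f al| <= K * ((be `^ q - al `^ q) / q).
Proof.
move=> al0 albe q0 Df H.
have := @derive_le R f df (fun t => K / q * t `^ q) (fun t => K * t `^ (q - 1)) al be albe Df.
have -> : K * ((be `^ q - al `^ q) / q) = K / q * be `^ q - K / q * al `^ q by field.
apply=> // t /andP[alt tbe]; have t0 : 0 < t := lt_le_trans al0 alt.
apply: (is_derive_eq (is_deriveZ (K / q) (is_derive1_powR q t0))).
by rewrite /GRing.scale/=; field.
Qed.

Lemma powR_decay f df K q al be : 0 <= K -> 0 < al -> al <= be -> q < 0 ->
  (forall t : R, al <= t <= be -> is_derive t 1 f (df t)) ->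
  (forall t, al <= t <= be -> `|df t| <= K * t `^ (q - 1)) ->
  `|f be - f al| <= K * (al `^ q / - q).
Proof.
move=> K0 al0 albe q0 Df H.
apply: (le_trans (powR_growth al0 albe (ltr0_neq0 q0) Df H)).
rewrite ler_wpM2l// invrN mulrN -mulNr ler_wnM2r ?invr_le0 ?(ltW q0)//.
by rewrite lerBrDr addNr powR_ge0.
Qed.

(** The two bounds on df coincide at b = dl^-2. Below b the first one integrates to K dl b^q / q,
    above b the second one to K b^(q - 1/2) / (1/2 - q), and both powers equal dl^(1 - 2 q). The
    condition dl <= 1/2 makes b >= 4. *)
Lemma two_regimes f df K q dl be : 0 <= K -> 0 < q -> q < 2^-1 -> 0 < dl -> dl <= 2^-1 ->
  4 <= be ->
  (forall t : R, 4 <= t -> is_derive t 1 f (df t)) ->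
  (forall t, 4 <= t -> `|df t| <= K * dl * t `^ (q - 1)) ->
  (forall t, 4 <= t -> `|df t| <= K * t `^ (q - 2^-1 - 1)) ->
  `|f be - f 4| <= K * (q^-1 + (2^-1 - q)^-1) * dl `^ (1 - 2 * q).
Proof.
move=> K0 q0 q2 d0 d2 be4 Df H1 H2.
have p0 : 0 < 2^-1 - q by rewrite subr_gt0.
have q'0 : q - 2^-1 < 0 by rewrite subr_lt0.
pose b := dl ^- 2.
have b0 : 0 < b by rewrite invr_gt0 exprn_gt0.
have b4 : 4 <= b.
  rewrite -[4]invrK lef_pV2 ?posrE ?exprn_gt0 ?invr_gt0//.
  have -> : 4^-1 = 2^-1 ^+ 2 :> R by field.
  by rewrite ler_sqr ?nnegrE ?invr_ge0// ltW.
have bp p : b `^ p = dl `^ (- (2 * p)).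
  rewrite /b -powR_invn ?(ltW d0)// -powRrM; congr (_ `^ _); ring.
have bq : dl * b `^ q = dl `^ (1 - 2 * q).
  by rewrite bp powRD ?powRr1 ?(ltW d0)//; rewrite (gt_eqF d0) implybT.
have bq' : b `^ (q - 2^-1) = dl `^ (1 - 2 * q).
  by rewrite bp; congr (_ `^ _); field.
have lo be' : 4 <= be' -> be' <= b ->
    `|f be' - f 4| <= K * q^-1 * dl `^ (1 - 2 * q).
  move=> b'4 b'b.
  have D t : 4 <= t <= be' -> is_derive t 1 f (df t) by move=> /andP[t4 _]; exact: Df.
  have B t : 4 <= t <= be' -> `|df t| <= K * dl * t `^ (q - 1).
    by move=> /andP[t4 _]; exact: H1.
  apply: (le_trans (powR_growth _ b'4 (lt0r_neq0 q0) D B)) => //.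
  rewrite -bq -!mulrA ler_wpM2l// (mulrCA q^-1) ler_wpM2l ?(ltW d0)// mulrC.
  rewrite ler_wpM2l ?invr_ge0 ?(ltW q0)// lerBlDr.
  rewrite (@le_trans _ _ (b `^ q))// ?lerDl ?powR_ge0//.
  by rewrite ge0_ler_powR ?nnegrE ?(ltW q0) ?(ltW b0)// (le_trans _ b'4).
rewrite mulrDr mulrDl.
have [beb|/ltW bbe] := leP be b.
  apply: (le_trans (lo be be4 beb)).
  by rewrite lerDl !mulr_ge0 ?powR_ge0 ?invr_ge0 ?(ltW p0).
have -> : f be - f 4 = (f b - f 4) + (f be - f b) by ring.
apply: (le_trans (ler_normD _ _)); apply: lerD; first exact: lo.
have D t : b <= t <= be -> is_derive t 1 f (df t).
  by move=> /andP[tb _]; apply: Df; exact: le_trans tb.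
have B t : b <= t <= be -> `|df t| <= K * t `^ (q - 2^-1 - 1).
  by move=> /andP[tb _]; apply: H2; exact: le_trans tb.
apply: (le_trans (powR_decay K0 b0 bbe q'0 D B)).
by rewrite bq' opprB -!mulrA (mulrC (dl `^ _)).
Qed.

End integrated_estimates.

Section fixed_scale.
Variables (R : realType) (n : nat) (a rho : R).
Hypotheses (a1 : -1 < a) (rho0 : 0 < rho).
Local Notation E := 'rV[R]_n.+1.
Notation Omega := (half_ball rho : set E).

Lemma avg_C2 (h : E * R -> E -> R) (r : R) : fam (kbase rho) h ->
  exists2 C, 0 <= C & forall (w : E -> R) M, measurable_fun Omega w -> 0 <= M ->
  (forall x, Omega x -> `|w x| <= M * weight a x) ->
  let G := fun y => avg a rho w (h^~ y) in
  [/\ forall y, differentiable G y, forall i y, differentiable (partial i G) y,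
      forall y, `|y| <= r -> `|G y| <= M * C,
      forall i y, `|y| <= r -> `|partial i G y| <= M * C &
      forall i j y, `|y| <= r -> `|partial j (partial i G) y| <= M * C].
Proof.
move=> fh; have [C C0 [H0 H1 H2]] := kbase_fam_C2 r fh.
exists (C * wtot n a rho); first by rewrite mulr_ge0// wtot_ge0.
move=> w M mw M0 wM G.
have dG y := fam_avg_differentiable a1 rho0 mw wM y fh.
have f1 i := fam_kbase_partial i fh.
have f2 i j := fam_kbase_partial j (f1 i).
have pG i : partial i G = fun y => avg a rho w (fun z => partial i (h z) y).
  by apply/funext => y; exact: (dG y).2.
have dpG i y := fam_avg_differentiable a1 rho0 mw wM y (f1 i).
have ppG i j : partial j (partial i G) =
    fun y => avg a rho w (fun z => partial j (partial i (h z)) y).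
  by rewrite pG; apply/funext => y; exact: (dpG i y).2.
split.
- by move=> y; exact: (dG y).1.
- by move=> i y; rewrite pG; exact: (dpG i y).1.
- move=> y yr; rewrite mulrA; apply: (avg_le a1 rho0 mw wM).
    exact: (fam_admissible y fh).
  by move=> z Dz; exact: H0.
- move=> i y yr; rewrite pG mulrA; apply: (avg_le a1 rho0 mw wM).
    exact: (fam_admissible y (f1 i)).
  by move=> z Dz; exact: H1.
- move=> i j y yr; rewrite ppG mulrA; apply: (avg_le a1 rho0 mw wM).
    exact: (fam_admissible y (f2 i j)).
  by move=> z Dz; exact: H2.
Qed.

(** The starting value of the integration over scales. C is chosen before w and enters linearly with
    M, so the estimates are uniform in u. *)
Lemma Sy_C2 (lam r : R) :
  exists2 C, 0 <= C & forall (w : E -> R) M, measurable_fun Omega w -> 0 <= M ->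
  (forall x, Omega x -> `|w x| <= M * weight a x) ->
  let G := Sy a rho w lam in
  [/\ forall y, differentiable G y, forall i y, differentiable (partial i G) y,
      forall y, `|y| <= r -> `|G y| <= M * C,
      forall i y, `|y| <= r -> `|partial i G y| <= M * C &
      forall i j y, `|y| <= r -> `|partial j (partial i G) y| <= M * C].
Proof.
pose h (z : E * R) (y : E) := lam `^ (hdim n a) * kf a (kl lam) (cos z.2) z.1 y.
have fk : fam (kbase rho) (fun (z : E * R) (y : E) => kf a (kl lam) (cos z.2) z.1 y).
  by apply: fam_kf; [exact: kbase_cst|exact: kbase_coord|exact: kbase_cos|exact: jet_kl].
have fh : fam (kbase rho) h.
  by apply: fam_mul; [exact: (fam_cst _ (@kbase_cst R n rho))|exact: fk].
have [C C0 HC] := avg_C2 r fh; exists C; first exact: C0.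
move=> w M mw M0 wM G.
have -> : G = fun y => avg a rho w (h^~ y).
  apply/funext => y; rewrite /h (avgZ a1 rho0 mw wM _ (fam_admissible y fk)).
  rewrite /G /Sy /Sw; congr (_ * avg _ _ _ _).
  by apply/funext => z; rewrite /comb big_seq1 mul1r.
exact: (HC w M mw M0 wM).
Qed.

End fixed_scale.

(** * The means determine u almost everywhere *)

Section mass.
Variables (R : realType) (n : nat) (a : R).
Hypothesis a1 : -1 < a.
Local Notation E := 'rV[R]_n.+1.
Notation mu := (@lebesgue_measure R).
Notation I := (`[0%R, pi]%classic : set R).
Notation P := (leb n.+1 \x mu)%E.
Notation Omega rho := (half_ball rho : set E).
Implicit Types (rho lam : R) (y : E).

Let mO rho : measurable (Omega rho) := @measurable_half_ball R n rho.
Let mI : measurable I. Proof. exact: measurable_itv. Qed.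
Let I_fin : (mu I < +oo)%E.
Proof. by rewrite lebesgue_measure_itv/= lte_fin pi_gt0 -EFinD ltry. Qed.
Let muI : fine (mu I) = pi.
Proof. by rewrite lebesgue_measure_itv/= lte_fin pi_gt0 -EFinD/= subr0. Qed.

Lemma enormZ (s : R) (x : E) : 0 <= s -> enorm (s *: x) = s * enorm x.
Proof.
move=> s0; rewrite /enorm dotpZl dotpZr mulrA -expr2 sqrtrM ?sqr_ge0//.
by rewrite sqrtr_sqr ger0_norm.
Qed.

Lemma half_ball_sub rho1 rho2 : rho1 <= rho2 -> Omega rho1 `<=` Omega rho2.
Proof. by move=> r12 x [/= xr x0]; split => //=; exact: lt_le_trans r12. Qed.

Let Rintegral0 (A : set E) : \int[leb n.+1]_(x in A) (0 : R) = 0.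
Proof. by rewrite /Rintegral integral0. Qed.

Lemma weak_gradient_cst rho : 0 < rho -> weak_gradient (Omega rho) (fun=> 1) (fun=> 0).
Proof.
move=> rho0 phi [sphi cphi phiO] i.
under [in RHS]eq_Rintegral do rewrite mxE mul0r.
rewrite Rintegral0 oppr0; under eq_Rintegral do rewrite mul1r.
have out x : ~ Omega rho x -> partial i phi x = 0.
  by move=> nO; apply: partial_out => /phiO.
have outr (x : E) : rho <= `|x| -> ~ Omega rho x.
  move=> xr [/= H _]; move: (le_lt_trans (le_trans xr (norm_le_enorm x)) H).
  by rewrite ltxx.
rewrite /Rintegral integral_mkcond.
have -> : ((fun x => (partial i phi x)%:E) \_ (Omega rho) = fun x => (partial i phi x)%:E)%E.
  by apply/funext => x; rewrite patchE; case: ifPn => //; rewrite notin_setE => /out ->.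
rewrite (@integral_partial R n.+1 i phi rho)//.
- by move=> x; have [_] := sphi [::]; exact.
- by have [] := sphi [:: i].
- by move=> x /outr nO; apply: supp_out => /phiO.
- by move=> x /ltW/outr; exact: out.
Qed.

(** The function 1 has weak gradient 0, so [weak_form] gives an integral equal to 0. *)
Lemma subflux_weight rho : 0 < rho -> subflux a rho 0 (weight a : E -> R).
Proof.
move=> rho0 psi epsi cpsi spsi psi0; rewrite mul0r.
have := @weak_form R n a rho 1 (fun=> 1) (fun=> 0) a1 rho0 _ _ _ (weak_gradient_cst rho0)
  psi epsi cpsi spsi psi0.
under [in LHS]eq_Rintegral do rewrite mul1r.
move=> ->.
- rewrite (_ : energy a _ _ psi = 0) ?oppr0 ?normr0// -[RHS](Rintegral0 (Omega rho)).
  apply: eq_Rintegral => x _; rewrite /dotp big1 ?mul0r// => i _.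
  by rewrite mxE mul0r.
- exact: measurable_cst.
- by move=> x _; rewrite normr1.
- move=> i; split; first by under eq_fun do rewrite mxE; exact: measurable_cst.
  under eq_integral do rewrite mxE expr0n/= mul0r.
  by rewrite integral0 ltry.
Qed.

Let mw rho : measurable_fun (Omega rho) (weight a : E -> R).
Proof. by apply: measurable_funTS; exact: measurable_weight. Qed.

Let wM rho (x : E) : Omega rho x -> `|weight a x| <= 1 * weight a x.
Proof. by move=> _; rewrite mul1r ger0_norm// powR_ge0. Qed.

Lemma comb_out f lam rho (c : R) x y : (forall j s, lam^-1 <= s -> f j s = 0) -> 0 < lam ->
  -1 <= c <= 1 -> 0 <= y 0 ord_max -> enorm y + (Num.sqrt lam)^-1 <= enorm x ->
  comb a f [:: (1, y)] c x = 0.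
Proof.
move=> f0 l0 c1 y0 xy; rewrite /comb big_seq1 mul1r.
apply: (@kf_out R n a f (Num.sqrt lam)^-1) => //.
by rewrite exprVn sqr_sqrtr// ltW.
Qed.

Lemma kl_out lam j (s : R) : 0 < lam -> lam^-1 <= s -> kl lam j s = 0.
Proof.
move=> l0 s1; rewrite /kl bump_out ?mulr0//.
by rewrite -ler_pdivrMl// mulr1.
Qed.

Lemma Sy_rho (w : E -> R) lam rho1 rho2 y : measurable_fun (Omega rho2) w ->
  0 < lam -> rho1 <= rho2 -> 0 <= y 0 ord_max ->
  enorm y + (Num.sqrt lam)^-1 <= rho1 -> Sy a rho1 w lam y = Sy a rho2 w lam y.
Proof.
move=> mw2 l0 r12 y0 yr; rewrite /Sy /Sw; congr (_ * _).
rewrite /mean /Rintegral; congr fine.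
rewrite [LHS]integral_mkcond [RHS]integral_mkcond; apply: eq_integral => z _.
rewrite !patchE; case: ifPn => [|z1]; case: ifPn => [|z2] //.
- move=> z1.
  exfalso.
  move/negP: z2; apply.
  move: z1; rewrite !inE.
  case=> zO zI.
  by split => //; exact: half_ball_sub zO.
- rewrite inE => -[zO zI]; rewrite (@comb_out _ lam rho1) ?mulr0//.
  + by move=> j s; exact: kl_out.
  + by rewrite cos_geN1 cos_le1.
  + rewrite (le_trans yr)// leNgt; apply/negP => zr; move/negP: z1; apply; rewrite inE; split => //.
    by split => //=; case: zO.
Qed.

(** With m = 0 the flux bound says that the lam-derivative vanishes. *)
Lemma mass_scale rho lam1 lam2 y : 0 < lam1 -> lam1 <= lam2 -> 0 <= y 0 ord_max ->
  enorm y + (Num.sqrt lam1)^-1 < rho ->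
  Sy a rho (weight a) lam1 y = Sy a rho (weight a) lam2 y.
Proof.
move=> l1 l12 y0 yr; set rho' := enorm y + (Num.sqrt lam1)^-1 in yr.
have rho'0 : 0 <= rho' by rewrite addr_ge0 ?enorm_ge0 ?invr_ge0 ?sqrtr_ge0.
have rho0 : 0 < rho := le_lt_trans rho'0 yr.
apply/esym/eqP; rewrite -subr_eq0 -normr_le0.
have D t : lam1 <= t <= lam2 ->
    is_derive t 1 ((Sy a rho (weight a))^~ y) (Ty a rho (weight a) t y).
  move=> /andP[t1 _].
  by apply: (is_derive_Sy a1 rho0 (@mw rho) (@wM rho)); exact: lt_le_trans t1.
have B t : lam1 <= t <= lam2 -> `|Ty a rho (weight a) t y| <= 0.
  move=> /andP[t1 _]; have t0 : 0 < t := lt_le_trans l1 t1.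
  have := @Ty_le R n a rho rho' 0 a1 rho0 (lexx _) rho'0 yr (weight a) 1 (@mw rho)
    (@wM rho) (subflux_weight rho0) 0 _ t y t0.
  rewrite !mul0r; apply => //; split => //.
  by rewrite lerD2l lef_pV2 ?posrE ?sqrtr_gt0// ler_wsqrtr.
rewrite -[leRHS](subrr (0 : R)).
exact: (derive_le l12 D (fun t _ => is_derive_cst (0 : R) t (1 : R)) B).
Qed.

Lemma wtot_le rho : 0 < rho ->
  wtot n a rho <= (rho *+ 2) ^+ n * (rho `^ (a + 1) / (a + 1)) * pi.
Proof.
move=> rho0; rewrite /wtot.
rewrite (@Rintegral_rectangle1 _ _ _ _ R (leb n.+1) mu (Omega rho) I _ (weight a) (mO rho) mI I_fin)//.
- under eq_Rintegral do rewrite /= Rintegral_cst// muI mulrC.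
  rewrite RintegralZl//; last exact: integrable_weight.
  rewrite mulrC ler_wpM2r ?pi_ge0// /Rintegral -lee_fin fineK.
    exact: weight_integral_le.
  by apply: integrable_fin_num => //; exact: integrable_weight.
- exact: measurable_weight_rectangle.
- exact: integrable_weight.
- by move=> x y _ _; rewrite ger0_norm// powR_ge0.
Qed.

(** [qf] is homogeneous of degree 2 in x and y jointly, and so is the factor in front of f' in
    [Ff]. *)
Lemma kf_scale lam (c : R) (x y : E) : 0 <= lam ->
  kf a (kl lam) c x y = kf a (kl 1) c (Num.sqrt lam *: x) (Num.sqrt lam *: y).
Proof.
move=> l0; have : Num.sqrt lam * Num.sqrt lam = lam by rewrite -expr2 sqr_sqrtr.
move: (Num.sqrt lam) => s s2.
have q e : qf e (s *: x) (s *: y) = lam * qf e x y.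
  by rewrite /qf -scalerBr dotpZl dotpZr !mxE -s2; ring.
have F e : Ff a (kl lam) e x y = Ff a (kl 1) e (s *: x) (s *: y).
  rewrite /Ff q /kl !mxE !expr1n !mul1r -s2; ring.
by rewrite /kf !F.
Qed.

Local Opaque kf.

(** Rescaling by lam^(1/2) brings the kernel to scale 1 and moves the centre y to distance lam^(1/2)
    |y| from 0. The half ball of radius 3 / lam^(1/2) becomes that of radius 3, on which the kernel
    is Lipschitz in its centre. *)
Lemma mass_lipschitz y : 0 <= y 0 ord_max -> exists2 C, 0 <= C & forall lam, 0 < lam ->
  Num.sqrt lam * enorm y <= 1 ->
  `|Sy a (3 / Num.sqrt lam) (weight a) lam y - Sy a (3 / Num.sqrt lam) (weight a) lam (0 : E)| <=
    C * Num.sqrt lam.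
Proof.
move=> y0.
have fk : fam (kbase 3) (fun (z : E * R) (y : E) => kf a (kl 1) (cos z.2) z.1 y).
  by apply: fam_kf; [exact: kbase_cst|exact: kbase_coord|exact: kbase_cos|exact: jet_kl].
have [C C0 [_ H1 _]] := kbase_fam_C2 1 fk.
set N : R := n.+1%:R.
have a10 : 0 < a + 1 by rewrite -ltrBlDr sub0r.
pose C' := N * C * enorm y * (6 ^+ n * (3 `^ (a + 1) / (a + 1)) * pi).
exists C'.
  by rewrite /C' !mulr_ge0 ?exprn_ge0 ?powR_ge0 ?pi_ge0 ?enorm_ge0 ?invr_ge0 ?(ltW a10) ?ler0n.
move=> lam l0 ly; set s := Num.sqrt lam in ly *.
have s0 : 0 < s by rewrite sqrtr_gt0.
have rho0 : 0 < 3 / s by rewrite divr_gt0.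
rewrite /Sy /Sw -mulrBr normrM (ger0_norm (powR_ge0 _ _)).
have adm y' : admissible (3 / s) (fun z : E * R => comb a (kl lam) [:: (1, y')] (cos z.2) z.1).
  by apply: comb_admissible; exact: jet_kl.
have -> : mean a (3 / s) (weight a) (comb a (kl lam) [:: (1, y)]) -
    mean a (3 / s) (weight a) (comb a (kl lam) [:: (1, 0 : E)]) =
    avg a (3 / s) (weight a) (fun z => comb a (kl lam) [:: (1, y)] (cos z.2) z.1 +
      (-1) * comb a (kl lam) [:: (1, 0 : E)] (cos z.2) z.1).
  rewrite (avgD a1 rho0 (@mw _) (@wM _) (adm _) (admissibleZ _ (adm _))).
  by rewrite (avgZ a1 rho0 (@mw _) (@wM _) _ (adm _)) mulN1r.
have B z : (Omega (3 / s) `*` I) z ->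
    `|comb a (kl lam) [:: (1, y)] (cos z.2) z.1 +
      (-1) * comb a (kl lam) [:: (1, 0 : E)] (cos z.2) z.1| <= N * C * (s * enorm y).
  move=> [[/= zr z0] Iz].
  rewrite /comb !big_seq1 !mul1r mulN1r !(kf_scale _ _ _ (ltW l0)) -/s scaler0.
  have Dz : (Omega 3 `*` I) (s *: z.1, z.2).
    split => //; split; last by rewrite /= mxE mulr_gt0.
    by rewrite /eball/= enormZ ?(ltW s0)// mulrC -ltr_pdivlMr.
  have := @lipschitz_bound R n.+1 (fun y => kf a (kl 1) (cos z.2) (s *: z.1) y) 1 C 0 (s *: y).
  rewrite add0r normr0 => H.
  have sy : `|s *: y| <= s * enorm y.
    by rewrite normrZ (gtr0_norm s0) ler_wpM2l ?(ltW s0)// norm_le_enorm.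
  have yl1 : `|s *: y| <= 1 := le_trans sy ly.
  have NC : N * C * `|s *: y| <= N * C * (s * enorm y) by rewrite ler_wpM2l// mulr_ge0.
  apply: le_trans NC; apply: H.
  - by move=> x; exact: (fam_differentiable (s *: z.1, z.2) x fk).
  - by move=> i x x1; exact: (H1 (s *: z.1, z.2)).
  - exact: ler01.
  - exact: yl1.
apply: (le_trans (ler_wpM2l (powR_ge0 _ _) (avg_le a1 rho0 (@mw _) (@wM _)
  (admissibleD (adm _) (admissibleZ _ (adm _))) B))).
rewrite mul1r.
apply: (le_trans (ler_wpM2l (powR_ge0 _ _) (ler_wpM2l _ (wtot_le rho0)))).
  by rewrite !mulr_ge0 ?enorm_ge0 ?(ltW s0).
have -> : lam `^ hdim n a * (N * C * (s * enorm y) *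
    ((3 / s *+ 2) ^+ n * ((3 / s) `^ (a + 1) / (a + 1)) * pi)) =
  C' * s * (lam `^ hdim n a * (s ^- n * s^-1 `^ (a + 1))).
  have e1 : (3 / s) `^ (a + 1) = 3 `^ (a + 1) * s^-1 `^ (a + 1).
    by rewrite powRM ?invr_ge0 ?(ltW s0).
  have e2 : (3 / s *+ 2) ^+ n = 6 ^+ n * s ^- n.
    have -> : 3 / s *+ 2 = 6 * s^-1 by rewrite -mulr_natr; ring.
    by rewrite exprMn exprVn.
  by rewrite e1 e2 /C'; ring.
(* The volume factor s^-(n + 1 + a) of the large half ball is exactly compensated by lam^hdim. *)
have -> : lam `^ hdim n a * (s ^- n * s^-1 `^ (a + 1)) = 1.
  have -> : lam = s `^ 2 by rewrite powR_mulrn ?(ltW s0)// sqr_sqrtr// ltW.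
  rewrite -(powR_invn _ (ltW s0)) -(powR_inv1 (ltW s0)) -!powRrM.
  have sD p q : s `^ (p + q) = s `^ p * s `^ q by rewrite powRD// (gt_eqF s0) implybT.
  rewrite -!sD [X in s `^ X](_ : _ = 0) ?powRr0//.
  by rewrite /hdim; field.
by rewrite mulr1.
Qed.

(** A sample value; by [massE] every admissible centre and scale gives the same one. *)
Definition total_mass : R := Sy a 2 (weight a) 4 (0 : E).

(** The mean does not depend on lam, so it may be evaluated as lam -> 0, where [mass_lipschitz]
    makes it the same for y and for 0. *)
Lemma massE rho lam y : 0 < lam -> 0 <= y 0 ord_max -> enorm y + (Num.sqrt lam)^-1 < rho ->
  Sy a rho (weight a) lam y = total_mass.
Proof.
move=> l0 y0 yr; have [C C0 HC] := mass_lipschitz y0.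
have z0 : 0 <= (0 : E) 0 ord_max by rewrite mxE.
apply/eqP; rewrite -subr_eq0 -normr_le0; apply/ler_addgt0Pl => e e0; rewrite addr0.
(* The bounds on s give, in order: a scale below lam, 1 / s >= 1, rho <= 3 / s, s |y| <= 1, and an
   error C s <= e. *)
pose s := Num.min (Num.min (Num.sqrt lam) 1) (Num.min (rho^-1) (Num.min (enorm y + 1)^-1 (e / (C + 1)))).
have rho0 : 0 < rho by apply: le_lt_trans yr; rewrite addr_ge0 ?enorm_ge0 ?invr_ge0 ?sqrtr_ge0.
have ey0 : 0 < enorm y + 1 by rewrite ltr_wpDl ?enorm_ge0.
have s0 : 0 < s by rewrite /s !lt_min sqrtr_gt0 l0 ltr01 invr_gt0 rho0 invr_gt0 ey0 divr_gt0// ltr_wpDl.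
have : [/\ s <= Num.sqrt lam, s <= 1, s <= rho^-1, s <= (enorm y + 1)^-1 & s <= e / (C + 1)].
  have := lexx s; rewrite {2}/s !le_min => /andP[/andP[-> ->] /and3P[-> -> ->]].
  by [].
move=> [s1 s2 s3 s4 s5].
have sl : Num.sqrt (s ^+ 2) = s by rewrite sqrtr_sqr gtr0_norm.
have l'0 : 0 < s ^+ 2 by exact: exprn_gt0.
have rr : rho <= 3 / s.
  rewrite ler_pdivlMr//; apply: (@le_trans _ _ 1).
    by rewrite mulrC -ler_pdivlMr// div1r.
  by rewrite ler1n.
have yr' : enorm y + s^-1 < 3 / s.
  have : enorm y + 1 <= s^-1 by rewrite -[leLHS]invrK lef_pV2 ?posrE ?invr_gt0.
  have : 1 <= s^-1 by rewrite invf_ge1.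
  by lra.
have i1 : 1 <= s^-1 by rewrite invf_ge1.
have sy : s * enorm y <= 1.
  rewrite (@le_trans _ _ ((enorm y + 1)^-1 * enorm y))// ?ler_wpM2r ?enorm_ge0//.
  by rewrite mulrC ler_pdivrMr// mul1r lerDl.
have Cs : C * s <= e.
  rewrite (@le_trans _ _ ((C + 1) * s))//; first by rewrite ler_wpM2r ?(ltW s0)// lerDl.
  by rewrite mulrC -ler_pdivlMr// ltr_wpDl.
have sll : s ^+ 2 <= lam.
  by rewrite -(sqr_sqrtr (ltW l0)) ler_sqr ?nnegrE ?sqrtr_ge0 ?(ltW s0).
have ys : enorm y + (Num.sqrt (s ^+ 2))^-1 < 3 / s by rewrite sl.
have s4' : Num.sqrt 4 = 2 :> R.
  by have -> : 4 = 2 ^+ 2 :> R; [ring|rewrite sqrtr_sqr ger0_norm].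
have sll4 : s ^+ 2 <= 4.
  by rewrite (@le_trans _ _ 1)// ?ler1n// expr_le1// ltW.
have zs : enorm (0 : E) + (Num.sqrt (s ^+ 2))^-1 < 3 / s.
  by rewrite sl enorm0 add0r; lra.
have zs4 : enorm (0 : E) + (Num.sqrt 4)^-1 <= 2 by rewrite enorm0 add0r s4'; lra.
have rr2 : 2 <= 3 / s by lra.
have sy' : Num.sqrt (s ^+ 2) * enorm y <= 1 by rewrite sl.
have := HC _ l'0 sy'; rewrite sl.
have <- : Sy a rho (weight a) lam y = Sy a (3 / s) (weight a) (s ^+ 2) y.
  apply: etrans (esym (mass_scale l'0 sll y0 ys)).
  by apply: Sy_rho; [exact: mw|exact: l0|exact: rr|exact: y0|exact: ltW yr].
have <- : total_mass = Sy a (3 / s) (weight a) (s ^+ 2) (0 : E).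
  apply: etrans (esym (mass_scale l'0 sll4 z0 zs)).
  by apply: Sy_rho; [exact: mw|exact: ltr0n|exact: rr2|exact: z0|exact: zs4].
by move=> H; exact: le_trans H Cs.
Qed.

Transparent kf.

(** For the centre 0 the kernel does not depend on the angle and equals 4 (a + 1) times -[bump 1] at
    4 |x|^2, which is nonnegative. A zero integral would make it vanish almost everywhere, but it is
    positive on a box of positive measure. *)
Lemma total_mass_gt0 : 0 < total_mass.
Proof.
rewrite /total_mass /Sy /Sw mulr_gt0 ?powR_gt0//.
pose F (z : E * R) : R := weight a z.1 * (sw a z.2 * comb a (kl 4) [:: (1, 0 : E)] (cos z.2) z.1).
have a10 : 0 < a + 1 by rewrite -ltrBlDr sub0r.
have combE c (x : E) : comb a (kl 4) [:: (1, 0 : E)] c x = 4 * (a + 1) * - bump 1 (4 * dotp x x).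
  rewrite /comb big_seq1 mul1r /kf /Ff /qf /kl !mxE !subr0 !mulr0 !mul0r !addr0 !subr0 expr0 mul1r.
  by ring.
have F0 z : 0 <= F z.
  by rewrite /F combE !mulr_ge0 ?powR_ge0 ?sw_ge0 ?bump1_le0 ?(ltW a10).
have F_gt0 (z : E * R) : 0 < z.1 0 ord_max -> 0 < z.2 < pi -> dotp z.1 z.1 < 4^-1 -> 0 < F z.
  move=> x0 tp x4; rewrite /F combE !mulr_gt0 ?powR_gt0//.
    by rewrite normr_gt0 gt_eqF// sin_gt0_pi.
  by apply: bump1_lt0; rewrite -ltr_pdivlMl// mulr1.
have rho0 : 0 < 2 :> R by [].
have adm : admissible 2 (fun z : E * R => comb a (kl 4) [:: (1, 0 : E)] (cos z.2) z.1).
  by apply: comb_admissible; exact: jet_kl.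
have iF : P.-integrable (Omega 2 `*` I) (EFin \o F).
  exact: (avg_integrable a1 rho0 (@mw 2) (@wM 2) adm).
have mD := measurableX (mO 2) mI.
rewrite lt_neqAle; apply/andP; split; last by apply: Rintegral_ge0 => z _; exact: F0.
apply/eqP => F00.
have [iF0 _] := @ae_eq_integral_abs _ _ _ P _ mD (EFin \o F) (measurable_int _ iF).
have [|N [mN PN0 FN]] := iF0 _.
  under eq_integral do rewrite /= ger0_norm//.
  have fin : (\int[P]_(z in Omega 2 `*` I) (F z)%:E)%E \is a fin_num.
    by apply: integrable_fin_num => //; exact: measurableX.
  by rewrite -(fineK fin); congr EFin; exact: esym F00.
(* Points of the cube of half side t0 / 2 around t0 e_N have sup norm at most 2 t0, so their squared
   length is at most 4 (n + 1) t0^2 <= 1 / 16, inside the region |x|^2 < 1/4 where the kernel is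
   positive. *)
pose t0 : R := (8 * n.+1%:R)^-1.
have n0 : 0 < n.+1%:R :> R by rewrite ltr0n.
have t00 : 0 < t0 by rewrite invr_gt0 mulr_gt0.
have nt0 : 8 * (n.+1%:R * t0) = 1 by rewrite mulrA divff// mulf_neq0// gt_eqF.
pose y0 : E := t0 *: delta_mx 0 ord_max.
pose C := [set x : E | forall i, `|x 0 i - y0 0 i| <= t0 / 2].
have mC : measurable C.
  apply: (@measurable_box R n.+1 (fun i => [set t : R | `|t - y0 0 i| <= t0 / 2])) => i.
  rewrite (_ : mkset _ = `[y0 0 i - t0 / 2, y0 0 i + t0 / 2]%classic); first exact: measurable_itv.
  by apply/seteqP; split => t /=; rewrite in_itv/= ler_distl.
have BN : C `*` `]0%R, pi[ `<=` N.
  move=> z [Cz /=]; rewrite in_itv/= => tz; apply: FN => /= H.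
  have x0 : 0 < z.1 0 ord_max.
    have := Cz ord_max; rewrite !mxE !eqxx mulr1 ler_distl => /andP[+ _].
    by apply: lt_le_trans; rewrite subr_gt0 ltr_pdivrMr// ltr_pMr// ltr1n.
  have zn : `|z.1| <= 2 * t0.
    apply: norm_le_coord => [|i]; first by rewrite mulr_ge0// ltW.
    have := Cz i; have := ler_normD (z.1 0 i - y0 0 i) (y0 0 i); rewrite subrK.
    have : `|y0 0 i| <= t0.
      rewrite !mxE normrM (gtr0_norm t00) ler_piMr ?(ltW t00)//.
      by case: (_ && _); rewrite /= ?normr1 ?normr0 ?ler01.
    by lra.
  have zz : dotp z.1 z.1 <= n.+1%:R * (2 * t0) ^+ 2.
    apply: (le_trans (dotp_le_norm _)); rewrite ler_wpM2l ?(ltW n0)//.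
    by rewrite ler_sqr ?nnegrE ?mulr_ge0// ltW.
  have t1 : 8 * t0 <= 1.
    rewrite -[leRHS]nt0 ler_wpM2l// ler_peMl ?(ltW t00)//.
    by rewrite ler1n.
  have z4 : dotp z.1 z.1 < 4^-1.
    apply: (le_lt_trans zz).
    have -> : n.+1%:R * (2 * t0) ^+ 2 = 4 * (8 * (n.+1%:R * t0)) * (8 * t0) / 64 by field.
    by rewrite nt0; lra.
  have := F_gt0 z x0 tz z4; suff -> : F z = 0 by rewrite ltxx.
  suff [] : EFin (F z) = 0%E by [].
  apply: H; split; last first.
    by rewrite /= in_itv/=; case/andP: tz => /ltW -> /ltW ->.
  split; last exact: x0.
  rewrite /eball/= -(@ltr_pXn2r _ 2) ?nnegrE ?enorm_ge0// enorm_sqr.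
  have -> : 2 ^+ 2 = 4 :> R by ring.
  lra.
have CE : leb n.+1 C = ((t0 / 2 *+ 2) ^+ n.+1)%:E by apply: leb_cube; rewrite divr_ge0// ltW.
have muE : mu `]0%R, pi[%classic = pi%:E.
  by rewrite lebesgue_measure_itv/= lte_fin pi_gt0 -EFinD subr0.
have PE : P (C `*` `]0%R, pi[) = ((t0 / 2 *+ 2) ^+ n.+1 * pi)%:E.
  rewrite product_measure1E//; apply: etrans (f_equal2 _ CE muE) _.
  by rewrite -EFinM.
have : (P (C `*` `]0%R, pi[) <= 0)%E.
  by rewrite -PN0; apply: le_measure => //; rewrite inE//; apply: measurableX.
rewrite PE lee_fin leNgt.
by rewrite mulr_gt0 ?pi_gt0// exprn_gt0// mulrn_wgt0// divr_gt0.
Qed.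

End mass.

(** * An integrable function with zero integral over all lower orthants vanishes almost
    everywhere *)

Section ray_boxes.
Variables (R : realType) (m : nat).
Local Notation E := 'rV[R]_m.

Definition ray_box (b : E) : set E := [set x | forall i, x 0 i < b 0 i].

Lemma measurable_ray_box b : measurable (ray_box b).
Proof.
apply: (@measurable_box R m (fun i => [set t : R | t < b 0 i])) => i.
rewrite (_ : mkset _ = `]-oo, b 0 i[%classic); first exact: measurable_itv.
by apply/seteqP; split => t /=; rewrite in_itv.
Qed.

Let G : set (set E) := range ray_box.

Let GI : setI_closed G.
Proof.
move=> _ _ [b _ <-] [c _ <-]; exists (\row_i Num.min (b 0 i) (c 0 i)) => //.
apply/seteqP; split => x /=.
  by move=> H; split => i; have := H i; rewrite mxE lt_min => /andP[].
by move=> [H1 H2] i; rewrite mxE lt_min H1 H2.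
Qed.

Lemma near_all_ltn (x : E) : exists k : nat, forall i, x 0 i < k%:R.
Proof.
exists (Num.trunc `|x|).+1 => i.
rewrite (le_lt_trans (ler_norm _))// (le_lt_trans (coord_le_norm _ _))//.
exact: truncnS_gt.
Qed.

(** A half space x_i < c is the increasing union of orthants whose other bounds are integers k. *)
Let GE : @measurable _ E = <<s G >>.
Proof.
apply/seteqP; split => A; last first.
  apply: smallest_sub; first exact: sigma_algebra_measurable.
  by move=> _ [b _ <-]; exact: measurable_ray_box.
apply: smallest_sub; first exact: smallest_sigma_algebra.
move=> B; rewrite -bigcup_seq/= => -[i _] [C mC <-]; rewrite setTI.
have [s0 sC sU] := @smallest_sigma_algebra _ [set: E] G.
have : <<s @RGenInftyO.G R >> C.
  by rewrite -[<<s _ >>]/((@RGenInftyO.G R).-sigma.-measurable) -RGenInftyO.measurableE.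
move: C {mC}; apply: smallest_sub.
  split.
  - by rewrite /= preimage_set0.
  - by move=> C /= H; exact: (sC _ H).
  - by move=> F /= FC; rewrite preimage_bigcup; exact: sU.
move=> _ [c ->] /=.
rewrite (_ : _ @^-1` _ = \bigcup_k ray_box (\row_j if j == i then c else k%:R)).
  by apply: sU => k; apply: sub_sigma_algebra; exists (\row_j if j == i then c else k%:R).
apply/seteqP; split => x /=.
  rewrite in_itv/= => xc; have [k Hk] := near_all_ltn x.
  by exists k => // j; rewrite mxE; case: eqP => [->|_] //.
by move=> [k _ /(_ i)]; rewrite mxE eqxx in_itv.
Qed.

Variable g : E -> R.
Hypothesis ig : (leb m).-integrable setT (EFin \o g).
Hypothesis g0 : forall b, \int[leb m]_(x in ray_box b) g x = 0.

Let mg : measurable_fun setT g.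
Proof. by apply/measurable_EFinP; exact: measurable_int ig. Qed.

Let IA (A : set E) : R := \int[leb m]_x (g x * \1_A x).

Let IAE A : measurable A -> IA A = \int[leb m]_(x in A) g x.
Proof.
move=> mA; rewrite /IA /Rintegral; congr fine; rewrite [RHS]integral_mkcond.
apply: eq_integral => x _; rewrite patchE indicE; case: (x \in A); first by rewrite mulr1.
by rewrite mulr0.
Qed.

Let mI (A : set E) : measurable A -> measurable_fun setT (fun x => g x * \1_A x).
Proof. by move=> mA; apply: measurable_funM => //; exact: measurable_indic. Qed.

Let ginorm : (leb m).-integrable setT (EFin \o (fun x => `|g x|)).
Proof.
have := integrable_abse ig; apply: eq_integrable => // x _.
Qed.

Let bI (A : set E) x : `|g x * \1_A x| <= `|g x|.
Proof. by rewrite normrM ler_piMr// indicE; case: (x \in A); rewrite ?normr1 ?normr0. Qed.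

Let iI (A : set E) : measurable A -> (leb m).-integrable setT (EFin \o (fun x => g x * \1_A x)).
Proof.
move=> mA; apply: (@integrable_bound _ _ R (leb m) setT measurableT _ (fun x => `|g x|)) => //.
exact: mI.
Qed.

Let cvgI (F : (set E)^nat) (A : set E) : (forall k, measurable (F k)) -> measurable A ->
  (forall x, (\1_(F k) x : R) @[k --> \oo] --> (\1_A x : R)) ->
  IA (F k) @[k --> \oo] --> IA A.
Proof.
move=> mF mA FA.
apply: (@Rintegral_dominated _ _ R (leb m) setT measurableT (fun k x => g x * \1_(F k) x)
  _ (fun x => `|g x|)) => //.
- by move=> k; exact: mI.
- exact: mI.
by move=> x _; apply: cvgMr; exact: FA.
Qed.

Let IT : IA setT = 0.
Proof.
have cv := @cvgI (fun k => ray_box (\row_i k%:R)) setT (fun k => measurable_ray_box _) measurableT.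
apply: (cvg_unique (@norm_hausdorff _ R) (cv _)).
  move=> x; apply: cvg_near_cst; have [k0 Hk0] := near_all_ltn x.
  near=> k; rewrite !indicE in_setT mem_set// => i; rewrite mxE.
  rewrite (lt_le_trans (Hk0 i))// ler_nat; near: k; exact: nbhs_infty_ge.
rewrite (_ : (fun k => IA _) = cst 0); first exact: cvg_cst.
by apply/funext => k; rewrite IAE ?g0//; exact: measurable_ray_box.
Unshelve. all: by end_near. Qed.

(** Orthants are stable under intersection and generate the sigma-algebra, so Dynkin's lemma extends
    the vanishing to all measurable sets; disjoint unions are handled by dominated convergence of
    partial sums. *)
Let IA0 (A : set E) : measurable A -> IA A = 0.
Proof.
move=> mA; move: (mA); rewrite GE.
apply: (@dynkin_induction _ E G (fun A => IA A = 0) GE GI IT).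
- by move=> _ [b _ <-]; rewrite IAE ?g0//; exact: measurable_ray_box.
- move=> S mS S0; rewrite -[RHS]IT -[RHS]subr0 -S0 /IA -RintegralB//; [|exact: iI..].
  apply: eq_Rintegral => x _; rewrite !indicE in_setT in_setC.
  by case: (x \in S) => /=; ring.
- move=> F mF tF F0.
  have mU : measurable (\bigcup_k F k) by exact: bigcup_measurable.
  pose H k := \big[setU/set0]_(i < k) F i.
  have mH k : measurable (H k) by apply: bigsetU_measurable.
  have HE k x : \1_(H k) x = \sum_(i < k) \1_(F i) x :> R.
    elim: k => [|k IH]; first by rewrite /H !big_ord0 indicE in_set0.
    rewrite /H !big_ord_recr/= -IH -/(H k).
    have dis : H k `&` F k = set0.
      rewrite /H -bigcup_mkord setI_bigcupl bigcup0// => i /= ik.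
      have [//|/set0P ne] := eqVneq (F i `&` F k) set0.
      by move: ik; rewrite (tF i k I I ne) ltnn.
    rewrite !indicE in_setU; case: (boolP (x \in H k)) => xH; case: (boolP (x \in F k)) => xF //=.
    + exfalso; have : (H k `&` F k) x by split; exact: set_mem.
      by rewrite dis.
    + by rewrite addr0.
    + by rewrite add0r.
    + by rewrite addr0.
  have H0 k : IA (H k) = 0.
    rewrite /IA; under eq_Rintegral do rewrite HE big_distrr/=.
    transitivity (\sum_(i <- index_enum 'I_k) \int[leb m]_x (g x * \1_(F i) x)).
      apply: (@Rintegral_sum _ _ R (leb m) setT measurableT _ (index_enum 'I_k)
        (fun i x => g x * \1_(F i) x)) => i.
      exact: iI.
    by rewrite big1// => i _; exact: F0.
  apply: (cvg_unique (@norm_hausdorff _ R) (@cvgI H _ mH mU _)).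
    move=> x; apply: cvg_near_cst.
    case: (boolP (x \in \bigcup_k F k)) => xU; last first.
      near=> k; rewrite !indicE (negbTE xU) memNset// /H -bigcup_mkord => -[i _ Fi].
      by move/negP: xU; apply; rewrite inE; exists i.
    move: (xU); rewrite inE => -[i _ Fi]; near=> k.
    rewrite !indicE xU mem_set// /H -bigcup_mkord; exists i => //=.
    near: k; exact: nbhs_infty_gt.
  rewrite (_ : (fun k => IA _) = cst 0); first exact: cvg_cst.
  by apply/funext => k; exact: H0.
Unshelve. all: by end_near. Qed.

(** The integral of |g| is the difference of the integrals of g over {g >= 0} and over its
    complement. *)
Lemma ray_boxes_ae0 : ae_eq (leb m) setT g (cst 0).
Proof.
have mp : measurable [set x | 0 <= g x].
  have := mg measurableT (@measurable_itv R `[0, +oo[); rewrite setTI.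
  rewrite (_ : _ @^-1` _ = [set x | 0 <= g x])//.
  by apply/seteqP; split => t /=; rewrite in_itv/= andbT.
set A := [set x | 0 <= g x] in mp.
have mgE : measurable_fun setT (EFin \o g) by apply/measurable_EFinP.
suff : ae_eq (leb m) setT (EFin \o g) (cst 0%E).
  by apply: filterS => x /= H _; have [] := H I.
apply/(ae_eq_integral_abs _ _ mgE) => //.
have fin : (\int[leb m]_x (`|g x|)%:E)%E \is a fin_num by exact: integrable_fin_num ginorm.
rewrite -[LHS](fineK fin); congr EFin.
rewrite -[LHS]/(\int[leb m]_x `|g x|).
have -> : \int[leb m]_x `|g x| = IA A - IA (~` A).
  rewrite /IA -RintegralB//; [|exact: iI|by apply: iI; exact: measurableC].
  apply: eq_Rintegral => x _; rewrite !indicE in_setC.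
  have -> : (x \in A) = (0 <= g x) by apply/idP/idP; rewrite inE.
  by have [gx|gx] := leP 0 (g x); [rewrite ger0_norm//=|rewrite ltr0_norm//=]; ring.
by rewrite !IA0 ?subrr//; exact: measurableC.
Qed.

End ray_boxes.

Section product_leb.
Variables (R : realType) (n : nat).
Notation P := ((@leb R n) \x (@lebesgue_measure R))%E.
Lemma product_leb_sigma_finite : sigma_finite setT P.
Proof.
exists (fun k => [set x : 'rV[R]_n | `|x| <= k%:R] `*` `[- k%:R, k%:R]%classic).
  apply/seteqP; split => // -[x t] _.
  exists (Num.trunc (Num.max `|x| `|t|)).+1 => //.
  have H : Num.max `|x| `|t| <= (Num.trunc (Num.max `|x| `|t|)).+1%:R by exact/ltW/truncnS_gt.
  split; first by rewrite /= (le_trans _ H)// le_max lexx.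
  by rewrite /= in_itv/= -ler_norml (le_trans _ H)// le_max lexx orbT.
move=> k; have mk := measurable_cube (m := n) (k%:R : R); split.
  by apply: measurableX.
have mf : (@lebesgue_measure R (`[(- k%:R)%R, k%:R%R]%classic : set R) < +oo)%E.
  by rewrite lebesgue_measure_itv/=; case: ifP; rewrite ?ltry// -EFinD ltry.
rewrite product_measure1E//; apply: lte_mul_pinfty => //.
by rewrite ge0_fin_numE//; exact: (eq_ind_r (fun e => (e < +oo)%E) (ltry _) (leb_cube0 n (ler0n R k))).
Qed.
(** Packaged as a sigma-finite measure, the product can be a factor in a further application of
    Fubini. *)
Definition product_leb : {sigma_finite_measure set _ -> \bar R} :=
  HB.pack P (Measure_isSigmaFinite.Build _ _ _ P product_leb_sigma_finite).

End product_leb.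

Section joint_measurability.
Variables (R : realType) (n : nat) (a : R).
Local Notation E := 'rV[R]_n.+1.
Context d (T : measurableType d).
Variables (X Y : T -> E) (C : T -> R).
Hypotheses (mX : forall i, measurable_fun setT (fun t => X t 0 i))
  (mY : forall i, measurable_fun setT (fun t => Y t 0 i)) (mC : measurable_fun setT C).

Let measurable_qf_comp (e : R) : measurable_fun setT (fun t => qf (e * C t) (X t) (Y t)).
Proof.
apply: measurable_funD.
  apply: measurable_sum => i.
  have H : measurable_fun setT (fun t => (X t - Y t) 0 i).
    rewrite (_ : (fun t => _) = fun t => X t 0 i - Y t 0 i); first exact: measurable_funB.
    by apply/funext => t; rewrite !mxE.
  exact: measurable_funM.
apply: measurable_funM => //; apply: measurable_funM => //; apply: measurable_funM => //.
by apply: measurable_funB => //; exact: measurable_funM.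
Qed.

Lemma measurable_kf_comp f : jet f ->
  measurable_fun setT (fun t => kf a f (C t) (X t) (Y t)).
Proof.
move=> jf.
have mf e j : measurable_fun setT (fun t => f j (qf (e * C t) (X t) (Y t))).
  apply: (measurableT_comp (f := f j)) => //; apply: continuous_measurable_fun.
  exact: jet_continuous.
have mF e : measurable_fun setT (fun t => Ff a f (e * C t) (X t) (Y t)).
  apply: measurable_funB; first exact: measurable_funM.
  apply: measurable_funM => //; do 2 apply: measurable_funM => //.
  by apply: measurable_funM => //; exact: measurable_funM.
rewrite (_ : (fun t => _) = fun t => Ff a f (1 * C t) (X t) (Y t) + Ff a f (-1 * C t) (X t) (Y t)).
  exact: measurable_funD.
by apply/funext => t; rewrite mul1r mulN1r.
Qed.

End joint_measurability.

(** * Symmetry of the kernel *)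

Section symmetry.
Variables (R : realType) (n : nat) (a : R).
Hypothesis a1 : -1 < a.
Local Notation E := 'rV[R]_n.+1.
Notation mu := (@lebesgue_measure R).
Notation I := (`[0%R, pi]%classic : set R).
Notation P := (leb n.+1 \x mu)%E.
Notation Omega rho := (half_ball rho : set E).
Variables (rho1 rho2 : R) (w1 w2 : E -> R) (M1 M2 : R).
Hypotheses (rho10 : 0 < rho1) (rho20 : 0 < rho2).
Hypotheses (mw1 : measurable_fun (Omega rho1) w1) (mw2 : measurable_fun (Omega rho2) w2).
Hypothesis wM1 : forall x, Omega rho1 x -> `|w1 x| <= M1 * weight a x.
Hypothesis wM2 : forall x, Omega rho2 x -> `|w2 x| <= M2.
Hypotheses (M10 : 0 <= M1) (M20 : 0 <= M2).
Variable f : nat -> R -> R.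
Hypothesis jf : jet f.

Let mO rho : measurable (Omega rho) := @measurable_half_ball R n rho.
Let mI : measurable I. Proof. exact: measurable_itv. Qed.
Let I_fin : (mu I < +oo)%E.
Proof. by rewrite lebesgue_measure_itv/= lte_fin pi_gt0 -EFinD ltry. Qed.
Let mOI rho := measurableX (mO rho) mI.

Lemma half_ball_fin rho : 0 < rho -> (leb n.+1 (Omega rho) < +oo)%E.
Proof.
move=> r0; apply: (@le_lt_trans _ _ (leb n.+1 [set x : E | `|x| <= rho])).
  apply: le_measure; rewrite ?inE//; [exact: measurable_cube|].
  by move=> x [/= xr _]; rewrite (le_trans (norm_le_enorm _))// ltW.
by apply: (@le_lt_trans _ _ ((rho *+ 2) ^+ n.+1)%:E); rewrite ?ltry// leb_cube0// ltW.
Qed.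

Let cst_int (c : R) : (leb n.+1).-integrable (Omega rho2) (EFin \o cst c).
Proof.
apply: measurable_bounded_integrable => //; first exact: half_ball_fin.
by exists `|c|; split; [exact: num_real|move=> M cM x _ /=; exact: ltW].
Qed.

Let k_bound : exists2 C, 0 <= C & forall (x y : E) t, Omega rho1 x -> Omega rho2 y -> I t ->
  `|kf a f (cos t) x y| <= C.
Proof.
have fk : fam (kbase rho1) (fun (z : E * R) (y : E) => kf a f (cos z.2) z.1 y).
  by apply: fam_kf; [exact: kbase_cst|exact: kbase_coord|exact: kbase_cos|exact: jf].
have [C C0 HC] := kbase_fam_bounded rho2 fk; exists C => // x y t Ox Oy It.
apply: (HC (x, t) y) => //.
by case: Oy => /= yr _; rewrite (le_trans (norm_le_enorm _))// ltW.
Qed.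

Let mfst3 i : measurable_fun setT (fun t : (E * R) * E => t.1.1 0 i).
Proof.
apply: (measurableT_comp (@measurable_coords R n.+1 i)).
exact: (measurableT_comp measurable_fst measurable_fst).
Qed.

Let msnd3 i : measurable_fun setT (fun t : (E * R) * E => t.2 0 i).
Proof. exact: (measurableT_comp (@measurable_coords R n.+1 i) measurable_snd). Qed.

Let mcos3 : measurable_fun setT (fun t : (E * R) * E => cos t.1.2).
Proof.
apply: (measurableT_comp (f := cos)).
  by apply: continuous_measurable_fun; exact: continuous_cos.
exact: (measurableT_comp measurable_snd measurable_fst).
Qed.

Let h (t : (E * R) * E) : R :=
  w1 t.1.1 * (sw a t.1.2 * kf a f (cos t.1.2) t.1.1 t.2) * w2 t.2.

Let mh : measurable_fun ((Omega rho1 `*` I) `*` Omega rho2) h.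
Proof.
have m3 : measurable ((Omega rho1 `*` I) `*` Omega rho2) by apply: measurableX.
apply: measurable_funM; last first.
  apply: (measurable_comp (mO rho2) _ mw2) => [x [z [_ Oz] <-]//|].
  exact: measurable_funTS.
apply: measurable_funM.
  apply: (measurable_comp (mO rho1) _ mw1) => [x [z [[Oz _] _] <-]//|].
  by apply: measurable_funTS; exact: (measurableT_comp measurable_fst measurable_fst).
apply: measurable_funTS; apply: measurable_funM; last exact: measurable_kf_comp.
apply: (measurableT_comp (f := sw a)).
  by apply: continuous_measurable_fun; exact: continuous_sw.
exact: (measurableT_comp measurable_snd measurable_fst).
Qed.

(** Fubini over x, theta and y together with [kfC]. Only w1 carries the weight in its bound; w2 is
    bounded outright, which is why it will contain a cutoff away from {x_N = 0}. *)
Lemma mean_swap :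
  \int[leb n.+1]_(y in Omega rho2) (w2 y * mean a rho1 w1 (comb a f [:: (1, y)])) =
  \int[leb n.+1]_(x in Omega rho1) (w1 x * mean a rho2 w2 (comb a f [:: (1, x)])).
Proof.
have [C C0 HC] := k_bound.
have c1 c (x y : E) : comb a f [:: (1, y)] c x = kf a f c x y.
  by rewrite /comb big_seq1 mul1r.
have sw1 t : `|sw a t| <= 1 by rewrite ger0_norm ?sw_ge0// sw_le1.
have hb z y : (Omega rho1 `*` I) z -> Omega rho2 y -> `|h (z, y)| <= M1 * C * M2 * weight a z.1.
  move=> [Oz Iz] Oy; rewrite /h/= !normrM.
  have -> : M1 * C * M2 * weight a z.1 = (M1 * weight a z.1) * (1 * C) * M2 by ring.
  rewrite ler_pM ?mulr_ge0// ?wM2// ler_pM ?mulr_ge0// ?wM1// ler_pM//.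
  exact: HC.
have ig : P.-integrable (Omega rho1 `*` I) (EFin \o (fun z : E * R => M1 * C * M2 * weight a z.1)).
  rewrite (_ : EFin \o _ = fun z : E * R => ((M1 * C * M2)%:E * (weight a z.1)%:E)%E)//.
  by apply: integrableZl; [exact: mOI|exact: integrable_weight_rectangle].
have L1 := @Rintegral_rectangle1 _ _ _ _ R (product_leb R n.+1) (leb n.+1) (Omega rho1 `*` I) (Omega rho2) h _
  (mOI rho1) (mO rho2) (half_ball_fin rho20) mh ig hb.
have L2 := @Rintegral_rectangle2 _ _ _ _ R (product_leb R n.+1) (leb n.+1) (Omega rho1 `*` I) (Omega rho2) h _
  (mOI rho1) (mO rho2) (half_ball_fin rho20) mh ig hb.
pose V : R := \int[leb n.+1]_(y in Omega rho2) cst 1 y.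
have vol c : \int[leb n.+1]_(y in Omega rho2) cst c y = c * V.
  transitivity (\int[leb n.+1]_(y in Omega rho2) (c * cst 1 y)).
    by apply: eq_Rintegral => y _; rewrite /= mulr1.
  by apply: RintegralZl; [exact: mO|exact: (cst_int 1)].
pose H z := \int[leb n.+1]_(y in Omega rho2) h (z, y).
have mH : measurable_fun (Omega rho1 `*` I) H.
  exact: (@measurable_Rintegral_section1 _ _ _ _ R (product_leb R n.+1) (leb n.+1)
    (Omega rho1 `*` I) (Omega rho2) h _ (mOI rho1) (mO rho2) (half_ball_fin rho20) mh ig hb).
have mhz z : (Omega rho1 `*` I) z -> measurable_fun (Omega rho2) (fun y => h (z, y)).
  move=> _; rewrite /h/=; apply: measurable_funM => //; apply: measurable_funM.
    exact: measurable_cst.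
  apply: measurable_funM; first exact: measurable_cst.
  apply: measurable_funTS.
  apply: (@measurable_kf_comp R n a _ _ (cst z.1) id (cst (cos z.2))) => // i.
  exact: (@measurable_coords R n.+1 i).
have Hb x t : Omega rho1 x -> I t -> `|H (x, t)| <= M1 * C * M2 * V * weight a x.
  move=> Ox It; have Dz : (Omega rho1 `*` I) (x, t) by [].
  have -> : M1 * C * M2 * V * weight a x =
      \int[leb n.+1]_(y in Omega rho2) cst (M1 * C * M2 * weight a x) y.
    by rewrite vol; ring.
  apply: (le_norm_Rintegral_bound (mO rho2) (mhz _ Dz)) => [y Oy|]; first exact: (hb (x, t)).
  exact: cst_int.
have iw c : (leb n.+1).-integrable (Omega rho1) (EFin \o (fun x => c * weight a x)).
  exact: integrable_dominating.
have L3 := @Rintegral_rectangle1 _ _ _ _ R (leb n.+1) mu (Omega rho1) I H _ (mO rho1) mI I_fin mH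
  (iw _) Hb.
have adm1 y : admissible rho1 (fun z : E * R => comb a f [:: (1, y)] (cos z.2) z.1).
  exact: comb_admissible.
transitivity (\int[leb n.+1]_(y in Omega rho2) \int[product_leb R n.+1]_(z in Omega rho1 `*` I) h (z, y)).
  apply: eq_Rintegral => y _; rewrite mulrC /mean -RintegralZr; first last.
  - exact: (avg_integrable a1 rho10 mw1 wM1 (adm1 y)).
  - exact: mOI.
  by apply: eq_Rintegral => z _; rewrite /h/= c1.
rewrite -L2 L1; apply: etrans L3 _; apply: eq_Rintegral => x; rewrite inE => Ox.
pose h2 (z : E * R) := w2 z.1 * (sw a z.2 * comb a f [:: (1, x)] (cos z.2) z.1).
have mh2 : measurable_fun (Omega rho2 `*` I) h2.
  apply: measurable_mean_integrand => //; apply: measurable_funTS.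
  exact: measurable_comb.
have h2b y t : Omega rho2 y -> I t -> `|h2 (y, t)| <= cst (M2 * C) y.
  move=> Oy It; rewrite /h2/= c1 kfC !normrM.
  rewrite ler_pM ?mulr_ge0 ?wM2//.
  by rewrite -[C]mul1r ler_pM// HC.
have L4 := @Rintegral_rectangle2 _ _ _ _ R (leb n.+1) mu (Omega rho2) I h2 _ (mO rho2) mI I_fin mh2
  (cst_int _) h2b.
have m4 := @measurable_Rintegral_section2 _ _ _ _ R (leb n.+1) mu (Omega rho2) I h2 _ (mO rho2) mI I_fin mh2
  (cst_int _) h2b.
have i4 := @integrable_section2 _ _ _ _ R (leb n.+1) (Omega rho2) I h2 _ (mO rho2) mI mh2
  (cst_int _) h2b.
transitivity (w1 x * \int[mu]_(t in I) \int[leb n.+1]_(y in Omega rho2) h2 (y, t)); last first.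
  by congr (_ * _); exact: esym L4.
rewrite -RintegralZl; first last.
- apply: measurable_bounded_integrable => //.
  exists (M2 * C * V); split; first exact: num_real.
  move=> K KK t It; apply: le_trans _ (ltW KK); rewrite /= -vol.
  apply: (le_norm_Rintegral_bound (mO rho2)) => [|y Oy|]; last exact: cst_int.
    by have /measurable_int/measurable_EFinP := i4 t It.
  exact: h2b.
- exact: mI.
apply: eq_Rintegral => t; rewrite inE => It; rewrite -RintegralZl; first last.
- exact: i4.
- exact: mO.
by apply: eq_Rintegral => y _; rewrite /h /h2/= c1 kfC; ring.
Qed.

End symmetry.

Section trigonometric_bounds.
Variable R : realType.
Implicit Types t : R.

Let derive_pow k t : is_derive t 1 (fun s : R => s ^+ k.+1 / k.+1%:R) (t ^+ k).
Proof.
have := is_deriveZ (k.+1%:R^-1 : R) (is_deriveX k.+1 (is_derive_id t (1 : R))).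
rewrite (_ : _ \*: _ = fun s : R => s ^+ k.+1 / k.+1%:R); last first.
  by apply/funext => s; rewrite -[LHS]/(_ * (id ^+ k.+1) s) exprfctE mulrC.
move=> d; apply: (is_derive_eq d).
by rewrite /GRing.scale/= mulr1 mulrA mulVf ?mul1r// pnatr_eq0.
Qed.

Lemma sin_le t : 0 <= t -> `|sin t| <= t.
Proof.
move=> t0; have := @derive_le R sin cos id (cst 1) 0 t t0 (fun s _ => is_derive_sin s)
  (fun s _ => is_derive_id s (1 : R)).
by rewrite sin0 !subr0; apply => s _; rewrite ler_norml cos_geN1 cos_le1.
Qed.

Let cos_near1 t : 0 <= t -> `|cos t - 1| <= t ^+ 2 / 2.
Proof.
move=> t0; have := @derive_le R cos (fun s => - sin s) (fun s : R => s ^+ 2 / 2) id 0 t t0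
  (fun s _ => is_derive_cos s) (fun s _ => derive_pow 1 s).
rewrite cos0 expr0n mul0r subr0; apply => s /andP[s0 _].
by rewrite normrN; exact: sin_le.
Qed.

Let sin_near t : 0 <= t -> `|sin t - t| <= t ^+ 3 / 6.
Proof.
move=> t0; have D2 (s : R) : is_derive s 1 (fun s : R => s ^+ 3 / 6) (s ^+ 2 / 2).
  rewrite (_ : (fun s => _) = 2^-1 \*: (fun s : R => s ^+ 3 / 3)); last first.
    by apply/funext => u; rewrite -[RHS]/(2^-1 * (u ^+ 3 / 3)); field.
  by apply: (is_derive_eq (is_deriveZ (2^-1 : R) (derive_pow 2 s))); rewrite /GRing.scale/= mulrC.
have D1 (s : R) : is_derive s 1 (fun s : R => sin s - s) (cos s - 1).
  exact: is_deriveB (is_derive_sin s) (is_derive_id s (1 : R)).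
have := @derive_le R _ _ _ _ 0 t t0 (fun s _ => D1 s) (fun s _ => D2 s).
rewrite sin0 !expr0n !mul0r !subr0; apply => s /andP[s0 _].
exact: cos_near1.
Qed.

(** 1 - cos t = 2 sin(t/2)^2, and sin x >= x - x^3 / 6 >= x / 3 for 0 <= x <= 2. *)
Lemma cos_upper t : 0 <= t <= pi -> t ^+ 2 / 18 <= 1 - cos t.
Proof.
move=> /andP[t0 tpi]; pose x := t / 2.
have x0 : 0 <= x by rewrite divr_ge0.
have x2 : x <= 2 by rewrite ler_pdivrMr// (le_trans tpi)// -ler_pdivrMr// ltW// pihalf_lt2.
have -> : t = x *+ 2 by rewrite /x -mulr_natr; field.
rewrite cos_mulr2n cos2sin2.
have sx : x / 3 <= sin x.
  have := sin_near x0; rewrite ler_distl => /andP[+ _].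
  apply: le_trans; rewrite -subr_ge0.
  have -> : x - x ^+ 3 / 6 - x / 3 = x * (2 - x) * (2 + x) / 6 by field.
  by rewrite divr_ge0// !mulr_ge0 ?subr_ge0// addr_ge0.
have : (x / 3) ^+ 2 <= sin x ^+ 2.
  by rewrite ler_sqr ?nnegrE ?divr_ge0// (le_trans _ sx)// divr_ge0.
move: (sin x ^+ 2) => S.
have -> : (x *+ 2) ^+ 2 / 18 = 2 * (x / 3) ^+ 2 by rewrite -mulr_natr; field.
have -> : 1 - ((1 - S) *+ 2 - 1) = 2 * S by rewrite -mulr_natr; ring.
by rewrite ler_pM2l.
Qed.

Lemma bump_bounded j : exists2 C, 0 <= C & forall t, 0 <= t -> `|bump j t| <= C.
Proof.
have [C [C0 HC]] := flat_le (iter j (@dflat R) 1); exists C => // t t0.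
have [t1|/ltW t1] := leP 1 t; first by rewrite bump_out// normr0.
rewrite /bump normrM normrX normrN1 expr1n mul1r; apply: (le_trans (HC _)).
by rewrite ler_piMr// expr_le1 ?subr_ge0// gerBl.
Qed.

End trigonometric_bounds.

(** * The kernels as an approximate identity on Lipschitz functions supported away from {x_N = 0} *)

Section concentration.
Variables (R : realType) (n : nat) (a : R).
Hypothesis a1 : -1 < a.
Local Notation E := 'rV[R]_n.+1.
Notation mu := (@lebesgue_measure R).
Notation I := (`[0%R, pi]%classic : set R).
Notation P := (leb n.+1 \x mu)%E.
Notation Omega rho := (half_ball rho : set E).
Notation D2 := (Omega 2 `*` I).
Variables (eta : E -> R) (L del : R).
Hypotheses (meta : measurable_fun setT eta) (L0 : 0 <= L) (del0 : 0 < del) (del1 : del <= 1).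
Hypothesis eta1 : forall x, `|eta x| <= 1.
Hypothesis etaL : forall x y, `|eta x - eta y| <= L * enorm (x - y).
Hypothesis eta_out : forall x, eta x != 0 -> del <= x 0 ord_max.

Let mO rho : measurable (Omega rho) := @measurable_half_ball R n rho.
Let mI : measurable I. Proof. exact: measurable_itv. Qed.
Let mD := measurableX (mO 2) mI.
Let a10 : 0 < a + 1. Proof. by rewrite -ltrBlDr sub0r. Qed.

(** Bounds x_N^a for del / 2 <= x_N <= 2, whatever the sign of a. *)
Let Ca : R := (del / 2) `^ a + 2 `^ a.

Let Ca0 : 0 <= Ca. Proof. by rewrite addr_ge0 ?powR_ge0. Qed.

Let weight_le (y : E) : del / 2 <= y 0 ord_max -> y 0 ord_max <= 2 -> weight a y <= Ca.
Proof.
move=> y1 y2; have d2 : 0 < del / 2 by rewrite divr_gt0.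
have y0 : 0 < y 0 ord_max := lt_le_trans d2 y1.
rewrite /weight /Ca; have [a0|a0] := leP 0 a.
  by rewrite (@le_trans _ _ (2 `^ a)) ?lerDr ?powR_ge0// ge0_ler_powR ?nnegrE ?(ltW y0).
rewrite (@le_trans _ _ ((del / 2) `^ a)) ?lerDl ?powR_ge0//.
rewrite -[a]opprK ![_ `^ - - a]powRN lef_pV2 ?posrE ?powR_gt0//.
by rewrite ge0_ler_powR ?nnegrE ?(ltW y0) ?(ltW d2)// oppr_ge0 ltW.
Qed.

Let Ck_ex : exists2 C, 0 <= C & forall (lam c : R) (x y : E), 1 <= lam -> -1 <= c <= 1 ->
  Omega 1 x -> Omega 2 y -> `|Ff a (kl lam) c y x| <= C * lam.
Proof.
have [C1 C10 H1] := @bump_bounded R 1; have [C2 C20 H2] := @bump_bounded R 2.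
exists (2 * (a + 1) * C1 + 8 * C2).
  by rewrite addr_ge0// !mulr_ge0// ltW.
move=> lam c x y l1 c1 Ox Oy.
have x0 := half_ball_last Ox; have y0 := half_ball_last Oy.
have l0 : 0 < lam by exact: lt_le_trans l1.
have x1 : x 0 ord_max <= 1.
  by case: Ox => /= xr _; rewrite (le_trans (ler_norm _))// (le_trans (coord_le_enorm _ _))// ltW.
have y2 : y 0 ord_max <= 2.
  by case: Oy => /= yr _; rewrite (le_trans (ler_norm _))// (le_trans (coord_le_enorm _ _))// ltW.
have q0 : 0 <= qf c y x.
  by rewrite (le_trans _ (qf_ge y c1 (ltW x0)))// sqr_ge0.
have lq : 0 <= lam * qf c y x by rewrite mulr_ge0// ltW.
have B1 := H1 _ lq; have B2 := H2 _ lq.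
rewrite /Ff /kl expr0 expr1 mul1r.
move: (bump 1 _) (bump 2 _) B1 B2 => u1 u2 B1 B2.
apply: (le_trans (ler_normB _ _)); rewrite [leRHS]mulrDl lerD//.
  rewrite !normrM (gtr0_norm a10) normrN (ger0_norm (ler0n _ 2)).
  have -> : 2 * (a + 1) * C1 * lam = (a + 1) * (2 * (C1 * lam)) by ring.
  rewrite ler_wpM2l ?(ltW a10)// ler_wpM2l// (le_trans B1)//.
  by rewrite ler_peMr.
rewrite !normrM (gtr0_norm x0) (gtr0_norm y0) (gtr0_norm l0) normrN !(ger0_norm (ler0n _ 2)).
have -> : 8 * C2 * lam = 2 * 1 * 2 * 1 * (2 * (lam * C2)) by ring.
have cn : `|c| <= 1 by rewrite ler_norml.
apply: ler_pM.
- by rewrite !mulr_ge0 ?(ltW x0) ?(ltW y0).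
- by rewrite !mulr_ge0 ?(ltW l0).
- apply: ler_pM => //; [by rewrite !mulr_ge0 ?(ltW y0)|exact: ltW|].
  apply: ler_pM; [by rewrite mulr_ge0|exact: ltW| |exact: y2].
  by rewrite ler_wpM2l.
- by rewrite ler_wpM2l// ler_wpM2l ?(ltW l0).
Qed.

(** The cells on which the two halves of the kernel centred at x can matter: y within r of x in each
    coordinate, and theta within b of 0, respectively of pi. *)
Let A1 (x : E) (r b : R) : set (E * R) :=
  [set y : E | forall i, `|y 0 i - x 0 i| <= r] `*` `[0, b]%classic.
Let A2 (x : E) (r b : R) : set (E * R) :=
  [set y : E | forall i, `|y 0 i - x 0 i| <= r] `*` `[pi - b, pi]%classic.

(** Where the kernel does not vanish, |y - x|^2 and 2 (1 - e cos t) x_N y_N are both at most r^2. If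
    moreover eta y differs from eta x, one height is at least del, hence both are at least del / 2.
    So 1 - e cos t <= 2 r^2 / del^2, and [cos_upper] puts the angle within b = 6 r / del of 0 or of
    pi. *)
Let integrand_le (lam r b e C : R) (x y : E) (t : R) : 1 <= lam -> r = (Num.sqrt lam)^-1 ->
  r <= del / 2 -> b = 6 * r / del -> e * e = 1 -> Omega 1 x -> Omega 2 y -> I t ->
  `|Ff a (kl lam) (e * cos t) y x| <= C * lam -> 0 <= C ->
  `|(eta y - eta x) * weight a y * (sw a t * Ff a (kl lam) (e * cos t) y x)| <=
  L * r * Ca * (b `^ (a + 1) * (C * lam)) * \1_(if e == 1 then A1 x r b else A2 x r b) (y, t).
Proof.
move=> l1 rE rd bE ee Ox Oy It FC C0.
have x0 := half_ball_last Ox; have y0 := half_ball_last Oy.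
have l0 : 0 < lam by exact: lt_le_trans l1.
have r0 : 0 < r by rewrite rE invr_gt0 sqrtr_gt0.
have r2 : r ^+ 2 = lam^-1 by rewrite rE exprVn sqr_sqrtr// ltW.
have b0 : 0 < b by rewrite bE divr_gt0// mulr_gt0.
set K := L * r * Ca * (b `^ (a + 1) * (C * lam)).
have K0 : 0 <= K by rewrite !mulr_ge0 ?powR_ge0 ?(ltW r0) ?(ltW l0).
have rhs0 (A : set (E * R)) : 0 <= K * \1_A (y, t) by rewrite mulr_ge0.
have [q1|q1] := leP lam^-1 (qf (e * cos t) y x).
  by rewrite /Ff !kl_out// !mulr0 subrr !mulr0 normr0 rhs0.
have [->|ne] := eqVneq (eta y) (eta x).
  by rewrite subrr !mul0r normr0 rhs0.
have e1 : e = 1 \/ e = -1.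
  have : (e - 1) * (e + 1) = 0.
    have -> : (e - 1) * (e + 1) = e * e - 1 by ring.
    by rewrite ee subrr.
  move/eqP; rewrite mulf_eq0 => /orP[|/eqP e1]; first by rewrite subr_eq0 => /eqP; left.
  by right; apply/eqP; rewrite -addr_eq0 e1.
have c1 : e * cos t <= 1.
  case: e1 => ->; first by rewrite mul1r cos_le1.
  by rewrite mulN1r lerNl cos_geN1.
have t1 : 0 <= 2 * (1 - e * cos t) * y 0 ord_max * x 0 ord_max.
  by rewrite !mulr_ge0 ?subr_ge0 ?(ltW x0) ?(ltW y0).
have en : enorm (y - x) < r.
  rewrite -(@ltr_pXn2r _ 2) ?nnegrE ?enorm_ge0 ?(ltW r0)// enorm_sqr r2.
  by apply: le_lt_trans q1; rewrite /qf lerDl.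
have cl : `|y 0 ord_max - x 0 ord_max| < r.
  by have := coord_le_enorm (y - x) ord_max; rewrite !mxE => /le_lt_trans; apply.
have [yd xd] : del / 2 <= y 0 ord_max /\ del / 2 <= x 0 ord_max.
  have : del <= y 0 ord_max \/ del <= x 0 ord_max.
    have [y00|/eta_out] := eqVneq (eta y) 0; last by left.
    by right; apply: eta_out; rewrite eq_sym -y00.
  move: cl; rewrite ltr_distl => /andP[c2 c3] [d|d].
    by split; lra.
  by split; lra.
have q2 : 2 * (1 - e * cos t) * (del / 2) * (del / 2) <= r ^+ 2.
  rewrite r2; apply: le_trans (ltW q1); rewrite /qf.
  have d2 : 0 <= del / 2 by rewrite divr_ge0// ltW.
  have c2 : 0 <= 2 * (1 - e * cos t) by rewrite mulr_ge0// subr_ge0.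
  apply: (@le_trans _ _ (2 * (1 - e * cos t) * y 0 ord_max * x 0 ord_max)).
    apply: ler_pM => //; first exact: mulr_ge0.
    by rewrite ler_wpM2l.
  by rewrite lerDr dotp_ge0.
have [t0 tpi] : 0 <= t /\ t <= pi by move: It => /=; rewrite in_itv/= => /andP.
have ang s : 0 <= s <= pi -> cos s = e * cos t -> s <= b.
  move=> s0pi cs; have s0 : 0 <= s by case/andP: s0pi.
  have := cos_upper s0pi; rewrite cs => H.
  rewrite -ler_sqr ?nnegrE ?(ltW b0)// bE expr_div_n ler_pdivlMr ?exprn_gt0//.
  have -> : (6 * r) ^+ 2 = 36 * r ^+ 2 by ring.
  apply: le_trans (ler_wpM2l _ q2) => //.
  have -> : 36 * (2 * (1 - e * cos t) * (del / 2) * (del / 2)) = 18 * (1 - e * cos t) * del ^+ 2 by field.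
  by rewrite ler_wpM2r ?sqr_ge0// -ler_pdivrMl// mulrC.
have [tA sb] : (if e == 1 then A1 x r b else A2 x r b) (y, t) /\ `|sin t| <= b.
  have yQ i : `|y 0 i - x 0 i| <= r.
    by have := coord_le_enorm (y - x) i; rewrite !mxE => /le_trans; apply; exact: ltW.
  case: e1 => eE.
    rewrite eE eqxx; have tb : t <= b by apply: ang; rewrite ?t0// eE mul1r.
    split; last by rewrite (le_trans (sin_le t0)).
    by split => //=; rewrite in_itv/= t0.
  have -> : (e == 1) = false by rewrite eE eq_sym -addr_eq0; apply/negbTE; rewrite gt_eqF// addr_gt0.
  have tb : pi - t <= b.
    apply: ang; first by rewrite subr_ge0 tpi gerBl.
    by rewrite eE mulN1r -(opprB t pi) cosN cosB cospi sinpi mulr0 addr0 mulrN1.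
  split; first by split => //=; rewrite in_itv/= tpi lerBlDr -lerBlDl tb.
  have -> : sin t = sin (pi - t) by rewrite sinB sinpi cospi mul0r sub0r mulN1r opprK.
  by rewrite (le_trans (sin_le _))// subr_ge0.
rewrite indicE mem_set// mulr1 !normrM.
have y2 : y 0 ord_max <= 2.
  by case: Oy => /= yr _; rewrite (le_trans (ler_norm _))// (le_trans (coord_le_enorm _ _))// ltW.
rewrite ler_pM ?mulr_ge0//.
  rewrite ler_pM//; last by rewrite ger0_norm ?powR_ge0// weight_le.
  by rewrite (le_trans (etaL _ _))// ler_wpM2l// ltW.
rewrite ler_pM// ger0_norm ?powR_ge0//.
by rewrite /sw ge0_ler_powR ?nnegrE ?(ltW a10) ?(ltW b0).
Qed.

Lemma concentrate : exists C lam0 : R, [/\ 0 <= C, 4 <= lam0 & forall lam, lam0 <= lam ->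
  forall x, Omega 1 x ->
  `|Sy a 2 (fun y => eta y * weight a y) lam x - total_mass n a * eta x| <= C / Num.sqrt lam].
Proof.
have [Ck Ck0 HCk] := Ck_ex.
(* Lipschitz constant, weight, angular weight, angular width and kernel bound; 2^(n + 2) accounts
   for two cells of side 2 r in n + 1 directions. The threshold 4 / del^2 means r <= del / 2. *)
pose C := L * Ca * (6 / del) `^ (a + 1) * (6 / del) * Ck * 2 ^+ n.+2.
exists C, (4 / del ^+ 2); split.
- rewrite /C mulr_ge0 ?exprn_ge0// mulr_ge0// mulr_ge0 ?divr_ge0 ?(ltW del0)//.
  by rewrite mulr_ge0 ?powR_ge0// mulr_ge0.
- by rewrite ler_peMr// invf_ge1 ?exprn_gt0// expr_le1// ltW.
move=> lam lam4 x Ox.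
have d20 : 0 < del ^+ 2 by exact: exprn_gt0.
have l0 : 0 < lam by apply: lt_le_trans lam4; rewrite divr_gt0.
have l1 : 1 <= lam.
  apply: le_trans lam4; rewrite (@le_trans _ _ 4) ?ler1n//.
  by rewrite ler_peMr// invf_ge1// expr_le1// ltW.
set r := (Num.sqrt lam)^-1; set b := 6 * r / del.
have sl0 : 0 < Num.sqrt lam by rewrite sqrtr_gt0.
have r0 : 0 < r by rewrite invr_gt0.
have r2 : r ^+ 2 = lam^-1 by rewrite /r exprVn sqr_sqrtr// ltW.
have rd : r <= del / 2.
  rewrite -ler_sqr ?nnegrE ?divr_ge0 ?(ltW r0) ?(ltW del0)// r2 expr_div_n.
  rewrite -[leRHS]invrK lef_pV2 ?posrE ?invr_gt0 ?divr_gt0 ?exprn_gt0// invf_div.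
  by apply: le_trans lam4; rewrite -natrX.
have b0 : 0 < b by rewrite divr_gt0// mulr_gt0.
have x0 := half_ball_last Ox.
have xr : enorm x + r < 2.
  have r1 : r <= 1.
    by apply: (le_trans rd); rewrite ler_pdivrMr// (le_trans del1)// mul1r ler1n.
  case: Ox => /= x1 _; apply: (lt_le_trans (ltr_leD x1 r1)).
  by rewrite -[1 + 1]/(2%:R).
rewrite -(massE a1 l0 (ltW x0) xr) (mulrC _ (eta x)).
pose k (z : E * R) := comb a (kl lam) [:: (1, x)] (cos z.2) z.1.
have adm : admissible 2 k by apply: comb_admissible; exact: jet_kl.
have mwt : measurable_fun (Omega 2) (weight a : E -> R).
  by apply: measurable_funTS; exact: measurable_weight.
have mew : measurable_fun (Omega 2) (fun y => eta y * weight a y).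
  by apply: measurable_funM => //; exact: measurable_funTS.
have wb (y : E) : Omega 2 y -> `|weight a y| <= 1 * weight a y.
  by move=> _; rewrite mul1r ger0_norm// powR_ge0.
have ewb (y : E) : Omega 2 y -> `|eta y * weight a y| <= 1 * weight a y.
  by move=> _; rewrite normrM (ger0_norm (powR_ge0 _ _)) ler_wpM2r ?powR_ge0.
have i1 := avg_integrable a1 (ltr0n R 2) mew ewb adm.
have i2 := avg_integrable a1 (ltr0n R 2) mwt wb adm.
pose F (z : E * R) := (eta z.1 - eta x) * weight a z.1 * (sw a z.2 * k z).
have FE : Sy a 2 (fun y => eta y * weight a y) lam x - eta x * Sy a 2 (weight a) lam x =
    lam `^ hdim n a * \int[P]_(z in D2) F z.
  rewrite /Sy /Sw mulrCA -mulrBr; congr (_ * _).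
  have i3 : P.-integrable D2 (EFin \o (fun z : E * R => eta x * (weight a z.1 * (sw a z.2 * k z)))).
    rewrite (_ : EFin \o _ = fun z : E * R =>
      ((eta x)%:E * (weight a z.1 * (sw a z.2 * k z))%:E)%E)//.
    by apply: integrableZl => //; exact: i2.
  have E2 : eta x * \int[P]_(z in D2) (weight a z.1 * (sw a z.2 * k z)) =
      \int[P]_(z in D2) (eta x * (weight a z.1 * (sw a z.2 * k z))).
    by rewrite RintegralZl.
  apply: etrans (f_equal (fun u => _ - u) E2) _.
  have E3 : \int[P]_(z in D2) (eta z.1 * weight a z.1 * (sw a z.2 * k z)) -
      \int[P]_(z in D2) (eta x * (weight a z.1 * (sw a z.2 * k z))) = \int[P]_(z in D2) F z.
    rewrite -RintegralB//.
    by apply: eq_Rintegral => z _; rewrite /F; ring.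
  exact: E3.
rewrite FE normrM (ger0_norm (powR_ge0 _ _)).
pose K := L * r * Ca * (b `^ (a + 1) * (Ck * lam)).
have K0 : 0 <= K by rewrite !mulr_ge0 ?powR_ge0 ?(ltW r0) ?(ltW l0).
pose Q := [set y : E | forall i, `|y 0 i - x 0 i| <= r].
have mQ : measurable Q.
  apply: (@measurable_box R n.+1 (fun i => [set t : R | `|t - x 0 i| <= r])) => i.
  rewrite (_ : mkset _ = `[x 0 i - r, x 0 i + r]%classic); first exact: measurable_itv.
  by apply/seteqP; split => t /=; rewrite in_itv/= ler_distl.
have QE : leb n.+1 Q = ((r *+ 2) ^+ n.+1)%:E by exact: leb_cube (ltW r0).
pose p := (r *+ 2) ^+ n.+1 * b.
have itv (u v : R) : v - u = b -> P (Q `*` `[u, v]%classic) = p%:E.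
  move=> uv; rewrite product_measure1E//.
  have muE : mu `[u, v]%classic = b%:E.
    by rewrite lebesgue_measure_itv/= lte_fin -subr_gt0 uv b0 -EFinB uv.
  apply: etrans (f_equal2 _ QE muE) _; by rewrite -EFinM.
have ind (u v : R) : v - u = b ->
    P.-integrable D2 (EFin \o \1_(Q `*` `[u, v]%classic)) /\
    \int[P]_(z in D2) \1_(Q `*` `[u, v]%classic) z <= p.
  move=> uv; have mA : measurable (Q `*` `[u, v]%classic) by apply: measurableX.
  have PA := itv u v uv.
  have le : (\int[P]_(z in D2) (\1_(Q `*` `[u, v]%classic) z)%:E <= p%:E)%E.
    rewrite integral_indic// -PA; apply: le_measure; rewrite ?inE//.
    exact: measurableI.
  have fin : P.-integrable D2 (EFin \o \1_(Q `*` `[u, v]%classic)).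
    apply/integrableP; split; first by apply/measurable_EFinP; exact: measurable_indic.
    under eq_integral do rewrite gee0_abs ?lee_fin//.
    by apply: le_lt_trans le _; rewrite ltry.
  by split => //; rewrite /Rintegral -lee_fin fineK//; exact: integrable_fin_num fin.
have b1 : b - 0 = b by rewrite subr0.
have b2 : pi - (pi - b) = b by rewrite subKr.
have [iA1 A1p] := ind _ _ b1; have [iA2 A2p] := ind _ _ b2.
have mF : measurable_fun D2 F.
  apply: (@measurable_mean_integrand R n a 2 a1 (fun y => (eta y - eta x) * weight a y)).
    apply: measurable_funM => //; apply: measurable_funB => //.
    exact: measurable_funTS.
  by case: adm.
pose G z := K * (\1_(A1 x r b) z + \1_(A2 x r b) z).
have iG : P.-integrable D2 (EFin \o G).
  rewrite (_ : EFin \o _ = fun z : E * R =>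
    (K%:E * ((\1_(A1 x r b) z)%:E + (\1_(A2 x r b) z)%:E))%E)//.
  by apply: integrableZl => //; apply: integrableD.
have FG z : D2 z -> `|F z| <= G z.
  move=> [Oz Iz]; have zE : z = (z.1, z.2) by case: (z).
  have cr1 : -1 <= 1 * cos z.2 <= 1 by rewrite mul1r cos_geN1 cos_le1.
  have cr2 : -1 <= -1 * cos z.2 <= 1 by rewrite mulN1r lerN2 cos_le1 lerNl cos_geN1.
  have kE : k z = Ff a (kl lam) (1 * cos z.2) z.1 x + Ff a (kl lam) (-1 * cos z.2) z.1 x.
    by rewrite /k /comb big_seq1 mul1r /kf mul1r mulN1r.
  have H e (ee : e * e = 1) (cr : -1 <= e * cos z.2 <= 1) := integrand_le l1 erefl rd erefl ee Ox Oz Iz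
    (HCk lam _ x z.1 l1 cr Ox Oz) Ck0.
  have ee1 : 1 * 1 = 1 :> R by rewrite mulr1.
  have ee2 : -1 * -1 = 1 :> R by rewrite mulrNN mulr1.
  have FE2 (X F1 F2 : R) : X * (sw a z.2 * (F1 + F2)) = X * (sw a z.2 * F1) + X * (sw a z.2 * F2).
    by ring.
  rewrite /F kE FE2; apply: (le_trans (ler_normD _ _)).
  rewrite /G (mulrDr K).
  have := H 1 ee1 cr1; have := H (-1) ee2 cr2; rewrite eqxx -zE.
  have -> : (-1 == 1 :> R) = false by rewrite eq_sym -addr_eq0; apply/negbTE; rewrite gt_eqF// addr_gt0.
  by move=> h2 h1; exact: lerD h1 h2.
apply: (le_trans (ler_wpM2l (powR_ge0 _ _) (@le_norm_Rintegral_bound _ _ R P D2 mD F G mF FG iG))).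
have -> : \int[P]_(z in D2) G z =
    K * (\int[P]_(z in D2) \1_(A1 x r b) z + \int[P]_(z in D2) \1_(A2 x r b) z).
  have iS : P.-integrable D2 (EFin \o (fun z : E * R => \1_(A1 x r b) z + \1_(A2 x r b) z)).
    rewrite (_ : EFin \o _ = fun z : E * R =>
      ((\1_(A1 x r b) z)%:E + (\1_(A2 x r b) z)%:E)%E)//.
    by apply: integrableD.
  by rewrite -RintegralD// -RintegralZl.
apply: (le_trans (ler_wpM2l (powR_ge0 _ _) (ler_wpM2l K0 (lerD A1p A2p)))).
rewrite le_eqVlt; apply/orP; left; apply/eqP.
have b1E : b `^ (a + 1) = (6 / del) `^ (a + 1) * r `^ (a + 1).
  rewrite -powRM ?divr_ge0 ?(ltW del0) ?(ltW r0)//; congr (_ `^ _).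
  by rewrite /b mulrAC.
have lE : lam = r ^- 2 by rewrite r2 invrK.
have l2 : lam `^ hdim n a = r `^ (- (n%:R + 1 + a)).
  rewrite lE -powR_invn ?(ltW r0)// -powRrM; congr (_ `^ _).
  by rewrite /hdim; field.
have rD p' q : r `^ (p' + q) = r `^ p' * r `^ q by rewrite powRD// (gt_eqF r0) implybT.
(* All powers of r cancel except the one due to the Lipschitz bound. *)
have key : lam `^ hdim n a * r `^ (a + 1) * lam * r ^+ n.+1 * r = 1.
  have r21 : r ^- 2 = r `^ (- 2%:R) by rewrite powR_invn// ltW.
  have rn1 : r ^+ n.+1 = r `^ n.+1%:R by rewrite powR_mulrn// ltW.
  have r11 : r = r `^ 1 by rewrite powRr1// ltW.
  rewrite l2 lE r21 rn1 [X in _ * X = _]r11 -!rD [X in r `^ X](_ : _ = 0) ?powRr0//.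
  by rewrite -natr1; ring.
rewrite /K /p b1E -[r *+ 2]mulr_natr exprMn /C -/r /b.
have -> : 2 ^+ n.+2 = 2 * 2 ^+ n.+1 :> R by rewrite exprS.
transitivity (L * Ca * (6 / del) `^ (a + 1) * (6 / del) * Ck * (2 * 2 ^+ n.+1) * r *
    (lam `^ hdim n a * r `^ (a + 1) * lam * r ^+ n.+1 * r)); last by rewrite key mulr1.
by field; rewrite gt_eqF.
Qed.

End concentration.

Section ramp.
Variable R : realType.

(** A Lipschitz approximation from below of the indicator of s > 0: it is 0 up to 1 / (k + 1) and 1
    from 2 / (k + 1) on. *)
Definition ramp (k : nat) (s : R) : R := Num.min 1 (Num.max 0 (s * k.+1%:R - 1)).

Lemma ramp_range k (s : R) : 0 <= ramp k s <= 1.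
Proof. by rewrite /ramp le_min ler01 le_max lexx/= ge_min lexx. Qed.

Lemma ramp_neq0 k (s : R) : ramp k s != 0 -> k.+1%:R^-1 <= s.
Proof.
apply: contra_neqT; rewrite -ltNge => sk; rewrite /ramp.
have h : s * k.+1%:R - 1 <= 0.
  by rewrite subr_le0 -ler_pdivlMr// mul1r ltW.
by rewrite (max_idPl h) (min_idPr ler01).
Qed.

Lemma ramp_lip k (s t : R) : `|ramp k s - ramp k t| <= k.+1%:R * `|s - t|.
Proof.
wlog st : s t / s <= t.
  move=> H; have [/H//|/ltW/H] := leP s t.
  by rewrite distrC [in leRHS]distrC.
have h : s * k.+1%:R - 1 <= t * k.+1%:R - 1 by rewrite lerD2r ler_wpM2r.
have d : (t * k.+1%:R - 1) - (s * k.+1%:R - 1) = k.+1%:R * (t - s) by ring.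
have d0 : 0 <= k.+1%:R * (t - s) by rewrite mulr_ge0// subr_ge0.
rewrite distrC (distrC s t) (ger0_norm (x := t - s)) ?subr_ge0// -d; move: d0; rewrite -d.
rewrite /ramp; move: (s * _ - 1) (t * _ - 1) h => A B AB BA.
rewrite ler_norml; apply/andP; split.
  by rewrite /Num.min /Num.max; do ![case: ifPn]; rewrite -?leNgt; lra.
by rewrite /Num.min /Num.max; do ![case: ifPn]; rewrite -?leNgt; lra.
Qed.

Lemma ramp_cvg (s : R) : ramp k s @[k --> \oo] --> (if 0 < s then 1 else 0 : R).
Proof.
have [s0|s0] := ltP 0 s; apply: cvg_near_cst; last first.
  apply: nearW => k; apply/eqP; apply: contraT => /ramp_neq0 H.
  have : (0 : R) < k.+1%:R^-1 by rewrite invr_gt0.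
  by move/lt_le_trans => /(_ _ H); rewrite ltNge s0.
have := near_large 1 s0; apply: filterS => k H; rewrite /ramp.
by rewrite (max_idPr (le_trans ler01 H)) (min_idPl H).
Qed.

End ramp.

Section lipschitz_cutoffs.
Variables (R : realType) (n : nat).
Local Notation E := 'rV[R]_n.

Definition lip01 (f : E -> R) := (forall x, `|f x| <= 1) /\
  exists2 K, 0 <= K & forall x y, `|f x - f y| <= K * enorm (x - y).

Lemma lip01_mul f g : lip01 f -> lip01 g -> lip01 (fun x => f x * g x).
Proof.
move=> [f1 [K K0 fK]] [g1 [L L0 gL]]; split=> [x|].
  by rewrite normrM -[1]mulr1 ler_pM.
exists (K + L); first exact: addr_ge0.
move=> x y; have -> : f x * g x - f y * g y = (f x - f y) * g x + f y * (g x - g y) by ring.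
apply: (le_trans (ler_normD _ _)); rewrite [leRHS]mulrDl !normrM lerD//.
  by rewrite -[leRHS]mulr1 ler_pM.
by rewrite -[leRHS]mul1r ler_pM.
Qed.

Lemma lip01_prod (I : Type) (r : seq I) (f : I -> E -> R) : (forall i, lip01 (f i)) ->
  lip01 (fun x => \prod_(i <- r) f i x).
Proof.
move=> lf; elim: r => [|i r IH].
  under eq_fun do rewrite big_nil; split=> [x|]; first by rewrite normr1.
  by exists 0 => // x y; rewrite subrr normr0 mul0r.
by under eq_fun do rewrite big_cons; exact: lip01_mul.
Qed.

Lemma enorm_le_norm (x : E) : enorm x <= n%:R * `|x|.
Proof.
rewrite -ler_sqr ?nnegrE ?enorm_ge0 ?mulr_ge0// enorm_sqr exprMn (le_trans (dotp_le_norm x))//.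
rewrite ler_wpM2r ?sqr_ge0// -natrX ler_nat expnS expn1.
by case: n => // k; rewrite leq_pmulr.
Qed.

Lemma lip01_continuous f : lip01 f -> continuous f.
Proof.
move=> [_ [K K0 fK]] x; apply/(@cvgrPdist_le _ R^o _ (nbhs (x : E))) => e e0.
have M0 : 0 < K * n%:R + 1 by rewrite ltr_wpDl// mulr_ge0.
have eM : 0 < e / (K * n%:R + 1) by rewrite divr_gt0.
have H := @cvgr_dist_le _ E _ _ _ id x (@cvg_id _ (nbhs (x : E))) _ eM.
have FF : Filter (nbhs (x : E)) := nbhs_filter _.
apply: (@filterS _ (nbhs (x : E)) FF _ _ _ (H FF)) => y Hy; rewrite (le_trans (fK x y))//.
apply: (le_trans (ler_wpM2l K0 (enorm_le_norm _))); rewrite mulrA.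
rewrite (@le_trans _ _ ((K * n%:R + 1) * `|x - y|))//.
  by rewrite ler_wpM2r// lerDl.
by rewrite mulrC -ler_pdivlMr.
Qed.

Lemma enorm_diff (x y : E) : `|enorm x - enorm y| <= enorm (x - y).
Proof.
rewrite ler_norml; apply/andP; split; last first.
  by have := enormD (x - y) y; rewrite subrK; lra.
by have := enormD (y - x) x; rewrite subrK -(enormN (y - x)) opprB; lra.
Qed.

Lemma lip01_ramp k (g : E -> R) : (forall x y, `|g x - g y| <= enorm (x - y)) ->
  lip01 (fun x => ramp k (g x)).
Proof.
move=> gl; split=> [x|].
  by have /andP[h0 h1] := ramp_range k (g x); rewrite ger0_norm.
exists k.+1%:R => // x y; rewrite (le_trans (ramp_lip _ _ _))//.
by rewrite ler_wpM2l.
Qed.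

End lipschitz_cutoffs.

(** * Identification of u with the final value of its means *)

Section ae_identity.
Variables (R : realType) (n : nat) (a : R).
Hypothesis a1 : -1 < a.
Local Notation E := 'rV[R]_n.+1.
Notation Omega rho := (half_ball rho : set E).
Variables (u v : E -> R) (M : R).
Hypotheses (mu : measurable_fun (Omega 1) u) (mv : measurable_fun (Omega 4^-1) v).
Hypotheses (M0 : 0 <= M) (uM : forall x, Omega 1 x -> `|u x| <= M).
Hypothesis vM : forall x, Omega 4^-1 x -> `|v x| <= M.
Let w1 (x : E) : R := u x * weight a x.
Hypothesis Sv : forall (lam : R) y, Omega 4^-1 y -> 4 <= lam -> 1 <= lam * y 0 ord_max ^+ 2 ->
  Sy a 1 w1 lam y = total_mass n a * v y.

Let mO rho : measurable (Omega rho) := @measurable_half_ball R n rho.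
Let r1 : (0 : R) < 1. Proof. exact: ltr01. Qed.
Let r2 : (0 : R) < 2. Proof. exact: ltr0n. Qed.
Let U0 : set E := Omega 4^-1.

Let U1 : U0 `<=` Omega 1.
Proof. by apply: half_ball_sub; rewrite invf_le1// ler1n. Qed.

Let U2 : U0 `<=` Omega 2.
Proof.
apply: subset_trans U1 _; apply: half_ball_sub.
by rewrite ler1n.
Qed.

Let mw1 : measurable_fun (Omega 1) w1.
Proof.
apply: measurable_funM => //; apply: measurable_funTS; exact: measurable_weight.
Qed.

Let w1M x : Omega 1 x -> `|w1 x| <= M * weight a x.
Proof.
by move=> Ox; rewrite normrM (ger0_norm (powR_ge0 _ _)) ler_wpM2r ?powR_ge0// uM.
Qed.

Let Rsub (A B : set E) (f : E -> R) : A `<=` B -> (forall x, ~ A x -> f x = 0) ->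
  \int[leb n.+1]_(x in B) f x = \int[leb n.+1]_(x in A) f x.
Proof.
move=> AB f0; rewrite Rintegral_mkcond [RHS]Rintegral_mkcond.
apply: eq_Rintegral => x _; rewrite !patchE.
have [xA|] := boolP (x \in A); first by rewrite mem_set//; apply: AB; rewrite inE in xA.
by rewrite notin_setE => xA; case: ifP => // _; rewrite f0.
Qed.

Let g (x : E) : R := (u x - v x) * weight a x * \1_U0 x.

Let mU0 : measurable U0. Proof. exact: mO. Qed.

Let ib (h : E -> R) (B : R) : measurable_fun U0 h -> (forall x, U0 x -> `|h x| <= B) ->
  (leb n.+1).-integrable U0 (EFin \o (fun x => h x * weight a x)).
Proof.
move=> mh hB.
have r4 : (0 : R) < 4^-1 by rewrite invr_gt0.
apply: (integrable_bound (g := fun x : E => B * weight a x) mU0); last exact: integrable_dominating.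
  by apply: measurable_funM => //; apply: measurable_funTS; exact: measurable_weight.
by move=> x Ux; rewrite normrM (ger0_norm (powR_ge0 _ _)) ler_wpM2r ?powR_ge0// hB.
Qed.

Let muU : measurable_fun U0 u. Proof. exact: measurable_funS U1 mu. Qed.

Let ig0 : (leb n.+1).-integrable U0 (EFin \o (fun x => (u x - v x) * weight a x)).
Proof.
apply: (@ib _ (M + M)); first exact: measurable_funB.
move=> x Ux; apply: (le_trans (ler_normB _ _)); apply: lerD; last exact: vM.
by apply: uM; exact: U1.
Qed.

Let ig : (leb n.+1).-integrable setT (EFin \o g).
Proof.
have := (integrable_restrict (leb n.+1) mU0 (@measurableT _ E)
  (EFin \o (fun x => (u x - v x) * weight a x))).1.
rewrite setTI => /(_ ig0); apply: eq_integrable => // x _; rewrite patchE /g /= indicE.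
by case: ifP => _; rewrite ?mulr1// mulr0.
Qed.

Let weight_le del x : 0 < del -> U0 x -> del <= x 0 ord_max -> weight a x <= del `^ a + 1.
Proof.
move=> d0 Ux dx; rewrite /weight.
have x0 : 0 < x 0 ord_max by exact: lt_le_trans dx.
have x1 : x 0 ord_max <= 1.
  case: Ux => /= xr _; rewrite (le_trans (ler_norm _))// (le_trans (coord_le_enorm _ _))// ltW//.
  by rewrite (lt_trans xr)// invf_lt1// ltr1n.
have [a0|a0] := leP 0 a.
  rewrite (@le_trans _ _ 1) ?lerDr ?powR_ge0//.
  have := @ge0_ler_powR R a a0 (x 0 ord_max) 1.
  by rewrite !nnegrE (ltW x0) ler01 powR1; apply.
rewrite (@le_trans _ _ (del `^ a)) ?lerDl//.
rewrite -[a]opprK powRN [leRHS]powRN lef_pV2 ?posrE ?powR_gt0//.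
have na : 0 <= - a by rewrite oppr_ge0 ltW.
by apply: (@ge0_ler_powR R _ na); [exact: ltW|exact: ltW|].
Qed.

(** By [mean_swap], u x_N^a integrated against the means of eta x_N^a equals eta x_N^a integrated
    against the means of u x_N^a. For large lam the latter is c0 times the integral of v eta x_N^a,
    because eta lives where x_N >= del; by [concentrate] the former tends to c0 times the integral
    of u eta x_N^a. *)
Let g_eta (eta : E -> R) (del : R) : lip01 eta -> 0 < del -> del <= 1 ->
  (forall x, eta x != 0 -> U0 x /\ del <= x 0 ord_max) ->
  \int[leb n.+1]_x (g x * eta x) = 0.
Proof.
move=> le d0 d1 es; have [e1 [L L0 eL]] := le.
have me : measurable_fun setT eta by apply: continuous_measurable_rV; exact: lip01_continuous.
have meO rho : measurable_fun (Omega rho) eta by exact: measurable_funTS.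
have es2 x : eta x != 0 -> del <= x 0 ord_max by move=> /es[].
have [C [lam0 [C0 l04 Hc]]] := concentrate a1 me L0 d0 d1 e1 eL es2.
pose w2 (x : E) : R := eta x * weight a x.
have mwt rho : measurable_fun (Omega rho) (weight a : E -> R).
  by apply: measurable_funTS; exact: measurable_weight.
have mw2 rho : measurable_fun (Omega rho) w2 by exact: measurable_funM.
have ev0 x : ~ U0 x -> eta x = 0.
  by move=> nU; apply/eqP; apply: contra_notT nU => /es[].
have w2W x : Omega 2 x -> `|w2 x| <= 1 * weight a x.
  by move=> _; rewrite normrM (ger0_norm (powR_ge0 _ _)) ler_wpM2r ?powR_ge0.
have B0 : 0 <= del `^ a + 1 by rewrite addr_ge0// powR_ge0.
have w2B x : Omega 2 x -> `|w2 x| <= del `^ a + 1.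
  move=> _; have [z|nz] := eqVneq (eta x) 0; first by rewrite /w2 z mul0r normr0.
  have [Ux dx] := es _ nz; rewrite normrM (ger0_norm (powR_ge0 _ _)).
  by rewrite -[leRHS]mul1r ler_pM// ?powR_ge0// weight_le.
set c0 := total_mass n a.
pose Jv := \int[leb n.+1]_(x in U0) (v x * eta x * weight a x).
pose Ju := \int[leb n.+1]_(x in U0) (u x * eta x * weight a x).
have vB x : U0 x -> `|v x * eta x| <= M.
  by move=> Ux; rewrite normrM -[leRHS]mulr1 ler_pM// vM.
have uB x : U0 x -> `|u x * eta x| <= M.
  by move=> Ux; rewrite normrM -[leRHS]mulr1 ler_pM// uM//; exact: U1.
have iv := ib (measurable_funM mv (meO _)) vB.
have iu := ib (measurable_funM muU (meO _)) uB.
have iS lam : measurable_fun (Omega 1) (Sy a 2 w2 lam) /\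
    (leb n.+1).-integrable (Omega 1) (EFin \o (fun x => w1 x * Sy a 2 w2 lam x)).
  have [CS CS0 HS] := Sy_C2 n a1 r2 lam 1.
  have [dS _ bS _ _] := HS w2 1 (mw2 2) ler01 w2W.
  have mS : measurable_fun (Omega 1) (Sy a 2 w2 lam).
    apply: measurable_funTS; apply: continuous_measurable_rV => x.
    by apply: differentiable_continuous; exact: dS.
  split=> //.
  apply: (integrable_bound (g := fun x : E => M * CS * weight a x) (mO 1)); last exact: integrable_dominating.
    exact: measurable_funM.
  move=> x Ox; rewrite normrM mulrAC; apply: ler_pM => //; first exact: w1M.
  rewrite -[leRHS]mul1r; apply: bS; case: Ox => /= xr _.
  exact: le_trans (norm_le_enorm x) (ltW xr).
have sw lam : 4 <= lam -> del ^- 2 <= lam ->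
    \int[leb n.+1]_(x in Omega 1) (w1 x * Sy a 2 w2 lam x) = c0 * Jv.
  move=> l4 ld; have l0 : 0 < lam by exact: lt_le_trans l4.
  have h0 : lam `^ (hdim n a) != 0 by rewrite gt_eqF// powR_gt0.
  have := mean_swap a1 r1 r2 mw1 (mw2 2) w1M w2B (jet_kl lam).
  have -> : \int[leb n.+1]_(x in Omega 1) (w1 x * mean a 2 w2 (comb a (kl lam) [:: (1, x)])) =
      (lam `^ (hdim n a))^-1 * \int[leb n.+1]_(x in Omega 1) (w1 x * Sy a 2 w2 lam x).
    rewrite -RintegralZl//; last exact: (iS lam).2.
    by apply: eq_Rintegral => x _; rewrite mulrCA; congr (_ * _); rewrite /Sy /Sw mulKf.
  rewrite (Rsub U2); last by move=> x nx; rewrite /w2 ev0// !mul0r.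
  have -> : \int[leb n.+1]_(y in U0) (w2 y * mean a 1 w1 (comb a (kl lam) [:: (1, y)])) =
      (lam `^ (hdim n a))^-1 * (c0 * Jv).
    rewrite mulrA -RintegralZl//.
    apply: eq_Rintegral => y yU; have {}yU : U0 y by rewrite inE in yU.
    have [z|nz] := eqVneq (eta y) 0; first by rewrite /w2 z mulr0 !mul0r mulr0.
    have [_ dy] := es _ nz.
    have ly : 1 <= lam * y 0 ord_max ^+ 2.
      rewrite (@le_trans _ _ (del ^- 2 * del ^+ 2))//.
        by rewrite mulVf// expf_neq0// gt_eqF.
      apply: ler_pM => //; [by rewrite invr_ge0 sqr_ge0|exact: sqr_ge0|].
      by apply: lerXn2r => //; rewrite nnegrE; [exact: ltW|exact: le_trans (ltW d0) dy].
    have := Sv yU l4 ly; rewrite /Sy /Sw => e.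
    have -> : mean a 1 w1 (comb a (kl lam) [:: (1, y)]) = (lam `^ (hdim n a))^-1 * (c0 * v y).
      by rewrite -e mulKf.
    rewrite /w2; set p := _^-1; move: p (weight a y) => p q; ring.
  by move=> /(mulfI _) <- //; rewrite invr_neq0.
have ew1 : \int[leb n.+1]_(x in Omega 1) (w1 x * (c0 * eta x)) = c0 * Ju.
  rewrite (Rsub U1); last by move=> x nx; rewrite ev0// !mulr0.
  rewrite -RintegralZl//; apply: eq_Rintegral => x _; rewrite /w1; ring.
pose A := M * C * \int[leb n.+1]_(x in Omega 1) weight a x.
have fin lam : 4 <= lam -> del ^- 2 <= lam -> lam0 <= lam ->
    `|c0 * Jv - c0 * Ju| <= A / Num.sqrt lam.
  move=> l4 ld ll; rewrite -(sw lam)// -ew1 -RintegralB//; first last.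
  - apply: (integrable_bound (g := fun x : E => M * c0 * weight a x) (mO 1)); last exact: integrable_dominating.
      by apply: measurable_funM => //; exact: measurable_funM.
    move=> x Ox; rewrite normrM (_ : M * c0 * _ = M * weight a x * c0); last by ring.
    apply: ler_pM; [exact: normr_ge0|exact: normr_ge0|exact: w1M|].
    rewrite normrM gtr0_norm ?total_mass_gt0// -[leRHS]mulr1 ler_wpM2l//.
    by rewrite ltW// total_mass_gt0.
  - exact: (iS lam).2.
  have iW1 : (leb n.+1).-integrable (Omega 1) (EFin \o (weight a : E -> R)).
    apply: (integrable_bound (g := fun x : E => 1 * weight a x) (mO 1)) => //; last exact: integrable_dominating.
    by move=> x _; rewrite mul1r (ger0_norm (powR_ge0 _ _)).
  have -> : A / Num.sqrt lam =
      \int[leb n.+1]_(x in Omega 1) (M * C / Num.sqrt lam * weight a x).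
    by rewrite RintegralZl// /A; ring.
  apply: (le_norm_Rintegral_bound (mO 1)); last exact: integrable_dominating.
    apply: measurable_funB.
      by apply: measurable_funM => //; exact: (iS lam).1.
    by apply: measurable_funM => //; exact: measurable_funM.
  move=> x Ox; rewrite -mulrBr normrM.
  have -> : M * C / Num.sqrt lam * weight a x = (M * weight a x) * (C / Num.sqrt lam) by ring.
  by apply: ler_pM => //; [exact: w1M|exact: Hc].
have A0 : 0 <= A.
  by rewrite /A !mulr_ge0// Rintegral_ge0// => x _; exact: powR_ge0.
have JE : Ju = Jv.
  have c00 : c0 != 0 by rewrite gt_eqF// total_mass_gt0.
  apply: (mulfI c00); apply/eqP; rewrite eq_sym -subr_eq0 -normr_eq0.
  set D := `|_|; apply/negPn; apply/negP => D0.
  have Dp : 0 < D by rewrite lt_def D0 /D normr_ge0.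
  (* Large enough for s^2 to pass every threshold while A / s stays below D. *)
  pose s := 4 + del ^- 2 + lam0 + (A + 1) / D.
  have l00 : 0 <= lam0 by exact: le_trans l04.
  have di : 0 <= del ^- 2 by rewrite invr_ge0 sqr_ge0.
  have AD : 0 < (A + 1) / D by rewrite divr_gt0// ltr_wpDl.
  have s4 : 4 <= s by rewrite /s; lra.
  have s0 : 0 < s by lra.
  have ss : s <= s ^+ 2 by rewrite expr2 ler_peMr//; lra.
  have := fin (s ^+ 2).
  rewrite sqrtr_sqr (gtr0_norm s0) -/D.
  have H x : x <= s -> x <= s ^+ 2 by move=> /le_trans; apply.
  move=> /(_ (H _ s4)); have -> : del ^- 2 <= s ^+ 2 by apply: H; rewrite /s; lra.
  move=> /(_ isT); have -> : lam0 <= s ^+ 2 by apply: H; rewrite /s; lra.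
  move=> /(_ isT); rewrite ler_pdivlMr//; apply/negP; rewrite -ltNge.
  have : (A + 1) / D <= s by rewrite /s; lra.
  rewrite ler_pdivrMr// mulrC; lra.
have -> : \int[leb n.+1]_x (g x * eta x) = Ju - Jv.
  rewrite (@Rsub U0 setT)//; last by move=> x nx; rewrite ev0// mulr0.
  rewrite -RintegralB//; apply: eq_Rintegral => x xU.
  rewrite /g indicE xU mulr1; ring.
by rewrite JE subrr.
Qed.

(** The cutoffs eta approximate indicators of orthants, so g has zero integral over each of them and
    vanishes almost everywhere; the weight is positive on the half ball and can be divided out. *)
Lemma ae_identity : {ae leb n.+1, forall x, Omega 4^-1 x -> u x = v x}.
Proof.
have gb b : \int[leb n.+1]_(x in ray_box b) g x = 0.
  (* A Lipschitz approximation of the indicator of the half ball of radius 1/4 intersected with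
     [ray_box b], supported where x_N >= 1 / (k + 1). *)
  pose eta k (x : E) : R := ramp k (4^-1 - enorm x) *
    (ramp k (x 0 ord_max) * \prod_i ramp k (b 0 i - x 0 i)).
  have etal k : lip01 (eta k).
    apply: lip01_mul.
      apply: lip01_ramp => x y.
      rewrite (_ : _ - _ = enorm y - enorm x); last by ring.
      by rewrite distrC; exact: enorm_diff.
    apply: lip01_mul.
      by apply: lip01_ramp => x y; have := coord_le_enorm (x - y) ord_max; rewrite !mxE.
    apply: lip01_prod => i; apply: lip01_ramp => x y.
    have -> : b 0 i - x 0 i - (b 0 i - y 0 i) = - ((x - y) 0 i) by rewrite !mxE; ring.
    by rewrite normrN coord_le_enorm.
  have et0 k : \int[leb n.+1]_x (g x * eta k x) = 0.
    apply: (g_eta (etal k) (del := k.+1%:R^-1)).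
    - by rewrite invr_gt0.
    - by rewrite invf_le1// ler1n.
    - move=> x; rewrite /eta mulf_eq0 negb_or => /andP[/ramp_neq0 h1].
      rewrite mulf_eq0 negb_or => /andP[/ramp_neq0 h2 _]; split=> //.
      have k0 : (0 : R) < k.+1%:R^-1 by rewrite invr_gt0.
      split; last exact: lt_le_trans h2.
      by rewrite /eball/= -subr_gt0; exact: lt_le_trans h1.
  have mg : measurable_fun setT g by have /measurable_int/measurable_EFinP := ig.
  have igN : (leb n.+1).-integrable setT (EFin \o (fun x => `|g x|)) by exact: integrable_norm ig.
  have -> : \int[leb n.+1]_(x in ray_box b) g x = \int[leb n.+1]_x (g x * \1_(ray_box b) x).
    rewrite Rintegral_mkcond; apply: eq_Rintegral => x _; rewrite patchE indicE.
    by case: ifP => _; rewrite ?mulr1// mulr0.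
  have cv := @Rintegral_dominated _ _ _ (leb n.+1) setT measurableT
    (fun k x => g x * eta k x) (fun x => g x * \1_(ray_box b) x) (fun x => `|g x|).
  apply: (cvg_unique (@norm_hausdorff _ R^o) (cv _ _ _ igN _)) => //.
  - move=> k; apply: measurable_funM => //.
    by apply: continuous_measurable_rV; exact: lip01_continuous.
  - apply: measurable_funM => //; apply: measurable_indic; exact: measurable_ray_box.
  - move=> x _.
    have [Ux|nU] := pselect (U0 x); last first.
      rewrite /g indicE memNset// mulr0 !mul0r; apply: cvg_near_cst; apply: nearW => k.
      by rewrite mul0r.
    apply: cvgMr.
    have c1 := @ramp_cvg R (4^-1 - enorm x); have c2 := @ramp_cvg R (x 0 ord_max).
    have c3 : \prod_i ramp k (b 0 i - x 0 i) @[k --> \oo] -->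
        \prod_i (if 0 < b 0 i - x 0 i then 1 else 0 : R).
      elim: (index_enum _) => [|i r IH].
        by apply: cvg_near_cst; apply: nearW => k; rewrite !big_nil.
      under eq_fun do rewrite big_cons.
      by rewrite big_cons; apply: cvgM => //; exact: ramp_cvg.
    have c4 : eta k x @[k --> \oo] --> (if 0 < 4^-1 - enorm x then 1 else 0 : R) *
        ((if 0 < x 0 ord_max then 1 else 0) * \prod_i (if 0 < b 0 i - x 0 i then 1 else 0)).
      by apply: cvgM => //; exact: cvgM.
    move: c4; have [xr x0] := Ux; rewrite subr_gt0 xr x0 !mul1r.
    suff -> : \prod_i (if 0 < b 0 i - x 0 i then 1 else 0 : R) = \1_(ray_box b) x by [].
    rewrite indicE; case: (boolP (x \in _)) => [|xb].
      by rewrite inE => xb; apply: big1 => i _; rewrite subr_gt0 xb.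
    move: xb; rewrite notin_setE /ray_box/= => /existsNP[i /negP xi].
    by rewrite (bigD1 i)//= subr_gt0 (negbTE xi) mul0r.
  - move=> k x _; rewrite normrM ler_piMr//; exact: (etal k).1.
  - by apply: cvg_near_cst; apply: nearW => k; exact: et0.
have := ray_boxes_ae0 ig gb; apply: filterS => x /= H Ux.
have := H I; rewrite /g indicE mem_set// mulr1 => /eqP; rewrite mulf_eq0 => /orP[|].
  by rewrite subr_eq0 => /eqP.
by rewrite /weight gt_eqF// powR_gt0// (half_ball_last Ux).
Qed.

End ae_identity.

(** * Regularity of the limit *)

Section differentiability_tools.
Variables (R : realType) (m : nat).
Local Notation E := 'rV[R]_m.

Lemma near_eq_differentiable (f g : E -> R) (x : E) : (\forall z \near x, f z = g z) ->
  differentiable f x -> differentiable g x.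
Proof.
move=> fg /diff_locallyP[cf /eqaddoP fo].
have go : (g \o shift x : E -> R) = (cst (g x) + 'd f x : E -> R) +o_ (0 : E) id.
  apply/eqaddoP => e e0; have Hf := fo e e0.
  have fgx := nbhs_singleton fg.
  have fg0 : \forall d \near (0 : E), f (d + x) = g (d + x).
    have c : (fun d : E => d + x) @ nbhs (0 : E) --> (x : E).
      by rewrite -[X in _ --> X]add0r; apply: cvgD; [exact: cvg_id|exact: cvg_cst].
    exact: c _ fg.
  have FF : Filter (nbhs (0 : E)) := nbhs_filter _.
  apply: (@filterS2 _ (nbhs (0 : E)) FF _ _ _ _ fg0 Hf) => d e1.
  rewrite -[X in X -> _]/(is_true (`|f (d + x) - (f x + 'd f x d)| <= e * `|d|)).
  by rewrite e1 fgx.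
by apply/diff_locallyP; rewrite (diff_unique cf go).
Qed.

(** Passage to the limit in difference quotients; with g1 = g2 it turns bounds on second differences
    into bounds on increments of the derivative. *)
Lemma derive_diff_le (g1 g2 : E -> R) (y z e : E) L : derivable g1 y e -> derivable g2 z e ->
  (\forall h \near (0 : R)^',
    `|g1 (h *: e + y) - g1 y - (g2 (h *: e + z) - g2 z)| <= L * `|h|) ->
  `|'D_e g1 y - 'D_e g2 z| <= L.
Proof.
move=> d1 d2 H.
have FF : Filter ((0 : R)^') := dnbhs_filter _.
have /(_ FF) c0 := cvgB d1 d2; have /(_ FF) c := cvg_norm c0.
rewrite -(cvg_lim _ c)//; apply: limr_le; first by apply/cvg_ex; eexists; exact: c.
have h0 : \forall h \near (0 : R)^', h != 0 by exact: nbhs_dnbhs_neq.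
near=> h; have hn : h != 0 by near: h.
rewrite -[leLHS]/`|h^-1 * _ - h^-1 * _| -mulrBr normrM normfV mulrC ler_pdivrMr ?normr_gt0//.
by near: h.
Unshelve. all: by end_near. Qed.

End differentiability_tools.

Lemma le_powR (R : realType) (t p : R) : 0 < t <= 1 -> p <= 1 -> t <= t `^ p.
Proof.
move=> t01 p1; have t0 : 0 <= t by case/andP: t01 => /ltW.
by rewrite -{1}(powRr1 t0) ger_powR.
Qed.

(** The lower bound on the last coordinate lets one scale serve a whole neighbourhood. *)
Lemma near_half_ball (R : realType) n (r : R) (y : 'rV[R]_n.+1) : half_ball r y ->
  \forall z \near y, half_ball r z /\ y 0 ord_max / 2 <= z 0 ord_max.
Proof.
move=> [/= yr y0]; rewrite /eball/= in yr.
pose e := Num.min (y 0 ord_max / 2) ((r - enorm y) / (n.+1%:R *+ 2)).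
have n0 : 0 < n.+1%:R *+ 2 :> R by rewrite pmulrn_lgt0.
have e0 : 0 < e by rewrite lt_min !divr_gt0// subr_gt0.
have H := @cvgr_dist_le _ 'rV[R]_n.+1 _ _ _ id y (@cvg_id _ (nbhs y)) _ e0.
have FF : Filter (nbhs y) := nbhs_filter _.
apply: (@filterS _ (nbhs y) FF _ _ _ (H FF)) => z; rewrite /e le_min => /andP[h1 h2].
have zN : y 0 ord_max / 2 <= z 0 ord_max.
  have := le_trans (coord_le_norm (y - z) ord_max) h1; rewrite !mxE ler_norml => /andP[_].
  by lra.
split=> //; split; last by apply: lt_le_trans zN; rewrite divr_gt0.
rewrite /eball/=; have := enormD (z - y) y; rewrite subrK => /le_lt_trans; apply.
rewrite -ltrBrDr; apply: (le_lt_trans (enorm_le_norm _)).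
rewrite -[z - y]opprB normrN; apply: le_lt_trans (_ : _ <= (r - enorm y) / 2) _.
  apply: (le_trans (ler_wpM2l _ h2)) => //.
  by rewrite le_eqVlt; apply/orP; left; apply/eqP; field.
by rewrite ltr_pdivrMr// ltr_pMr ?subr_gt0// ltr1n.
Qed.

(** * Hoelder estimates for the limit, from the bounds on S and its scale derivative T alone *)

Section kernel_regularity.
Variables (R : realType) (n : nat) (a : R).
Hypotheses (a1 : -1 < a) (a2 : a < 1).
Local Notation E := 'rV[R]_n.+1.
Variables (S T : R -> E -> R) (B B' c0 : R).
Definition in_closed (y : E) := 0 <= y 0 ord_max /\ enorm y <= 4^-1.
Local Notation P := in_closed.
Hypotheses (B0 : 0 <= B) (B'0 : 0 <= B') (c00 : 0 < c0).
Hypothesis dS : forall (t : R) y, 0 < t -> is_derive t 1 (S^~ y) (T t y).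
Hypothesis T0 : forall (t : R) y, 4 <= t -> P y -> 1 <= t * y 0 ord_max ^+ 2 -> T t y = 0.
Hypothesis T1 : forall (t : R) y, 4 <= t -> P y -> `|T t y| <= B * t `^ ((a - 3) / 2).
Hypothesis T2 : forall (t : R) (y d : E), 4 <= t -> P y -> P (y + d) ->
  `|T t (y + d) - T t y| <= B * `|d| * t `^ ((a - 2) / 2).
Hypothesis T3 : forall (t : R) (y d h : E), 4 <= t -> P y -> P (y + d) -> P (y + h) -> P (y + h + d) ->
  `|T t (y + h + d) - T t (y + h) - T t (y + d) + T t y| <= B * `|h| * t `^ ((a - 2) / 2).
Hypothesis T4 : forall (t : R) (y d h : E), 4 <= t -> P y -> P (y + d) -> P (y + h) -> P (y + h + d) ->
  `|T t (y + h + d) - T t (y + h) - T t (y + d) + T t y| <=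
    B * (`|h| * `|d|) * t `^ ((a - 1) / 2).
Hypothesis S0 : forall (t : R) y, differentiable (S t) y.
Hypothesis S1 : forall i y, differentiable (partial i (S 4)) y.
Hypothesis S2 : forall y : E, `|y| <= 1 -> `|S 4 y| <= B'.
Hypothesis S3 : forall i (y : E), `|y| <= 1 -> `|partial i (S 4) y| <= B'.
Hypothesis S4 : forall i j (y : E), `|y| <= 1 -> `|partial j (partial i (S 4)) y| <= B'.

(* From this scale on the kernels centred at y vanish on {x_N = 0}. *)
Definition stable (y : E) : R := 4 + (y 0 ord_max ^+ 2)^-1.
Definition vlim (y : E) : R := S (stable y) y / c0.

Let st4 (y : E) : 4 <= stable y.
Proof. by rewrite lerDl invr_ge0 sqr_ge0. Qed.

Let stP (t : R) (y : E) : 0 < y 0 ord_max -> stable y <= t -> 1 <= t * y 0 ord_max ^+ 2.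
Proof.
move=> y0 st; have y2 : 0 < y 0 ord_max ^+ 2 by rewrite exprn_gt0.
rewrite -ler_pdivrMr// mul1r; apply: le_trans st; by rewrite /stable; lra.
Qed.

Let P1 (y : E) : P y -> `|y| <= 1.
Proof.
move=> [_ yr]; apply: le_trans (norm_le_enorm y) (le_trans yr _).
by rewrite invf_le1// ler1n.
Qed.

Let Pd (y d : E) : P y -> P (y + d) -> `|d| <= 2^-1.
Proof.
move=> [_ yr] [_ zr]; apply: le_trans (norm_le_enorm d) _.
have := enormD (y + d) (- y); rewrite enormN addrAC subrr add0r.
by move: zr yr; lra.
Qed.

Lemma vlimE (t : R) (y : E) : P y -> 0 < y 0 ord_max -> 4 <= t -> 1 <= t * y 0 ord_max ^+ 2 ->
  S t y = c0 * vlim y.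
Proof.
move=> Py y0 t4 ty; rewrite /vlim mulrC divfK ?gt_eqF//.
have y2 : 0 < y 0 ord_max ^+ 2 by rewrite exprn_gt0.
have H al be : 4 <= al -> 1 <= al * y 0 ord_max ^+ 2 -> al <= be -> S be y = S al y.
  move=> al4 aly albe; apply/eqP; rewrite -subr_eq0 -normr_eq0; apply/eqP/le_anti.
  rewrite normr_ge0 andbT.
  have := @derive_le R (S^~ y) (T^~ y) (cst 0) (cst 0) al be albe.
  rewrite subrr; apply => s /andP[s1 s2].
  - by apply: dS; apply: lt_le_trans s1; apply: lt_le_trans al4.
  - rewrite T0 ?normr0//; first exact: le_trans s1.
    by apply: (le_trans aly); rewrite ler_wpM2r ?sqr_ge0.
have [ts|st] := leP t (stable y); first by rewrite (H t).
by rewrite (H (stable y))//; [exact: stP|exact: ltW].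
Qed.

Lemma vlim_le (y : E) : P y -> 0 < y 0 ord_max ->
  `|vlim y| <= (B * (4 `^ ((a - 1) / 2) / - ((a - 1) / 2)) + B') / c0.
Proof.
move=> Py y0; rewrite /vlim normrM normfV (gtr0_norm c00) ler_pM2r ?invr_gt0//.
rewrite -(subrK (S 4 y) (S (stable y) y)) (le_trans (ler_normD _ _))//.
apply: lerD; last by apply: S2; exact: P1.
apply: (@powR_decay R (S^~ y) (T^~ y)) => //.
- by rewrite pmulr_llt0// subr_lt0.
- by move=> t /andP[t4 _]; apply: dS; apply: lt_le_trans t4.
- move=> t /andP[t4 _]; have -> : (a - 1) / 2 - 1 = (a - 3) / 2 by field.
  exact: T1.
Qed.

Let diff_derive (y z : E) (t : R) : 0 < t ->
  is_derive t 1 (fun t => S t z - S t y) (T t z - T t y).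
Proof. by move=> t0; exact: is_deriveB (dS z t0) (dS y t0). Qed.

Let vlim_diff (y d : E) : P y -> P (y + d) -> 0 < y 0 ord_max -> 0 < (y + d) 0 ord_max ->
  exists2 t, 4 <= t & vlim (y + d) - vlim y = (S t (y + d) - S t y) / c0.
Proof.
move=> Py Pd' y0 d0; exists (stable y + stable (y + d)).
  by rewrite (le_trans (st4 y))// lerDl (le_trans _ (st4 _)).
have h : 4 <= stable y + stable (y + d).
  by rewrite (le_trans (st4 y))// lerDl (le_trans _ (st4 _)).
rewrite !vlimE//; first by rewrite -mulrBr mulrAC divff ?gt_eqF// mul1r.
  by apply: stP => //; rewrite lerDl (le_trans _ (st4 _)).
by apply: stP => //; rewrite lerDr (le_trans _ (st4 _)).
Qed.

Let S4_lip (y d : E) : P y -> P (y + d) -> `|S 4 (y + d) - S 4 y| <= n.+1%:R * B' * `|d|.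
Proof.
by move=> Py Pd'; apply: (lipschitz_bound (rho := 1)) => //; exact: P1.
Qed.

Lemma vlim_hoelder (y d : E) : 0 < a -> P y -> P (y + d) ->
  0 < y 0 ord_max -> 0 < (y + d) 0 ord_max -> d != 0 ->
  `|vlim (y + d) - vlim y| <=
    (B * ((a / 2)^-1 + (2^-1 - a / 2)^-1) *+ 2 + n.+1%:R * B') / c0 * `|d| `^ (1 - a).
Proof.
move=> a0 Py Pyd y0 yd0 dn0; have [t t4 ->] := vlim_diff Py Pyd y0 yd0.
have dl0 : 0 < `|d| by rewrite normr_gt0.
have dl2 := Pd Py Pyd.
rewrite normrM normfV (gtr0_norm c00) mulrAC ler_pM2r ?invr_gt0// mulrDl.
rewrite -(subrK (S 4 (y + d) - S 4 y) (S t (y + d) - S t y)) (le_trans (ler_normD _ _))//.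
apply: lerD; last first.
  apply: (le_trans (S4_lip Py Pyd)); rewrite ler_wpM2l ?mulr_ge0//.
  by apply: le_powR; [rewrite dl0/= (le_trans dl2)// invf_le1// ler1n|lra].
(* q = a / 2 produces the exponent 1 - 2 q = 1 - a. B is doubled because at large scales the two
   values of T are bounded separately. *)
have := @two_regimes R (fun t => S t (y + d) - S t y) (fun t => T t (y + d) - T t y)
  (B *+ 2) (a / 2) `|d| t.
have -> : 1 - 2 * (a / 2) = 1 - a by field.
rewrite !mulrnAl; apply => //.
- by rewrite mulrn_wge0.
- by rewrite divr_gt0.
- by rewrite ltr_pdivrMr// mulVf.
- by move=> s s4; apply: diff_derive; apply: lt_le_trans s4.
- move=> s s4; have -> : a / 2 - 1 = (a - 2) / 2 by field.
  apply: (le_trans (T2 s4 Py Pyd)); rewrite ler_wpM2r ?powR_ge0//.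
  by rewrite mulr2n lerDl mulr_ge0.
- move=> s s4; have -> : a / 2 - 2^-1 - 1 = (a - 3) / 2 by field.
  rewrite mulr2n mulrDl (le_trans (ler_normB _ _))//.
  by apply: lerD; apply: T1.
Qed.

(** For a < 0 the first differences of T decay like t^(a / 2 - 1), which is integrable, so one
    regime covers all scales. *)
Lemma vlim_lipschitz (y d : E) : a < 0 -> P y -> P (y + d) ->
  0 < y 0 ord_max -> 0 < (y + d) 0 ord_max ->
  `|vlim (y + d) - vlim y| <=
    (B * (4 `^ (a / 2) / - (a / 2)) + n.+1%:R * B') / c0 * `|d|.
Proof.
move=> a0 Py Pyd y0 yd0; have [t t4 ->] := vlim_diff Py Pyd y0 yd0.
rewrite normrM normfV (gtr0_norm c00) mulrAC ler_pM2r ?invr_gt0// mulrDl.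
rewrite -(subrK (S 4 (y + d) - S 4 y) (S t (y + d) - S t y)) (le_trans (ler_normD _ _))//.
apply: lerD; last exact: S4_lip.
rewrite mulrAC.
apply: (@powR_decay R (fun t => S t (y + d) - S t y) (fun t => T t (y + d) - T t y)) => //.
- by rewrite mulr_ge0.
- by rewrite pmulr_llt0.
- by move=> s /andP[s4 _]; apply: diff_derive; apply: lt_le_trans s4.
- move=> s /andP[s4 _]; have -> : a / 2 - 1 = (a - 2) / 2 by field.
  exact: T2.
Qed.

Definition hess_const : R :=
  (B * (((a + 1) / 2)^-1 + (2^-1 - (a + 1) / 2)^-1) + n.+1%:R * (n.+1%:R * B')) / c0.

Lemma vlim_second (y d h : E) : a < 0 -> P y -> P (y + d) -> P (y + h) -> P (y + h + d) ->
  0 < y 0 ord_max -> 0 < (y + d) 0 ord_max -> 0 < (y + h) 0 ord_max ->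
  0 < (y + h + d) 0 ord_max -> d != 0 ->
  `|vlim (y + h + d) - vlim (y + h) - vlim (y + d) + vlim y| <=
    hess_const * `|d| `^ (- a) * `|h|.
Proof.
move=> a0 Py Pyd Pyh Pyhd y0 yd0 yh0 yhd0 dn0.
have dl0 : 0 < `|d| by rewrite normr_gt0.
have dl2 := Pd Py Pyd.
pose t := stable y + stable (y + d) + stable (y + h) + stable (y + h + d).
have := st4 y; have := st4 (y + d); have := st4 (y + h); have := st4 (y + h + d) => s1 s2 s3 s5.
have t4 : 4 <= t by rewrite /t; move: s1 s2 s3 s5; lra.
have E z : P z -> 0 < z 0 ord_max -> stable z <= t -> vlim z = S t z / c0.
  by move=> Pz z0 zt; rewrite (vlimE Pz z0 t4 (stP z0 zt)) mulrAC divff ?gt_eqF// mul1r.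
have e1 : stable y <= t by rewrite /t; move: s1 s2 s3 s5; lra.
have e2 : stable (y + d) <= t by rewrite /t; move: s1 s2 s3 s5; lra.
have e3 : stable (y + h) <= t by rewrite /t; move: s1 s2 s3 s5; lra.
have e4 : stable (y + h + d) <= t by rewrite /t; move: s1 s2 s3 s5; lra.
rewrite !E// -!mulrBl -mulrDl normrM normfV (gtr0_norm c00).
rewrite /hess_const.
rewrite (_ : _ / c0 * _ * _ = (B * `|h| * (((a + 1) / 2)^-1 + (2^-1 - (a + 1) / 2)^-1) *
  `|d| `^ (- a) + n.+1%:R * (n.+1%:R * B') * `|h| * `|d| `^ (- a)) / c0); last by ring.
rewrite ler_pM2r ?invr_gt0//.
pose f s := S s (y + h + d) - S s (y + h) - S s (y + d) + S s y.
rewrite -/(f t) -(subrK (f 4) (f t)) (le_trans (ler_normD _ _))//.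
apply: lerD; last first.
  have := second_difference_bound (rho := 1) (S0 4) S1 S4 (P1 Py) (P1 Pyd) (P1 Pyh) (P1 Pyhd).
  move=> /le_trans; apply.
  have -> : n.+1%:R * (n.+1%:R * B' * `|d|) * `|h| = n.+1%:R * (n.+1%:R * B') * `|h| * `|d| by ring.
  rewrite ler_wpM2l ?mulr_ge0//.
  by apply: le_powR; [rewrite dl0/= (le_trans dl2)// invf_le1// ler1n|rewrite lerNl ltW].
(* q = (a + 1) / 2 lies in (0, 1/2) because -1 < a < 0, and 1 - 2 q = - a. The factor |h| is carried
   along in the constant. *)
have := @two_regimes R f (fun s => T s (y + h + d) - T s (y + h) - T s (y + d) + T s y)
  (B * `|h|) ((a + 1) / 2) `|d| t.
have -> : 1 - 2 * ((a + 1) / 2) = - a by field.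
apply => //.
- by rewrite mulr_ge0.
- by rewrite divr_gt0// -ltrBlDr sub0r.
- by rewrite ltr_pdivrMr// mulVf// gtrDr.
- move=> s s4; have s0 : 0 < s by exact: lt_le_trans s4.
  exact: is_deriveD (is_deriveB (is_deriveB (dS _ s0) (dS _ s0)) (dS _ s0)) (dS _ s0).
- move=> s s4; have -> : (a + 1) / 2 - 1 = (a - 1) / 2 by field.
  by rewrite -(mulrA B); exact: T4.
- move=> s s4; have -> : (a + 1) / 2 - 2^-1 - 1 = (a - 2) / 2 by field.
  exact: T3.
Qed.

Local Notation U := (half_ball 4^-1 : set E).

Let UP (y : E) : U y -> P y /\ 0 < y 0 ord_max.
Proof. by move=> [yr y0]; split=> //; split; exact: ltW. Qed.

(** Nearby points z have z_N >= y_N / 2, and 4 / y_N^2 is a sufficient scale for all of them. So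
    [vlim] is locally a fixed-scale mean and inherits its differentiability. *)
Lemma vlim_near (y : E) : U y ->
  \forall z \near y, S (4 + 4 * (y 0 ord_max ^+ 2)^-1) z / c0 = vlim z.
Proof.
move=> Uy; have [Py y0] := UP Uy; have y2 : 0 < y 0 ord_max ^+ 2 by rewrite exprn_gt0.
apply: filterS (near_half_ball Uy) => z [Uz zy]; have [Pz z0] := UP Uz.
have yi : 0 < (y 0 ord_max ^+ 2)^-1 by rewrite invr_gt0.
rewrite (vlimE Pz z0); first by rewrite mulrAC divff ?gt_eqF// mul1r.
  by rewrite lerDl mulr_ge0// ltW.
rewrite (@le_trans _ _ (4 * (y 0 ord_max ^+ 2)^-1 * (y 0 ord_max / 2) ^+ 2))//.
  by rewrite le_eqVlt; apply/orP; left; apply/eqP; field; rewrite gt_eqF.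
apply: ler_pM.
- by rewrite mulr_ge0// ltW.
- exact: sqr_ge0.
- by rewrite lerDr.
- by apply: lerXn2r => //; rewrite nnegrE; [rewrite divr_ge0// ltW|exact: ltW].
Qed.

Lemma vlim_differentiable (y : E) : U y -> differentiable vlim y.
Proof.
move=> Uy; apply: near_eq_differentiable (vlim_near Uy) _.
rewrite (_ : (fun _ => _) = c0^-1 \*: S (4 + 4 * (y 0 ord_max ^+ 2)^-1)); last first.
  by apply/funext => z; rewrite /= mulrC.
exact: differentiableZ.
Qed.

Let dvlim (y e : E) : U y -> derivable vlim y e.
Proof. by move=> Uy; apply: diff_derivable; exact: vlim_differentiable. Qed.

Let near_shift (y e : E) : U y -> \forall h \near (0 : R)^', U (h *: e + y).
Proof.
move=> Uy; apply: nbhs_dnbhs.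
have c : (fun h : R => h *: e + y) @ nbhs (0 : R) --> (y : E).
  rewrite -[X in _ --> X]add0r -(scale0r e); apply: cvgD; last exact: cvg_cst.
  by apply: cvgZr_tmp; exact: cvg_id.
by have := c _ (near_half_ball Uy); apply: filterS => h [].
Qed.

Let norm_delta (h : R) i : `|h *: delta_mx 0 i : E| <= `|h|.
Proof.
apply: norm_le_coord => // j; rewrite !mxE normrM ler_piMr//.
by case: (_ && _); rewrite ?normr1 ?normr0.
Qed.

Lemma vlim_partial_le i (y : E) : a < 0 -> U y ->
  `|partial i vlim y| <= (B * (4 `^ (a / 2) / - (a / 2)) + n.+1%:R * B') / c0.
Proof.
move=> a0 Uy; have [Py y0] := UP Uy; set L := _ / c0.
have L0 : 0 <= L.
  rewrite divr_ge0 ?(ltW c00)// addr_ge0 ?mulr_ge0 ?powR_ge0// invr_ge0 oppr_ge0.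
  by rewrite pmulr_lle0// ltW.
have D0 : 'D_(delta_mx 0 i) (cst (0 : R)) y = 0 by exact: derive_cst.
rewrite -[X in `|X|]subr0 /partial -D0; apply: derive_diff_le; [exact: dvlim|exact: derivable_cst|].
apply: filterS (near_shift (delta_mx 0 i) Uy) => h Uh; have [Ph h0] := UP Uh.
rewrite addrC in Ph; rewrite addrC in h0.
rewrite /cst subrr subr0 (addrC _ y).
rewrite (le_trans (vlim_lipschitz a0 Py Ph y0 h0))//.
by rewrite ler_wpM2l.
Qed.

(** [vlim_second] is linear in |h|, so dividing by h and letting h tend to 0 bounds the increment of
    the derivative. *)
Lemma vlim_partial_hoelder i (y z : E) : a < 0 -> U y -> U z -> z != y ->
  `|partial i vlim z - partial i vlim y| <= hess_const * `|z - y| `^ (- a).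
Proof.
move=> a0 Uy Uz zy; have [Py y0] := UP Uy; have [Pz z0] := UP Uz.
have d0 : z - y != 0 by rewrite subr_eq0.
have K0 : 0 <= hess_const.
  rewrite divr_ge0 ?(ltW c00)// addr_ge0 ?mulr_ge0// addr_ge0// invr_ge0.
    by rewrite divr_ge0// -lerBlDr sub0r ltW.
  by rewrite subr_ge0 ler_pdivrMr// mulVf// gerDr ltW.
apply: derive_diff_le; [exact: dvlim|exact: dvlim|].
apply: filterS2 (near_shift (delta_mx 0 i) Uy) (near_shift (delta_mx 0 i) Uz) => h Uh Uh'.
have [Ph h0] := UP Uh; have [Ph' h0'] := UP Uh'.
have E1 : z = y + (z - y) by rewrite addrC subrK.
have E2 : h *: delta_mx 0 i + z = y + h *: delta_mx 0 i + (z - y).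
  by rewrite {1}E1 addrCA addrA.
have E3 : h *: delta_mx 0 i + y = y + h *: delta_mx 0 i by rewrite addrC.
rewrite E2 E3; rewrite E3 in Ph, h0; rewrite E2 in Ph', h0'; rewrite E1 in Pz, z0.
have := vlim_second a0 Py Pz Ph Ph' y0 z0 h0 h0' d0.
move=> H; rewrite (_ : _ - _ - _ = vlim (y + h *: delta_mx 0 i + (z - y)) -
  vlim (y + h *: delta_mx 0 i) - vlim (y + (z - y)) + vlim y); last by rewrite -E1; ring.
by apply: (le_trans H); rewrite ler_wpM2l// mulr_ge0// powR_ge0.
Qed.

End kernel_regularity.

Lemma powR_small (R : realType) (K al e : R) : 0 <= K -> 0 < al -> 0 < e ->
  exists2 dl, 0 < dl & forall t, 0 <= t <= dl -> K * t `^ al < e.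
Proof.
move=> K0 al0 e0; have K1 : 0 < K + 1 by rewrite ltr_wpDl.
have eK : 0 < e / (K + 1) by rewrite divr_gt0.
exists ((e / (K + 1)) `^ al^-1); first by rewrite powR_gt0.
move=> t /andP[t0 td]; apply: (@le_lt_trans _ _ (K * (e / (K + 1)))).
  rewrite ler_wpM2l//.
  have := ge0_ler_powR (ltW al0) _ _ td; rewrite !nnegrE t0 powR_ge0 => /(_ isT isT).
  by rewrite -powRrM mulVf ?gt_eqF// powRr1// ltW.
by rewrite mulrCA -[ltRHS]mulr1 ltr_pM2l// ltr_pdivrMr// mul1r ltrDl.
Qed.

(** * Extension of a Hoelder function to the flat boundary *)

Section hoelder_extension.
Variables (R : realType) (n : nat) (V : normedModType R).
Local Notation E := 'rV[R]_n.+1.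
(** Completeness is kept as a hypothesis on V, since the extension serves both v, with real values,
    and its gradient, with values in row vectors. *)
Hypothesis cauchyV : forall F : set_system V, ProperFilter F -> cauchy F -> cvg F.
Variables (r K al : R) (F : E -> V).
Local Notation U := (half_ball r : set E).
Local Notation D := (half_ball r `|` flat_ball r : set E).
Hypotheses (K0 : 0 <= K) (al0 : 0 < al).
Hypothesis FH : forall y z, U y -> U z -> `|F y - F z| <= K * enorm (y - z) `^ al.

(** For F = [grad v] this is [grad_upto] on the half ball. *)
Definition flat_ext (x : E) : V := if x \in U then F x else lim (F @ within U (nbhs x)).

(** Vertical approach from inside. Moving x and y by the same vector preserves x - y, so the Hoelder
    inequality passes to the limit unchanged. *)
Let up (x : E) (k : nat) : E := x + k.+1%:R^-1 *: delta_mx 0 ord_max.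

Let enorm_delta : enorm (delta_mx 0 ord_max : E) = 1.
Proof.
rewrite /enorm /dotp (bigD1 ord_max)//= big1 => [|i /negbTE im].
  by rewrite !mxE !eqxx mulr1 addr0 sqrtr1.
by rewrite !mxE im andbF mul0r.
Qed.

Let osc e : 0 < e -> exists2 dl, 0 < dl &
  forall y z, U y -> U z -> enorm (y - z) <= dl -> `|F y - F z| < e.
Proof.
move=> e0; have [dl d0 Hd] := powR_small K0 al0 e0; exists dl => // y z Uy Uz yz.
by apply: (le_lt_trans (FH Uy Uz)); apply: Hd; rewrite enorm_ge0.
Qed.

Let up_near (x : E) (A : set E) : D x -> within U (nbhs x) A -> \forall k \near \oo, A (up x k).
Proof.
move=> Dx wA.
have xr : enorm x < r by case: Dx => -[].
have x0 : 0 <= x 0 ord_max by case: Dx => [[_ /ltW]|[_ /= ->]].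
have rx : 0 < r - enorm x by rewrite subr_gt0.
have [e /= e1 He] := (nbhs_ballP (x : E) _).1 wA.
have c1 := @near_infty_natSinv_lt R (PosNum rx).
have c2 := @near_infty_natSinv_lt R (PosNum e1).
near=> k.
have k0 : (0 : R) < k.+1%:R^-1 by rewrite invr_gt0.
have n1 : enorm (k.+1%:R^-1 *: delta_mx 0 ord_max : E) = k.+1%:R^-1.
  by rewrite enormZ ?enorm_delta ?mulr1// ltW.
apply: He.
  rewrite -ball_normE /ball_/= /up opprD addNKr normrN.
  by apply: le_lt_trans (norm_le_enorm _) _; rewrite n1; near: k.
split.
  rewrite /eball/= (le_lt_trans (enormD _ _))// n1 -ltrBrDl.
  by near: k.
by rewrite /up /= !mxE !eqxx mulr1 ltr_wpDl.
Unshelve. all: by end_near. Qed.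

Let proper_within (x : E) : D x -> ProperFilter (within U (nbhs x)).
Proof.
move=> Dx; apply: Build_ProperFilter.
  move=> /(up_near Dx) [k _ /(_ k)]; apply; exact: leqnn.
Qed.

Let near_enorm (x : E) (dl : R) : 0 < dl ->
  within U (nbhs x) [set z | U z /\ enorm (x - z) <= dl].
Proof.
move=> d0; pose e := dl / (n.+1%:R).
have e0 : 0 < e by rewrite divr_gt0.
have H := @cvgr_dist_le _ E _ _ _ id x (@cvg_id _ (nbhs x)) _ e0.
have FF : Filter (nbhs x) := nbhs_filter _.
apply: (@filterS _ (nbhs x) FF _ _ _ (H FF)) => z h Uz; split=> //.
apply: (le_trans (enorm_le_norm _)); apply: (le_trans (ler_wpM2l _ h)) => //.
by rewrite /e mulrC divfK.
Qed.

Lemma flat_ext_cvg (x : E) : D x -> F @ within U (nbhs x) --> flat_ext x.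
Proof.
move=> Dx; have PF := proper_within Dx; rewrite /flat_ext.
have [|xU] := boolP (x \in U).
  rewrite inE => Ux; apply/cvgrPdist_lt => e e0; have [dl d0 Hd] := osc e0.
  by apply: filterS (near_enorm x d0) => z [Uz xz]; exact: Hd.
apply: cauchyV; apply: cauchy_exP => e e0.
have [dl d0 Hd] := osc e0; have d2 : 0 < dl / 2 by rewrite divr_gt0.
have [z [Uz xz]] := filter_ex (near_enorm x d2).
exists (F z); apply: filterS (near_enorm x d2) => y [Uy xy].
rewrite /= -ball_normE /=; apply: Hd => //.
rewrite (_ : z - y = - (x - z) + (x - y)); last by rewrite opprB addrA subrK.
apply: (le_trans (enormD _ _)); rewrite enormN.
by rewrite [dl]splitr lerD.
Qed.

Let up_cvg (x : E) : D x -> F (up x k) @[k --> \oo] --> flat_ext x.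
Proof.
move=> Dx; have c := flat_ext_cvg Dx.
apply: cvg_trans c => A /= FA; exact: up_near Dx FA.
Qed.

Let up_U (x : E) : D x -> \forall k \near \oo, U (up x k).
Proof. by move=> Dx; apply: up_near => //; apply: nearW. Qed.

Lemma flat_ext_hoelder (x y : E) : D x -> D y ->
  `|flat_ext x - flat_ext y| <= K * enorm (x - y) `^ al.
Proof.
move=> Dx Dy; have c : `|F (up x k) - F (up y k)| @[k --> \oo] --> `|flat_ext x - flat_ext y|.
  by apply: cvg_norm; apply: cvgB; exact: up_cvg.
rewrite -(cvg_lim _ c)//; apply: limr_le; first by apply/cvg_ex; eexists; exact: c.
near=> k; have Ux : U (up x k) by near: k; exact: up_U.
have Uy : U (up y k) by near: k; exact: up_U.
have := FH Ux Uy; by rewrite /up opprD addrACA subrr addr0.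
Unshelve. all: by end_near. Qed.

Lemma flat_ext_le B (x : E) : (forall y, U y -> `|F y| <= B) -> D x -> `|flat_ext x| <= B.
Proof.
move=> FB Dx; have c : `|F (up x k)| @[k --> \oo] --> `|flat_ext x| by apply: cvg_norm; exact: up_cvg.
rewrite -(cvg_lim _ c)//; apply: limr_le; first by apply/cvg_ex; eexists; exact: c.
near=> k; apply: FB; near: k; exact: up_U.
Unshelve. all: by end_near. Qed.

Lemma flat_ext_continuous : {within D, continuous flat_ext}.
Proof.
apply/subspace_continuousP => x Dx; apply/cvgrPdist_lt => e e0.
have [dl d0 Hd] := powR_small K0 al0 e0.
have dn : 0 < dl / n.+1%:R by rewrite divr_gt0.
have H := @cvgr_dist_le _ E _ _ _ id x (@cvg_id _ (nbhs x)) _ dn.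
have FF : Filter (nbhs x) := nbhs_filter _.
apply: (@filterS _ (nbhs x) FF _ _ _ (H FF)) => z h Dz.
apply: (le_lt_trans (flat_ext_hoelder Dx Dz)); apply: Hd; rewrite enorm_ge0/=.
apply: (le_trans (enorm_le_norm _)); apply: (le_trans (ler_wpM2l _ h)) => //.
by rewrite mulrC divfK.
Qed.

End hoelder_extension.

Section norm_bounds.
Variables (R : realType) (n : nat).
Local Notation E := 'rV[R]_n.

Lemma sup_norm_le (V : zmodType) (N : V -> R) (D : set E) (f : E -> V) (B : R) :
  (forall x, D x -> N (f x) <= B) -> (sup_norm N D f <= B%:E)%E.
Proof. by move=> H; apply: ge_ereal_sup => _ [x Dx <-]; rewrite lee_fin H. Qed.

Lemma hoelder_seminorm_le (V : zmodType) (N : V -> R) (D : set E) al (f : E -> V) (B : R) :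
  (forall x y, D x -> D y -> x != y -> N (f x - f y) <= B * enorm (x - y) `^ al) ->
  (hoelder_seminorm N D al f <= B%:E)%E.
Proof.
move=> H; apply: ge_ereal_sup => _ [[x y] [/= Dx Dy xy] <-].
rewrite lee_fin ler_pdivrMr; first exact: H.
rewrite powR_gt0// lt_def enorm_ge0 andbT; apply: contra_neq xy => /enorm_eq0/eqP.
by rewrite subr_eq0 => /eqP.
Qed.

End norm_bounds.

Section limit_function.
Variables (R : realType) (n : nat) (a mu M : R).
Hypotheses (a1 : -1 < a) (a2 : a < 1) (mu0 : 0 <= mu) (M0 : 0 <= M).
Local Notation E := 'rV[R]_n.+1.
Local Notation U := (half_ball 4^-1 : set E).

Let r1 : (0 : R) < 1. Proof. exact: ltr01. Qed.

(** For t >= 4 the radius t^(-1/2) is at most 1/2, and 1/4 + 1/2 = 3/4 stays inside the unit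
    ball. *)
Let ok_closed (t : R) (y : E) : 4 <= t -> in_closed y -> ok (3 / 4) t y.
Proof.
move=> t4 [y0 yr]; split=> //.
have s4 : Num.sqrt (4 : R) = 2.
  by rewrite (_ : 4 = 2 ^+ 2)// ?sqrtr_sqr ?ger0_norm//; ring.
have : (Num.sqrt t)^-1 <= 2^-1.
  have t0 : 0 < t by exact: lt_le_trans t4.
  by rewrite lef_pV2 ?posrE ?sqrtr_gt0// -s4 ler_wsqrtr.
by lra.
Qed.

(** The constant precedes w, so it depends on n, a, mu and M only. Its four candidates k1 to k4 come
    from the bounds on [vlim], on its Hoelder and Lipschitz increments, and on the increments of its
    gradient. *)
Lemma limit_function : exists2 C, 0 <= C & forall w : E -> R,
  measurable_fun (half_ball 1) w -> (forall x, half_ball 1 x -> `|w x| <= M * weight a x) ->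
  subflux a 1 mu w -> exists v : E -> R,
  [/\ forall lam y, U y -> 4 <= lam -> 1 <= lam * y 0 ord_max ^+ 2 ->
        Sy a 1 w lam y = total_mass n a * v y,
      forall y, U y -> `|v y| <= C,
      forall y : E, U y -> differentiable v y,
      0 < a -> forall y z, U y -> U z -> `|v z - v y| <= C * `|z - y| `^ (1 - a) &
      a < 0 -> [/\ forall y z, U y -> U z -> `|v z - v y| <= C * `|z - y|,
        forall i y, U y -> `|partial i v y| <= C &
        forall i y z, U y -> U z ->
          `|partial i v z - partial i v y| <= C * `|z - y| `^ (- a)]].
Proof.
have [K K1 [phi1 phi2]] := @phi_diff R n.
have [CS CS0 HS] := Sy_C2 n a1 r1 4 1.
have [C3 C3E] : exists C3, C3 = mu * (a + 1) * 6 ^+ n * pi by eexists.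
have a10 : 0 < a + 1 by rewrite -ltrBlDr sub0r.
have C30 : 0 <= C3 by rewrite C3E !mulr_ge0 ?pi_ge0// ltW.
have K0 : 0 <= K by exact: le_trans K1.
(* The factor 4, needed for second differences, also covers C3 and 2 C3 K. *)
pose B := 4 * C3 * K; pose B' := M * CS; pose c0 := total_mass n a.
have B0 : 0 <= B by rewrite /B !mulr_ge0.
have B'0 : 0 <= B' by rewrite /B' mulr_ge0.
have c00 : 0 < c0 by exact: total_mass_gt0.
have CK : C3 <= C3 * K by rewrite ler_peMr.
have BK : 2 * C3 * K <= B by rewrite /B ler_wpM2r// ler_wpM2r// ler_nat.
have BC : C3 <= B.
  apply: (le_trans CK); rewrite /B -mulrA ler_peMl ?mulr_ge0//; by rewrite ler1n.
pose k1 := (B * (4 `^ ((a - 1) / 2) / - ((a - 1) / 2)) + B') / c0.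
pose k2 := (B * ((a / 2)^-1 + (2^-1 - a / 2)^-1) *+ 2 + n.+1%:R * B') / c0.
pose k3 := (B * (4 `^ (a / 2) / - (a / 2)) + n.+1%:R * B') / c0.
pose k4 := hess_const n a B B' c0.
pose C := Num.max k1 (Num.max k2 (Num.max k3 k4)).
have C0 : 0 <= C.
  rewrite le_max /k1 divr_ge0 ?(ltW c00)// addr_ge0 ?mulr_ge0 ?powR_ge0//.
  by rewrite invr_ge0 oppr_ge0 pmulr_lle0 ?invr_gt0// subr_le0 ltW.
exists C => //.
have kC1 : k1 <= C by rewrite le_max lexx.
have kC2 : k2 <= C by rewrite !le_max lexx orbT.
have kC3 : k3 <= C by rewrite !le_max lexx !orbT.
have kC4 : k4 <= C by rewrite !le_max lexx !orbT.
move=> w mw wM fw.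
have r3 : (0 : R) <= 3 / 4 by rewrite divr_ge0.
have r31 : (3 / 4 : R) < 1 by rewrite ltr_pdivrMr// mul1r ltr_nat.
have [_ dpS bS bpS bppS] := HS w M mw M0 wM.
have dS t (y : E) : differentiable (Sy a 1 w t) y.
  have [CS' _ HS'] := Sy_C2 n a1 r1 t 1.
  by have [d _ _ _ _] := HS' w M mw M0 wM; exact: d.
have t40 (t : R) : 4 <= t -> 0 < t by exact: lt_le_trans.
have D1 (t : R) (y : E) : 0 < t -> is_derive t 1 ((Sy a 1 w)^~ y) (Ty a 1 w t y).
  exact: (is_derive_Sy a1 r1 mw wM).
have H0 (t : R) (y : E) : 4 <= t -> in_closed y -> 1 <= t * y 0 ord_max ^+ 2 -> Ty a 1 w t y = 0.
  move=> t4 Py; exact: (Ty_eq0 a1 r1 mu0 r3 r31 mw wM fw C3E (t40 _ t4) (ok_closed t4 Py)).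
have H1 (t : R) (y : E) : 4 <= t -> in_closed y ->
    `|Ty a 1 w t y| <= B * t `^ ((a - 3) / 2).
  move=> t4 Py; apply: le_trans
    (Ty_le a1 r1 mu0 r3 r31 mw wM fw C3E (t40 _ t4) (ok_closed t4 Py)) _.
  by rewrite ler_wpM2r ?powR_ge0.
have H2 (t : R) (y d : E) : 4 <= t -> in_closed y -> in_closed (y + d) ->
    `|Ty a 1 w t (y + d) - Ty a 1 w t y| <= B * `|d| * t `^ ((a - 2) / 2).
  move=> t4 Py Pd; apply: le_trans (Ty_diff a1 r1 mu0 r3 r31 mw wM fw C3E K1 phi1
    (t40 _ t4) (ok_closed t4 Py) (ok_closed t4 Pd)) _.
  by rewrite ler_wpM2r ?powR_ge0// ler_wpM2r.
have H3 (t : R) (y d h : E) : 4 <= t -> in_closed y -> in_closed (y + d) ->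
    in_closed (y + h) -> in_closed (y + h + d) ->
    `|Ty a 1 w t (y + h + d) - Ty a 1 w t (y + h) - Ty a 1 w t (y + d) + Ty a 1 w t y| <=
    B * `|h| * t `^ ((a - 2) / 2).
  move=> t4 Py Pd Ph Phd; exact: (Ty_diff2 a1 r1 mu0 r3 r31 mw wM fw C3E K1 phi1
    (t40 _ t4) (ok_closed t4 Py) (ok_closed t4 Pd) (ok_closed t4 Ph) (ok_closed t4 Phd)).
have H4 (t : R) (y d h : E) : 4 <= t -> in_closed y -> in_closed (y + d) ->
    in_closed (y + h) -> in_closed (y + h + d) ->
    `|Ty a 1 w t (y + h + d) - Ty a 1 w t (y + h) - Ty a 1 w t (y + d) + Ty a 1 w t y| <=
    B * (`|h| * `|d|) * t `^ ((a - 1) / 2).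
  move=> t4 Py Pd Ph Phd; exact: (Ty_diff3 a1 r1 mu0 r3 r31 mw wM fw C3E K1 phi1 phi2
    (t40 _ t4) (ok_closed t4 Py) (ok_closed t4 Pd) (ok_closed t4 Ph) (ok_closed t4 Phd)).
move: {HS} (Sy a 1 w) (Ty a 1 w) dpS bS bpS bppS dS D1 H0 H1 H2 H3 H4
  => S T dpS bS bpS bppS dS D1 H0 H1 H2 H3 H4.
have UP (y : E) : U y -> in_closed y /\ 0 < y 0 ord_max.
  by move=> [yr y0]; split=> //; split; exact: ltW.
have sub (y z : E) : z = y + (z - y) by rewrite addrC subrK.
exists (vlim S c0); split.
- by move=> lam y Uy l4 ly; have [Py y0] := UP y Uy; exact: (vlimE c00 D1 H0).
- move=> y Uy; have [Py y0] := UP y Uy; apply: le_trans kC1.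
  exact: (vlim_le a2 B0 c00 D1 H1 bS).
- by move=> y Uy; exact: (vlim_differentiable c00 D1 H0 dS).
- move=> a0 y z Uy Uz; have [-> |zy] := eqVneq z y.
    by rewrite subrr normr0 mulr_ge0// powR_ge0.
  have [Py y0] := UP y Uy; have [Pz z0] := UP z Uz; rewrite {1}(sub y z).
  rewrite (sub y z) in Pz z0.
  have d0 : z - y != 0 by rewrite subr_eq0.
  apply: (le_trans (vlim_hoelder a2 B0 B'0 c00 D1 H0 H1 H2 dS bpS a0 Py Pz y0 z0 d0)).
  by rewrite ler_wpM2r ?powR_ge0.
- move=> a0; split.
  + move=> y z Uy Uz.
    have [Py y0] := UP y Uy; have [Pz z0] := UP z Uz; rewrite {1}(sub y z).
    rewrite (sub y z) in Pz z0.
    apply: (le_trans (vlim_lipschitz B0 c00 D1 H0 H2 dS bpS a0 Py Pz y0 z0)).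
    by rewrite ler_wpM2r.
  + move=> i y Uy; apply: le_trans kC3.
    exact: (vlim_partial_le B0 B'0 c00 D1 H0 H2 dS bpS).
  + move=> i y z Uy Uz; have [-> |zy] := eqVneq z y.
      by rewrite subrr normr0 mulr_ge0// powR_ge0.
    apply: (le_trans (vlim_partial_hoelder a1 B0 B'0 c00 D1 H0 H3 H4 dS dpS bppS i a0 Uy Uz zy)).
    by rewrite ler_wpM2r ?powR_ge0.
Qed.

End limit_function.

Lemma open_half_ball (R : realType) n (r : R) : open (half_ball r : set 'rV[R]_n.+1).
Proof. by rewrite openE => y /near_half_ball; apply: filterS => z []. Qed.

Lemma open_continuous_measurable (R : realType) n (U : set 'rV[R]_n) (f : 'rV[R]_n -> R) :
  open U -> (forall x, U x -> {for x, continuous f}) -> measurable_fun U f.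
Proof.
move=> oU cf; apply: (measurability _ (RGenOpens.measurableE R)).
move=> _ [_ [a [b ->] <-]]; apply: open_measurable_rV.
rewrite openE => x [Ux fx]; apply: filterI; first exact: open_nbhs_nbhs.
by apply: (cf x Ux); apply: open_nbhs_nbhs; split=> //; exact: interval_open.
Qed.

Lemma open_continuous_within (T : topologicalType) (S : topologicalType) (U : set T) (f : T -> S) :
  (forall x, U x -> {for x, continuous f}) -> {within U, continuous f}.
Proof.
move=> cf; apply/subspace_continuousP => x Ux.
by apply: cvg_trans (cf x Ux); apply: cvg_app; exact: cvg_within.
Qed.

(** * A representative of u that is bounded everywhere *)

Section truncation.
Variables (R : realType) (n : nat) (a mu M : R).
Hypotheses (a1 : -1 < a) (M0 : 0 <= M).
Local Notation E := 'rV[R]_n.+1.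
Variables (u : E -> R) (Du : E -> E).
Hypothesis uW : wW12 a (half_ball 1) u Du.
Hypothesis uM : {ae leb n.+1, forall x, half_ball 1 x -> `|u x| <= M}.
Hypothesis u_flux : forall psi : E -> R, test_fun (eball 1) psi ->
  `|energy a (half_ball 1) Du psi| <= mu * flat_integral 1 (fun x => `|psi x|).

(** The bound on u holds only almost everywhere; its truncation satisfies it at every point and
    keeps the same weak gradient. *)
Definition trunc (x : E) : R := Num.max (- M) (Num.min M (u x)).

Let mO : measurable (half_ball 1 : set E). Proof. exact: measurable_half_ball. Qed.

Lemma trunc_le x : `|trunc x| <= M.
Proof.
rewrite ler_norml /trunc le_max lexx/= ge_max ge_min lexx/= andbT.
by apply: le_trans M0; rewrite oppr_le0.
Qed.

Let truncE x : `|u x| <= M -> trunc x = u x.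
Proof. by rewrite ler_norml /trunc => /andP[h1 h2]; rewrite (min_idPr h2) (max_idPr h1). Qed.

Lemma trunc_ae : {ae leb n.+1, forall x, half_ball 1 x -> u x = trunc x}.
Proof. by apply: filterS uM => x h Ox; rewrite truncE// h. Qed.

Lemma measurable_trunc : measurable_fun (half_ball 1 : set E) trunc.
Proof.
have [[mu_ _] _ _] := uW.
by apply: measurable_maxr => //; exact: measurable_minr.
Qed.

(** By [weak_form], the integral against [bessel a psi] is minus the energy of psi, which the flux
    condition bounds. *)
Lemma trunc_subflux : subflux a 1 mu (fun x => trunc x * weight a x).
Proof.
have [[mu_ _] Du2 wg] := uW.
have wgt : weak_gradient (half_ball 1) trunc Du.
  move=> phi tphi i; rewrite -(wg phi tphi i).
  have [sphi _ _] := tphi.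
  have mphi : measurable_fun (half_ball 1 : set E) (partial i phi).
    by apply: measurable_funTS; apply: continuous_measurable_rV; have [] := sphi [:: i].
  apply: Rintegral_ae_eq => //.
  - by apply: measurable_funM => //; exact: measurable_trunc.
  - exact: measurable_funM.
  - by apply: filterS trunc_ae => x h Ox; rewrite h.
move=> psi epsi cpsi spsi even.
have := weak_form a1 ltr01 measurable_trunc (fun x _ => trunc_le x) Du2 wgt epsi cpsi spsi even.
move=> ->; rewrite normrN; apply: u_flux; split=> //; exact: elem_smooth.
Qed.

End truncation.

(** * From pointwise estimates to the Hoelder norms *)

Section boundary_regularity.
Variables (R : realType) (n : nat) (C : R).
Hypothesis C0 : 0 <= C.
Local Notation E := 'rV[R]_n.+1.
Local Notation U := (half_ball 4^-1 : set E).
Local Notation S := (flat_ball 4^-1 : set E).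

Lemma norm_powR_le (x : E) (b : R) : 0 <= b -> C * `|x| `^ b <= C * enorm x `^ b.
Proof.
by move=> b0; rewrite ler_wpM2l// ge0_ler_powR ?nnegrE ?enorm_ge0// norm_le_enorm.
Qed.

Lemma C0_bound (al : R) (v : E -> R) : 0 <= al ->
  (forall y, U y -> `|v y| <= C) -> (forall y, U y -> differentiable v y) ->
  (forall y z, U y -> U z -> `|v z - v y| <= C * `|z - y| `^ al) ->
  C0_hoelder U al v /\ (C0_norm U al v <= (C * (2 * n.+1%:R + 1))%:E)%E.
Proof.
move=> al0 vC dv vH.
have le1 : (C0_norm U al v <= (C * (2 * n.+1%:R + 1))%:E)%E.
  apply: (@le_trans _ _ (C%:E + C%:E)%E).
    apply: leeD; first exact: sup_norm_le.
    apply: hoelder_seminorm_le => x y Ux Uy _.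
    by apply: (le_trans (vH y x Uy Ux)); exact: norm_powR_le.
  (* Here 2 C would do; the larger constant is shared with the case of the gradient. *)
  rewrite -EFinD lee_fin (_ : C + C = C * 2); last by ring.
  rewrite ler_wpM2l//.
  have : (1 : R) <= n.+1%:R by rewrite ler1n.
  by lra.
split=> //; split; last exact: le_lt_trans le1 (ltry _).
by apply: open_continuous_within => x Ux; apply: differentiable_continuous; exact: dv.
Qed.

(** Both v, as a Lipschitz function, and its gradient extend to the flat part by [flat_ext]. The
    three terms of the norm contribute C, (n + 1) C and (n + 1) C, the factor n + 1 comparing
    Euclidean and sup norms. *)
Lemma C1_bound (al : R) (v : E -> R) : 0 < al ->
  (forall y, U y -> `|v y| <= C) -> (forall y, U y -> differentiable v y) ->
  (forall y z, U y -> U z -> `|v z - v y| <= C * `|z - y|) ->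
  (forall i y, U y -> `|partial i v y| <= C) ->
  (forall i y z, U y -> U z -> `|partial i v z - partial i v y| <= C * `|z - y| `^ al) ->
  exists v' : E -> R, [/\ forall x, U x -> v x = v' x, C1_hoelder U S al v' &
    (C1_norm U S al v' <= (C * (2 * n.+1%:R + 1))%:E)%E].
Proof.
move=> al0 vC dv vL pC pH.
have cR (F : set_system R^o) : ProperFilter F -> cauchy F -> cvg F by exact: cauchy_cvg.
have cE (F : set_system E) : ProperFilter F -> cauchy F -> cvg F by exact: cauchy_cvg.
have vL' y z : U y -> U z -> `|v y - v z : R^o| <= C * enorm (y - z) `^ 1.
  move=> Uy Uz; rewrite powRr1 ?enorm_ge0//; apply: (le_trans (vL z y Uz Uy)).
  by rewrite ler_wpM2l// norm_le_enorm.
(* The values of v on the flat part are arbitrary, so they are replaced by limits from the half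
   ball. *)
pose v' : E -> R := @flat_ext R n R^o 4^-1 v.
have vE x : U x -> v x = v' x by move=> Ux; rewrite /v' /flat_ext mem_set.
have vnear x : U x -> \forall z \near x, v z = v' z.
  move=> Ux; have := open_nbhs_nbhs (conj (@open_half_ball R n 4^-1) Ux).
  by apply: filterS => z; exact: vE.
have gE i x : U x -> partial i v x = partial i v' x.
  by move=> Ux; apply: near_eq_derive; exact: vnear.
have gH y z : U y -> U z -> `|grad v' y - grad v' z| <= C * enorm (y - z) `^ al.
  move=> Uy Uz; apply: norm_le_coord => [|i].
    by rewrite mulr_ge0// powR_ge0.
  rewrite !mxE -!gE//; apply: (le_trans (pH i z y Uz Uy)).
  by apply: norm_powR_le; exact: ltW.
have gC y : U y -> `|grad v' y| <= C.
  by move=> Uy; apply: norm_le_coord => // i; rewrite mxE -gE//; exact: pC.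
have le1 : (C1_norm U S al v' <= (C * (2 * n.+1%:R + 1))%:E)%E.
  have -> : (C * (2 * n.+1%:R + 1))%:E = (C%:E + (n.+1%:R * C)%:E + (n.+1%:R * C)%:E)%E.
    by rewrite -!EFinD; congr (_%:E); ring.
  apply: leeD; first apply: leeD.
  - apply: sup_norm_le => x Dx.
    exact: (@flat_ext_le R n R^o cR 4^-1 C 1 v C0 ltr01 vL' C x vC Dx).
  - apply: sup_norm_le => x Dx; apply: (le_trans (enorm_le_norm _)); rewrite ler_wpM2l//.
    exact: (@flat_ext_le R n E cE 4^-1 C al (grad v') C0 al0 gH C x gC Dx).
  - apply: hoelder_seminorm_le => x y Dx Dy _; rewrite -mulrA.
    apply: (le_trans (enorm_le_norm _)); rewrite ler_wpM2l//.
    exact: (@flat_ext_hoelder R n E cE 4^-1 C al (grad v') C0 al0 gH x y Dx Dy).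
exists v'; split=> //; split.
- by move=> x Ux; apply: near_eq_differentiable (vnear x Ux) _; exact: dv.
- move=> x Sx; apply/cvg_ex; eexists.
  exact: (@flat_ext_cvg R n E cE 4^-1 C al (grad v') C0 al0 gH x (or_intror Sx)).
- exact: (@flat_ext_continuous R n R^o cR 4^-1 C 1 v C0 ltr01 vL').
- exact: (@flat_ext_continuous R n E cE 4^-1 C al (grad v') C0 al0 gH).
- exact: le_lt_trans le1 (ltry _).
Qed.

End boundary_regularity.

Theorem theorem6p4 (R : realType) (n : nat) (a mu M : R)
    (ha1 : -1 < a) (ha2 : a < 1) (ha0 : a != 0)
    (hmu : 0 <= mu) (hM : 0 <= M) :
  exists C : R, forall (u : 'rV[R]_n.+1 -> R) (Du : 'rV[R]_n.+1 -> 'rV[R]_n.+1),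
    wW12 a (half_ball 1) u Du ->
    (forall phi : 'rV[R]_n.+1 -> R, test_fun (half_ball 1) phi ->
       energy a (half_ball 1) Du phi = 0) ->
    (forall psi : 'rV[R]_n.+1 -> R, test_fun (eball 1) psi ->
       `|energy a (half_ball 1) Du psi| <=
       mu * flat_integral 1 (fun x => `|psi x|)) ->
    {ae leb n.+1, forall x, half_ball 1 x -> `|u x| <= M} ->
    (0 < a ->
       exists v : 'rV[R]_n.+1 -> R,
         [/\ {ae leb n.+1, forall x, half_ball 4^-1 x -> u x = v x},
             C0_hoelder (half_ball 4^-1) (1 - a) v &
             (C0_norm (half_ball 4^-1) (1 - a) v <= C%:E)%E]) /\
    (a < 0 ->
       exists v : 'rV[R]_n.+1 -> R,
         [/\ {ae leb n.+1, forall x, half_ball 4^-1 x -> u x = v x},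
             C1_hoelder (half_ball 4^-1) (flat_ball 4^-1) (- a) v &
             (C1_norm (half_ball 4^-1) (flat_ball 4^-1) (- a) v <= C%:E)%E]).
Proof.
have [C C0 HC] := @limit_function R n a mu M ha1 ha2 hmu hM.
exists (C * (2 * n.+1%:R + 1)) => u Du uW _ uF uM.
have tM := trunc_le hM u.
have mt := measurable_trunc M uW.
pose w (x : 'rV[R]_n.+1) : R := trunc M u x * weight a x.
have mw : measurable_fun (half_ball 1) w.
  by apply: measurable_funM => //; apply: measurable_funTS; exact: measurable_weight.
have wM x : half_ball 1 x -> `|w x| <= M * weight a x.
  by move=> _; rewrite normrM (ger0_norm (powR_ge0 _ _)) ler_wpM2r ?powR_ge0.
have [v [Sv vC dv hol lip]] := HC w mw wM (trunc_subflux ha1 hM uW uM uF).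
have mv : measurable_fun (half_ball 4^-1) v.
  apply: open_continuous_measurable => [|x Ux]; first exact: open_half_ball.
  by apply: differentiable_continuous; exact: dv.
have uv : {ae leb n.+1, forall x, half_ball 4^-1 x -> u x = v x}.
  have h1 : {ae leb n.+1, forall x, half_ball 4^-1 x -> trunc M u x = v x}.
    (* The larger of M and C bounds both the truncation and v. *)
    apply: (@ae_identity R n a ha1 (trunc M u) v (Num.max M C)) => //.
    - by rewrite le_max hM.
    - by move=> x _; rewrite le_max tM.
    - by move=> x Ux; rewrite le_max vC ?orbT.
  have h2 := trunc_ae uM.
  apply: filterS2 h1 h2 => x e1 e2 Ux; rewrite -e1// e2//.
  by apply: half_ball_sub Ux; rewrite invf_le1// ler1n.
split=> [a0|a0].
  exists v; have al0 : 0 <= 1 - a by rewrite subr_ge0 ltW.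
  by have [h1 h2] := C0_bound C0 al0 vC dv (hol a0).
have na : 0 < - a by rewrite oppr_gt0.
have [vL pC pH] := lip a0.
have [v' [vv' h1 h2]] := C1_bound C0 na vC dv vL pC pH.
by exists v'; split=> //; apply: filterS uv => x h Ux; rewrite h// vv'.
Qed.
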